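(* Let $F$ be the Bryant representation of a compact Bryant surface with smooth ends, with underlying compact Riemann surface $M$. Then the Willmore energy of the compact Bryant surface with smooth ends is $4\pi N$, where $N$ is the total pole order of $F$ on a fundamental domain (i.e. the sum over all ends $p\in M$ of the pole order of $F$ at a point of $\tilde M$ over $p$).
   Context: Let $\mathbf{B}^3=\{x\in\mathbb{R}^3: |x|<1\}$ with the metric $\frac{4|dx|^2}{(1-|x|^2)^2}$ (Poincaré ball model of hyperbolic space). A Bryant surface is a conformally immersed Riemann surface in $\mathbf{B}^3$ with constant mean curvature $1$ (with respect to the unit normal determined by the orientation, with conventions such that the representation below holds). A smooth Bryant end is a Bryant surface $E\subset \mathbf{B}^3$ for which there is a point $p_\infty\in\partial\mathbf{B}^3$ such that $E\cup\{p_\infty\}$ is a conformally immersed open disc in $\mathbb{R}^3$ (i.e. $E$ is parametrized on the punctured disc and the parametrization extends to a smooth conformal immersion of the disc into $\mathbb{R}^3$ sending the puncture to $p_\infty$). A compact Bryant surface with smooth ends is a Bryant surface that is conformally equivalent to a compact Riemann surface $M$ minus a finite number of points (the ends) such that each of these points has a punctured neighborhood that is a smooth Bryant end; it extends to a conformal immersion $M\to\mathbb{R}^3$. Bryant representation: a conformal immersion $f\colon M_0\to \mathbf{B}^3$ of a Riemann surface is a Bryant surface if and only if there is a holomorphic immersion $F\colon\tilde M_0\to \mathrm{SL}(2,\mathbb{C})$ on the universal covering of $M_0$ with $\det F'=0$ such that $$f=\frac{(x_1,x_2,x_3)}{x_0+1},\qquad \begin{pmatrix}x_0+x_3&x_1+x_2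 i\\ x_1-x_2 i&x_0-x_3\end{pmatrix}=F\bar F^{t};$$ $F$ is unique up to right multiplication by a constant $\mathrm{SU}(2)$ matrix. For a compact Bryant surface with smooth ends, $F$ is a meromorphic $\mathrm{SL}(2,\mathbb{C})$-valued map on the universal covering $\tilde M$ of the compact surface $M$, its monodromy under deck transformations is right multiplication by $\mathrm{SU}(2)$ matrices, and its poles lie over the ends. The pole order of $F$ at a point is the maximum of the pole orders of its entries; it depends only on the image of the point in $M$. The Willmore energy of the surface is $W=\int_M H^2\,dA$ of the extended immersion $M\to\mathbb{R}^3$, with Euclidean mean curvature $H$ and area element $dA$ (equivalently the conformally invariant quantity $\int_M(H^2-G)\,dA+2\pi\chi(M)$, $G$ the determinant of the Weingarten operator). *)

(* Defs.v *)
From HB Require Import structures.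
From mathcomp Require Import all_boot all_order all_algebra.
From mathcomp Require Import complex.
From mathcomp Require Import all_classical all_reals all_analysis.

Set Implicit Arguments.
Unset Strict Implicit.
Unset Printing Implicit Defensive.

Import Order.TTheory GRing.Theory Num.Theory.
Import numFieldNormedType.Exports.

Local Open Scope classical_set_scope.
Local Open Scope ring_scope.

(* R[i] seen through numClosedFieldType, so that it receives the topology and
   the normed module structure (over itself) that MathComp-Analysis gives to
   every such field; [derivable] is then complex differentiability. *)
Definition cplx (R : realType) : numClosedFieldType := R[i]%C.

Definition toC (R : realType) (x : R * R) : cplx R := Complex x.1 x.2.

Definition realC (R : realType) (x : R) : cplx R := toC (x, 0).

Section RiemannSurfaces.
Variable R : realType.
Local Notation C := (cplx R).

(* [cmap] and [cinv] are total; only their restrictions to [cdom] and to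
   [cimg] are meaningful. *)
Record chart (X : topologicalType) := Chart {
  cdom : set X;
  cmap : X -> C;
  cinv : C -> X;
  cdom_open : open cdom;
  cimg_open : open (cmap @` cdom);
  cmapK : forall x, cdom x -> cinv (cmap x) = x;
  cmap_continuous : forall x, cdom x -> {for x, continuous cmap};
  cinv_continuous : forall z, (cmap @` cdom) z -> {for z, continuous cinv}
}.

Definition cimg (X : topologicalType) (c : chart X) : set C := cmap c @` cdom c.

Record riemannSurface := RiemannSurface {
  rs_carrier :> topologicalType;
  rs_atlas : set (chart rs_carrier);
  rs_nonempty : [set: rs_carrier] !=set0;
  rs_hausdorff : hausdorff_space rs_carrier;
  rs_connected : connected [set: rs_carrier];
  rs_cover : forall x : rs_carrier, exists c, rs_atlas c /\ cdom c x;
  rs_holomorphic : forall c d, rs_atlas c -> rs_atlas d ->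
    forall x, cdom c x -> cdom d x ->
      derivable (fun z : C => cmap d (cinv c z)) (cmap c x) 1
}.

Definition chart_at (M : riemannSurface) (x : M) : chart M :=
  sval (cid (rs_cover x)).

Definition simply_connected (X : topologicalType) : Prop :=
  connected [set: X] /\
  forall g : R -> X, {within `[0, 1]%classic, continuous g} -> g 0 = g 1 ->
    exists H : R * R -> X,
      [/\ {within `[0, 1]%classic `*` `[0, 1]%classic, continuous H},
          forall t, 0 <= t <= 1 -> H (0, t) = g t,
          forall t, 0 <= t <= 1 -> H (1, t) = g 0 &
          forall s, 0 <= s <= 1 -> H (s, 0) = g 0 /\ H (s, 1) = g 0].

(* An evenly covered neighbourhood V is given by the sections [s i] of [f] over
   V that parametrize the sheets. *)
Definition covering_map (X Y : topologicalType) (f : Y -> X) : Prop :=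
  [/\ continuous f, range f = setT &
      forall x : X, exists V : set X, [/\ open V, V x &
        exists (I : Type) (s : I -> X -> Y),
          [/\ forall i y, V y -> {for y, continuous (s i)},
              forall i y, V y -> f (s i y) = y,
              forall i, open (s i @` V),
              forall i j y, V y -> s i y = s j y -> i = j &
              forall q, V (f q) -> exists i, s i (f q) = q]]].

Definition holomorphic_map (M N : riemannSurface) (f : M -> N) : Prop :=
  continuous f /\
  forall c d, rs_atlas c -> rs_atlas d ->
    forall q, cdom c q -> cdom d (f q) ->
      derivable (fun z : C => cmap d (f (cinv c z))) (cmap c q) 1.

Definition universal_covering (M Mt : riemannSurface) (f : Mt -> M) : Prop :=
  [/\ covering_map f, holomorphic_map f & simply_connected Mt].

(* Integral over M of a nonnegative density, given by its coefficient [w c]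
   with respect to dx dy in each chart c: the supremum, over all finite
   disjoint families of measurable pieces each lying in a chart, of the sum of
   the integrals over the pieces.  By countable additivity it is attained on
   any finite measurable partition of M subordinate to the atlas. *)
Definition surface_integral (M : riemannSurface)
    (w : chart M -> R * R -> \bar R) : \bar R :=
  ereal_sup [set v | exists (n : nat) (c : 'I_n -> chart M)
      (D : 'I_n -> set (R * R)),
    [/\ forall i, rs_atlas (c i),
        forall i, measurable (D i),
        forall i, D i `<=` @toC R @^-1` cimg (c i),
        forall i j, i != j ->
          (fun x => cinv (c i) (toC x)) @` D i `&`
          (fun x => cinv (c j) (toC x)) @` D j = set0 &
        v = (\sum_(i < n) \int[@lebesgue_measure R \x @lebesgue_measure R]_(x in D i)
               w (c i) x)%E]].

End RiemannSurfaces.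

Section SurfaceGeometry.
Variable R : realType.
Local Notation E3 := 'rV[R]_3.

Definition dotmx (G : 'M[R]_3) (u v : E3) : R := (u *m G *m v^T) 0 0.

Definition normsq (u : E3) : R := dotmx 1%:M u u.

Definition vec3 (a b c : R) : E3 := \row_(k < 3) nth 0 [:: a; b; c] k.

Definition cross (u v : E3) : E3 :=
  let x (w : E3) (k : nat) := w 0 (inord k) in
  vec3 (x u 1 * x v 2 - x u 2 * x v 1)
       (x u 2 * x v 0 - x u 0 * x v 2)
       (x u 0 * x v 1 - x u 1 * x v 0).

Definition B3 : set E3 := [set x | normsq x < 1].
Definition dB3 : set E3 := [set x | normsq x = 1].

Definition metric_euc (x : E3) : 'M[R]_3 := 1%:M.

Definition metric_hyp (x : E3) : 'M[R]_3 := (4 / (1 - normsq x) ^+ 2)%:M.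

Definition christoffel (G : E3 -> 'M[R]_3) (x : E3) (k i j : 'I_3) : R :=
  let dG (a b c : 'I_3) : R :=
    'D_(delta_mx 0 a : E3) (fun y : E3 => G y b c) x in
  2^-1 * \sum_(l < 3) invmx (G x) k l * (dG i j l + dG j i l - dG l i j).

Definition smooth_on (U : set (R * R)) (g : R * R -> E3) : Prop :=
  forall (s : seq (R * R)) x, U x ->
    differentiable (foldr (fun v h => 'D_v h) g s) x.

Definition dir (a : 'I_2) : R * R := ((a == 0)%:R, (a == 1)%:R).

Definition partial (g : R * R -> E3) (a : 'I_2) : R * R -> E3 := 'D_(dir a) g.

Definition conformal_immersion (U : set (R * R)) (g : R * R -> E3) : Prop :=
  smooth_on U g /\
  forall x, U x ->
    [/\ partial g 0 x != 0,
        normsq (partial g 0 x) = normsq (partial g 1 x) &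
        dotmx 1%:M (partial g 0 x) (partial g 1 x) = 0].

Definition covariant (G : E3 -> 'M[R]_3) (g : R * R -> E3) (a b : 'I_2)
    (x : R * R) : E3 :=
  partial (partial g b) a x +
  \row_(k < 3) \sum_(i < 3) \sum_(j < 3)
    christoffel G (g x) k i j * partial g a x 0 i * partial g b x 0 j.

(* The Euclidean cross product of the partials is a conormal; it is turned
   into a normal vector by raising its index with G.  The result is positively
   oriented with respect to the partials. *)
Definition unit_normal (G : E3 -> 'M[R]_3) (g : R * R -> E3) (x : R * R) : E3 :=
  let nu := cross (partial g 0 x) (partial g 1 x) *m invmx (G (g x)) in
  (Num.sqrt (dotmx (G (g x)) nu nu))^-1 *: nu.

Definition first_form (G : E3 -> 'M[R]_3) (g : R * R -> E3) (x : R * R) :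
    'M[R]_2 :=
  \matrix_(a, b) dotmx (G (g x)) (partial g a x) (partial g b x).

Definition second_form (G : E3 -> 'M[R]_3) (g : R * R -> E3) (x : R * R) :
    'M[R]_2 :=
  \matrix_(a, b) dotmx (G (g x)) (covariant G g a b x) (unit_normal G g x).

(* Half the trace of the Weingarten operator.  With these signs the horosphere
   represented by F(z) = [[1, z], [0, 1]] has hyperbolic mean curvature +1. *)
Definition mean_curvature (G : E3 -> 'M[R]_3) (g : R * R -> E3) (x : R * R) : R :=
  \tr (invmx (first_form G g x) *m second_form G g x) / 2.

Definition area_density (G : E3 -> 'M[R]_3) (g : R * R -> E3) (x : R * R) : R :=
  Num.sqrt (\det (first_form G g x)).

Definition bryant_patch (U : set (R * R)) (g : R * R -> E3) : Prop :=
  conformal_immersion U g /\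
  forall x, U x -> B3 (g x) /\ mean_curvature metric_hyp g x = 1.

Definition local_rep (M : riemannSurface R) (f : M -> E3) (c : chart R M) :
    R * R -> E3 :=
  fun x => f (cinv c (toC x)).

Definition bryant_surface (M : riemannSurface R) (M0 : set M) (f : M -> E3) :
    Prop :=
  forall c, rs_atlas c ->
    bryant_patch (@toC R @^-1` (cmap c @` (cdom c `&` M0))) (local_rep f c).

(* The end is parametrized, in a chart c, by the punctured disc of radius r
   around the image of p; f p is the limit point at infinity. *)
Definition smooth_bryant_end (M : riemannSurface R) (f : M -> E3) (p : M) :
    Prop :=
  exists (c : chart R M) (r : cplx R),
    let U := @toC R @^-1` ball (cmap c p) r in
    [/\ rs_atlas c, cdom c p, 0 < r & ball (cmap c p) r `<=` cimg c] /\
    [/\ bryant_patch (U `\` [set x | toC x = cmap c p]) (local_rep f c),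
        dB3 (f p) &
        conformal_immersion U (local_rep f c)].

(* f stands for the extension to the compact surface M, and E for the set of
   ends. *)
Definition compact_bryant_surface (M : riemannSurface R) (E : set M)
    (f : M -> E3) : Prop :=
  [/\ compact [set: M], finite_set E, bryant_surface (~` E) f &
      forall p, E p -> smooth_bryant_end f p].

Definition willmore_energy (M : riemannSurface R) (f : M -> E3) : \bar R :=
  surface_integral (fun (c : chart R M) (x : R * R) =>
    (mean_curvature metric_euc (local_rep f c) x ^+ 2
     * area_density metric_euc (local_rep f c) x)%:E).

End SurfaceGeometry.

Section BryantRepresentation.
Variable R : realType.
Local Notation C := (cplx R).

Definition mx22 (a b c d : C) : 'M[C]_2 :=
  \matrix_(i < 2, j < 2) nth 0 (nth [::] [:: [:: a; b]; [:: c; d]] i) j.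

Definition entry_rep (M : riemannSurface R) (F : M -> 'M[C]_2) (c : chart R M)
    (i j : 'I_2) : C -> C :=
  fun z => F (cinv c z) i j.

Definition deriv_rep (M : riemannSurface R) (F : M -> 'M[C]_2) (c : chart R M)
    (z : C) : 'M[C]_2 :=
  \matrix_(i, j) derive1 (entry_rep F c i j) z.

(* The value of g at z0 plays no role; k = 0 means that g has a removable
   singularity at z0. *)
Definition has_pole_order (g : C -> C) (z0 : C) (k : nat) : Prop :=
  exists h : C -> C,
    [/\ \forall z \near z0, derivable h z 1,
        \forall z \near z0^', (z - z0) ^+ k * g z = h z &
        k = 0%N \/ h z0 != 0].

Definition pole_order (g : C -> C) (z0 : C) : nat :=
  xget 0%N [set k | has_pole_order g z0 k].

Definition meromorphic_mx (M : riemannSurface R) (F : M -> 'M[C]_2) : Prop :=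
  forall c q, rs_atlas c -> cdom c q ->
    forall i j, exists k, has_pole_order (entry_rep F c i j) (cmap c q) k.

Definition pole_order_mx (M : riemannSurface R) (F : M -> 'M[C]_2) (q : M) :
    nat :=
  let c := chart_at q in
  \max_(i < 2) \max_(j < 2) pole_order (entry_rep F c i j) (cmap c q).

Definition bryant_formula (A : 'M[C]_2) (y : 'rV[R]_3) : Prop :=
  exists x0 x1 x2 x3 : R,
    A *m (map_mx Num.conj A)^T
      = mx22 (realC (x0 + x3)) (toC (x1, x2))
             (toC (x1, - x2)) (realC (x0 - x3))
    /\ y = (x0 + 1)^-1 *: vec3 x1 x2 x3.

Definition bryant_representation (M : riemannSurface R) (E : set M)
    (f : M -> 'rV[R]_3) (Mt : riemannSurface R) (u : Mt -> M)
    (F : Mt -> 'M[C]_2) : Prop :=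
  [/\ universal_covering u,
      meromorphic_mx F,
      forall q, ~ E (u q) -> \det (F q) = 1 /\ bryant_formula (F q) (f (u q)) &
      forall c q, rs_atlas c -> cdom c q -> ~ E (u q) ->
        [/\ forall i j, derivable (entry_rep F c i j) (cmap c q) 1,
            deriv_rep F c (cmap c q) != 0 &
            \det (deriv_rep F c (cmap c q)) = 0]].

End BryantRepresentation.

(* Main.v *)
Require Import Defs.
From HB Require Import structures.
From mathcomp Require Import all_boot all_order all_algebra.
From mathcomp Require Import complex.
From mathcomp Require Import all_classical all_reals all_analysis.
From mathcomp Require Import ring lra measurable_realfun.

Set Implicit Arguments.
Unset Strict Implicit.
Unset Printing Implicit Defensive.

Import Order.TTheory GRing.Theory Num.Theory.
Import numFieldNormedType.Exports.

Local Open Scope classical_set_scope.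
Local Open Scope ring_scope.


(** Why the energy is 4 pi times the total pole order.

    Let phi = - ln (1 - |f|^2), a smooth function on the surface away from the
    ends. The condition that the hyperbolic mean curvature is 1 prescribes the
    normal component of the Laplacian of f, and makes the Euclidean Willmore
    density the Laplacian of phi in every conformal coordinate ([wdens_lap]).
    On a compact surface the integral of a Laplacian only sees the
    singularities of phi, which are the ends.

    At an end the representation gives 1 - |f|^2 = 4 / (2 + |F|^2)
    ([bryant_gram]), so that phi + n ln |w|^2 has a limit, where w is a
    coordinate centred at the end and n is the pole order of F
    ([end_asymptotics]). Since f is immersed at the end, the Willmore density
    is bounded around it, hence so is the Laplacian of phi, and phi has no
    worse singularity than this logarithm; it contributes 4 pi n
    ([log_residue]). Summing over the ends gives the theorem
    ([willmore_ends]). The sum is localized by bump functions on finitely many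
    coordinate discs, arranged so that each end is the centre of a disc.

    Two parts of this need support. On the side of integration, the supremum
    over families of pieces in charts is computed by one finite partition
    ([surface_integral_total]); this rests on the change of variables for
    conformal maps ([change_of_variables]), proved by comparing the images of
    small squares with squares.

    On the side of complex analysis, the changes of charts are only known to be
    complex differentiable. Away from the ends they intertwine smooth conformal
    immersions, from which they inherit all their derivatives ([bootstrap]). At
    an end, the pole order is measured in a chart of the covering surface and
    phi in a chart of M, so the covering map must have a nonzero derivative
    there ([lift_deriv_at]). At the other points this is because F is immersed
    while its Gram matrix is a function of f ([rep_deriv_neq0]). At the end
    itself, a local inverse of the covering map is continuous, and holomorphic
    around the point; Cauchy's formula, from Goursat's lemma ([goursat]), makes
    it Lipschitz at the point ([lipschitz_at0]), and the inverse of a map whose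
    derivative vanishes is not Lipschitz ([inverse_deriv_neq0]). *)

(** * First-order calculus in the plane *)

Section PlaneCalculus.
Variable R : realType.
Local Notation P := (R * R)%type.
Implicit Types (g : P -> R) (x : P) (a b : R).

(** Differentiability and the value of the gradient in a single relation:
    gradients of compound expressions are then computed by unification with
    the rules below. *)
Definition grad g x a b := is_diff x g (fun v : P => a * v.1 + b * v.2).

Lemma prod_normE2 (x : P) : `|x| = Num.max `|x.1| `|x.2|.
Proof. by []. Qed.

Definition linP a b (v : P) : R := a * v.1 + b * v.2.

Lemma linP_linear a b : linear (linP a b).
Proof. by move=> k u v; rewrite /linP /= /GRing.scale /=; ring. Qed.
HB.instance Definition _ a b :=
  GRing.isLinear.Build R P R _ (linP a b) (@linP_linear a b).

Lemma linP_continuous a b : continuous (linP a b).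
Proof.
move=> x; apply: cvgD; apply: cvgM; try exact: cvg_cst.
  exact: cvg_fst.
exact: cvg_snd.
Qed.

Lemma grad_eps g x a b :
  (forall e, 0 < e -> \forall y \near x,
    `|g y - g x - (a * (y.1 - x.1) + b * (y.2 - x.2))| <= e * `|y - x|) ->
  grad g x a b.
Proof.
move=> H.
have Ho : g \o shift x = cst (g x) + linP a b +o_ (0 : P) id.
  apply/eqaddoP => e e0.
  have := H e e0; rewrite (@near_shift _ _ 0 x).
  apply: filterS => y; rewrite /= subr0 !addrK.
  congr (`| _ | <= _); rewrite /linP !fctE /=; ring.
have [Hd Hu] : differentiable g x /\ 'd g x = linP a b :> (P -> R).
  have Hu := diff_unique (@linP_continuous a b) Ho.
  split=> //; apply/diff_locallyP; rewrite Hu; split => //.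
  exact: linP_continuous.
exact: DiffDef.
Qed.

Lemma gradP g x a b : grad g x a b ->
  forall e, 0 < e -> \forall y \near x,
    `|g y - g x - (a * (y.1 - x.1) + b * (y.2 - x.2))| <= e * `|y - x|.
Proof.
move=> [Hd Hl] e e0.
have /diff_locally/eqaddoP /(_ e e0) H0 := Hd.
rewrite (@near_shift _ _ 0 x).
apply: filterS H0 => y; rewrite Hl /= subr0 !addrK.
congr (`| _ | <= _); rewrite !fctE /=; ring.
Qed.

Lemma grad_unique g x a b a' b' : grad g x a b -> grad g x a' b' ->
  a = a' /\ b = b'.
Proof.
move=> [_ H1] [_]; rewrite H1 => /funeqP H.
have := H (1, 0); have := H (0, 1); rewrite /= !(mulr0,mulr1,addr0,add0r).
by [].
Qed.

Lemma grad_derive g x a b v : grad g x a b -> 'D_v g x = a * v.1 + b * v.2.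
Proof. by move=> [Hd Hl]; rewrite deriveE // Hl. Qed.

(** The directional derivatives are sealed: comparing [d1 g x] with [d2 g x]
    by conversion would otherwise unfold the definition of limits. *)
Fact d1_def : {d : (P -> R) -> P -> R | forall g, d g = 'D_((1, 0) : P) g}.
Proof. by exists (fun g => 'D_((1, 0) : P) g). Qed.
Fact d2_def : {d : (P -> R) -> P -> R | forall g, d g = 'D_((0, 1) : P) g}.
Proof. by exists (fun g => 'D_((0, 1) : P) g). Qed.
Definition d1 := sval d1_def.
Definition d2 := sval d2_def.

Lemma d1E g : d1 g = 'D_((1, 0) : P) g.
Proof. exact: (svalP d1_def). Qed.

Lemma d2E g : d2 g = 'D_((0, 1) : P) g.
Proof. exact: (svalP d2_def). Qed.

Lemma grad_d1 g x a b : grad g x a b -> d1 g x = a.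
Proof. by move=> /grad_derive Hg; rewrite d1E Hg /= mulr1 mulr0 addr0. Qed.

Lemma grad_d2 g x a b : grad g x a b -> d2 g x = b.
Proof. by move=> /grad_derive Hg; rewrite d2E Hg /= mulr1 mulr0 add0r. Qed.

Lemma differentiable_grad g x : differentiable g x -> grad g x (d1 g x) (d2 g x).
Proof.
move=> Hd; apply: DiffDef => //; apply/funext => v.
rewrite d1E d2E !deriveE //.
have {1}-> : v = v.1 *: ((1, 0) : P) + v.2 *: ((0, 1) : P).
  case: v => v w; congr (_, _); rewrite /= /GRing.scale /=;
  by rewrite mulr0 mulr1 ?addr0 ?add0r.
by rewrite linearD !linearZ /= /GRing.scale /= ![v.1 * _]mulrC ![v.2 * _]mulrC.
Qed.

Lemma grad_continuous g x a b : grad g x a b -> {for x, continuous g}.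
Proof. by move=> [/differentiable_continuous]. Qed.

Lemma grad_near g g' x a b : (\forall y \near x, g y = g' y) ->
  grad g x a b -> grad g' x a b.
Proof.
move=> H /gradP Hg; apply: grad_eps => e e0.
have gx : g x = g' x := nbhs_singleton H.
by have := Hg e e0; apply: filterS2 H => y <-; rewrite -gx.
Qed.

Lemma grad_eq g x a b a' b' : grad g x a b -> a = a' -> b = b' -> grad g x a' b'.
Proof. by move=> H <- <-. Qed.

Lemma grad_cst (c : R) x : grad (fun=> c) x 0 0.
Proof.
apply: grad_eps => e e0; apply: filterE => y.
by rewrite !mul0r addr0 !subrr normr0 mulr_ge0 // ltW.
Qed.

Lemma grad_fst x : grad fst x 1 0.
Proof.
apply: grad_eps => e e0; apply: filterE => y.
by rewrite mul1r mul0r addr0 subrr normr0 mulr_ge0 // ltW.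
Qed.

Lemma grad_snd x : grad snd x 0 1.
Proof.
apply: grad_eps => e e0; apply: filterE => y.
by rewrite mul1r mul0r add0r subrr normr0 mulr_ge0 // ltW.
Qed.

Lemma gradD g h x a b c d : grad g x a b -> grad h x c d ->
  grad (fun y => g y + h y) x (a + c) (b + d).
Proof.
move=> Hg Hh; have H := is_diffD Hg Hh.
apply: DiffDef; first exact: ex_diff.
rewrite (@diff_val _ _ _ _ _ _ _ H); apply/funext => v; rewrite !fctE; ring.
Qed.

Lemma gradM g h x a b c d : grad g x a b -> grad h x c d ->
  grad (fun y => g y * h y) x (a * h x + g x * c) (b * h x + g x * d).
Proof.
move=> Hg Hh; have H := is_diffM Hg Hh.
apply: DiffDef; first exact: ex_diff.
rewrite (@diff_val _ _ _ _ _ _ _ H); apply/funext => v.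
rewrite !fctE /= /GRing.scale /=; ring.
Qed.

Lemma gradN g x a b : grad g x a b -> grad (fun y => - g y) x (- a) (- b).
Proof.
move=> Hg; have := gradM (grad_cst (-1) x) Hg.
rewrite (_ : (fun y => -1 * g y) = (fun y => - g y)); last first.
  by apply/funext => y; rewrite mulN1r.
by move/grad_eq; apply; rewrite mul0r add0r mulN1r.
Qed.

Lemma gradB g h x a b c d : grad g x a b -> grad h x c d ->
  grad (fun y => g y - h y) x (a - c) (b - d).
Proof. by move=> Hg /gradN; apply: gradD. Qed.

Lemma grad_comp1 (f : R -> R) f' g x a b : grad g x a b ->
  is_derive (g x) 1 f f' -> grad (fun y => f (g y)) x (f' * a) (f' * b).
Proof.
move=> Hg [/derivable1_diffP Hd Hv].
have Hf : is_diff (g x) f (fun h => h * f').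
  apply: DiffDef => //; rewrite diff1E //; apply/funext => h.
  by rewrite derive1E Hv.
have H := is_diff_comp Hg Hf.
apply: DiffDef; first exact: ex_diff.
rewrite (@diff_val _ _ _ _ _ _ _ H); apply/funext => v /=; ring.
Qed.

Lemma grad_comp g (T1 T2 : P -> R) x a b a1 b1 a2 b2 :
  grad T1 x a1 b1 -> grad T2 x a2 b2 -> grad g (T1 x, T2 x) a b ->
  grad (fun y => g (T1 y, T2 y)) x (a * a1 + b * a2) (a * b1 + b * b2).
Proof.
move=> H1 H2 Hg.
have H := is_diff_comp (is_diff_pair H1 H2) Hg.
apply: DiffDef; first exact: ex_diff.
rewrite (@diff_val _ _ _ _ _ _ _ H); apply/funext => v /=; ring.
Qed.

Lemma gradV g x a b : grad g x a b -> g x != 0 ->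
  grad (fun y => (g y)^-1) x (- (g x) ^- 2 * a) (- (g x) ^- 2 * b).
Proof.
move=> Hg g0; apply: (@grad_comp1 GRing.inv) => //.
have /= := is_deriveV g0 (is_derive_id (g x) (1 : R)).
by rewrite /GRing.scale /= mulr1.
Qed.

End PlaneCalculus.

(** * Functions of class C^k and the Laplacian *)

Section Ck.
Variable R : realType.
Local Notation P := (R * R)%type.
Implicit Types (g : P -> R) (x : P) (U V : set P).

Lemma near_open (T : topologicalType) (U : set T) (x : T) :
  open U -> U x -> \forall y \near x, U y.
Proof. by rewrite openE => H /H. Qed.

(** Only the values on U matter, up to taking U open; see [Ck_ext]. *)
Fixpoint Ck n U g : Prop :=
  match n with
  | 0 => forall x, U x -> {for x, continuous g}
  | n'.+1 => [/\ forall x, U x -> differentiable g x,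
                 Ck n' U (d1 g) & Ck n' U (d2 g)]
  end.

Lemma Ck_grad n U g x : Ck n.+1 U g -> U x -> grad g x (d1 g x) (d2 g x).
Proof. by move=> [H _ _] /H; apply: differentiable_grad. Qed.

Lemma Ck_d1 n U g : Ck n.+1 U g -> Ck n U (d1 g).
Proof. by case. Qed.

Lemma Ck_d2 n U g : Ck n.+1 U g -> Ck n U (d2 g).
Proof. by case. Qed.

Lemma CkS n U g : Ck n.+1 U g -> Ck n U g.
Proof.
elim: n g => [|n IH] g Hg.
  by move=> x Ux; have [/(_ x Ux)/differentiable_continuous] := Hg.
split; first by case: Hg.
  by apply: IH; exact: Ck_d1 Hg.
by apply: IH; exact: Ck_d2 Hg.
Qed.

Lemma Ck_continuous n U g x : Ck n U g -> U x -> {for x, continuous g}.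
Proof. by elim: n g => [|n IH] g; [apply|move/CkS; exact: IH]. Qed.

Lemma Ck_sub n U V g : V `<=` U -> Ck n U g -> Ck n V g.
Proof.
move=> VU; elim: n g => [|n IH] g /=; first by move=> H x /VU /H.
by move=> [H1 H2 H3]; split; [move=> x /VU /H1|exact: IH|exact: IH].
Qed.

Lemma CkU n U V g : Ck n U g -> Ck n V g -> Ck n (U `|` V) g.
Proof.
elim: n g => [|n IH] g /=; first by move=> H H' x [/H|/H'].
move=> [H1 H2 H3] [H1' H2' H3']; split; [|exact: IH|exact: IH].
by move=> x [/H1|/H1'].
Qed.

Lemma Ck_ext n U g g' : open U -> (forall x, U x -> g x = g' x) ->
  Ck n U g -> Ck n U g'.
Proof.
move=> oU; elim: n g g' => [|n IH] g g' E /=.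
  move=> H x Ux; suff : g' @ x --> g' x by [].
  rewrite -(E x Ux).
  apply: cvg_trans (H x Ux); apply: near_eq_cvg.
  by have := near_open oU Ux; apply: filterS => y /E.
have G x : U x -> differentiable g x -> grad g' x (d1 g x) (d2 g x).
  move=> Ux /differentiable_grad; apply: grad_near.
  by have := near_open oU Ux; apply: filterS => y /E.
move=> [H1 H2 H3]; split.
- by move=> x Ux; have [] := G x Ux (H1 x Ux).
- by apply: IH H2 => x Ux; have /grad_d1 := G x Ux (H1 x Ux).
- by apply: IH H3 => x Ux; have /grad_d2 := G x Ux (H1 x Ux).
Qed.

(** Regularity is always obtained from an explicit gradient, whose components
    are one degree less regular. *)
Lemma Ck_intro n U g g1 g2 : open U ->
  (forall x, U x -> grad g x (g1 x) (g2 x)) -> Ck n U g1 -> Ck n U g2 ->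
  Ck n.+1 U g.
Proof.
move=> oU H H1 H2; split.
- by move=> x /H [].
- by apply: Ck_ext H1 => // x /H /grad_d1.
- by apply: Ck_ext H2 => // x /H /grad_d2.
Qed.

Lemma Ck_cst n U (c : R) : open U -> Ck n U (fun=> c).
Proof.
move=> oU; elim: n c => [|n IH] c; first by move=> x _; exact: cvg_cst.
by apply: (Ck_intro oU (fun x _ => grad_cst c x)).
Qed.

Lemma Ck_fst n U : open U -> Ck n U (fst : P -> R).
Proof.
move=> oU; case: n => [|n]; first by move=> x _; exact: cvg_fst.
by apply: (Ck_intro oU (fun x _ => grad_fst x)); exact: Ck_cst.
Qed.

Lemma Ck_snd n U : open U -> Ck n U (snd : P -> R).
Proof.
move=> oU; case: n => [|n]; first by move=> x _; exact: cvg_snd.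
by apply: (Ck_intro oU (fun x _ => grad_snd x)); exact: Ck_cst.
Qed.

Lemma CkD n U g h : open U -> Ck n U g -> Ck n U h ->
  Ck n U (fun y => g y + h y).
Proof.
move=> oU; elim: n g h => [|n IH] g h Hg Hh.
  by move=> x Ux; apply: cvgD; [exact: Hg|exact: Hh].
have [_ g1 g2] := Hg; have [_ h1 h2] := Hh.
apply: (Ck_intro oU (fun x Ux => gradD (Ck_grad Hg Ux) (Ck_grad Hh Ux)));
exact: IH.
Qed.

Lemma CkM n U g h : open U -> Ck n U g -> Ck n U h ->
  Ck n U (fun y => g y * h y).
Proof.
move=> oU; elim: n g h => [|n IH] g h Hg Hh.
  by move=> x Ux; apply: cvgM; [exact: Hg|exact: Hh].
have [_ g1 g2] := Hg; have [_ h1 h2] := Hh.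
have cg := CkS Hg; have ch := CkS Hh.
apply: (Ck_intro oU (fun x Ux => gradM (Ck_grad Hg Ux) (Ck_grad Hh Ux)));
by apply: CkD => //; exact: IH.
Qed.

Lemma CkN n U g : open U -> Ck n U g -> Ck n U (fun y => - g y).
Proof.
move=> oU Hg; apply: (@Ck_ext _ _ (fun y => -1 * g y)) => //.
  by move=> x _; rewrite mulN1r.
by apply: CkM => //; exact: Ck_cst.
Qed.

Lemma CkB n U g h : open U -> Ck n U g -> Ck n U h ->
  Ck n U (fun y => g y - h y).
Proof. by move=> oU Hg /(CkN oU); exact: CkD. Qed.

Lemma CkX n U g k : open U -> Ck n U g -> Ck n U (fun y => g y ^+ k).
Proof.
move=> oU Hg; elim: k => [|k IH]; first exact: Ck_cst.
apply: (@Ck_ext _ _ (fun y => g y * g y ^+ k)) => //.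
  by move=> x _; rewrite exprS.
exact: (CkM oU Hg IH).
Qed.

Lemma Ck_sum n U (I : Type) (s : seq I) (h : I -> P -> R) : open U ->
  (forall i, Ck n U (h i)) -> Ck n U (fun y => \sum_(i <- s) h i y).
Proof.
move=> oU H; elim: s => [|i s IH].
  apply: (@Ck_ext _ _ (fun=> 0)) => //; last exact: Ck_cst.
  by move=> x _; rewrite big_nil.
apply: (@Ck_ext _ _ (fun y => h i y + \sum_(i <- s) h i y)) => //.
  by move=> x _; rewrite big_cons.
exact: CkD.
Qed.

Lemma CkV n U g : open U -> (forall x, U x -> g x != 0) -> Ck n U g ->
  Ck n U (fun y => (g y)^-1).
Proof.
move=> oU g0; elim: n => [|n IH] Hg.
  by move=> x Ux; apply: cvgV; [exact: g0|exact: Hg].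
have [_ g1 g2] := Hg; have cg := IH (CkS Hg).
apply: (Ck_intro oU (fun x Ux => gradV (Ck_grad Hg Ux) (g0 x Ux)));
  apply: CkM => //; apply: CkN => //;
  apply: (@Ck_ext _ _ (fun y => (g y)^-1 ^+ 2)) => //; try exact: CkX;
  by move=> x _; rewrite exprVn.
Qed.

Lemma Ck_ln n U g : open U -> (forall x, U x -> 0 < g x) -> Ck n U g ->
  Ck n U (fun y => ln (g y)).
Proof.
move=> oU g0; case: n => [|n] Hg.
  move=> x Ux; apply: (@continuous_comp P R R g (@ln R)); first exact: Hg.
  by apply: continuous_ln; exact: g0.
have [_ g1 g2] := Hg.
have cg : Ck n U (fun y => (g y)^-1).
  by apply: CkV => //; [move=> x /g0 /lt0r_neq0|exact: CkS].
by apply: (Ck_intro oU (fun x Ux =>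
  grad_comp1 (Ck_grad Hg Ux) (is_derive1_ln (g0 x Ux)))); exact: CkM.
Qed.

Lemma Ck_comp n U V g (T1 T2 : P -> R) : open U -> open V ->
  (forall x, U x -> V (T1 x, T2 x)) -> Ck n U T1 -> Ck n U T2 -> Ck n V g ->
  Ck n U (fun y => g (T1 y, T2 y)).
Proof.
move=> oU oV UV; elim: n g => [|n IH] g HT1 HT2 Hg.
  move=> x Ux; apply: (@continuous_comp _ _ _ (fun y => (T1 y, T2 y)) g).
    apply: (@cvg_pair _ _ _ _ (nbhs (T1 x)) (nbhs (T2 x))).
      exact: HT1.
    exact: HT2.
  exact/Hg/UV.
have [_ ? ?] := Hg; have [_ ? ?] := HT1; have [_ ? ?] := HT2.
apply: (Ck_intro oU (fun x Ux =>
  grad_comp (Ck_grad HT1 Ux) (Ck_grad HT2 Ux) (Ck_grad Hg (UV x Ux))));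
by apply: CkD => //; apply: CkM => //; apply: IH => //; exact: CkS.
Qed.

(** Its square is of class C^1 and its cube of class C^2; all cutoffs below
    are made of them. *)
Definition max0 (t : R) : R := Num.max 0 t.

Lemma is_derive_eps (f : R -> R) (t a : R) :
  (forall e, 0 < e -> \forall y \near t,
    `|f y - f t - a * (y - t)| <= e * `|y - t|) -> is_derive t 1 f a.
Proof.
move=> H.
have H0 : h^-1 *: ((f \o shift t) (h *: 1) - f t) @[h --> 0^'] --> a.
  apply/cvgrPdist_le => e e0.
  have := H e e0; rewrite (@near_shift _ _ 0 t) => H1.
  rewrite near_withinE; apply: filterS H1 => h; rewrite /= subr0 !addrK.
  rewrite /GRing.scale /= mulr1 => H2 h0.
  have hp : 0 < `|h| by rewrite normr_gt0.
  rewrite -(ler_pM2r hp) -normrM; apply: le_trans H2.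
  rewrite -normrN le_eqVlt; apply/orP; left; apply/eqP; congr `| _ |.
  by field.
by split; [apply/cvg_ex; exists a|exact: (cvg_lim _ H0)].
Qed.

Lemma is_derive_max0sq (t : R) :
  is_derive t 1 (fun y => max0 y ^+ 2) (2 * max0 t).
Proof.
apply: is_derive_eps => e e0.
suff H y : `|max0 y ^+ 2 - max0 t ^+ 2 - 2 * max0 t * (y - t)|
    <= `|y - t| * `|y - t|.
  have : \forall y \near t, `|y - t| <= e.
    by near=> y; rewrite distrC; near: y; apply: cvgr_dist_le e0; exact: cvg_id.
  apply: filterS => y Hy; apply: le_trans (H y) _; rewrite ler_wpM2r //.
rewrite -normrM /max0 ler_norml.
have -> : `|(y - t) * (y - t)| = (y - t) ^+ 2.
  by rewrite ger0_norm -?expr2 // sqr_ge0.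
have sq := sqr_ge0 (y - t).
case: (leP 0 y) => hy; case: (leP 0 t) => ht; apply/andP; split; rewrite ?expr0n /=.
- nra.
- nra.
- nra.
- nra.
- nra.
- nra.
- nra.
- nra.
Unshelve. all: by end_near. Qed.

Lemma max0_continuous : continuous max0.
Proof.
move=> t; apply: (@continuous_max _ _ (fun=> 0) id t); first exact: cvg_cst.
exact: cvg_id.
Qed.

Lemma Ck1_max0sq U g : open U -> Ck 1 U g -> Ck 1 U (fun y => max0 (g y) ^+ 2).
Proof.
move=> oU Hg; have Hm : Ck 0 U (fun y => 2 * max0 (g y)).
  apply: (CkM (n := 0) oU (Ck_cst 0 2 oU)).
  move=> x Ux; apply: (@continuous_comp _ _ _ g max0).
    exact: (Ck_continuous Hg).
  exact: max0_continuous.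
have H x Ux := grad_comp1 (Ck_grad (x := x) Hg Ux) (is_derive_max0sq (g x)).
apply: (Ck_intro oU H).
  exact: (CkM oU Hm (Ck_d1 Hg)).
exact: (CkM oU Hm (Ck_d2 Hg)).
Qed.

Lemma max0_mul (t : R) : t * max0 t = max0 t ^+ 2.
Proof. by rewrite /max0; case: leP => _ //; rewrite mulr0 expr0n. Qed.

Lemma is_derive_max0cube (t : R) :
  is_derive t 1 (fun y => max0 y ^+ 3) (3 * max0 t ^+ 2).
Proof.
have := is_deriveM (is_derive_id t (1 : R)) (is_derive_max0sq t).
rewrite (_ : id * _ = (fun y => max0 y ^+ 3)); last first.
  apply/funext => y; rewrite !fctE /= [RHS]exprSr.
  by rewrite -[in RHS]max0_mul expr2 mulrA.
move=> H; apply: (is_derive_eq H).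
by rewrite /GRing.scale /= mulr1 mulrCA max0_mul; ring.
Qed.

Lemma Ck2_max0cube U g : open U -> Ck 2 U g -> Ck 2 U (fun y => max0 (g y) ^+ 3).
Proof.
move=> oU Hg; have Hm : Ck 1 U (fun y => 3 * max0 (g y) ^+ 2).
  apply: CkM => //; first exact: Ck_cst.
  by apply: Ck1_max0sq => //; exact: CkS.
have H x Ux := grad_comp1 (Ck_grad (x := x) Hg Ux) (is_derive_max0cube (g x)).
apply: (Ck_intro oU H).
  exact: (CkM oU Hm (Ck_d1 Hg)).
exact: (CkM oU Hm (Ck_d2 Hg)).
Qed.

Definition lap g x := d1 (d1 g) x + d2 (d2 g) x.

Lemma Ck_lap U g : open U -> Ck 2 U g -> Ck 0 U (lap g).
Proof.
by move=> oU Hg; exact: (CkD oU (Ck_d1 (Ck_d1 Hg)) (Ck_d2 (Ck_d2 Hg))).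
Qed.

Lemma lap_ext U g g' x : open U -> U x -> (forall x, U x -> g x = g' x) ->
  Ck 2 U g -> lap g x = lap g' x.
Proof.
move=> oU Ux E Hg; have Hg1 := Ck_d1 Hg; have Hg2 := Ck_d2 Hg.
have N y : U y -> \forall z \near y, g z = g' z.
  by move=> Uy; have := near_open oU Uy; apply: filterS => z /E.
have N1 : \forall z \near x, d1 g z = d1 g' z.
  have := near_open oU Ux; apply: filterS => z Uz.
  by rewrite (grad_d1 (grad_near (N z Uz) (Ck_grad Hg Uz))).
have N2 : \forall z \near x, d2 g z = d2 g' z.
  have := near_open oU Ux; apply: filterS => z Uz.
  by rewrite (grad_d2 (grad_near (N z Uz) (Ck_grad Hg Uz))).
rewrite /lap (grad_d1 (grad_near N1 (Ck_grad Hg1 Ux))).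
by rewrite (grad_d2 (grad_near N2 (Ck_grad Hg2 Ux))).
Qed.

Lemma mono_dist (x y : P) : `|x.1 - y.1| <= `|x - y| /\ `|x.2 - y.2| <= `|x - y|.
Proof. by rewrite prod_normE2 /= !le_max !lexx orbT. Qed.

Lemma is_derive_line1 g x a b : grad g x a b ->
  is_derive x.1 1 (fun t => g (t, x.2)) a.
Proof.
case: x => x1 x2 /gradP H; apply: is_derive_eps => e e0 /=.
have := H e e0; rewrite /= => {}H.
have C : (t, x2) @[t --> x1] --> ((x1, x2) : P).
  by apply: (@cvg_pair _ _ _ _ (nbhs x1) (nbhs x2)); [exact: cvg_id|exact: cvg_cst].
have {}H : \forall t \near x1, `|g (t, x2) - g (x1, x2) -
  (a * (t - x1) + b * (x2 - x2))| <= e * `|(t, x2) - (x1, x2)| := C _ H.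
apply: filterS H => t; rewrite subrr mulr0 addr0 prod_normE2 /= subrr normr0.
by rewrite (max_idPl (normr_ge0 _)).
Qed.

Lemma is_derive_line2 g x a b : grad g x a b ->
  is_derive x.2 1 (fun t => g (x.1, t)) b.
Proof.
case: x => x1 x2 /gradP H; apply: is_derive_eps => e e0 /=.
have := H e e0; rewrite /= => {}H.
have C : (x1, t) @[t --> x2] --> ((x1, x2) : P).
  by apply: (@cvg_pair _ _ _ _ (nbhs x1) (nbhs x2)); [exact: cvg_cst|exact: cvg_id].
have {}H : \forall t \near x2, `|g (x1, t) - g (x1, x2) -
  (a * (x1 - x1) + b * (t - x2))| <= e * `|(x1, t) - (x1, x2)| := C _ H.
apply: filterS H => t; rewrite subrr mulr0 add0r prod_normE2 /= subrr normr0.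
by rewrite (max_idPr (normr_ge0 _)).
Qed.

Lemma MVT_derive (f df : R -> R) (a b : R) : a < b ->
  (forall t : R, t \in `[a, b]%R -> is_derive t 1 f (df t)) ->
  exists2 c, c \in `]a, b[%R & f b - f a = df c * (b - a).
Proof.
move=> ab H.
have H1 : forall t : R, t \in `]a, b[%R -> is_derive t 1 f (df t).
  by move=> t tab; apply: H; apply: subset_itv_oo_cc.
have H2 : {within `[a, b], continuous f}.
  apply: derivable_within_continuous => t /H Ht; exact: ex_derive.
exact: MVT ab H1 H2.
Qed.

(** The second difference of g over a small square equals, by the mean value
    theorem applied in either order, each of the mixed derivatives at some
    nearby point. *)
Lemma schwarz_aux g U x e : open U -> Ck 2 U g -> U x -> 0 < e ->
  exists y z : P, [/\ `|y - x| < e, `|z - x| < e & d2 (d1 g) y = d1 (d2 g) z].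
Proof.
move=> oU Hg Ux e0.
have [d d0 HU] : exists2 d : R, 0 < d & forall y, `|y - x| <= d -> U y.
  have /nbhs_ballP[d /= d0 Hd] := near_open oU Ux.
  exists (d / 2); first by rewrite divr_gt0.
  move=> y Hy; apply: Hd; rewrite -ball_normE /= distrC.
  by apply: le_lt_trans Hy _; rewrite ltr_pdivrMr // ltr_pMr // ltr1n.
pose h := Num.min d (e / 2).
have h0 : 0 < h by rewrite lt_min d0 divr_gt0.
have hd : h <= d by rewrite ge_min lexx.
have he : h < e.
  by apply: le_lt_trans (_ : e / 2 < e); rewrite ?ge_min ?lexx ?orbT // ltr_pdivrMr // ltr_pMr // ltr1n.
case: x Ux HU => x1 x2 Ux HU.
have dist y1 y2 : x1 <= y1 <= x1 + h -> x2 <= y2 <= x2 + h ->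
    `|(y1, y2) - (x1, x2)| <= h.
  move=> H1 H2; rewrite prod_normE2 /= ge_max !ler_norml.
  by apply/andP; split; lra.
have HU' y1 y2 : x1 <= y1 <= x1 + h -> x2 <= y2 <= x2 + h -> U (y1, y2).
  by move=> H1 H2; apply: HU; apply: le_trans hd; apply: dist.
have lex : x1 <= x1 <= x1 + h by rewrite lexx lerDl ltW.
have lexh : x1 <= x1 + h <= x1 + h by rewrite lexx lerDl ltW.
have ley : x2 <= x2 <= x2 + h by rewrite lexx lerDl ltW.
have leyh : x2 <= x2 + h <= x2 + h by rewrite lexx lerDl ltW.
have Hg1 := Ck_d1 Hg; have Hg2 := Ck_d2 Hg.
pose A := (g (x1 + h, x2 + h) - g (x1 + h, x2)) - (g (x1, x2 + h) - g (x1, x2)).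
have [c1 c1I E1] := @MVT_derive (fun t => g (t, x2 + h) - g (t, x2))
   (fun t => d1 g (t, x2 + h) - d1 g (t, x2)) x1 (x1 + h) (ltac:(by rewrite ltrDl))
  (ltac:(move=> t; rewrite in_itv /= => Ht; apply: is_deriveB;
    [exact: (is_derive_line1 (Ck_grad Hg (HU' t (x2 + h) Ht leyh)))|
     exact: (is_derive_line1 (Ck_grad Hg (HU' t x2 Ht ley)))])).
have {}c1I : x1 <= c1 <= x1 + h.
  by move: c1I; rewrite in_itv /= => /andP[/ltW -> /ltW ->].
have [c2 c2I E2] := @MVT_derive (fun t => d1 g (c1, t))
   (fun t => d2 (d1 g) (c1, t)) x2 (x2 + h) (ltac:(by rewrite ltrDl))
  (ltac:(move=> t; rewrite in_itv /= => Ht;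
    exact: (is_derive_line2 (Ck_grad Hg1 (HU' c1 t c1I Ht))))).
have {}c2I : x2 <= c2 <= x2 + h.
  by move: c2I; rewrite in_itv /= => /andP[/ltW -> /ltW ->].
have [c3 c3I E3] := @MVT_derive (fun t => g (x1 + h, t) - g (x1, t))
   (fun t => d2 g (x1 + h, t) - d2 g (x1, t)) x2 (x2 + h) (ltac:(by rewrite ltrDl))
  (ltac:(move=> t; rewrite in_itv /= => Ht; apply: is_deriveB;
    [exact: (is_derive_line2 (Ck_grad Hg (HU' (x1 + h) t lexh Ht)))|
     exact: (is_derive_line2 (Ck_grad Hg (HU' x1 t lex Ht)))])).
have {}c3I : x2 <= c3 <= x2 + h.
  by move: c3I; rewrite in_itv /= => /andP[/ltW -> /ltW ->].
have [c4 c4I E4] := @MVT_derive (fun t => d2 g (t, c3))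
   (fun t => d1 (d2 g) (t, c3)) x1 (x1 + h) (ltac:(by rewrite ltrDl))
  (ltac:(move=> t; rewrite in_itv /= => Ht;
    exact: (is_derive_line1 (Ck_grad Hg2 (HU' t c3 Ht c3I))))).
have {}c4I : x1 <= c4 <= x1 + h.
  by move: c4I; rewrite in_itv /= => /andP[/ltW -> /ltW ->].
exists (c1, c2), (c4, c3); split.
- exact: le_lt_trans (dist _ _ c1I c2I) he.
- exact: le_lt_trans (dist _ _ c4I c3I) he.
have [hh1 hh2] : x1 + h - x1 = h /\ x2 + h - x2 = h by split; ring.
rewrite hh1 in E1 E4; rewrite hh2 in E2 E3; rewrite /= in E1 E2 E3 E4.
have hn : h != 0 by rewrite lt0r_neq0.
move: E1 E3; rewrite E2 E4.
move: (d2 (d1 g) _) (d1 (d2 g) _) => A1 A2.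
rewrite -!mulrA -expr2 => E1 E3; apply: (mulIf (expf_neq0 2 hn)).
rewrite -E1 -E3; ring.
Qed.

Lemma schwarz g U x : open U -> Ck 2 U g -> U x -> d2 (d1 g) x = d1 (d2 g) x.
Proof.
move=> oU Hg Ux; apply/eqP; rewrite -subr_eq0 -normr_le0.
apply/ler_addgt0Pl => e e0; rewrite addr0.
have e2 : 0 < e / 2 by rewrite divr_gt0.
have [/= _ _ C1] := Ck_d1 Hg; have [/= _ C2 _] := Ck_d2 Hg.
have /cvgrPdist_lt/(_ _ e2)/nbhs_ballP[a /= a0 Ha] := C1 x Ux.
have /cvgrPdist_lt/(_ _ e2)/nbhs_ballP[b /= b0 Hb] := C2 x Ux.
have ab0 : 0 < Num.min a b by rewrite lt_min a0.
have [y [z [Hy Hz E]]] := schwarz_aux oU Hg Ux ab0.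
have := Ha y; rewrite -ball_normE /= distrC => /(_ (lt_le_trans Hy _)).
rewrite ge_min lexx => /(_ isT) H1.
have := Hb z; rewrite -ball_normE /= distrC => /(_ (lt_le_trans Hz _)).
rewrite ge_min lexx orbT => /(_ isT) H2.
rewrite E in H1; move: H1 H2.
move: (d2 (d1 g) x) (d1 (d2 g) x) (d1 (d2 g) z) => A B C H1 H2.
have -> : A - B = (A - C) - (B - C) by ring.
apply: le_trans (ler_normB _ _) _.
by rewrite [leRHS]splitr; apply: lerD; exact: ltW.
Qed.

(** The components of a conformal map are harmonic, which removes the first
    order terms of the chain rule. *)
Lemma lap_comp U V (T1 T2 : P -> R) g x : open U -> open V ->
  (forall x, U x -> V (T1 x, T2 x)) -> Ck 2 U T1 -> Ck 2 U T2 -> Ck 2 V g ->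
  (forall x, U x -> d1 T1 x = d2 T2 x /\ d2 T1 x = - d1 T2 x) -> U x ->
  lap (fun y => g (T1 y, T2 y)) x =
  lap g (T1 x, T2 x) * (d1 T1 x ^+ 2 + d1 T2 x ^+ 2).
Proof.
move=> oU oV UV H1 H2 Hg CR Ux; have Vx := UV x Ux.
have G y (Uy : U y) := grad_comp (Ck_grad H1 Uy) (Ck_grad H2 Uy) (Ck_grad Hg (UV y Uy)).
have E1 : \forall y \near x, d1 g (T1 y, T2 y) * d1 T1 y + d2 g (T1 y, T2 y) * d1 T2 y
    = d1 (fun y => g (T1 y, T2 y)) y.
  by have := near_open oU Ux; apply: filterS => y /G/grad_d1.
have E2 : \forall y \near x, - d1 g (T1 y, T2 y) * d1 T2 y + d2 g (T1 y, T2 y) * d1 T1 y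
    = d2 (fun y => g (T1 y, T2 y)) y.
  have := near_open oU Ux; apply: filterS => y Uy; rewrite (grad_d2 (G y Uy)).
  have [-> ->] := CR y Uy; ring.
have g1 := Ck_grad (Ck_d1 Hg) Vx; have g2 := Ck_grad (Ck_d2 Hg) Vx.
have t1 := Ck_grad H1 Ux; have t2 := Ck_grad H2 Ux.
have t11 := Ck_grad (Ck_d1 H1) Ux; have t21 := Ck_grad (Ck_d1 H2) Ux.
have G1 := gradD (gradM (grad_comp t1 t2 g1) t11) (gradM (grad_comp t1 t2 g2) t21).
have G2 := gradD (gradM (gradN (grad_comp t1 t2 g1)) t21) (gradM (grad_comp t1 t2 g2) t11).
rewrite /lap (grad_d1 (grad_near E1 G1)) (grad_d2 (grad_near E2 G2)).
have S1 := schwarz oU H1 Ux; have S2 := schwarz oU H2 Ux.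
have N1 : \forall y \near x, d1 T1 y = d2 T2 y.
  by have := near_open oU Ux; apply: filterS => y /CR[].
have N2 : \forall y \near x, d2 T1 y = - d1 T2 y.
  by have := near_open oU Ux; apply: filterS => y /CR[].
have L1 : d1 (d1 T1) x = d1 (d2 T2) x.
  exact/esym/(grad_d1 (grad_near N1 (Ck_grad (Ck_d1 H1) Ux))).
have L3 : d1 (d2 T1) x = - d1 (d1 T2) x.
  have N2' : \forall y \near x, - d1 T2 y = d2 T1 y.
    by apply: filterS N2 => y ->.
  exact: grad_d1 (grad_near N2' (gradN (Ck_grad (Ck_d1 H2) Ux))).
have [C1 C2] := CR x Ux; rewrite {}S2 -{}L1 {}S1 {}L3 C2 -C1.
move: (d1 (d1 T1) x) (d1 (d1 T2) x) => a11 a12.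
move: (d1 (d1 g) _) (d1 (d2 g) _) (d2 (d1 g) _) (d2 (d2 g) _) => b1 b2 b3 b4.
move: (d1 T1 x) (d1 T2 x) (d1 g _) (d2 g _) => p q c1 c2.
ring.
Qed.

End Ck.

(** * Conformal immersions in the ball *)

Section LocalGeometry.
Variable R : realType.
Local Notation P := (R * R)%type.
Local Notation E3 := 'rV[R]_3.
Implicit Types (g : P -> E3) (x : P) (U : set P).

Definition fc g (k : 'I_3) : P -> R := fun x => g x 0 k.

Lemma fc_derive g x v k : differentiable g x ->
  differentiable (fc g k) x /\ 'D_v g x 0 k = 'D_v (fc g k) x.
Proof.
move=> Hd; split.
  rewrite /fc; apply: (@differentiable_comp _ _ _ _ g (fun M : E3 => M 0 k)) => //.
  exact: differentiable_coord.
rewrite derive_mx; first by rewrite mxE.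
exact: diff_derivable.
Qed.

Lemma smooth_Ck U g n k : open U -> smooth_on U g -> Ck n U (fc g k).
Proof.
move=> oU; elim: n g => [|n IH] g Hg.
  move=> x Ux; apply: differentiable_continuous.
  by have [] := fc_derive 0 k (Hg [::] x Ux).
have D v : smooth_on U ('D_v g).
  by move=> s x Ux; have := Hg (rcons s v) x Ux; rewrite foldr_rcons.
split.
- by move=> x Ux; have [] := fc_derive 0 k (Hg [::] x Ux).
- apply: Ck_ext (IH _ (D (1, 0))) => // x Ux.
  by have [_] := fc_derive (1, 0) k (Hg [::] x Ux); rewrite d1E.
- apply: Ck_ext (IH _ (D (0, 1))) => // x Ux.
  by have [_] := fc_derive (0, 1) k (Hg [::] x Ux); rewrite d2E.
Qed.

Lemma partial0 U g x k : smooth_on U g -> U x ->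
  partial g 0 x 0 k = d1 (fc g k) x.
Proof.
move=> Hg Ux; rewrite /partial d1E.
by have [_ <-] := fc_derive (1, 0) k (Hg [::] x Ux).
Qed.

Lemma partial1 U g x k : smooth_on U g -> U x ->
  partial g 1 x 0 k = d2 (fc g k) x.
Proof.
move=> Hg Ux; rewrite /partial d2E.
by have [_ <-] := fc_derive (0, 1) k (Hg [::] x Ux).
Qed.

Lemma smooth_partial U g a : smooth_on U g -> smooth_on U (partial g a).
Proof.
by move=> Hg s x Ux; have := Hg (rcons s (dir R a)) x Ux; rewrite foldr_rcons.
Qed.

Lemma partial00 U g x k : open U -> smooth_on U g -> U x ->
  partial (partial g 0) 0 x 0 k = d1 (d1 (fc g k)) x.
Proof.
move=> oU Hg Ux; rewrite (partial0 _ (smooth_partial 0 Hg) Ux).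
have Hc := smooth_Ck 1 k oU (smooth_partial 0 Hg).
apply/esym; apply: grad_d1; apply: grad_near (Ck_grad Hc Ux).
by have := near_open oU Ux; apply: filterS => y Uy; exact: (partial0 k Hg Uy).
Qed.

Lemma partial11 U g x k : open U -> smooth_on U g -> U x ->
  partial (partial g 1) 1 x 0 k = d2 (d2 (fc g k)) x.
Proof.
move=> oU Hg Ux; rewrite (partial1 _ (smooth_partial 1 Hg) Ux).
have Hc := smooth_Ck 1 k oU (smooth_partial 1 Hg).
apply/esym; apply: grad_d2; apply: grad_near (Ck_grad Hc Ux).
by have := near_open oU Ux; apply: filterS => y Uy; exact: (partial1 k Hg Uy).
Qed.

Lemma dotE (u v : E3) : Defs.dotmx 1%:M u v = \sum_k u 0 k * v 0 k.
Proof. by rewrite /Defs.dotmx mulmx1 mxE; apply: eq_bigr => k _; rewrite mxE. Qed.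

Lemma dotcE (c : R) (u v : E3) : Defs.dotmx c%:M u v = c * \sum_k u 0 k * v 0 k.
Proof.
rewrite /Defs.dotmx mul_mx_scalar mxE big_distrr.
by apply: eq_bigr => k _; rewrite !mxE /= mulrA.
Qed.

Definition o0 : 'I_3 := @Ordinal 3 0 isT.
Definition o1 : 'I_3 := @Ordinal 3 1 isT.
Definition o2 : 'I_3 := @Ordinal 3 2 isT.

Lemma sum3 (h : 'I_3 -> R) : \sum_k h k = h o0 + h o1 + h o2.
Proof.
rewrite !big_ord_recl big_ord0 addr0 addrA; congr (_ + _ + _); congr h;
by apply: val_inj; rewrite /= ?inordK.
Qed.

Lemma ord3P (Q : 'I_3 -> Prop) : Q o0 -> Q o1 -> Q o2 -> forall k, Q k.
Proof.
move=> q0 q1 q2 k.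
have [->|[->|->]] // : k = o0 \/ k = o1 \/ k = o2.
case: k => -[|[|[|//]]] Hk; [left|right; left|right; right];
  by apply: val_inj; rewrite /= ?inordK.
Qed.

Lemma inord3 : (inord 0 = o0) * (inord 1 = o1) * (inord 2 = o2).
Proof. by do !split; apply: val_inj; rewrite /= ?inordK. Qed.

Lemma vec3E (a b c : R) :
  (vec3 a b c 0 o0 = a) * (vec3 a b c 0 o1 = b) * (vec3 a b c 0 o2 = c).
Proof. by do !split; rewrite mxE /= ?inordK. Qed.

Lemma crossE (u v : E3) :
  (cross u v 0 o0 = u 0 o1 * v 0 o2 - u 0 o2 * v 0 o1) *
  (cross u v 0 o1 = u 0 o2 * v 0 o0 - u 0 o0 * v 0 o2) *
  (cross u v 0 o2 = u 0 o0 * v 0 o1 - u 0 o1 * v 0 o0).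
Proof. by rewrite /cross !vec3E !inord3. Qed.

Definition dot (u v : E3) : R := \sum_k u 0 k * v 0 k.

Lemma normsq_dot u : normsq u = dot u u.
Proof. exact: dotE. Qed.

Lemma dotmx_dot u v : Defs.dotmx 1%:M u v = dot u v.
Proof. exact: dotE. Qed.

Lemma dot3 u v : dot u v = u 0 o0 * v 0 o0 + u 0 o1 * v 0 o1 + u 0 o2 * v 0 o2.
Proof. exact: sum3. Qed.

(** The Gram determinant of (w, u, v) against (z, u, v) is
    (w . (u x v)) (z . (u x v)). *)
Lemma gram (u v w z : E3) L : dot u u = L -> dot v v = L -> dot u v = 0 ->
  L ^+ 2 * dot w z = L * (dot w u * dot z u) + L * (dot w v * dot z v)
    + dot w (cross u v) * dot z (cross u v).
Proof.
move=> uu vv uv.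
have E : dot w (cross u v) * dot z (cross u v) =
  dot w z * (dot u u * dot v v - dot u v * dot u v)
  - dot w u * (dot z u * dot v v - dot u v * dot z v)
  + dot w v * (dot z u * dot u v - dot u u * dot z v).
  rewrite !dot3 !crossE; ring.
by rewrite E uu vv uv; ring.
Qed.

Lemma dot_cross u v : (dot u (cross u v) = 0) * (dot v (cross u v) = 0).
Proof. by split; rewrite dot3 !crossE; ring. Qed.

Lemma cross_cross u v L : dot u u = L -> dot v v = L -> dot u v = 0 ->
  dot (cross u v) (cross u v) = L ^+ 2.
Proof.
move=> uu vv uv.
have -> : dot (cross u v) (cross u v) = dot u u * dot v v - dot u v ^+ 2.
  rewrite !dot3 !crossE; ring.
by rewrite uu vv uv; ring.
Qed.

Lemma mxtrace2 (A : 'M[R]_2) : \tr A = A 0 0 + A 1 1.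
Proof.
rewrite /mxtrace !big_ord_recl big_ord0 addr0; congr (A _ _ + A _ _);
exact: val_inj.
Qed.

Lemma ord2P (Q : 'I_2 -> Prop) : Q 0 -> Q 1 -> forall k, Q k.
Proof.
move=> q0 q1 k; have [->|->] // : k = 0 \/ k = 1.
by case: k => -[|[|//]] Hk; [left|right]; apply: val_inj.
Qed.

Section AtPoint.
Variables (G : E3 -> 'M[R]_3) (g : P -> E3) (x : P) (c L : R).
Let u := partial g 0 x.
Let v := partial g 1 x.
Hypothesis Gc : G (g x) = (c ^+ 2)%:M.
Hypothesis c0 : 0 < c.
Hypothesis L0 : 0 < L.
Hypothesis uu : dot u u = L.
Hypothesis vv : dot v v = L.
Hypothesis uv : dot u v = 0.

Lemma first_formE : first_form G g x = (c ^+ 2 * L)%:M.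
Proof.
apply/matrixP; apply: ord2P; apply: ord2P; rewrite !mxE Gc dotcE -/(dot _ _).
- by rewrite uu.
- by rewrite uv mulr0.
- rewrite /dot; under eq_bigr do rewrite mulrC.
  by rewrite -/(dot u v) uv mulr0.
- by rewrite vv.
Qed.

Lemma unit_normalE : unit_normal G g x = (c * L)^-1 *: cross u v.
Proof.
rewrite /unit_normal Gc invmx_scalar mul_mx_scalar -/u -/v.
rewrite dotcE -/(dot _ _).
have -> (n : E3) (t : R) : dot (t *: n) (t *: n) = t * t * dot n n.
  by rewrite /dot big_distrr; apply: eq_bigr => k _; rewrite !mxE mulrACA.
rewrite (cross_cross uu vv uv) mulrA.
have cn : c != 0 by rewrite lt0r_neq0.
have Ln : L != 0 by rewrite lt0r_neq0.
have -> : c ^+ 2 * ((c ^+ 2)^-1 * (c ^+ 2)^-1) * L ^+ 2 = (L / c) ^+ 2.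
  by field.
rewrite sqrtr_sqr ger0_norm; last by rewrite divr_ge0 // ltW.
by rewrite scalerA; congr (_ *: _); field; rewrite cn Ln.
Qed.

Lemma mean_curvatureE : mean_curvature G g x =
  dot (covariant G g 0 0 x + covariant G g 1 1 x) (cross u v) / (2 * L ^+ 2 * c).
Proof.
have cn : c != 0 by rewrite lt0r_neq0.
have Ln : L != 0 by rewrite lt0r_neq0.
rewrite /mean_curvature first_formE invmx_scalar mul_scalar_mx mxtrace2.
have II a b : second_form G g x a b =
    c ^+ 2 * dot (covariant G g a b x) ((c * L)^-1 *: cross u v).
  by rewrite mxE Gc unit_normalE dotcE.
rewrite [X in X + _]mxE [X in _ + X]mxE !II.
move: (covariant G g 0 0 x) (covariant G g 1 1 x) (cross u v) => A B n.
rewrite !dot3 !mxE; field; by rewrite cn Ln.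
Qed.

Lemma area_densityE : area_density G g x = c ^+ 2 * L.
Proof.
rewrite /area_density first_formE det_scalar sqrtr_sqr ger0_norm //.
by rewrite mulr_ge0 ?sqr_ge0 // ltW.
Qed.

End AtPoint.

Lemma christoffel_euc (y : E3) k i j : christoffel (@metric_euc R) y k i j = 0.
Proof.
rewrite /christoffel /metric_euc big1 ?mulr0 // => l _.
by rewrite !derive_cst addr0 subr0 mulr0.
Qed.

Lemma is_derive_coord (y v : E3) k :
  is_derive y v (fun z : E3 => z 0 k) (v 0 k).
Proof.
have H : is_derive y v id v by exact: is_derive_id.
have D := derivableP.
have dd : derivable (fun z : E3 => z) y v by exact: derivable_id.
apply: DeriveDef.
  apply: diff_derivable; exact: differentiable_coord.
have := derive_mx dd; rewrite derive_id => /matrixP/(_ 0 k).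
by rewrite mxE.
Qed.

Lemma is_derive_mul (V : normedModType R) (h1 h2 : V -> R) (y v : V) a b :
  is_derive y v h1 a -> is_derive y v h2 b ->
  is_derive y v (fun z => h1 z * h2 z) (a * h2 y + h1 y * b).
Proof.
move=> H1 H2; have := is_deriveM H1 H2.
rewrite (_ : h1 * h2 = fun z => h1 z * h2 z); last by [].
by move=> H; apply: (is_derive_eq H); rewrite /GRing.scale /=; ring.
Qed.

Lemma is_derive_add (V : normedModType R) (h1 h2 : V -> R) (y v : V) a b :
  is_derive y v h1 a -> is_derive y v h2 b ->
  is_derive y v (fun z => h1 z + h2 z) (a + b).
Proof. by move=> H1 H2; exact: is_deriveD H1 H2. Qed.

Lemma is_derive_inv (V : normedModType R) (h : V -> R) (y v : V) a :
  h y != 0 -> is_derive y v h a ->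
  is_derive y v (fun z => (h z)^-1) (- (h y) ^- 2 * a).
Proof.
move=> h0 [D E]; have := deriveV h0 D; have := derivableV h0 D.
by rewrite E => D' E'; apply: DeriveDef.
Qed.

Lemma normsqE (y : E3) : normsq y = y 0 o0 ^+ 2 + y 0 o1 ^+ 2 + y 0 o2 ^+ 2.
Proof. by rewrite /normsq dotE sum3 !expr2. Qed.

Lemma derive_metric_hyp (y : E3) (a b c : 'I_3) : normsq y != 1 ->
  'D_(delta_mx 0 a : E3) (fun z : E3 => metric_hyp z b c) y =
  16 * y 0 a / (1 - normsq y) ^+ 3 *+ (b == c).
Proof.
move=> y1.
have rn : 1 - normsq y != 0 by rewrite subr_eq0 eq_sym.
have H : is_derive y (delta_mx 0 a : E3) (@normsq R) (2 * y 0 a).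
  have -> : @normsq R = fun z : E3 => z 0 o0 ^+ 2 + z 0 o1 ^+ 2 + z 0 o2 ^+ 2.
    by apply/funext => z; rewrite normsqE.
  have X k : is_derive y (delta_mx 0 a : E3) (fun z : E3 => z 0 k ^+ 2)
     (2 * y 0 k * (delta_mx 0 a : E3) 0 k).
    have C := is_derive_coord y (delta_mx 0 a : E3) k.
    by apply: is_derive_eq (is_derive_mul C C) _; ring.
  apply: is_derive_eq (is_derive_add (is_derive_add (X o0) (X o1)) (X o2)) _.
  move: a X; apply: ord3P => X; rewrite !mxE /= !(mulr0,mulr1,addr0,add0r) //.
have -> : (fun z : E3 => metric_hyp z b c) =
   (fun z => 4 / (1 - normsq z) ^+ 2 *+ (b == c)).
  by apply/funext => z; rewrite /metric_hyp mxE.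
case: (b == c); last by rewrite mulr0n; exact: derive_cst.
have I1 : is_derive y (delta_mx 0 a : E3) (fun z => 1 - normsq z) (- (2 * y 0 a)).
  have N := is_derive_mul (is_derive_cst (-1 : R) y (delta_mx 0 a : E3)) H.
  have := is_derive_add (is_derive_cst (1 : R) y (delta_mx 0 a : E3)) N.
  rewrite (_ : (fun z => _ + _) = (fun z => 1 - normsq z)); last first.
    by apply/funext => z /=; rewrite mulN1r.
  by move=> H'; apply: (is_derive_eq H'); rewrite mul0r !add0r mulN1r.
have n2 : (1 - normsq y) * (1 - normsq y) != 0 by rewrite mulf_neq0.
have := is_derive_mul (is_derive_cst (4 : R) y (delta_mx 0 a : E3))
  (@is_derive_inv _ (fun z : E3 => (1 - normsq z) * (1 - normsq z)) y _ _ n2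
    (is_derive_mul I1 I1)).
rewrite (_ : (fun z => _ * _) =
  (fun z => 4 / (1 - normsq z) ^+ 2 *+ true)); last first.
  by apply/funext => z /=; rewrite mulr1n expr2.
move=> [_ ->]; rewrite mulr1n; field.
exact: rn.
Qed.

Lemma christoffel_hyp (y : E3) k i j : 0 < 1 - normsq y ->
  christoffel (@metric_hyp R) y k i j = 2 / (1 - normsq y) *
    (y 0 i *+ (j == k) + y 0 j *+ (i == k) - y 0 k *+ (i == j)).
Proof.
move=> r0; have rn : 1 - normsq y != 0 by rewrite lt0r_neq0.
have y1 : normsq y != 1 by rewrite eq_sym -subr_eq0.
rewrite /christoffel.
have gn : 4 / (1 - normsq y) ^+ 2 != 0.
  by rewrite mulf_neq0 // invr_neq0 // expf_neq0.
under eq_bigr do rewrite !derive_metric_hyp // invmx_scalar mxE.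
rewrite (bigD1 k) //= big1 ?addr0; last first.
  by move=> l lk; rewrite eq_sym (negbTE lk) mulr0n mul0r.
rewrite eqxx mulr1n (eq_sym i j).
case: (j == k); case: (i == k); case: (j == i); rewrite ?mulr1n ?mulr0n; field;
  by rewrite rn.
Qed.

(** Conformal change of the Levi-Civita connection: for G = c^2 Id the
    correction is 2 d(ln c)(v) v - |v|^2 grad (ln c), where ln c = ln 2 - ln
    (1 - |x|^2). *)
Lemma covariant_hyp (g : P -> E3) x : 0 < 1 - normsq (g x) -> forall a k,
  covariant (@metric_hyp R) g a a x 0 k = partial (partial g a) a x 0 k +
  2 / (1 - normsq (g x)) * (2 * dot (g x) (partial g a x) * partial g a x 0 k
     - g x 0 k * dot (partial g a x) (partial g a x)).
Proof.
move=> r0 a k; rewrite /covariant mxE mxE; congr (_ + _).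
under eq_bigr do under eq_bigr do rewrite christoffel_hyp //.
move: (partial g a x) (g x) (2 / _) => v y c.
rewrite !dot3; move: k; apply: ord3P;
  rewrite !sum3 -!val_eqE /= ?inordK //= ?mulr1n ?mulr0n; ring.
Qed.

Lemma covariant_euc (g : P -> E3) x a k :
  covariant (@metric_euc R) g a a x 0 k = partial (partial g a) a x 0 k.
Proof.
rewrite /covariant mxE mxE big1 ?addr0 // => i _.
by rewrite big1 // => j _; rewrite christoffel_euc !mul0r.
Qed.

Definition pvec (x : P) (d : (P -> R) -> P -> R) g : E3 :=
  \row_k d (fc g k) x.

Lemma pvecE (x : P) d g k : pvec x d g 0 k = d (fc g k) x.
Proof. by rewrite mxE. Qed.

Lemma dot_pvec (x : P) d d' g : dot (pvec x d g) (pvec x d' g) =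
  d (fc g o0) x * d' (fc g o0) x + d (fc g o1) x * d' (fc g o1) x
  + d (fc g o2) x * d' (fc g o2) x.
Proof. by rewrite dot3 !mxE. Qed.

Lemma dot_fc_pvec (x : P) d g : dot (g x) (pvec x d g) =
  fc g o0 x * d (fc g o0) x + fc g o1 x * d (fc g o1) x
  + fc g o2 x * d (fc g o2) x.
Proof. by rewrite dot3 !mxE. Qed.

(** The coefficient of H^2 dA with respect to dx dy: the Laplacian of g is 2 H
    |g_x|^2 N, and g_x x g_y is |g_x|^2 N. *)
Definition wdens g x : R :=
  dot (pvec x (@lap R) g)
      (cross (pvec x (@d1 R) g) (pvec x (@d2 R) g)) ^+ 2
  / (4 * dot (pvec x (@d1 R) g) (pvec x (@d1 R) g) ^+ 3).

Section Immersion.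
Variables (U : set P) (g : P -> E3).
Hypothesis oU : open U.
Hypothesis Hg : conformal_immersion U g.

Let sg : smooth_on U g. Proof. by case: Hg. Qed.

Lemma pvec0 x : U x -> partial g 0 x = pvec x (@d1 R) g.
Proof. by move=> Ux; apply/rowP => k; rewrite pvecE (partial0 k sg Ux). Qed.

Lemma pvec1 x : U x -> partial g 1 x = pvec x (@d2 R) g.
Proof. by move=> Ux; apply/rowP => k; rewrite pvecE (partial1 k sg Ux). Qed.

Lemma pvec_lap x : U x ->
  partial (partial g 0) 0 x + partial (partial g 1) 1 x = pvec x (@lap R) g.
Proof.
move=> Ux; apply/rowP => k; rewrite mxE pvecE.
congr (_ + _); first exact: (partial00 k oU sg Ux).
exact: (partial11 k oU sg Ux).
Qed.

Lemma conformalE x : U x -> let L := dot (pvec x (@d1 R) g) (pvec x (@d1 R) g) in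
  [/\ 0 < L, dot (pvec x (@d2 R) g) (pvec x (@d2 R) g) = L &
      dot (pvec x (@d1 R) g) (pvec x (@d2 R) g) = 0].
Proof.
have aux (p q : E3) :
    [/\ p != 0, normsq p = normsq q & Defs.dotmx 1%:M p q = 0] ->
    [/\ 0 < dot p p, dot q q = dot p p & dot p q = 0].
  rewrite !normsq_dot dotmx_dot => -[n0 pq pq0]; split=> [||//]; last exact: esym.
  rewrite lt_neqAle eq_sym; apply/andP; split; last first.
    by apply: sumr_ge0 => k _; rewrite -expr2 sqr_ge0.
  apply: contra n0 => /eqP ww; apply/eqP/rowP => k; rewrite [RHS]mxE.
  have /psumr_eq0P : \sum_k p 0 k * p 0 k = 0 by [].
  have P0 i : true -> 0 <= p 0 i * p 0 i by rewrite -expr2 sqr_ge0.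
  move=> /(_ P0 k isT) /eqP; rewrite -expr2 sqrf_eq0 => /eqP //.
move=> Ux /=; have [_ /(_ x Ux) H] := Hg; move: H.
rewrite (pvec0 Ux) (pvec1 Ux); exact: aux.
Qed.

Lemma lap_perp_alg (p0 p1 p2 q0 q1 q2 a0 a1 a2 b0 b1 b2 c0 c1 c2 e0 e1 e2 : R) :
  b0 = c0 -> b1 = c1 -> b2 = c2 ->
  a0 * p0 + p0 * a0 + (a1 * p1 + p1 * a1) + (a2 * p2 + p2 * a2) =
  c0 * q0 + q0 * c0 + (c1 * q1 + q1 * c1) + (c2 * q2 + q2 * c2) ->
  b0 * p0 + p0 * b0 + (b1 * p1 + p1 * b1) + (b2 * p2 + p2 * b2) =
  e0 * q0 + q0 * e0 + (e1 * q1 + q1 * e1) + (e2 * q2 + q2 * e2) ->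
  a0 * q0 + p0 * c0 + (a1 * q1 + p1 * c1) + (a2 * q2 + p2 * c2) = 0 ->
  b0 * q0 + p0 * e0 + (b1 * q1 + p1 * e1) + (b2 * q2 + p2 * e2) = 0 ->
  (a0 + e0) * p0 + (a1 + e1) * p1 + (a2 + e2) * p2 = 0 /\
  (a0 + e0) * q0 + (a1 + e1) * q1 + (a2 + e2) * q2 = 0.
Proof. by move=> -> -> -> E1 E2 E3 E4; split; lra. Qed.

(** The Laplacian is a multiple of the mean curvature vector; orthogonality to
    the tangent plane comes from differentiating the conformality relations
    and from the symmetry of second derivatives. *)
Lemma lap_perp x : U x ->
  dot (pvec x (@lap R) g) (pvec x (@d1 R) g) = 0 /\
  dot (pvec x (@lap R) g) (pvec x (@d2 R) g) = 0.
Proof.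
move=> Ux; have C k : Ck 2 U (fc g k) by apply: smooth_Ck.
have S k := schwarz oU (C k) Ux.
have a1 k := Ck_grad (Ck_d1 (C k)) Ux; have a2 k := Ck_grad (Ck_d2 (C k)) Ux.
pose su := fun y => d1 (fc g o0) y * d1 (fc g o0) y
  + d1 (fc g o1) y * d1 (fc g o1) y + d1 (fc g o2) y * d1 (fc g o2) y.
pose sv := fun y => d2 (fc g o0) y * d2 (fc g o0) y
  + d2 (fc g o1) y * d2 (fc g o1) y + d2 (fc g o2) y * d2 (fc g o2) y.
pose st := fun y => d1 (fc g o0) y * d2 (fc g o0) y
  + d1 (fc g o1) y * d2 (fc g o1) y + d1 (fc g o2) y * d2 (fc g o2) y.
have N1 : \forall y \near x, su y = sv y.
  have := near_open oU Ux; apply: filterS => y Uy.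
  have Su : su y = dot (pvec y (@d1 R) g) (pvec y (@d1 R) g) by exact/esym/dot_pvec.
  have Sv : sv y = dot (pvec y (@d2 R) g) (pvec y (@d2 R) g) by exact/esym/dot_pvec.
  by have [_ E _] := conformalE Uy; rewrite Su Sv; exact: esym.
have N2 : \forall y \near x, st y = 0.
  have := near_open oU Ux; apply: filterS => y Uy.
  have St : st y = dot (pvec y (@d1 R) g) (pvec y (@d2 R) g) by exact/esym/dot_pvec.
  by have [_ _ E] := conformalE Uy; rewrite St; exact: E.
have Gu : grad su x _ _ := gradD (gradD (gradM (a1 o0) (a1 o0)) (gradM (a1 o1) (a1 o1))) (gradM (a1 o2) (a1 o2)).
have Gv : grad sv x _ _ := gradD (gradD (gradM (a2 o0) (a2 o0)) (gradM (a2 o1) (a2 o1))) (gradM (a2 o2) (a2 o2)).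
have Gt : grad st x _ _ := gradD (gradD (gradM (a1 o0) (a2 o0)) (gradM (a1 o1) (a2 o1))) (gradM (a1 o2) (a2 o2)).
have [E1 E2] := grad_unique (grad_near N1 Gu) Gv.
have [E3 E4] := grad_unique (grad_near N2 Gt) (grad_cst 0 x).
rewrite !dot_pvec /lap.
exact: lap_perp_alg (S o0) (S o1) (S o2) E1 E2 E3 E4.
Qed.

Lemma wdensE x : U x ->
  mean_curvature (@metric_euc R) g x ^+ 2 * area_density (@metric_euc R) g x
  = wdens g x.
Proof.
move=> Ux; have [L0 vv uv] := conformalE Ux.
have G1 : metric_euc (g x) = (1 ^+ 2)%:M by rewrite expr1n.
rewrite -(pvec0 Ux) -(pvec1 Ux) in L0 vv uv.
rewrite (mean_curvatureE G1 ltr01 L0 erefl vv uv).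
rewrite (area_densityE G1 L0 erefl vv uv).
have -> : covariant (@metric_euc R) g 0 0 x + covariant (@metric_euc R) g 1 1 x
   = pvec x (@lap R) g.
  apply: eq_trans (pvec_lap Ux); apply/rowP => k; rewrite [LHS]mxE [RHS]mxE.
  by congr (_ + _); exact: covariant_euc.
rewrite /wdens -(pvec0 Ux) -(pvec1 Ux).
have := lt0r_neq0 L0; move: (dot _ (cross _ _)) (dot _ _) => s L Ln.
by field.
Qed.

End Immersion.

Definition height g x : R := 1 - dot (g x) (g x).

Lemma bryant_alg (u v y w : E3) r : 0 < r -> 0 < dot u u ->
  dot (w + (2 / r) *: ((2 * dot y u) *: u + (2 * dot y v) *: v
    - (2 * dot u u) *: y)) (cross u v) / (2 * dot u u ^+ 2 * (2 / r)) = 1 ->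
  r * dot w (cross u v) = 4 * dot u u * (dot u u + dot y (cross u v)).
Proof.
move=> r0 L0; have [N1 N2] := dot_cross u v.
have D (A B : E3) t n : dot (A + t *: B) n = dot A n + t * dot B n.
  by rewrite !dot3 !mxE; ring.
have D' (A B n : E3) t : dot (A - t *: B) n = dot A n - t * dot B n.
  by rewrite !dot3 !mxE; ring.
have D'' (A n : E3) t : dot (t *: A) n = t * dot A n.
  by rewrite !dot3 !mxE; ring.
rewrite D D' D D'' N1 N2 !mulr0 addr0 sub0r.
have := lt0r_neq0 L0; have := lt0r_neq0 r0.
move: (dot w _) (dot u _) (dot y _) => s L h rn Ln E.
have {}E : s + 2 / r * - (2 * L * h) = 2 * L ^+ 2 * (2 / r).
  by rewrite -[LHS](divfK (_ : 2 * L ^+ 2 * (2 / r) != 0)) ?E ?mul1r //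
    !mulf_neq0 ?expf_neq0 ?invr_neq0 ?pnatr_eq0.
have {}E : s = 2 * L ^+ 2 * (2 / r) - 2 / r * - (2 * L * h).
  by rewrite -E; ring.
by rewrite E; field.
Qed.

Section BryantPatch.
Variables (U : set P) (g : P -> E3).
Hypothesis oU : open U.
Hypothesis Hg : bryant_patch U g.

Let ci : conformal_immersion U g. Proof. by case: Hg. Qed.

Lemma height_gt0 x : U x -> 0 < height g x.
Proof.
move=> Ux; have [_ /(_ x Ux)[]] := Hg; rewrite /B3 /= normsq_dot => H _.
by rewrite subr_gt0.
Qed.

Lemma Ck_height n : Ck n U (height g).
Proof.
have C k : Ck n U (fc g k) by apply: smooth_Ck => //; case: ci.
apply: (@Ck_ext _ _ _ (fun x => 1 - (fc g o0 x * fc g o0 x + fc g o1 x * fc g o1 x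
  + fc g o2 x * fc g o2 x))) => //.
  by move=> x _; rewrite /height dot3.
by apply: CkB => //; [exact: Ck_cst|apply: CkD => //; [apply: CkD => //|]; exact: CkM].
Qed.

(** The conformal change of metric turns unit hyperbolic mean curvature into
    an affine relation between the Euclidean mean curvature and the scalar
    product of the position with the normal. *)
Lemma bryant_equation x : U x ->
  let u := pvec x (@d1 R) g in let v := pvec x (@d2 R) g in
  height g x * dot (pvec x (@lap R) g) (cross u v)
  = 4 * dot u u * (dot u u + dot (g x) (cross u v)).
Proof.
move=> Ux; have [L0 vv uv] := conformalE ci Ux.
have r0 := height_gt0 Ux; move=> /=.
have [_ /(_ x Ux)[_ H1]] := Hg; move: H1.
have hE : 1 - normsq (g x) = height g x by rewrite normsq_dot.
have Gc : metric_hyp (g x) = ((2 / height g x) ^+ 2)%:M.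
  rewrite /metric_hyp hE; congr (_%:M); have := lt0r_neq0 r0; move: (height g x) => r rn.
  by field.
have c0 : 0 < 2 / height g x by rewrite divr_gt0.
rewrite -(pvec0 ci Ux) -(pvec1 ci Ux) in L0 vv uv *.
rewrite (mean_curvatureE Gc c0 L0 erefl vv uv).
have -> : covariant (@metric_hyp R) g 0 0 x + covariant (@metric_hyp R) g 1 1 x
   = pvec x (@lap R) g + (2 / height g x) *:
     ((2 * dot (g x) (partial g 0 x)) *: partial g 0 x +
      (2 * dot (g x) (partial g 1 x)) *: partial g 1 x
      - (2 * dot (partial g 0 x) (partial g 0 x)) *: g x).
  apply: eq_trans (congr1 (fun A => A + _) (pvec_lap oU ci Ux)).
  apply/rowP => k.
  have r0' : 0 < 1 - normsq (g x) by rewrite hE.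
  have C0 := covariant_hyp r0' 0 k; have C1 := covariant_hyp r0' 1 k.
  rewrite [LHS]mxE; apply: eq_trans (congr2 +%R C0 C1) _.
  rewrite vv hE.
  set A := partial (partial g 0) 0 x; set B := partial (partial g 1) 1 x.
  set u := partial g 0 x; set v := partial g 1 x.
  clearbody A B u v; move: (g x) => y.
  rewrite [RHS]mxE [X in _ = X + _]mxE [X in _ = _ + X]mxE.
  rewrite [X in _ = _ + _ * X]mxE [X in _ = _ + _ * (X + _)]mxE.
  rewrite [X in _ = _ + _ * (X + _ + _)]mxE [X in _ = _ + _ * (_ + X + _)]mxE.
  rewrite [X in _ = _ + _ * (_ + X)]mxE [X in _ = _ + _ * (_ - X)]mxE.
  ring.
exact: bryant_alg.
Qed.

(** The local identity on which everything rests. Write L = |g_x|^2, h = 1 -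
    |g|^2 and s for the scalar product of g with the unit normal. By
    [bryant_equation] the normal component of the Laplacian of g is 4 L (1 +
    s) / h, so the Willmore density is 4 L (1 + s)^2 / h^2; expanding the
    Laplacian of - ln h and decomposing g in the frame of g_x, g_y and the
    normal gives the same value. *)
Lemma wdens_lap x : U x -> wdens g x = lap (fun y => - ln (height g y)) x.
Proof.
move=> Ux; have [L0 vv uv] := conformalE ci Ux.
have r0 := height_gt0 Ux; have BE := bryant_equation Ux.
have sg : smooth_on U g by case: ci.
have C k : Ck 2 U (fc g k) by apply: smooth_Ck.
have G y (Uy : U y) k := Ck_grad (C k) Uy.
pose h1 y := - 2 * (fc g o0 y * d1 (fc g o0) y + fc g o1 y * d1 (fc g o1) y
   + fc g o2 y * d1 (fc g o2) y).
pose h2 y := - 2 * (fc g o0 y * d2 (fc g o0) y + fc g o1 y * d2 (fc g o1) y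
   + fc g o2 y * d2 (fc g o2) y).
have Gh y : U y -> grad (height g) y (h1 y) (h2 y).
  move=> Uy; have S k := gradM (G y Uy k) (G y Uy k).
  have := gradB (grad_cst 1 y) (gradD (gradD (S o0) (S o1)) (S o2)).
  rewrite (_ : (fun z => _ - _) = height g); last first.
    by apply/funext => z; rewrite /height dot3.
  by move/grad_eq; apply; rewrite /h1 /h2; ring.
have Gl y : U y -> grad (fun z => - ln (height g z)) y
    (- ((height g y)^-1 * h1 y)) (- ((height g y)^-1 * h2 y)).
  move=> Uy; apply: gradN; apply: (grad_comp1 (f := @ln R)); first exact: Gh.
  by apply: is_derive1_ln; exact: height_gt0.
have N1 : \forall y \near x, - ((height g y)^-1 * h1 y) = d1 (fun z => - ln (height g z)) y.
  by have := near_open oU Ux; apply: filterS => y /Gl/grad_d1.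
have N2 : \forall y \near x, - ((height g y)^-1 * h2 y) = d2 (fun z => - ln (height g z)) y.
  by have := near_open oU Ux; apply: filterS => y /Gl/grad_d2.
have rn := lt0r_neq0 r0.
have Gi := gradV (Gh x Ux) rn.
have g1 k := Ck_grad (Ck_d1 (C k)) Ux; have g2 k := Ck_grad (Ck_d2 (C k)) Ux.
have S1 k := gradM (G x Ux k) (g1 k); have S2 k := gradM (G x Ux k) (g2 k).
have Gh1 := gradM (grad_cst (- 2) x) (gradD (gradD (S1 o0) (S1 o1)) (S1 o2)).
have Gh2 := gradM (grad_cst (- 2) x) (gradD (gradD (S2 o0) (S2 o1)) (S2 o2)).
rewrite /lap (grad_d1 (grad_near N1 (gradN (gradM Gi Gh1)))).
rewrite (grad_d2 (grad_near N2 (gradN (gradM Gi Gh2)))).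
have [P1 P2] := lap_perp oU ci Ux.
pose su := d1 (fc g o0) x * d1 (fc g o0) x + d1 (fc g o1) x * d1 (fc g o1) x
  + d1 (fc g o2) x * d1 (fc g o2) x.
pose sv := d2 (fc g o0) x * d2 (fc g o0) x + d2 (fc g o1) x * d2 (fc g o1) x
  + d2 (fc g o2) x * d2 (fc g o2) x.
pose sw := fc g o0 x * lap (fc g o0) x + fc g o1 x * lap (fc g o1) x
  + fc g o2 x * lap (fc g o2) x.
set RHS := (X in _ = X).
have -> : RHS = 4 * (dot (g x) (pvec x (@d1 R) g) ^+ 2 +
      dot (g x) (pvec x (@d2 R) g) ^+ 2) / height g x ^+ 2 +
   2 * (dot (pvec x (@d1 R) g) (pvec x (@d1 R) g) +
        dot (pvec x (@d2 R) g) (pvec x (@d2 R) g) +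
        dot (g x) (pvec x (@lap R) g)) / height g x.
  transitivity (4 * ((h1 x / - 2) ^+ 2 + (h2 x / - 2) ^+ 2) / height g x ^+ 2 +
   2 * (su + sv + sw) / height g x).
    rewrite /RHS /h1 /h2 /su /sv /sw /lap.
    move: (height g x) rn => r rn; field; exact: rn.
  have H2 t : - 2 * t / - 2 = t :> R by field.
  congr (4 * (_ ^+ 2 + _ ^+ 2) / _ + 2 * (_ + _ + _) / _).
  - rewrite /h1 H2; exact/esym/dot_fc_pvec.
  - rewrite /h2 H2; exact/esym/dot_fc_pvec.
  - exact/esym/dot_pvec.
  - exact/esym/dot_pvec.
  - exact/esym/dot_fc_pvec.
set u := pvec x (@d1 R) g in L0 vv uv BE P1 P2 *.
set v := pvec x (@d2 R) g in L0 vv uv BE P1 P2 *.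
set w := pvec x (@lap R) g in BE P1 P2 *.
have E1 := gram (g x) (g x) erefl vv uv.
have E2 := gram (g x) w erefl vv uv.
rewrite P1 P2 !mulr0 !add0r in E2; rewrite /= in BE.
rewrite /wdens vv -/u -/v -/w.
have hE : height g x = 1 - dot (g x) (g x) by [].
move: hE rn L0 BE E1 E2.
move: (dot (g x) (g x)) (dot w (cross u v)) (dot (g x) (cross u v)) => yy s h.
move: (dot (g x) w) (dot (g x) u) (dot (g x) v) (dot u u) (height g x) => Q a b L r.
move=> hE rn L0 BE E1 E2; have Ln := lt0r_neq0 L0.
have -> : Q = h * s / L ^+ 2 by rewrite -E2; field.
have -> : s = 4 * L * (L + h) / r by rewrite -BE; field.
have X : a ^+ 2 + b ^+ 2 = L * (1 - r) - h ^+ 2 / L.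
  apply: (mulfI Ln); rewrite hE.
  have -> : L * (L * (1 - (1 - yy)) - h ^+ 2 / L) = L ^+ 2 * yy - h ^+ 2 by field.
  by rewrite E1; ring.
by rewrite X; field; rewrite rn Ln.
Qed.

End BryantPatch.

End LocalGeometry.

(** * Complex numbers as points of the plane *)

Section ComplexPlane.
Variable R : realType.
Local Notation P := (R * R)%type.
Local Notation C := (cplx R).

(** The modulus as a real number; the norm of R[i] takes values in R[i]. *)
Definition nC (z : C) : R := complex.Re `|z|.
Definition ofC (z : C) : P := (complex.Re z, complex.Im z).

Lemma toCK (x : P) : ofC (toC x) = x.
Proof. by case: x. Qed.

Lemma ofCK (z : C) : toC (ofC z) = z.
Proof. by case: z. Qed.

Lemma toCB (x y : P) : toC (x - y) = toC x - toC y.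
Proof. by []. Qed.

Lemma toCD (x y : P) : toC (x + y) = toC x + toC y.
Proof. by []. Qed.

Lemma norm_nC (z : C) : `|z| = realC (nC z).
Proof. by []. Qed.

Lemma nCE (z : C) : nC z = Num.sqrt (complex.Re z ^+ 2 + complex.Im z ^+ 2).
Proof. by case: z. Qed.

Lemma nC_sqr (z : C) : nC z ^+ 2 = complex.Re z ^+ 2 + complex.Im z ^+ 2.
Proof. by rewrite nCE sqr_sqrtr // addr_ge0 // sqr_ge0. Qed.

Lemma nC_ge0 (z : C) : 0 <= nC z.
Proof. by rewrite nCE sqrtr_ge0. Qed.

Lemma realC_le (a b : R) : (realC a <= realC b) = (a <= b).
Proof. exact: lecR. Qed.

Lemma realC_lt (a b : R) : (realC a < realC b) = (a < b).
Proof. exact: ltcR. Qed.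

Lemma realC_gt0 (a : R) : (0 < realC a) = (0 < a).
Proof. exact: (realC_lt 0 a). Qed.

Lemma gt0_realC (e : C) : 0 < e -> exists2 r : R, 0 < r & e = realC r.
Proof.
case: e => a b; rewrite ltcE /= => /andP[/eqP -> a0]; by exists a.
Qed.

Lemma nCM (z w : C) : nC (z * w) = nC z * nC w.
Proof.
have := normrM z w; rewrite !norm_nC => /(congr1 (@complex.Re R)).
by rewrite /= mul0r subr0.
Qed.

Lemma nCD (z w : C) : nC (z + w) <= nC z + nC w.
Proof.
have := ler_normD z w; rewrite !norm_nC.
have -> : realC (nC z) + realC (nC w) = realC (nC z + nC w) :> C.
  by rewrite /realC /toC /=; congr Complex; rewrite addr0.
by rewrite realC_le.
Qed.

Lemma nC0 : nC (0 : C) = 0.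
Proof. by rewrite /nC normr0. Qed.

Lemma nC_eq0 (z : C) : (nC z == 0) = (z == 0).
Proof.
rewrite -[RHS]normr_eq0 norm_nC; apply/eqP/eqP => [-> //|].
by move=> /(congr1 (@complex.Re R)).
Qed.

Lemma nC_gt0 (z : C) : (0 < nC z) = (z != 0).
Proof. by rewrite lt_def nC_ge0 andbT nC_eq0. Qed.

Lemma nCN (z : C) : nC (- z) = nC z.
Proof. by rewrite /nC normrN. Qed.

Lemma nC_dist (z w : C) : nC (z - w) = nC (w - z).
Proof. by rewrite /nC distrC. Qed.

Lemma nCV (z : C) : nC z^-1 = (nC z)^-1.
Proof.
have [->|z0] := eqVneq z 0; first by rewrite invr0 nC0 invr0.
have n0 : nC z != 0 by rewrite nC_eq0.
by apply: (mulfI n0); rewrite -nCM !divff // /nC normr1.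
Qed.

Lemma nCX (z : C) n : nC (z ^+ n) = nC z ^+ n.
Proof.
elim: n => [|n IH]; first by rewrite !expr0 /nC normr1.
by rewrite !exprS nCM IH.
Qed.

Lemma Re_le_nC (z : C) : `|complex.Re z| <= nC z.
Proof.
rewrite -(ger0_norm (nC_ge0 z)) -ler_sqr ?nnegrE ?normr_ge0 //.
by rewrite !real_normK ?num_real // nC_sqr lerDl sqr_ge0.
Qed.

Lemma Im_le_nC (z : C) : `|complex.Im z| <= nC z.
Proof.
rewrite -(ger0_norm (nC_ge0 z)) -ler_sqr ?nnegrE ?normr_ge0 //.
by rewrite !real_normK ?num_real // nC_sqr lerDr sqr_ge0.
Qed.

Lemma nC_le (x : P) : nC (toC x) <= 2 * `|x|.
Proof.
rewrite prod_normE2; case: x => a b /=.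
have -> : toC (a, b) = toC (a, 0) + toC (0, b).
  by rewrite /toC /=; congr Complex; rewrite ?addr0 ?add0r.
apply: le_trans (nCD _ _) _.
rewrite !nCE /= !expr0n /= !(addr0, add0r) !sqrtr_sqr.
rewrite [leRHS]mulr_natl mulr2n.
by apply: lerD; rewrite le_max lexx ?orbT.
Qed.

Lemma norm_le_nC (x : P) : `|x| <= nC (toC x).
Proof.
by rewrite prod_normE2 ge_max (Re_le_nC (toC x)) (Im_le_nC (toC x)).
Qed.

Lemma nbhsCP (z : C) (A : set C) : nbhs z A <->
  exists2 e : R, 0 < e & forall w, nC (w - z) < e -> A w.
Proof.
split=> [/nbhs_ballP[e e0 H]|[e e0 H]].
  have [r r0 er] := gt0_realC e0; exists r => // w wz.
  by apply: H; rewrite -ball_normE /ball_ /= er norm_nC realC_lt nC_dist.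
apply/nbhs_ballP; exists (realC e) => /=; first by rewrite realC_gt0.
move=> w; rewrite -ball_normE /ball_ /= norm_nC realC_lt => wz.
by apply: H; rewrite nC_dist.
Qed.

Lemma nbhsPP (x : P) (A : set P) : nbhs x A <->
  exists2 e : R, 0 < e & forall y, `|y - x| < e -> A y.
Proof.
split=> [/nbhs_ballP[e /= e0 H]|[e e0 H]].
  by exists e => // y yx; apply: H; rewrite -ball_normE /= distrC.
apply/nbhs_ballP; exists e => //= y; rewrite -ball_normE /= distrC; exact: H.
Qed.

Lemma toC_continuous : continuous (@toC R).
Proof.
move=> x A /nbhsCP[e e0 H]; apply/nbhsPP; exists (e / 2); first by rewrite divr_gt0.
move=> y yx; apply: H; rewrite -toCB; apply: le_lt_trans (nC_le _) _.
by rewrite mulrC -ltr_pdivlMr.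
Qed.

Lemma ofC_continuous : continuous ofC.
Proof.
move=> z A /nbhsPP[e e0 H]; apply/nbhsCP; exists e => // w wz.
apply: H; apply: le_lt_trans wz; apply: le_trans (norm_le_nC _) _.
by rewrite toCB !ofCK.
Qed.

Lemma open_toC (A : set C) : open A -> open (@toC R @^-1` A).
Proof. by move=> oA; apply: open_comp => // x _; exact: toC_continuous. Qed.

Lemma derivable_eps (h : C -> C) z : derivable h z 1 ->
  forall e : R, 0 < e -> exists2 r : R, 0 < r &
    forall w, nC (w - z) < r -> nC (h w - h z - derive1 h z * (w - z)) <= e * nC (w - z).
Proof.
move=> /derivable1_diffP Hd e e0.
have /diff_locally/eqaddoP/(_ (realC e)) := Hd.
rewrite realC_gt0 => /(_ e0) /nbhsCP[r r0 H]; exists r => // w wz.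
have /= := H (w - z); rewrite subr0 => /(_ wz).
rewrite !fctE /= subrK diff1E // !norm_nC.
have -> : realC e * realC (nC (w - z)) = realC (e * nC (w - z)) :> C.
  by rewrite /realC /toC /=; congr Complex => /=; rewrite ?mulr0 ?mul0r ?subr0 ?addr0.
by rewrite realC_le /GRing.scale /= [(w - z) * _]mulrC opprD addrA.
Qed.

Lemma eps_derivable (h : C -> C) z d : (forall e : R, 0 < e -> exists2 r : R, 0 < r &
    forall w, nC (w - z) < r -> nC (h w - h z - d * (w - z)) <= e * nC (w - z)) ->
  derivable h z 1.
Proof.
move=> H; apply/cvg_ex; exists d; apply/cvgrPdist_le => e0 /gt0_realC[e e1 ->].
have [r r0 Hr] := H e e1.
rewrite near_withinE; apply/nbhsCP; exists r => // w; rewrite subr0 => wr w0.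
have := Hr (w + z); rewrite addrK => /(_ wr) H1.
rewrite norm_nC realC_le /= /GRing.scale /= mulr1.
have wp : 0 < nC w by rewrite nC_gt0.
rewrite -(ler_pM2r wp) -nCM; apply: le_trans H1.
rewrite -[X in X <= _]nCN le_eqVlt; apply/orP; left; apply/eqP; congr nC.
by field.
Qed.

(** The Cauchy-Riemann equations. *)
Lemma derivable_grad (h : C -> C) (x : P) : derivable h (toC x) 1 ->
  let d := derive1 h (toC x) in
  grad (fun y => complex.Re (h (toC y))) x (complex.Re d) (- complex.Im d) /\
  grad (fun y => complex.Im (h (toC y))) x (complex.Im d) (complex.Re d).
Proof.
move=> /derivable_eps; case: (derive1 h (toC x)) => a b H /=.
have K (e : R) : 0 < e -> \forall y \near x,
    nC (h (toC y) - h (toC x) - Complex a b * toC (y - x)) <= e * `|y - x|.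
  move=> e0; have [r r0 Hr] := H (e / 2) (divr_gt0 e0 (ltr0n _ 2)).
  apply/nbhsPP; exists (r / 2); first by rewrite divr_gt0.
  move=> y yx; have yx' : nC (toC y - toC x) < r.
    by rewrite -toCB; apply: le_lt_trans (nC_le _) _; rewrite mulrC -ltr_pdivlMr.
  have := Hr _ yx'; rewrite -toCB => /le_trans; apply.
  by rewrite -mulrA ler_pM2l // ler_pdivrMl // nC_le.
split; apply: grad_eps => e e0; have := K e e0; apply: filterS => y.
  move=> /(le_trans (Re_le_nC _)); apply: le_trans.
  rewrite le_eqVlt; apply/orP; left; apply/eqP; congr `|_|.
  by case: (h _) => ? ?; case: (h _) => ? ?; rewrite /=; ring.
move=> /(le_trans (Im_le_nC _)); apply: le_trans.
rewrite le_eqVlt; apply/orP; left; apply/eqP; congr `|_|.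
by case: (h _) => ? ?; case: (h _) => ? ?; rewrite /=; ring.
Qed.

End ComplexPlane.

Section Bootstrap.
Variable R : realType.
Local Notation P := (R * R)%type.
Local Notation E3 := 'rV[R]_3.

Lemma Ck_wdens (U : set P) (g : P -> E3) : open U -> conformal_immersion U g ->
  Ck 0 U (wdens g).
Proof.
move=> oU Hg; have sg : smooth_on U g by case: Hg.
have C k : Ck 2 U (fc g k) by apply: smooth_Ck.
have C1 k : Ck 0 U (d1 (fc g k)) by exact: CkS (Ck_d1 (C k)).
have C2 k : Ck 0 U (d2 (fc g k)) by exact: CkS (Ck_d2 (C k)).
have CL k : Ck 0 U (lap (fc g k)) by exact: Ck_lap.
pose L y := d1 (fc g o0) y * d1 (fc g o0) y + d1 (fc g o1) y * d1 (fc g o1) y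
  + d1 (fc g o2) y * d1 (fc g o2) y.
have CkL : Ck 0 U L.
  by apply: CkD => //; [apply: CkD => //|]; exact: CkM.
pose S y := lap (fc g o0) y * (d1 (fc g o1) y * d2 (fc g o2) y - d1 (fc g o2) y * d2 (fc g o1) y)
  + lap (fc g o1) y * (d1 (fc g o2) y * d2 (fc g o0) y - d1 (fc g o0) y * d2 (fc g o2) y)
  + lap (fc g o2) y * (d1 (fc g o0) y * d2 (fc g o1) y - d1 (fc g o1) y * d2 (fc g o0) y).
have CkSS : Ck 0 U S.
  by apply: CkD => //; [apply: CkD => //|]; apply: CkM => //; apply: CkB => //; exact: CkM.
apply: (@Ck_ext _ _ _ (fun y => S y ^+ 2 * (4 * L y ^+ 3)^-1)) => //.
  by move=> x _; rewrite /wdens dot_pvec dot3 !crossE !pvecE.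
apply: CkM => //; first exact: CkX.
apply: CkV => //; last by apply: CkM => //; [exact: Ck_cst|exact: CkX].
move=> x Ux; have [L0 _ _] := conformalE Hg Ux.
rewrite mulf_neq0 ?pnatr_eq0 // expf_neq0 // lt0r_neq0 //.
by rewrite /L -dot_pvec.
Qed.

(** A holomorphic change of variables between two conformal immersions inherits
    their regularity: its derivatives are rational expressions in those of the
    immersions. *)
Lemma bootstrap (O V : set P) (f g : P -> E3) (T1 T2 : P -> R) n :
  open O -> open V -> conformal_immersion O f -> conformal_immersion V g ->
  (forall x, O x -> V (T1 x, T2 x) /\ f x = g (T1 x, T2 x)) ->
  (forall x, O x -> exists a b, grad T1 x a (- b) /\ grad T2 x b a) ->
  Ck n O T1 /\ Ck n O T2.
Proof.
move=> oO oV Hf Hg fg CR.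
have Cf m k : Ck m O (fc f k) by apply: smooth_Ck => //; case: Hf.
have Cg m k : Ck m V (fc g k) by apply: smooth_Ck => //; case: Hg.
have OV x (Ox : O x) := (fg x Ox).1.
pose c (d : (P -> R) -> P -> R) k y := d (fc g k) (T1 y, T2 y).
pose L y := c (@d1 R) o0 y * c (@d1 R) o0 y + c (@d1 R) o1 y * c (@d1 R) o1 y
  + c (@d1 R) o2 y * c (@d1 R) o2 y.
pose N (d d' : (P -> R) -> P -> R) y := d (fc f o0) y * c d' o0 y
  + d (fc f o1) y * c d' o1 y + d (fc f o2) y * c d' o2 y.
have Gf x k : O x -> forall a b, grad T1 x a (- b) -> grad T2 x b a ->
    d1 (fc f k) x = c (@d1 R) k x * a + c (@d2 R) k x * b /\
    d2 (fc f k) x = c (@d1 R) k x * - b + c (@d2 R) k x * a.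
  move=> Ox a b H1 H2; have Gg := Ck_grad (Cg 1%N k) (OV x Ox).
  apply: grad_unique (Ck_grad (Cf 1%N k) Ox) _.
  apply: grad_near (grad_comp H1 H2 Gg).
  have := near_open oO Ox; apply: filterS => y Oy.
  by rewrite /fc (fg y Oy).2.
have E x : O x -> L x != 0 /\ forall a b, grad T1 x a (- b) -> grad T2 x b a ->
    [/\ a = N (@d1 R) (@d1 R) x / L x, b = N (@d1 R) (@d2 R) x / L x,
        - b = N (@d2 R) (@d1 R) x / L x & a = N (@d2 R) (@d2 R) x / L x].
  move=> Ox; have [L0 vv uv] := conformalE Hg (OV x Ox).
  rewrite !dot_pvec in L0 vv uv; have Ln : L x != 0 by exact: lt0r_neq0.
  split => // a b H1 H2.
  have L2 : L x = c (@d2 R) o0 x * c (@d2 R) o0 x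
    + c (@d2 R) o1 x * c (@d2 R) o1 x + c (@d2 R) o2 x * c (@d2 R) o2 x := esym vv.
  have [A0 B0] := Gf x o0 Ox a b H1 H2; have [A1 B1] := Gf x o1 Ox a b H1 H2.
  have [A2 B2] := Gf x o2 Ox a b H1 H2.
  split; apply: (mulIf Ln); rewrite divfK //.
  - transitivity (a * L x + b * 0); [ring|rewrite -uv /N A0 A1 A2 /L /c; ring].
  - transitivity (a * 0 + b * L x); [ring|rewrite -uv L2 /N A0 A1 A2 /c; ring].
  - transitivity (- b * L x + a * 0); [ring|rewrite -uv /N B0 B1 B2 /L /c; ring].
  - transitivity (- b * 0 + a * L x); [ring|rewrite -uv L2 /N B0 B1 B2 /c; ring].
elim: n => [|n [IH1 IH2]].
  split=> x Ox; have [a [b [H1 H2]]] := CR x Ox.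
    exact: grad_continuous H1.
  exact: grad_continuous H2.
have Cc k : Ck n O (c (@d1 R) k) /\ Ck n O (c (@d2 R) k).
  by split; apply: (Ck_comp oO oV) => //; [exact: Ck_d1|exact: Ck_d2].
have [c10 c20] := Cc o0; have [c11 c21] := Cc o1; have [c12 c22] := Cc o2.
have CL : Ck n O (fun y => (L y)^-1).
  apply: CkV => //; first by move=> x /E[].
  by apply: CkD => //; [apply: CkD => //|]; exact: CkM.
have D1 k : Ck n O (d1 (fc f k)) by exact: Ck_d1.
have D2 k : Ck n O (d2 (fc f k)) by exact: Ck_d2.
have CN d d' : (forall k, Ck n O (d (fc f k))) -> (forall k, Ck n O (c d' k)) ->
    Ck n O (fun y => N d d' y / L y).
  move=> Hd Hd'; apply: CkM => //.
  by apply: CkD => //; [apply: CkD => //|]; exact: CkM.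
have Cc1 k : Ck n O (c (@d1 R) k) by case: (Cc k).
have Cc2 k : Ck n O (c (@d2 R) k) by case: (Cc k).
split.
  apply: (Ck_intro oO _ (CN _ _ D1 Cc1) (CN _ _ D2 Cc1)) => x Ox.
  have [a [b [H1 H2]]] := CR x Ox; have [_ /(_ a b H1 H2)[<- _ <- _]] := E x Ox.
  exact: H1.
apply: (Ck_intro oO _ (CN _ _ D1 Cc2) (CN _ _ D2 Cc2)) => x Ox.
have [a [b [H1 H2]]] := CR x Ox; have [_ /(_ a b H1 H2)[_ <- _ <-]] := E x Ox.
exact: H2.
Qed.

End Bootstrap.

(** * Rectangles and area *)

Section Bisection.
Variable R : realType.
Local Notation P := (R * R)%type.

Definition mid (p q : P) : P := ((p.1 + q.1) / 2, (p.2 + q.2) / 2).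

Definition quadrant (b1 b2 : bool) (pq : P * P) : P * P :=
  let m := mid pq.1 pq.2 in
  ((if b1 then m.1 else pq.1.1, if b2 then m.2 else pq.1.2),
   (if b1 then pq.2.1 else m.1, if b2 then pq.2.2 else m.2)).

Definition subrect (p0 q0 p q : P) :=
  [/\ p0.1 <= p.1 /\ p.1 < q.1, q.1 <= q0.1, p0.2 <= p.2 /\ p.2 < q.2 & q.2 <= q0.2].

Lemma quadrant_subrect p0 q0 b1 b2 r : subrect p0 q0 r.1 r.2 ->
  subrect p0 q0 (quadrant b1 b2 r).1 (quadrant b1 b2 r).2.
Proof.
case: r => [[a b] [c d]]; case: p0 q0 => [p1 p2] [q1 q2].
rewrite /subrect /quadrant /mid /= => -[[h1 h2] h3 [h4 h5] h6].
have : [/\ a <= (a + c) / 2, a < (a + c) / 2, (a + c) / 2 < c & (a + c) / 2 <= c].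
  by rewrite ler_pdivlMr // ltr_pdivlMr // ltr_pdivrMr // ler_pdivrMr //; split; lra.
have : [/\ b <= (b + d) / 2, b < (b + d) / 2, (b + d) / 2 < d & (b + d) / 2 <= d].
  by rewrite ler_pdivlMr // ltr_pdivlMr // ltr_pdivrMr // ler_pdivrMr //; split; lra.
move: ((a + c) / 2) ((b + d) / 2) => m n [k1 k2 k3 k4] [l1 l2 l3 l4].
by case: b1; case: b2; split=> //; try split => //;
  apply: le_trans; try eassumption; apply: le_trans; eassumption.
Qed.

(** Lebesgue's bisection: an additive function of rectangles whose density
    vanishes everywhere vanishes.  Only rectangles similar to the initial one
    occur. *)
Lemma bisection (Phi : P -> P -> R) (p0 q0 : P) :
  p0.1 < q0.1 -> p0.2 < q0.2 ->
  (forall p q, subrect p0 q0 p q ->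
     `|Phi p q| <= \sum_b1 \sum_b2 `|Phi (quadrant b1 b2 (p, q)).1 (quadrant b1 b2 (p, q)).2|) ->
  (forall z e, p0.1 <= z.1 <= q0.1 -> p0.2 <= z.2 <= q0.2 -> 0 < e ->
     exists2 d, 0 < d & forall p q t, subrect p0 q0 p q ->
       p.1 <= z.1 <= q.1 -> p.2 <= z.2 <= q.2 ->
       0 < t < d -> q.1 - p.1 = t * (q0.1 - p0.1) -> q.2 - p.2 = t * (q0.2 - p0.2) ->
       `|Phi p q| <= e * ((q.1 - p.1) * (q.2 - p.2))) ->
  Phi p0 q0 = 0.
Proof.
move=> lt1 lt2 sub loc; apply/eqP; apply: contraT => Phi0.
have w1 : 0 < q0.1 - p0.1 by rewrite subr_gt0.
have w2 : 0 < q0.2 - p0.2 by rewrite subr_gt0.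
pose A (r : P * P) := (r.2.1 - r.1.1) * (r.2.2 - r.1.2).
have A0 : 0 < A (p0, q0) by rewrite mulr_gt0.
pose e := `|Phi p0 q0| / (A (p0, q0) * 2).
have e0 : 0 < e by rewrite divr_gt0 ?normr_gt0 // mulr_gt0.
pose bad (r : P * P) := e * A r < `|Phi r.1 r.2|.
have bad0 : bad (p0, q0).
  rewrite /bad (_ : e * A (p0, q0) = `|Phi p0 q0| / 2); last first.
    by rewrite /e; move: A0 => /lt0r_neq0; move: (A _) => a a0; field.
  by rewrite ltr_pdivrMr // ltr_pMr ?normr_gt0 // ltr1n.
have quadA b1 b2 r : A (quadrant b1 b2 r) = A r / 4.
  by case: r => [[a b] [c d]]; rewrite /A /quadrant /mid /=; case: b1; case: b2 => /=; field.
have step r : subrect p0 q0 r.1 r.2 -> bad r ->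
    exists b : bool * bool, bad (quadrant b.1 b.2 r).
  case: r => [[ra rb] [rc rd]] Hr badr; apply: contrapT => H.
  have {}H b1 b2 : `|Phi (quadrant b1 b2 ((ra, rb), (rc, rd))).1
       (quadrant b1 b2 ((ra, rb), (rc, rd))).2| <= e * (A ((ra, rb), (rc, rd)) / 4).
    rewrite -(quadA b1 b2) leNgt; apply/negP => B; apply: H; by exists (b1, b2).
  have := sub _ _ Hr; rewrite !big_bool.
  have := H true true; have := H true false; have := H false true; have := H false false.
  move: badr; rewrite /bad => B H1 H2 H3 H4 H5.
  have : `|Phi (ra, rb) (rc, rd)| <= e * A ((ra, rb), (rc, rd)).
    apply: le_trans H5 _; rewrite (_ : e * A ((ra, rb), (rc, rd)) = e * (A ((ra, rb), (rc, rd)) / 4) + e * (A ((ra, rb), (rc, rd)) / 4)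
      + (e * (A ((ra, rb), (rc, rd)) / 4) + e * (A ((ra, rb), (rc, rd)) / 4))); last by field.
    apply: lerD; apply: lerD; [exact: H4|exact: H3|exact: H2|exact: H1].
  by rewrite leNgt B.
pose next r : P * P := if pselect (exists b : bool * bool, bad (quadrant b.1 b.2 r)) is left H
  then quadrant (sval (cid H)).1 (sval (cid H)).2 r else r.
pose rs n := iter n next (p0, q0).
have subq b1 b2 r : subrect p0 q0 r.1 r.2 -> subrect p0 q0 (quadrant b1 b2 r).1 (quadrant b1 b2 r).2.
  exact: quadrant_subrect.
have inv n : [/\ subrect p0 q0 (rs n).1 (rs n).2, bad (rs n),
    (rs n).2.1 - (rs n).1.1 = 2 ^- n * (q0.1 - p0.1) &
    (rs n).2.2 - (rs n).1.2 = 2 ^- n * (q0.2 - p0.2)] /\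
    exists b : bool * bool, rs n.+1 = quadrant b.1 b.2 (rs n).
  elim: n => [|n [[IH1 IH2 IH3 IH4] [b Eb]]].
    have s0 : subrect p0 q0 p0 q0 by split => //.
    split; first by rewrite expr0 invr1 !mul1r.
    rewrite /rs /= /next; case: pselect => [H|[]]; last exact: step.
    by eexists.
  have S1 : subrect p0 q0 (rs n.+1).1 (rs n.+1).2 by rewrite Eb; exact: subq.
  have B1 : bad (rs n.+1).
    rewrite /rs /= -/(rs n) /next; case: pselect => [H|[]]; last exact: step.
    exact: (svalP (cid H)).
  split; last first.
    rewrite [rs n.+2]/(next (rs n.+1)) /next; case: pselect => [H|[]]; last exact: step.
    by eexists.
  split => //; rewrite Eb.
    rewrite exprS invfM -mulrA -IH3; case: b {Eb} => b1 b2.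
    by case: (rs n) => [[? ?] [? ?]]; rewrite /quadrant /mid /=; case: b1; field.
  rewrite exprS invfM -mulrA -IH4; case: b {Eb} => b1 b2.
  by case: (rs n) => [[? ?] [? ?]]; rewrite /quadrant /mid /=; case: b2; field.
have mono n m : (n <= m)%N -> [/\ (rs n).1.1 <= (rs m).1.1, (rs m).2.1 <= (rs n).2.1,
     (rs n).1.2 <= (rs m).1.2 & (rs m).2.2 <= (rs n).2.2].
  elim: m => [|m IH]; first by rewrite leqn0 => /eqP ->.
  rewrite leq_eqVlt => /predU1P[->//|/IH[I1 I2 I3 I4]].
  have [[[[_ S1] _ [_ S2] _] _ _ _] [b ->]] := inv m.
  have [/= [J1 _] J2 [J3 _] J4] := @quadrant_subrect (rs m).1 (rs m).2 b.1 b.2 (rs m)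
    (And4 (conj (lexx _) S1) (lexx _) (conj (lexx _) S2) (lexx _)).
  by split; [exact: le_trans I1 J1|exact: le_trans J2 I2|exact: le_trans I3 J3|exact: le_trans J4 I4].
have cross n m : (rs n).1.1 <= (rs m).2.1 /\ (rs n).1.2 <= (rs m).2.2.
  have [M1 _ M2 _] := mono n _ (leq_maxl n m); have [_ M3 _ M4] := mono m _ (leq_maxr n m).
  have [[[[_ S1] _ [_ S2] _] _ _ _] _] := inv (maxn n m).
  by split; [apply: le_trans M1 (le_trans (ltW S1) M3)|apply: le_trans M2 (le_trans (ltW S2) M4)].
pose z : P := (sup (range (fun n => (rs n).1.1)), sup (range (fun n => (rs n).1.2))).
have zin n : (rs n).1.1 <= z.1 <= (rs n).2.1 /\ (rs n).1.2 <= z.2 <= (rs n).2.2.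
  split; apply/andP; split.
  - apply: ub_le_sup; last by exists n.
    by exists (rs 0%N).2.1 => _ [m _ <-]; have [] := cross m 0%N.
  - apply: ge_sup; first by exists (rs 0%N).1.1; exists 0%N.
    by move=> _ [m _ <-]; have [] := cross m n.
  - apply: ub_le_sup; last by exists n.
    by exists (rs 0%N).2.2 => _ [m _ <-]; have [] := cross m 0%N.
  - apply: ge_sup; first by exists (rs 0%N).1.2; exists 0%N.
    by move=> _ [m _ <-]; have [] := cross m n.
have [Z1 Z2] := zin 0%N.
have [d d0 Hd] := loc z e Z1 Z2 e0.
pose N := Num.truncn d^-1.
have HN : 2 ^- N.+1 < d.
  rewrite invf_plt ?posrE ?exprn_gt0 //.
  apply: lt_trans (truncnS_gt d^-1) _.
  by rewrite -natrX ltr_nat ltn_expl.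
have [[S B E1 E2] _] := inv N.+1; have [z1 z2] := zin N.+1.
have := Hd _ _ (2 ^- N.+1) S z1 z2 _ E1 E2.
by rewrite HN invr_gt0 exprn_gt0 // => /(_ isT) H;
  move: B; rewrite /bad ltNge => /negP[].
Qed.

End Bisection.

Section PlaneMeasure.
Variable R : realType.
Local Notation P := (R * R)%type.
Local Notation MP := (measurableTypeR R * measurableTypeR R)%type.
Local Notation mble A := (@measurable _ MP A).
Local Notation mu1 := (@lebesgue_measure R).
Local Notation mu2 := (mu1 \x mu1)%E.


Lemma lebesgue_affine (s t : R) (A : set R) : s != 0 -> measurable A ->
  mu1 ((fun x => s * x + t) @^-1` A) = ((`|s|^-1)%:E * mu1 A)%E.
Proof.
move=> s0 mA; pose phi (x : measurableTypeR R) : measurableTypeR R := s * x + t.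
have mphi : measurable_fun setT phi.
  apply: measurable_realfun.continuous_measurable_fun => x.
  by apply: cvgD; [apply: cvgM; [exact: cvg_cst|exact: cvg_id]|exact: cvg_cst].
have sp : 0 < `|s| by rewrite normr_gt0.
pose c : {nonneg R} := NngNum (ltW sp).
pose nu := mscale c (measure_function_pushforward__canonical__measure_function_Measure mu1 mphi).
suff H : nu A = mu1 A.
  rewrite -H /nu /mscale /= /pushforward muleA -EFinM mulVf ?mul1e //.
  by rewrite lt0r_neq0.
apply/esym/lebesgue_measure_unique => // _ [[a b]] _ <-.
rewrite /nu /mscale /= /pushforward; move: (s0); rewrite neq_lt => /orP[sn|sn].
  have E : phi @^-1` `]a, b]%classic = `[(b - t) / s, (a - t) / s[%classic.
    apply/seteqP; split => x /=; rewrite !in_itv /= /phi.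
      by rewrite ler_ndivrMr // ltr_ndivlMr // => /andP[? ?]; apply/andP; split; lra.
    by rewrite ler_ndivrMr // ltr_ndivlMr // => /andP[? ?]; apply/andP; split; lra.
  pose I1 : set R := `[(b - t) / s, (a - t) / s[%classic.
  apply: (@eq_trans _ _ (`|s|%:E * mu1 I1)%E); last by congr (_ * mu1 _)%E; exact/esym.
  rewrite /I1.
  rewrite !lebesgue_measure_itv /= !lte_fin ltr_nM2r ?invr_lt0 // ltrD2r ltr0_norm //.
  case: ifPn => _; last by rewrite mule0.
  rewrite -!EFinB -EFinM; congr (_%:E); field; exact: s0.
have E : phi @^-1` `]a, b]%classic = `](a - t) / s, (b - t) / s]%classic.
  apply/seteqP; split => x /=; rewrite !in_itv /= /phi.
    by rewrite ler_pdivlMr // ltr_pdivrMr // => /andP[? ?]; apply/andP; split; lra.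
  by rewrite ler_pdivlMr // ltr_pdivrMr // => /andP[? ?]; apply/andP; split; lra.
pose I1 : set R := `](a - t) / s, (b - t) / s]%classic.
apply: (@eq_trans _ _ (`|s|%:E * mu1 I1)%E); last by congr (_ * mu1 _)%E; exact/esym.
rewrite /I1.
rewrite !lebesgue_measure_itv /= !lte_fin ltr_pM2r ?invr_gt0 // ltrD2r gtr0_norm //.
case: ifPn => _; last by rewrite mule0.
rewrite -!EFinB -EFinM; congr (_%:E); field; exact: s0.
Qed.

Lemma lebesgue2_swap (A : set MP) : measurable A -> mu2 A = (mu1 \x^ mu1)%E A.
Proof.
move=> mA; apply: product_measure_unique => // B C mB mC.
exact: product_measure2E.
Qed.

Lemma mfun_lin (s t c : R) :
  measurable_fun setT (fun x : MP => s * x.1 + t * x.2 + c : measurableTypeR R).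
Proof.
have M1 : measurable_fun setT (fun x : MP => x.1 : R) by exact: measurable_fst.
have M2 : measurable_fun setT (fun x : MP => x.2 : R) by exact: measurable_snd.
have Mc k : measurable_fun setT (fun x : MP => k : R) by exact: measurable_cst.
apply: measurable_realfun.measurable_funD; last exact: Mc.
by apply: measurable_realfun.measurable_funD; apply: measurable_realfun.measurable_funM.
Qed.

Lemma shear1 (s t c : R) (A : set MP) : s != 0 -> measurable A ->
  mu2 ((fun x : MP => (s * x.1 + t * x.2 + c, x.2)) @^-1` A)
  = ((`|s|^-1)%:E * mu2 A)%E.
Proof.
move=> s0 mA.
have mphi : measurable_fun setT (fun x : MP => (s * x.1 + t * x.2 + c, x.2): MP).
  by apply/measurable_fun_pair; [exact: mfun_lin|exact: measurable_snd].
rewrite lebesgue2_swap; last by rewrite -[X in measurable X]setTI; exact: mphi.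
rewrite lebesgue2_swap // /product_measure2 -ge0_integralZl //; last first.
  exact: measurable_fun_ysection.
apply: eq_integral => y _ /=.
rewrite -(lebesgue_affine (t * y + c) s0); last exact: measurable_ysection.
congr (mu1 _); apply/seteqP; split => x; rewrite /ysection /= !inE /= addrA //.
Qed.

Lemma shear2 (s t c : R) (A : set MP) : s != 0 -> measurable A ->
  mu2 ((fun x : MP => (x.1, t * x.1 + s * x.2 + c)) @^-1` A)
  = ((`|s|^-1)%:E * mu2 A)%E.
Proof.
move=> s0 mA.
rewrite /product_measure1 -ge0_integralZl //; last first.
  exact: measurable_fun_xsection.
apply: eq_integral => y _ /=.
rewrite -(lebesgue_affine (t * y + c) s0); last exact: measurable_xsection.
congr (mu1 _); apply/seteqP; split => x; rewrite /xsection /= !inE /= addrA [s * x + _]addrC //.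
Qed.

(** A similarity scales areas by the square of its ratio: it is a product of
    shears when its real part does not vanish, and a product of two such
    similarities otherwise. *)
Lemma similarity_measure (a b c d : R) (A : set MP) : a ^+ 2 + b ^+ 2 != 0 ->
  measurable A ->
  measurable ((fun x : MP => (a * x.1 - b * x.2 + c, b * x.1 + a * x.2 + d)) @^-1` A) /\
  mu2 ((fun x : MP => (a * x.1 - b * x.2 + c, b * x.1 + a * x.2 + d)) @^-1` A)
  = (((a ^+ 2 + b ^+ 2)^-1)%:E * mu2 A)%E.
Proof.
move=> J0 mA.
have M a' b' c' d' B : measurable B ->
    measurable ((fun x : MP => (a' * x.1 - b' * x.2 + c', b' * x.1 + a' * x.2 + d')) @^-1` B).
  move=> mB; rewrite -[X in measurable X]setTI.
  suff mphi : measurable_fun setT (fun x : MP => (a' * x.1 - b' * x.2 + c', b' * x.1 + a' * x.2 + d'): MP) by exact: mphi.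
  apply/measurable_fun_pair; last exact: mfun_lin.
  by under eq_fun do rewrite -mulNr; exact: mfun_lin.
split; first exact: M.
have main a' b' c' d' B : a' != 0 -> measurable B ->
  mu2 ((fun x : MP => (a' * x.1 - b' * x.2 + c', b' * x.1 + a' * x.2 + d')) @^-1` B)
  = (((a' ^+ 2 + b' ^+ 2)^-1)%:E * mu2 B)%E.
  move=> a0 mB.
  have J1 : a' ^+ 2 + b' ^+ 2 != 0.
    by rewrite lt0r_neq0 // ltr_wpDr ?sqr_ge0 // exprn_even_gt0.
  have s0 : (a' ^+ 2 + b' ^+ 2) / a' != 0 by rewrite mulf_neq0 // invr_neq0.
  have mB' : measurable ((fun x : MP => (x.1, b' / a' * x.1 + (a' ^+ 2 + b' ^+ 2) / a' * x.2 + (d' - b' / a' * c'))) @^-1` B).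
    rewrite -[X in measurable X]setTI.
    suff mphi : measurable_fun setT (fun x : MP => (x.1, b' / a' * x.1 + (a' ^+ 2 + b' ^+ 2) / a' * x.2 + (d' - b' / a' * c')): MP) by exact: mphi.
    by apply/measurable_fun_pair; [exact: measurable_fst|exact: mfun_lin].
  have := shear1 (- b') c' a0 mB'; rewrite shear2 // muleA -EFinM -invfM -normrM.
  rewrite mulrCA mulfV // mulr1 ger0_norm; last by rewrite addr_ge0 ?sqr_ge0.
  move=> <-; congr (mu2 _); apply/seteqP; split => x /=;
    rewrite (_ : _ + _ * _ + (d' - _) = b' * x.1 + a' * x.2 + d') ?mulNr //;
    by field.
have [a0|a0] := eqVneq a 0; last exact: main.
have b0 : b / 2 != 0.
  apply: contra J0 => /eqP b2; have bE : b = b / 2 * 2 by field.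
  by rewrite bE b2 a0 mul0r expr0n addr0.
have := main 1 1 0 0 _ (oner_neq0 _) (M (b / 2) (b / 2) c d _ mA).
rewrite (main (b / 2) (b / 2) c d A b0 mA) muleA -EFinM.
have -> : (1 ^+ 2 + 1 ^+ 2 : R)^-1 * ((b / 2) ^+ 2 + (b / 2) ^+ 2)^-1 = (a ^+ 2 + b ^+ 2)^-1.
  by rewrite -invfM; congr (_^-1); rewrite a0; field.
move=> <-; congr (mu2 _); apply/seteqP; split => x /=;
rewrite a0 (_ : b / 2 * (1 * x.1 - 1 * x.2 + 0) - b / 2 * (1 * x.1 + 1 * x.2 + 0) + c = 0 * x.1 - b * x.2 + c) 1?(_ : b / 2 * (1 * x.1 - 1 * x.2 + 0) + b / 2 * (1 * x.1 + 1 * x.2 + 0) + d = b * x.1 + 0 * x.2 + d) //; by field.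
Qed.

Definition rect (p q : P) : set P := `]p.1, q.1]%classic `*` `]p.2, q.2]%classic.

Lemma measurable_rect p q : mble (rect p q).
Proof. by apply: measurableX; exact: measurable_itv. Qed.

Lemma rectE (p q x : P) : rect p q x <->
  [/\ p.1 < x.1, x.1 <= q.1, p.2 < x.2 & x.2 <= q.2].
Proof.
rewrite /rect /= !in_itv /=; split; first by move=> [/andP[? ?] /andP[? ?]].
by move=> [-> -> -> ->].
Qed.

Lemma measure_rect (p q : P) : p.1 <= q.1 -> p.2 <= q.2 ->
  mu2 (rect p q) = ((q.1 - p.1) * (q.2 - p.2))%:E.
Proof.
move=> h1 h2; rewrite /rect product_measure1E; try exact: measurable_itv.
have L (a b : R) : a <= b -> mu1 `]a, b]%classic = (b - a)%:E.
  move=> ab; rewrite lebesgue_measure_itv /= lte_fin; case: ltP => // ba.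
  by rewrite (_ : b = a) ?subrr //; apply/eqP; rewrite eq_le ba.
transitivity (mu1 `]p.1, q.1]%classic * mu1 `]p.2, q.2]%classic)%E => //.
by rewrite !L // EFinM.
Qed.

Lemma measurable_rect_gen :
  (@measurable _ MP) =
  <<s [set A | exists p q, A = rect p q] >>.
Proof.
rewrite measurable_prod_measurableType; apply/seteqP; split; last first.
  apply: smallest_sub; first exact: smallest_sigma_algebra.
  move=> _ [p [q ->]]; apply: sub_sigma_algebra.
  by exists `]p.1, q.1]%classic => //; exists `]p.2, q.2]%classic.
set G := [set A | exists p q, A = rect p q].
have bigU : \bigcup_n (`](- n%:R), n%:R]%classic : set R) = setT.
  rewrite -subTset => x _; exists (Num.truncn `|x|).+1 => //=.
  rewrite in_itv /=; have := truncnS_gt `|x|; rewrite ltr_norml => /andP[-> /ltW ->//].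
have F1 (A : set R) : (@ocitv R).-sigma.-measurable A -> <<s G >> (A `*` setT).
  move=> mA; suff : <<s @ocitv R >> `<=` [set A | <<s G >> (A `*` [set: R])] by apply.
  apply: smallest_sub.
    split => /=; first by rewrite set0X; exact: sigma_algebra0.
    - move=> B HB; rewrite setTD; have := sigma_algebraCD HB.
      by rewrite setTD; congr (<<s G >> _); apply/seteqP; split => -[x y] /=; tauto.
    - move=> B HB; have := sigma_algebra_bigcup HB.
      by congr (<<s G >> _); apply/seteqP; split => [[x y] [n _ [? _]]|[x y] [[n _ ?] _]];
        [split => //; exists n|exists n].
  move=> _ [[a b] _ <-] /=; rewrite -bigU setX_bigcupr.
  apply: sigma_algebra_bigcup => n; apply: sub_sigma_algebra.
  by exists (a, - n%:R), (b, n%:R).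
have F2 (A : set R) : (@ocitv R).-sigma.-measurable A -> <<s G >> (setT `*` A).
  move=> mA; suff : <<s @ocitv R >> `<=` [set A | <<s G >> ([set: R] `*` A)] by apply.
  apply: smallest_sub.
    split => /=; first by rewrite setX0; exact: sigma_algebra0.
    - move=> B HB; rewrite setTD; have := sigma_algebraCD HB.
      by rewrite setTD; congr (<<s G >> _); apply/seteqP; split => -[x y] /=; tauto.
    - move=> B HB; have := sigma_algebra_bigcup HB.
      by congr (<<s G >> _); apply/seteqP; split => [[x y] [n _ [_ ?]]|[x y] [_ [n _ ?]]];
        [split => //; exists n|exists n].
  move=> _ [[a b] _ <-] /=; rewrite -bigU setX_bigcupl.
  apply: sigma_algebra_bigcup => n; apply: sub_sigma_algebra.
  by exists (- n%:R, a), (n%:R, b).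
apply: smallest_sub; first exact: smallest_sigma_algebra.
move=> _ [A mA [B mB <-]].
have -> : A `*` B = (A `*` setT) `&` (setT `*` B).
  by apply/seteqP; split => [[x y] [? ?]|[x y] [[? _] [_ ?]]].
apply: (@measurableI _ (g_sigma_algebraType G)); [exact: F1|exact: F2].
Qed.

Lemma rectI p q p' q' : rect p q `&` rect p' q' =
  rect (Num.max p.1 p'.1, Num.max p.2 p'.2) (Num.min q.1 q'.1, Num.min q.2 q'.2).
Proof.
apply/seteqP; split => x.
  move=> [/rectE[? ? ? ?] /rectE[? ? ? ?]]; apply/rectE => /=.
  by rewrite !gt_max !le_min; split; apply/andP.
by move=> /rectE /=; rewrite !gt_max !le_min => -[/andP[? ?] /andP[? ?] /andP[? ?] /andP[? ?]];
  split; apply/rectE.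
Qed.

(** Rectangles with rational corners form a countable family; being free to
    choose good ones among them turns estimates on small rectangles into
    estimates on open sets. *)
Lemma open_rects (O : set P) (good : P -> P -> Prop) :
  (forall x, O x -> exists2 d : R, 0 < d & forall p q, rect p q x ->
     `|p - x| < d -> `|q - x| < d -> good p q) ->
  (forall p q, good p q -> rect p q `<=` O) ->
  exists F : nat -> P * P, (forall n, good (F n).1 (F n).2 \/ rect (F n).1 (F n).2 = set0) /\
    O = \bigcup_n rect (F n).1 (F n).2.
Proof.
move=> H HO.
pose rr (t : rat * rat * (rat * rat)) : P * P :=
  ((ratr t.1.1, ratr t.1.2), (ratr t.2.1, ratr t.2.2)).
pose F n : P * P := if @unpickle (rat * rat * (rat * rat))%type n is Some t then
  if `[< good (rr t).1 (rr t).2 >] then rr t else (0, 0) else (0, 0).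
have r0 : rect (0 : P) 0 = set0.
  by apply/seteqP; split => x // /rectE[/= ? ? _ _]; lra.
exists F; split.
  move=> n; rewrite /F; case: (unpickle n) => [t|]; last by right.
  by case: asboolP => [|_]; [left|right].
apply/seteqP; split => x; last first.
  move=> [n _]; rewrite /F; case: (unpickle n) => [t|]; last by rewrite r0.
  by case: asboolP => [g|_]; [exact: HO|rewrite r0].
move=> /H[d d0 Hd].
have D (y e : R) : 0 < e -> exists q : rat, y < ratr q /\ ratr q < y + e.
  move=> e0; have [q] := @rat_in_itvoo R y (y + e) (ltac:(by rewrite ltrDl)).
  by rewrite in_itv /= => /andP[? ?]; exists q.
have [a1 [A1 A2]] := D (x.1 - d) d d0; have [a2 [A3 A4]] := D (x.2 - d) d d0.
have [b1 [B1 B2]] := D x.1 d d0; have [b2 [B3 B4]] := D x.2 d d0.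
pose t := ((a1, a2), (b1, b2)).
have g : good (rr t).1 (rr t).2.
  apply: Hd.
  - by apply/rectE => /=; split; lra.
  - by rewrite prod_normE2 /= gt_max !ltr_norml; apply/andP; split; apply/andP; split; lra.
  - by rewrite prod_normE2 /= gt_max !ltr_norml; apply/andP; split; apply/andP; split; lra.
exists (pickle t) => //; rewrite /F pickleK; case: asboolP => // _.
by apply/rectE => /=; split; lra.
Qed.

Lemma rect_norm (p q x : P) (d : R) : rect p q x -> `|p - x| < d -> `|q - x| < d ->
  forall y, rect p q y -> `|y - x| < d.
Proof.
move=> /rectE[? ? ? ?]; rewrite !prod_normE2 /= !gt_max !ltr_norml.
move=> /andP[/andP[? ?] /andP[? ?]] /andP[/andP[? ?] /andP[? ?]] y /rectE[? ? ? ?].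
by rewrite prod_normE2 /= gt_max !ltr_norml; apply/andP; split; apply/andP; split; lra.
Qed.

Lemma open_measurable2 (O : set P) : open O -> mble O.
Proof.
move=> oO; have [F [_ ->]] := @open_rects O (fun p q => rect p q `<=` O)
  (ltac:(move=> x /(near_open oO) /nbhsPP[d d0 Hd]; exists d => // p q px pd qd y ry;
    exact/Hd/(rect_norm px pd qd ry))) (fun _ _ H => H).
by apply: bigcupT_measurable => n; exact: measurable_rect.
Qed.

Lemma open_continuous_measurable (O : set P) (g : P -> R) : open O ->
  (forall x, O x -> {for x, continuous g}) -> @measurable_fun _ _ MP R O g.
Proof.
move=> oO cg; apply: (@measurability _ _ MP R _ _ _ (measurable_realfun.RGenOInfty.measurableE R)) => _ [_ [a ->] <-].
apply: open_measurable2.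
rewrite openE => x [Ox gx].
have : \forall y \near x, O y /\ `]a, +oo[%classic (g y).
  apply: filterI; first exact: (near_open oO Ox).
  have := cg x Ox; apply; apply: open_nbhs_nbhs; split; last exact: gx.
  exact: rray_open.
by apply: filterS => y [? ?].
Qed.

Lemma preimage_measurable (O : set P) (T : P -> P) : open O ->
  (forall x, O x -> {for x, continuous T}) -> forall A, mble A ->
  mble (O `&` T @^-1` A).
Proof.
move=> oO cT A mA.
have {}mA : <<s [set A | exists p q, A = rect p q] >> A by rewrite -measurable_rect_gen.
suff : <<s [set A | exists p q, A = rect p q] >> `<=` [set A | mble (O `&` T @^-1` A)] by apply; exact: mA.
have mO := open_measurable2 oO.
apply: smallest_sub.
  split => /=; first by rewrite preimage_set0 setI0.
  - move=> B HB; rewrite setTD preimage_setC.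
    have -> : O `&` ~` (T @^-1` B) = O `\` (O `&` T @^-1` B).
      by apply/seteqP; split => x /=; tauto.
    exact: measurableD.
  - move=> B HB; rewrite preimage_bigcup setI_bigcupr.
    exact: bigcupT_measurable.
move=> _ [p [q ->]] /=.
have c1 : @measurable_fun _ _ MP R O (fun x => (T x).1).
  apply: (open_continuous_measurable oO) => x Ox.
  by apply: (@continuous_comp P P R T fst); [exact: (cT x Ox)|exact: cvg_fst].
have c2 : @measurable_fun _ _ MP R O (fun x => (T x).2).
  apply: (open_continuous_measurable oO) => x Ox.
  by apply: (@continuous_comp P P R T snd); [exact: (cT x Ox)|exact: cvg_snd].
have -> : O `&` T @^-1` rect p q = (O `&` (fun x => (T x).1) @^-1` `]p.1, q.1]%classic)
   `&` (O `&` (fun x => (T x).2) @^-1` `]p.2, q.2]%classic).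
  by apply/seteqP; split => x /=; rewrite /rect /=; tauto.
by apply: measurableI; [apply: c1 => //; exact: measurable_itv|apply: c2 => //; exact: measurable_itv].
Qed.

End PlaneMeasure.

(** * Conformal change of variables *)

Section Density.
Variable R : realType.
Local Notation MP := (measurableTypeR R * measurableTypeR R)%type.
Local Notation mu2 := (@lebesgue_measure R \x @lebesgue_measure R)%E.
Variables (O : set MP) (T : MP -> MP) (J : MP -> R).
Hypothesis mO : measurable O.
Hypothesis mT : forall A, measurable A -> measurable (O `&` T @^-1` A).
Hypothesis mJ : measurable_fun O J.
Hypothesis J0 : forall x, O x -> 0 <= J x.

(** The image under [T] of the measure with density [J] on [O]. *)
Definition transported (A : set MP) : \bar R :=
  (\int[mu2]_(x in O `&` T @^-1` A) (J x)%:E)%E.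

Let tr0 : transported set0 = 0%E.
Proof. by rewrite /transported preimage_set0 setI0 integral_set0. Qed.

Let tr_ge0 A : (0 <= transported A)%E.
Proof. by apply: integral_ge0 => x [Ox _]; rewrite lee_fin; exact: J0. Qed.

Let tr_sigma : semi_sigma_additive transported.
Proof.
move=> F mF tF mUF; rewrite /transported preimage_bigcup setI_bigcupr.
rewrite ge0_integral_bigcup //.
- by apply: is_cvg_ereal_nneg_natsum_cond => // n _ _; exact: tr_ge0.
- by move=> k; exact: mT.
- apply/measurable_EFinP; apply: measurable_funS mJ => //.
  by move=> x [n _ []].
- by move=> x [n _ [Ox _]]; rewrite lee_fin; exact: J0.
- apply/trivIsetP => i j _ _ ij; rewrite setIACA setIid -preimage_setI.
  by move/trivIsetP : tF => /(_ _ _ _ _ ij) -> //; rewrite preimage_set0 setI0.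
Qed.

HB.instance Definition _ := isMeasure.Build _ _ _ transported tr0 tr_ge0 tr_sigma.

Definition transportedM : {measure set MP -> \bar R} := transported.

Import HBNNSimple.
Local Open Scope ereal_scope.

Lemma transported_integral (w : MP -> \bar R) : (forall y, 0 <= w y) ->
  measurable_fun setT w ->
  \int[transportedM]_y w y = \int[mu2]_(x in O) (w (T x) * (J x)%:E).
Proof.
move=> w0 mw; pose h := nnsfun_approx measurableT mw.
have mh n : measurable_fun O (fun x => (h n (T x))%:E).
  apply/measurable_EFinP => _ A mA; rewrite -[_ @^-1` A]/(T @^-1` (h n @^-1` A)).
  by apply: mT; rewrite -[_ @^-1` _]setTI; exact: (measurable_funP (h n)).
have mJE : measurable_fun O (EFin \o J) by exact/measurable_EFinP.
have -> : \int[transportedM]_y w y = limn (fun n => \int[transportedM]_y (h n y)%:E).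
  rewrite -monotone_convergence //.
  - by apply: eq_integral => y _; apply/esym/cvg_lim => //; exact: cvg_nnsfun_approx.
  - by move=> n; exact/measurable_EFinP.
  - by move=> n x _; rewrite lee_fin.
  - by move=> x _ a b ab; rewrite lee_fin; exact/lefP/nd_nnsfun_approx.
have -> : \int[mu2]_(x in O) (w (T x) * (J x)%:E) =
    limn (fun n => \int[mu2]_(x in O) ((h n (T x))%:E * (J x)%:E)).
  rewrite -monotone_convergence //.
  - apply: eq_integral => x _; apply/esym/cvg_lim => //.
    by apply: cvgeZr => //; exact: (cvg_nnsfun_approx measurableT mw).
  - by move=> n; exact: emeasurable_funM.
  - by move=> n x Ox; rewrite mule_ge0 ?lee_fin // J0.
  - move=> x Ox a b ab; rewrite lee_wpmul2r ?lee_fin ?J0 //.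
    exact/lefP/nd_nnsfun_approx.
congr (limn _); apply/funext => n.
rewrite integralT_nnsfun sintegralE.
have -> : \int[mu2]_(x in O) ((h n (T x))%:E * (J x)%:E) =
  \int[mu2]_(x in O) (\sum_(y \in range (h n)) ((y * \1_(h n @^-1` [set y]) (T x) * J x)%:E)).
  apply: eq_integral => x _; rewrite fsumEFin // -EFinM; congr (_%:E).
  by rewrite {1}(fimfunE (h n) (T x)) mulr_fsuml //.
have mind y : measurable_fun O (fun x => \1_(h n @^-1` [set y]) (T x) : R).
  move=> _ A mA; rewrite -[_ @^-1` A]/(T @^-1` (\1_(h n @^-1` [set y]) @^-1` A)).
  apply: mT; rewrite -[_ @^-1` _]setTI.
  apply: measurable_indic => //; exact: measurable_sfunP.
rewrite ge0_integral_fsum //; last 2 first.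
- move=> y; apply/measurable_EFinP; apply: measurable_realfun.measurable_funM => //.
  by apply: measurable_realfun.measurable_funM => //; exact: measurable_cst.
- move=> y x Ox; rewrite lee_fin mulr_ge0 ?J0 //.
  by have := nnfun_muleindic_ge0 (h n) y (T x); rewrite lee_fin.
apply: eq_fsbigr => y /[!inE] -[t _ <-].
have y0 : (0 <= h n t)%R by [].
under [RHS]eq_integral do rewrite -mulrA EFinM.
rewrite ge0_integralZl //; last 2 first.
- by apply/measurable_EFinP; apply: measurable_realfun.measurable_funM.
- by move=> x Ox; rewrite lee_fin mulr_ge0 ?J0 // indicE ler0n.
congr (_ * _); rewrite /transportedM /= /transported.
rewrite integral_mkcondr; apply: eq_integral => x _.
rewrite /patch indicE /=; case: ifPn => H.
  by rewrite (_ : _ \in _ = true) ?mul1r //; apply: mem_set; rewrite inE in H.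
rewrite (_ : _ \in _ = false) ?mul0r //; apply/negP => H'.
by move/negP: H; apply; apply: mem_set; rewrite inE in H'.
Qed.

End Density.

Section Scalars.
Variable R : realType.

Lemma cube_bound (t : R) : 0 < t -> 8 * t <= 1 -> (1 + t) ^+ 3 <= 1 + 8 * t /\ 1 - 8 * t <= (1 - t) ^+ 3.
Proof.
move=> t0 t1; have tt : 0 <= t * t by rewrite mulr_ge0 // ltW.
have tt1 : 0 <= t * (1 - t) by apply: mulr_ge0; lra.
have ttt : 0 <= t * t * (1 - t) by apply: mulr_ge0 => //; lra.
split; nra.
Qed.

(** The relative error of [cov_local] comes from three factors 1 + t: the two
    sides of the rectangle and the Jacobian. *)
Lemma inflated_area (t e h s l1 l2 : R) : 8 * t <= 1 -> 8 * t <= e -> 0 < t -> 0 < h -> h <= t ->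
  0 <= s -> s <= t * l1 -> s <= t * l2 -> 0 < l1 -> 0 < l2 ->
  (1 + h) * ((l1 + s) * (l2 + s)) <= (1 + e) * (l1 * l2).
Proof.
move=> t1 te t0 h0 ht s0 s1 s2 l10 l20; have [c _] := cube_bound t0 t1.
have a1 : l1 + s <= (1 + t) * l1 by rewrite mulrDl mul1r lerD2l.
have a2 : l2 + s <= (1 + t) * l2 by rewrite mulrDl mul1r lerD2l.
have b1 : 0 <= l1 + s by rewrite addr_ge0 // ltW.
have b2 : 0 <= l2 + s by rewrite addr_ge0 // ltW.
apply: (@le_trans _ _ ((1 + t) * (((1 + t) * l1) * ((1 + t) * l2)))).
  apply: ler_pM; [by rewrite addr_ge0 // ltW|exact: mulr_ge0|by rewrite lerD2l|].
  exact: ler_pM.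
have -> : (1 + t) * (((1 + t) * l1) * ((1 + t) * l2)) = (1 + t) ^+ 3 * (l1 * l2) by ring.
rewrite ler_pM2r ?mulr_gt0 //; apply: le_trans c _; by rewrite lerD2l.
Qed.

Lemma deflated_area (t e h s l1 l2 : R) : 8 * t <= 1 -> 8 * t <= e -> 0 < t -> 0 < h -> h <= t ->
  0 <= s -> s <= t * l1 -> s <= t * l2 -> 0 < l1 -> 0 < l2 ->
  (1 - e) * (l1 * l2) <= (1 - h) * ((l1 - s) * (l2 - s)).
Proof.
move=> t1 te t0 h0 ht s0 s1 s2 l10 l20; have [_ c] := cube_bound t0 t1.
have t2 : 0 <= 1 - t by lra.
have a1 : (1 - t) * l1 <= l1 - s by rewrite mulrBl mul1r lerB.
have a2 : (1 - t) * l2 <= l2 - s by rewrite mulrBl mul1r lerB.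
have b1 : 0 <= (1 - t) * l1 by rewrite mulr_ge0 // ltW.
have b2 : 0 <= (1 - t) * l2 by rewrite mulr_ge0 // ltW.
apply: (@le_trans _ _ ((1 - t) * (((1 - t) * l1) * ((1 - t) * l2)))); last first.
  by apply: ler_pM => //; [exact: mulr_ge0|exact: lerB|exact: ler_pM].
have -> : (1 - t) * (((1 - t) * l1) * ((1 - t) * l2)) = (1 - t) ^+ 3 * (l1 * l2) by ring.
rewrite ler_pM2r ?mulr_gt0 //; apply: le_trans c; by rewrite lerB.
Qed.

Lemma dist_in_itv (p q y z w : R) : p <= y <= q -> p <= z <= q -> q - p <= w -> `|y - z| <= w.
Proof. by move=> /andP[? ?] /andP[? ?] ?; rewrite ler_norml; apply/andP; split; lra. Qed.

Lemma dist_via (u v y : R) : `|u - v| <= `|y - v| + `|y - u|.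
Proof. have -> : u - v = (y - v) - (y - u) by ring. exact: ler_normB. Qed.

Lemma lower_after_drift (p s u v : R) : p < u -> u - v <= s -> p - s < v.
Proof. lra. Qed.
Lemma upper_after_drift (q s u v : R) : u <= q -> - s <= u - v -> v <= q + s.
Proof. lra. Qed.
Lemma lower_before_drift (p s u v : R) : p + s < v -> - s <= u - v -> p < u.
Proof. lra. Qed.
Lemma deflated_in_itv (p q s v : R) : p + s < v -> v <= q - s -> 0 <= s -> p <= v <= q.
Proof. by move=> ? ? ?; apply/andP; split; lra. Qed.
Lemma deflated_itv (p q s : R) : 2 * s <= q - p -> p + s <= q - s.
Proof. lra. Qed.
Lemma inflated_itv (p q s : R) : p < q -> 0 <= s -> p - s <= q + s.
Proof. lra. Qed.
Lemma deflated_area_jac (h J p1 p2 q1 q2 s : R) : J != 0 ->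
  (1 - h) * ((q1 - p1 - 2 * s) * (q2 - p2 - 2 * s)) =
  (1 - h) * J * (J^-1 * ((q1 - s - (p1 + s)) * (q2 - s - (p2 + s)))).
Proof. by move=> J0; field. Qed.
Lemma inflated_area_jac (h J p1 p2 q1 q2 s : R) : J != 0 ->
  (1 + h) * J * (J^-1 * ((q1 + s - (p1 - s)) * (q2 + s - (p2 - s)))) =
  (1 + h) * ((q1 - p1 + 2 * s) * (q2 - p2 + 2 * s)).
Proof. by move=> J0; field. Qed.
Lemma upper_before_drift (q s u v : R) : v <= q - s -> u - v <= s -> u <= q.
Proof. lra. Qed.

End Scalars.

Section ConformalChange.
Variable R : realType.
Local Notation P := (R * R)%type.
Local Notation MP := (measurableTypeR R * measurableTypeR R)%type.
Local Notation mble A := (@measurable _ MP A).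
Local Notation mu2 := (@lebesgue_measure R \x @lebesgue_measure R)%E.
Variables (O O' : set P) (T S : P -> P) (A B : P -> R).
Hypotheses (oO : open O) (oO' : open O').
Hypothesis hT : forall x, O x -> O' (T x) /\ S (T x) = x.
Hypothesis hS : forall y, O' y -> O (S y) /\ T (S y) = y.
Hypothesis cS : forall y, O' y -> {for y, continuous S}.
Let J x : R := A x ^+ 2 + B x ^+ 2.
Hypothesis gT : forall x, O x -> grad (fun y => (T y).1) x (A x) (- B x) /\
  grad (fun y => (T y).2) x (B x) (A x).
Hypothesis J_neq0 : forall x, O x -> J x != 0.
Hypothesis cJ : forall x, O x -> {for x, continuous J}.

Let cT x : O x -> {for x, continuous T}.
Proof.
move=> Ox; have [/grad_continuous c1 /grad_continuous c2] := gT Ox.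
have -> : T = (fun y => ((T y).1, (T y).2)) by apply/funext => y; rewrite -surjective_pairing.
apply: (@cvg_pair _ _ _ _ (nbhs (T x).1) (nbhs (T x).2)).
  exact: c1.
exact: c2.
Qed.

Let mO : mble O. Proof. exact: open_measurable2. Qed.
Let mO' : mble O'. Proof. exact: open_measurable2. Qed.
Let mT := preimage_measurable oO cT.
Let mJ : @measurable_fun _ _ MP R O J := open_continuous_measurable oO cJ.
Let Jge0 x : O x -> 0 <= J x.
Proof. by move=> _; rewrite addr_ge0 ?sqr_ge0. Qed.

Local Notation nu := (transportedM mO mT mJ Jge0).

Let J_gt0 x : O x -> 0 < J x.
Proof. by move=> Ox; rewrite lt_def J_neq0 // Jge0. Qed.

(** A relative precision h for the first order expansion of T such that the
    resulting displacement s changes the area by a factor close to 1, for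
    every rectangle of size w and bounded eccentricity k. *)
Let eta_choice (K k e : R) : 0 < K -> 0 < k -> 0 < e -> exists h : R,
  [/\ 0 < h, h * K <= 1 / 2, h < 1 &
     forall l1 l2 w, 0 < l1 -> 0 < l2 -> 0 <= w -> w <= k * l1 -> w <= k * l2 ->
      let s := 2 * h * K * w in
      [/\ (1 + h) * ((l1 + 2 * s) * (l2 + 2 * s)) <= (1 + e) * (l1 * l2),
       (1 - e) * (l1 * l2) <= (1 - h) * ((l1 - 2 * s) * (l2 - 2 * s)),
       2 * s <= l1 & 2 * s <= l2]].
Proof.
move=> K0 k0 e0; pose t := Num.min 1 e / 8.
have t0 : 0 < t by rewrite divr_gt0 // lt_min ltr01.
have t1 : 8 * t <= 1 by rewrite /t mulrC divfK // ge_min lexx.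
have te : 8 * t <= e by rewrite /t mulrC divfK // ge_min lexx orbT.
pose h := Num.min t (Num.min (1 / (2 * K)) (t / (4 * K * k))).
have Kk : 0 < 4 * K * k by rewrite !mulr_gt0.
have h0 : 0 < h.
  rewrite !lt_min t0 /=; apply/andP; split; apply: divr_gt0 => //.
  exact: mulr_gt0.
have ht : h <= t by rewrite ge_min lexx.
have hK : h <= 1 / (2 * K) by rewrite !ge_min lexx orbT.
have hk : h <= t / (4 * K * k) by rewrite !ge_min lexx !orbT.
exists h; split => //.
- move: hK; rewrite ler_pdivlMr ?mulr_gt0 //; lra.
- by apply: le_lt_trans ht _; lra.
move=> l1 l2 w l10 l20 w0 w1 w2 /=.
have hB l : 0 < l -> w <= k * l -> 2 * (2 * h * K * w) <= t * l.
  move=> l0 wl; move: hk; rewrite ler_pdivlMr // => hk.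
  have : h * K * w <= h * K * (k * l) by apply: ler_wpM2l => //; apply: mulr_ge0; exact: ltW.
  have : h * (4 * K * k) * l <= t * l by rewrite ler_wpM2r // ltW.
  nra.
have s0 : 0 <= 2 * (2 * h * K * w).
  by do 2?apply: mulr_ge0 => //; apply: mulr_ge0; [apply: mulr_ge0 => //|]; exact: ltW.
move: (hB _ l10 w1) (hB _ l20 w2) s0; move: (2 * (2 * h * K * w)) => s s1 s2 s0.
have tl1 : t * l1 <= l1 by rewrite ger_pMl //; lra.
have tl2 : t * l2 <= l2 by rewrite ger_pMl //; lra.
split; [|  |exact: le_trans tl1|exact: le_trans tl2].
  by apply: (inflated_area t1 te).
by apply: (deflated_area t1 te).
Qed.

(** On a small rectangle S is close to a similarity, so that the preimage of
    the rectangle under T lies between the images of a slightly smaller and a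
    slightly larger rectangle, where J is almost constant; the bound on the
    diameter in terms of the sides makes the relative error small. *)
Lemma cov_local z k e : O' z -> 0 < k -> 0 < e -> exists2 d : R, 0 < d &
  forall p q, p.1 <= z.1 <= q.1 -> p.2 <= z.2 <= q.2 ->
    p.1 < q.1 -> p.2 < q.2 -> `|q - p| < d ->
    `|q - p| <= k * (q.1 - p.1) -> `|q - p| <= k * (q.2 - p.2) ->
    (((1 - e) * ((q.1 - p.1) * (q.2 - p.2)))%:E <= nu (rect p q) <=
      ((1 + e) * ((q.1 - p.1) * (q.2 - p.2)))%:E)%E.
Proof.
move=> Oz k0 e0; have [Ox0 Tx0] := hS Oz; set x0 := S z in Ox0 Tx0.
have [g1 g2] := gT Ox0; have Jp := J_gt0 Ox0; have Jn := lt0r_neq0 Jp.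
set a := A x0 in g1 g2; set b := B x0 in g1 g2; set J1 := J x0 in Jp Jn.
have J1E : J1 = a ^+ 2 + b ^+ 2 by [].
pose K := (`|a| + `|b|) / J1.
have ab0 : 0 < `|a| + `|b|.
  rewrite lt_def addr_ge0 // andbT; apply: contra Jn.
  rewrite paddr_eq0 // !normr_eq0 J1E => /andP[/eqP -> /eqP ->].
  by rewrite expr0n addr0.
have K0 : 0 < K by rewrite divr_gt0.
(* [K] bounds the inverse of the linear part of T in the sup norm. *)
have Linv v1 v2 m : `|a * v1 - b * v2| <= m -> `|b * v1 + a * v2| <= m ->
    `|v1| <= K * m /\ `|v2| <= K * m.
  move=> h1 h2; have aux (c d m1 m2 : R) : `|m1| <= m -> `|m2| <= m ->
      `|c| + `|d| = `|a| + `|b| -> `|(c * m1 + d * m2) / J1| <= K * m.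
    move=> n1 n2 cd; rewrite normrM normfV (gtr0_norm Jp) /K mulrAC ler_pM2r ?invr_gt0 //.
    apply: le_trans (ler_normD _ _) _; rewrite !normrM -cd mulrDl.
    by apply: lerD; apply: ler_wpM2l.
  split.
    by have := aux a b _ _ h1 h2 erefl; congr (`|_| <= _); rewrite J1E in Jn *; field.
  have := aux (- b) a _ _ h1 h2; rewrite normrN addrC => /(_ erefl).
  by congr (`|_| <= _); rewrite J1E in Jn *; field.
have [h [h0 hK h1 choice]] := eta_choice K0 k0 e0.
have cJ0 : \forall x \near x0, `|J1 - J x| <= h * J1.
  have /cvgrPdist_le := cJ Ox0; apply; exact: mulr_gt0.
have /nbhsPP[r1 r10 near1] : \forall x \near x0,
    (`|(T x).1 - (T x0).1 - (a * (x.1 - x0.1) + - b * (x.2 - x0.2))| <= h * `|x - x0| /\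
     `|(T x).2 - (T x0).2 - (b * (x.1 - x0.1) + a * (x.2 - x0.2))| <= h * `|x - x0|) /\
    (O x /\ `|J1 - J x| <= h * J1).
  apply: filterI; apply: filterI.
  - exact: gradP g1 _ h0.
  - exact: gradP g2 _ h0.
  - exact: near_open oO Ox0.
  - exact: cJ0.
have /nbhsPP[r2 r20 near2] : \forall y \near z, `|S y - x0| < r1.
  have Hn : nbhs (S z) [set x | `|x - x0| < r1] by apply/nbhsPP; exists r1.
  exact: (cS Oz Hn).
exists (Num.min r2 (r1 / (2 * K))).
  by rewrite lt_min r20 divr_gt0 // mulr_gt0.
move=> p q z1 z2 l1 l2; rewrite lt_min => /andP[w2 w1] k1 k2.
set w := `|q - p| in w1 w2 k1 k2.
have w0 : 0 <= w by exact: normr_ge0.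
have [wl1 wl2] := mono_dist q p.
have wl1' : q.1 - p.1 <= w by apply: le_trans wl1; exact: ler_norm.
have wl2' : q.2 - p.2 <= w by apply: le_trans wl2; exact: ler_norm.
have l1' : 0 < q.1 - p.1 by rewrite subr_gt0.
have l2' : 0 < q.2 - p.2 by rewrite subr_gt0.
have [C1 C2 C3 C4] := choice _ _ _ l1' l2' w0 k1 k2.
set s := 2 * h * K * w in C1 C2 C3 C4.
have s0 : 0 <= s.
  by apply: mulr_ge0 => //; apply: mulr_ge0; [apply: mulr_ge0 => //|]; exact: ltW.
(* [L] is the affine map tangent to T at [x0]. *)
pose c1 := z.1 - a * x0.1 + b * x0.2; pose c2 := z.2 - b * x0.1 - a * x0.2.
pose L (x : P) : P := (a * x.1 - b * x.2 + c1, b * x.1 + a * x.2 + c2).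
have Lz1 x : (L x).1 - z.1 = a * (x.1 - x0.1) - b * (x.2 - x0.2) by rewrite /L /c1 /=; ring.
have Lz2 x : (L x).2 - z.2 = b * (x.1 - x0.1) + a * (x.2 - x0.2) by rewrite /L /c2 /=; ring.
have TL x : `|x - x0| < r1 -> [/\ O x, `|(T x).1 - (L x).1| <= h * `|x - x0|,
    `|(T x).2 - (L x).2| <= h * `|x - x0|, J x <= (1 + h) * J1 & (1 - h) * J1 <= J x].
  move=> /near1[[n1 n2] [Ox nJ]]; rewrite Tx0 in n1 n2; split => //.
  - apply: le_trans n1; rewrite le_eqVlt; apply/orP; left; apply/eqP; congr `|_|.
    by have := Lz1 x => E; rewrite -[(L x).1](subrK z.1) E; ring.
  - apply: le_trans n2; rewrite le_eqVlt; apply/orP; left; apply/eqP; congr `|_|.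
    by have := Lz2 x => E; rewrite -[(L x).2](subrK z.2) E; ring.
  - by move: nJ; rewrite ler_norml => /andP[? ?]; lra.
  - by move: nJ; rewrite ler_norml => /andP[? ?]; lra.
have Linv' x m : `|(L x).1 - z.1| <= m -> `|(L x).2 - z.2| <= m -> `|x - x0| <= K * m.
  by rewrite Lz1 Lz2 => m1 m2; have [? ?] := Linv _ _ _ m1 m2; rewrite prod_normE2 ge_max; apply/andP.
have box y : p.1 <= y.1 <= q.1 -> p.2 <= y.2 <= q.2 -> `|y.1 - z.1| <= w /\ `|y.2 - z.2| <= w.
  by move=> y1 y2; split; [exact: dist_in_itv y1 z1 wl1'|exact: dist_in_itv y2 z2 wl2'].
pose pp : P := (p.1 - s, p.2 - s); pose qp : P := (q.1 + s, q.2 + s).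
pose pm : P := (p.1 + s, p.2 + s); pose qm : P := (q.1 - s, q.2 - s).
have up x : O x -> rect p q (T x) -> rect pp qp (L x) /\ J x <= (1 + h) * J1.
  move=> Ox /rectE[t1 t2 t3 t4].
  have [b1 b2] : `|(T x).1 - z.1| <= w /\ `|(T x).2 - z.2| <= w.
    by apply: box; apply/andP; split => //; exact: ltW.
  have xr : `|x - x0| < r1.
    have [_ <-] := hT Ox; apply: near2; apply: le_lt_trans w2.
    by rewrite prod_normE2 ge_max b1.
  have [_ d1 d2 Jx _] := TL x xr; split => //.
  (* The error term is absorbed in the left-hand side, since h K <= 1/2. *)
  have bd : `|x - x0| <= K * (w + h * `|x - x0|).
    apply: Linv'; apply: le_trans (dist_via _ _ _) _.
      exact: lerD b1 d1.
    exact: lerD b2 d2.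
  have bd2 : `|x - x0| <= 2 * K * w.
    have : K * (h * `|x - x0|) <= 1 / 2 * `|x - x0|.
      by rewrite mulrA [K * h]mulrC; apply: ler_wpM2r.
    by move: bd; rewrite mulrDr; lra.
  have hs : h * `|x - x0| <= s.
    by rewrite /s (_ : 2 * h * K * w = h * (2 * K * w)); [apply: ler_wpM2l => //; exact: ltW|ring].
  move: (le_trans d1 hs) (le_trans d2 hs); rewrite !ler_norml => /andP[+ +] /andP[+ +].
  move: (L x) => Lx k3 k4 k5 k6; apply/rectE; rewrite /pp /qp /=.
  by split; [exact: lower_after_drift t1 k4|exact: upper_after_drift t2 k3|exact: lower_after_drift t3 k6|exact: upper_after_drift t4 k5].
(* The points sent by [L] to the deflated rectangle are close to [x0], so
   they lie in O. *)
have dn x : rect pm qm (L x) -> [/\ O x, rect p q (T x) & (1 - h) * J1 <= J x].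
  move=> /rectE; rewrite /pm /qm => -[]; rewrite [(p.1 + s, _).1]/= [(p.1 + s, _).2]/=.
  rewrite [(q.1 - s, _).1]/= [(q.1 - s, _).2]/= => t1 t2 t3 t4.
  have [b1 b2] : `|(L x).1 - z.1| <= w /\ `|(L x).2 - z.2| <= w.
    by apply: box; [exact: deflated_in_itv t1 t2 s0|exact: deflated_in_itv t3 t4 s0].
  have bd := Linv' x w b1 b2.
  have xr : `|x - x0| < r1.
    have K2p : 0 < 2 * K by rewrite mulr_gt0.
    apply: le_lt_trans bd _; rewrite ltr_pdivlMr // in w1; apply: le_lt_trans w1.
    have Kw : 0 <= K * w by apply: mulr_ge0 => //; exact: ltW.
    have -> : w * (2 * K) = K * w + K * w by ring.
    by rewrite lerDl.
  have [Ox d1 d2 _ Jx] := TL x xr; split => //.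
  have hs : h * `|x - x0| <= s.
    rewrite /s (_ : 2 * h * K * w = h * (2 * (K * w))); last by ring.
    apply: ler_wpM2l; first exact: ltW.
    by apply: le_trans bd _; rewrite [leRHS]mulr_natl mulr2n lerDl; apply: mulr_ge0 => //; exact: ltW.
  move: (le_trans d1 hs) (le_trans d2 hs); rewrite !ler_norml => /andP[k3 k4] /andP[k5 k6].
  apply/rectE.
  by split; [exact: lower_before_drift t1 k3|exact: upper_before_drift t2 k4|exact: lower_before_drift t3 k5|exact: upper_before_drift t4 k6].
have J1n : a ^+ 2 + b ^+ 2 != 0 by rewrite -J1E.
have [mup lup] := similarity_measure c1 c2 J1n (measurable_rect pp qp).
have [mdn ldn] := similarity_measure c1 c2 J1n (measurable_rect pm qm).
have lup' : mu2 ((L : MP -> MP) @^-1` rect pp qp) =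
  (((a ^+ 2 + b ^+ 2)^-1)%:E * mu2 (rect pp qp))%E := lup.
have ldn' : mu2 ((L : MP -> MP) @^-1` rect pm qm) =
  (((a ^+ 2 + b ^+ 2)^-1)%:E * mu2 (rect pm qm))%E := ldn.
have mpre : mble (O `&` T @^-1` rect p q) by apply: mT; exact: measurable_rect.
have mJ' D : mble D -> D `<=` O -> @measurable_fun _ _ MP _ D (fun x => (J x)%:E).
  by move=> mD DO; apply/measurable_EFinP; apply: measurable_funS mJ.
apply/andP; split.
- apply: (@le_trans _ _ (\int[mu2]_(x in (L : MP -> MP) @^-1` rect pm qm) ((1 - h) * J1)%:E)%E).
    have I1 : (\int[mu2]_(x in (L : MP -> MP) @^-1` rect pm qm) ((1 - h) * J1)%:E
        = ((1 - h) * J1)%:E * (((a ^+ 2 + b ^+ 2)^-1)%:E * mu2 (rect pm qm)))%E.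
      rewrite -ldn'; exact: integral_cst.
    rewrite I1 (measure_rect (p := pm) (q := qm) (deflated_itv C3) (deflated_itv C4)) -!EFinM lee_fin -J1E.
    apply: le_trans C2 _.
    rewrite le_eqVlt; apply/orP; left; apply/eqP; exact: deflated_area_jac.
  apply: (@le_trans _ _ (\int[mu2]_(x in (L : MP -> MP) @^-1` rect pm qm) (J x)%:E)%E).
    apply: ge0_le_integral => //.
    - by move=> x _; rewrite lee_fin mulr_ge0 ?(ltW Jp) // subr_ge0 ltW.
    - by apply: mJ' => // x /dn[].
    - by move=> x /dn[_ _ ?]; rewrite lee_fin.
  apply: ge0_subset_integral => //.
  - by apply: mJ' => // x [].
  - by move=> x [Ox _]; rewrite lee_fin; exact: Jge0.
  - by move=> x /dn[].
apply: (@le_trans _ _ (\int[mu2]_(x in O `&` (T : MP -> MP) @^-1` rect p q) ((1 + h) * J1)%:E)%E).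
  apply: ge0_le_integral => //.
  - by move=> x [Ox _]; rewrite lee_fin; exact: Jge0.
  - by apply: mJ' => // x [].
  - by move=> x [Ox /(up x Ox)[_ ?]]; rewrite lee_fin.
apply: (@le_trans _ _ (((1 + h) * J1)%:E * mu2 ((L : MP -> MP) @^-1` rect pp qp))%E).
  rewrite integral_cst //; apply: lee_wpmul2l.
    by rewrite lee_fin mulr_ge0 ?(ltW Jp) // addr_ge0 // ltW.
  have LE : (mu2 (O `&` T @^-1` rect p q) <= mu2 ((L : MP -> MP) @^-1` rect pp qp))%E.
    apply: (le_measure mu2); [exact/mem_set|exact/mem_set|].
    by move=> x [Ox /(up x Ox)[]].
  exact: LE.
rewrite lup' (measure_rect (p := pp) (q := qp) (inflated_itv l1 s0) (inflated_itv l2 s0)) -!EFinM lee_fin -J1E.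
apply: le_trans C1; rewrite le_eqVlt; apply/orP; left; apply/eqP; exact: inflated_area_jac.
Qed.

Let nu_le (D D' : set P) : mble D -> mble D' -> D `<=` D' -> (nu D <= nu D')%E.
Proof. by move=> mD mD' DD'; apply: le_measure; rewrite ?inE. Qed.

Let rect_mid1 (p q : P) m : p.1 <= m <= q.1 ->
  rect p q = rect p (m, q.2) `|` rect (m, p.2) q /\ rect p (m, q.2) `&` rect (m, p.2) q = set0.
Proof.
move=> /andP[pm mq]; split; apply/seteqP; split => x //.
- move=> /rectE[h1 h2 h3 h4]; have [xm|xm] := lerP x.1 m; [left|right]; exact/rectE.
- move=> [/rectE[/= h1 h2 h3 h4]|/rectE[/= h1 h2 h3 h4]]; apply/rectE; split => //.
    exact: le_trans mq.
  exact: le_lt_trans h1.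
- by move=> [/rectE[/= _ h1 _ _] /rectE[/= h2 _ _ _]]; move: (lt_le_trans h2 h1); rewrite ltxx.
Qed.

Let rect_mid2 (p q : P) m : p.2 <= m <= q.2 ->
  rect p q = rect p (q.1, m) `|` rect (p.1, m) q /\ rect p (q.1, m) `&` rect (p.1, m) q = set0.
Proof.
move=> /andP[pm mq]; split; apply/seteqP; split => x //.
- move=> /rectE[h1 h2 h3 h4]; have [xm|xm] := lerP x.2 m; [left|right]; exact/rectE.
- move=> [/rectE[/= h1 h2 h3 h4]|/rectE[/= h1 h2 h3 h4]]; apply/rectE; split => //.
    exact: le_trans mq.
  exact: le_lt_trans h3.
- by move=> [/rectE[/= _ _ _ h1] /rectE[/= _ _ h2 _]]; move: (lt_le_trans h2 h1); rewrite ltxx.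
Qed.

Let cov_rect (p0 q0 : P) : p0.1 < q0.1 -> p0.2 < q0.2 ->
  (forall y : P, p0.1 <= y.1 <= q0.1 -> p0.2 <= y.2 <= q0.2 -> O' y) ->
  (nu (rect p0 q0) < +oo)%E ->
  nu (rect p0 q0) = ((q0.1 - p0.1) * (q0.2 - p0.2))%:E.
Proof.
move=> lt1 lt2 HO fin.
have finS p q : subrect p0 q0 p q -> nu (rect p q) \is a fin_num.
  move=> [[h1 _] h2 [h3 _] h4]; rewrite ge0_fin_numE //.
  apply: le_lt_trans fin; apply: nu_le; try exact: measurable_rect.
  move=> x /rectE[? ? ? ?]; apply/rectE; split.
  - exact: le_lt_trans h1 _.
  - exact: le_trans h2.
  - exact: le_lt_trans h3 _.
  - exact: le_trans h4.
pose Phi (p q : P) := fine (nu (rect p q)) - (q.1 - p.1) * (q.2 - p.2).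
suff : Phi p0 q0 = 0.
  rewrite /Phi => /eqP; rewrite subr_eq0 => /eqP <-; rewrite fineK //.
  by apply: finS; split => //; split.
apply: bisection => //.
- move=> [pa pb] [qa qb] pq; have [[/= h1 lp1] h2 [h3 lp2] h4] := pq.
  have Q b1 b2 := finS _ _ (@quadrant_subrect _ p0 q0 b1 b2 ((pa, pb), (qa, qb)) pq).
  pose ma := (pa + qa) / 2; pose mb := (pb + qb) / 2.
  have [m1 m1'] : pa < ma /\ ma < qa.
    by rewrite /ma ltr_pdivlMr // ltr_pdivrMr //; split; lra.
  have [m2 m2'] : pb < mb /\ mb < qb.
    by rewrite /mb ltr_pdivlMr // ltr_pdivrMr //; split; lra.
  have Qff : nu (rect (pa, pb) (ma, mb)) \is a fin_num := Q false false.
  have Qft : nu (rect (pa, mb) (ma, qb)) \is a fin_num := Q false true.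
  have Qtf : nu (rect (ma, pb) (qa, mb)) \is a fin_num := Q true false.
  have Qtt : nu (rect (ma, mb) (qa, qb)) \is a fin_num := Q true true.
  rewrite !big_bool; change (`|Phi (pa, pb) (qa, qb)| <=
    `|Phi (ma, mb) (qa, qb)| + `|Phi (ma, pb) (qa, mb)|
    + (`|Phi (pa, mb) (ma, qb)| + `|Phi (pa, pb) (ma, mb)|)).
  have add (X Y Z : set P) : mble Y -> mble Z -> X = Y `|` Z -> Y `&` Z = set0 ->
      nu X = (nu Y + nu Z)%E.
    by move=> mY mZ -> YZ; apply: measureU => //; exact: mY.
  have mr a b : mble (rect a b) := measurable_rect a b.
  have [U1 I1] := @rect_mid1 (pa, pb) (qa, qb) ma (ltac:(by rewrite /= !ltW)).
  have [U2 I2] := @rect_mid2 (pa, pb) (ma, qb) mb (ltac:(by rewrite /= !ltW)).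
  have [U3 I3] := @rect_mid2 (ma, pb) (qa, qb) mb (ltac:(by rewrite /= !ltW)).
  have E : nu (rect (pa, pb) (qa, qb)) =
     (nu (rect (pa, pb) (ma, mb)) + nu (rect (pa, mb) (ma, qb)) +
     (nu (rect (ma, pb) (qa, mb)) + nu (rect (ma, mb) (qa, qb))))%E.
    rewrite (add _ _ _ (mr _ _) (mr _ _) U1 I1) (add _ _ _ (mr _ _) (mr _ _) U2 I2).
    by rewrite (add _ _ _ (mr _ _) (mr _ _) U3 I3).
  have EE : Phi (pa, pb) (qa, qb) = Phi (ma, mb) (qa, qb) + Phi (ma, pb) (qa, mb)
      + (Phi (pa, mb) (ma, qb) + Phi (pa, pb) (ma, mb)).
    rewrite /Phi E fineD; [|by rewrite fin_numD Qff Qft|by rewrite fin_numD Qtf Qtt].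
    rewrite (fineD Qff Qft) (fineD Qtf Qtt) ![(_, _).1]/= ![(_, _).2]/=; ring.
  rewrite EE; apply: le_trans (ler_normD _ _) _; apply: lerD; exact: ler_normD.
- move=> z e z1 z2 e0; have Oz := HO z z1 z2.
  have w1 : 0 < q0.1 - p0.1 by rewrite subr_gt0.
  have w2 : 0 < q0.2 - p0.2 by rewrite subr_gt0.
  pose W := Num.max (q0.1 - p0.1) (q0.2 - p0.2).
  have W0 : 0 < W by rewrite lt_max w1.
  pose k := W / (q0.1 - p0.1) + W / (q0.2 - p0.2).
  have k0 : 0 < k by rewrite addr_gt0 // divr_gt0.
  have [d d0 Hd] := cov_local Oz k0 e0.
  exists (d / W); first exact: divr_gt0.
  move=> p q t pq zp1 zp2 /andP[t0 tW] E1 E2.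
  have [[_ lp1] _ [_ lp2] _] := pq.
  have nE : `|q - p| = t * W.
    rewrite prod_normE2 [(q - p).1]/= [(q - p).2]/= E1 E2 !normrM.
    by rewrite (gtr0_norm t0) (gtr0_norm w1) (gtr0_norm w2) -maxr_pMr // ltW.
  have := Hd p q zp1 zp2 lp1 lp2; rewrite nE -ltr_pdivlMr // => /(_ tW).
  have kk1 : t * W <= k * (q.1 - p.1).
    rewrite E1 [leRHS]mulrCA ler_pM2l // /k mulrDl divfK ?lt0r_neq0 // lerDl.
    by rewrite mulr_ge0 ?divr_ge0 ?ltW.
  have kk2 : t * W <= k * (q.2 - p.2).
    rewrite E2 [leRHS]mulrCA ler_pM2l // /k mulrDl [X in _ + X]divfK ?lt0r_neq0 // lerDr.
    by rewrite mulr_ge0 ?divr_ge0 ?ltW.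
  move=> /(_ kk1 kk2); rewrite -(fineK (finS p q pq)) !lee_fin => /andP[f1 f2].
  by rewrite /Phi ler_norml; apply/andP; split; lra.
Qed.

Let good (p q : P) := (forall y : P, p.1 <= y.1 <= q.1 -> p.2 <= y.2 <= q.2 -> O' y) /\
  (nu (rect p q) < +oo)%E.

Let good_near x : O' x -> exists2 d : R, 0 < d & forall p q, rect p q x ->
     `|p - x| < d -> `|q - x| < d -> good p q.
Proof.
move=> Ox; have /nbhsPP[r r0 Hr] := near_open oO' Ox.
have [d d0 Hd] := cov_local Ox (ltr0n R 2) ltr01.
pose e := Num.min r (d / 4).
have e0 : 0 < e by rewrite lt_min r0 divr_gt0.
have er : e <= r by rewrite ge_min lexx.
have ed : e <= d / 4 by rewrite ge_min lexx orbT.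
exists e => // p q px pe qe.
have [pe1 pe2] := mono_dist p x; have [qe1 qe2] := mono_dist q x.
have := le_lt_trans pe1 pe; have := le_lt_trans pe2 pe.
have := le_lt_trans qe1 qe; have := le_lt_trans qe2 qe.
rewrite !ltr_norml => /andP[_ b2] /andP[_ b1] /andP[a2 _] /andP[a1 _].
have a1' : x.1 - e < p.1 by rewrite addrC -ltrBrDr opprK in a1 *; lra.
have a2' : x.2 - e < p.2 by lra.
have b1' : q.1 < x.1 + e by lra.
have b2' : q.2 < x.2 + e by lra.
split.
  move=> y /andP[y1 y2] /andP[y3 y4]; apply: Hr.
  rewrite prod_normE2 gt_max !ltr_norml /=.
  have [i1 i2] : x.1 - e < y.1 /\ y.1 < x.1 + e.
    by split; [exact: lt_le_trans a1' y1|exact: le_lt_trans y2 b1'].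
  have [i3 i4] : x.2 - e < y.2 /\ y.2 < x.2 + e.
    by split; [exact: lt_le_trans a2' y3|exact: le_lt_trans y4 b2'].
  by apply/andP; split; apply/andP; split; lra.
pose p' : P := (x.1 - e, x.2 - e); pose q' : P := (x.1 + e, x.2 + e).
have nE : `|q' - p'| = 2 * e.
  have e1 : (q' - p').1 = 2 * e by rewrite /=; ring.
  have e2 : (q' - p').2 = 2 * e by rewrite /=; ring.
  by rewrite prod_normE2 e1 e2 maxxx gtr0_norm // mulr_gt0.
have := Hd p' q'; rewrite nE /p' /q' /=.
have -> : x.1 + e - (x.1 - e) = 2 * e by ring.
have -> : x.2 + e - (x.2 - e) = 2 * e by ring.
have h1 : x.1 - e <= x.1 <= x.1 + e by apply/andP; split; lra.
have h2 : x.2 - e <= x.2 <= x.2 + e by apply/andP; split; lra.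
have h3 : x.1 - e < x.1 + e by lra.
have h4 : x.2 - e < x.2 + e by lra.
have h5 : 2 * e < d by lra.
have h6 : 2 * e <= 2 * (2 * e) by lra.
move=> /(_ h1 h2 h3 h4 h5 h6 h6) /andP[_ fin].
apply: le_lt_trans (le_lt_trans fin (ltry _)).
apply: nu_le; try exact: measurable_rect.
move=> y /rectE[y1 y2 y3 y4]; apply/rectE; split => /=.
- exact: lt_trans y1.
- exact: le_trans y2 (ltW b1').
- exact: lt_trans y3.
- exact: le_trans y4 (ltW b2').
Qed.

Let cov_good (p q : P) (D : set P) : good p q -> mble D ->
  nu (rect p q `&` D) = mu2 (rect p q `&` D).
Proof.
move=> [HO fin] mD; have mr := measurable_rect p q.
rewrite !(setIC (rect p q)).
apply: (@measure_unique _ R MP [set X | exists p q, X = rect p q]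
  (fun n => rect (- n%:R, - n%:R) (n%:R, n%:R)) (@measurable_rect_gen R) _ _ _
  (mrestr nu mr) (mrestr mu2 mr)) => //.
- by move=> _ _ [a [b ->]] [c [d ->]]; rewrite rectI; do 2 eexists.
- by move=> n; do 2 eexists.
- rewrite -subTset => x _.
  pose N := maxn (Num.truncn `|x.1|).+1 (Num.truncn `|x.2|).+1.
  exists N => //=.
  have HB (t : R) n : ((Num.truncn `|t|).+1 <= n)%N -> (- n%:R < t) && (t <= n%:R).
    move=> tn; have := lt_le_trans (truncnS_gt `|t|) (_ : _ <= n%:R :> R).
    by rewrite ler_nat => /(_ tn); rewrite ltr_norml => /andP[-> /ltW ->].
  have /andP[? ?] := HB x.1 N (leq_maxl _ _); have /andP[? ?] := HB x.2 N (leq_maxr _ _).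
  exact/rectE.
- move=> _ [a [b ->]]; change (nu (rect a b `&` rect p q) = mu2 (rect a b `&` rect p q)).
  rewrite setIC rectI.
  pose a' : P := (Num.max p.1 a.1, Num.max p.2 a.2).
  pose b' : P := (Num.min q.1 b.1, Num.min q.2 b.2).
  change (nu (rect a' b') = mu2 (rect a' b')).
  have [l1|l1] := ltP a'.1 b'.1; last first.
    suff -> : rect a' b' = set0 by rewrite !measure0.
    by apply/seteqP; split => // x /rectE[u1 u2 _ _]; move: (lt_le_trans u1 (le_trans u2 l1)); rewrite ltxx.
  have [l2|l2] := ltP a'.2 b'.2; last first.
    suff -> : rect a' b' = set0 by rewrite !measure0.
    by apply/seteqP; split => // x /rectE[_ _ u1 u2]; move: (lt_le_trans u1 (le_trans u2 l2)); rewrite ltxx.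
  rewrite measure_rect ?ltW //; apply: cov_rect => //.
    move=> y /andP[y1 y2] /andP[y3 y4]; apply: HO; apply/andP; split.
    - by apply: le_trans y1; rewrite le_max lexx.
    - by apply: le_trans y2 _; rewrite ge_min lexx.
    - by apply: le_trans y3; rewrite le_max lexx.
    - by apply: le_trans y4 _; rewrite ge_min lexx.
  apply: le_lt_trans fin; apply: nu_le => //; first exact: measurable_rect.
  by rewrite -rectI; exact: subIsetl.
- move=> n; rewrite /mrestr; apply: le_lt_trans fin; apply: nu_le => //.
  by apply: measurableI => //; exact: measurable_rect.
Qed.

(** The transported measure has density 1 with respect to area, hence equals
    it on rectangles by bisection, and on all measurable sets. *)
Lemma cov_measure (D : set P) : mble D -> nu D = mu2 (D `&` O').
Proof.
move=> mD.
have [F [HF OF]] := open_rects good_near (ltac:(move=> p q [HO _] y /rectE[? ? ? ?];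
  by apply: HO; apply/andP; split => //; exact: ltW)).
apply: (@g_sigma_algebra_measure_unique_cover _ R MP [set X | mble X] _
  (fun n => if n is n'.+1 then rect (F n').1 (F n').2 else ~` O') _ _
  nu (mrestr mu2 mO')) => //.
- by move=> [|n]; [exact: measurableC|exact: measurable_rect].
- rewrite -subTset => x _; have [|nO] := pselect (O' x).
    by rewrite OF => -[n _ Fx]; exists n.+1.
  by exists 0%N.
- move=> n X sX; have {}mX : mble X.
    by apply: sX; split => //; apply: sigma_algebra_measurable.
  case: n => [|n].
    (* Outside O' both measures vanish. *)
    have E0 : ~` O' `&` X `&` O' = set0 by apply/seteqP; split => // x [[]].
    have Z2 : mrestr mu2 mO' (~` O' `&` X) = 0%E by rewrite /mrestr E0 measure0.
    have E1 : O `&` T @^-1` (~` O' `&` X) = set0.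
      by apply/seteqP; split => // x [Ox [nO _]]; apply: nO; have [] := hT Ox.
    have Z1 : nu (~` O' `&` X) = 0%E by rewrite /= /transported E1 integral_set0.
    exact: eq_trans Z1 (esym Z2).
  have [g|e] := HF n; last by rewrite e !set0I !measure0.
  rewrite cov_good // /mrestr; congr (mu2 _).
  apply/seteqP; split => [x [rx Xx]|x [[? ?] _] //]; split => //.
  by rewrite OF; exists n.
- by apply: sub_sigma_algebra.
Qed.

(** Equality of the transported measure with area, read on integrals. *)
Lemma change_of_variables (D : set P) (w : P -> \bar R) : mble D -> D `<=` O ->
  @measurable_fun _ _ MP _ O' w -> (forall y, O' y -> (0 <= w y)%E) ->
  (\int[mu2]_(x in D) (w (T x) * (A x ^+ 2 + B x ^+ 2)%:E) =
   \int[mu2]_(y in O' `&` S @^-1` D) w y)%E.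
Proof.
move=> mD DO mw w0.
have mSD : mble (O' `&` S @^-1` D) by exact: preimage_measurable.
have SDO : O' `&` S @^-1` D `<=` O' by move=> y [].
have mw' : @measurable_fun _ _ MP _ (O' `&` S @^-1` D) w by exact: measurable_funS mw.
pose W := (w \_ (O' `&` S @^-1` D) : MP -> \bar R).
have W0 y : (0 <= W y)%E by rewrite /W /patch; case: ifPn => // /[!inE] -[/w0].
have mW : @measurable_fun _ _ MP _ setT W.
  by apply/(measurable_restrictT w mSD).
have E0 := transported_integral mO mT mJ Jge0 W0 mW.
have WO y : ~ O' y -> W y = 0%E.
  move=> nO; rewrite /W /patch ifF //; apply/negP => /[!inE] -[/nO].
  by [].
have E1 : (\int[nu]_y W y = \int[nu]_(y in O') W y)%E.
  rewrite [RHS]integral_mkcond; apply: eq_integral => y _; rewrite /patch.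
  by case: ifPn => //; rewrite notin_setE => /WO.
have E2 : (\int[nu]_(y in O') W y = \int[mu2]_(y in O') W y)%E.
  apply: eq_measure_integral => X mX XO.
  by have := cov_measure mX; rewrite (setIidl XO).
have E3 : (\int[mu2]_(y in O') W y = \int[mu2]_(y in O' `&` S @^-1` D) w y)%E.
  rewrite /W -integral_mkcondr; congr (integral _ _ _).
  by apply/seteqP; split => [y [_ ?] //|y [? ?]].
have L : (\int[mu2]_(x in D) (w (T x) * (A x ^+ 2 + B x ^+ 2)%:E) =
    \int[mu2]_(x in O) (W (T x) * (J x)%:E))%E.
  rewrite [in LHS](_ : D = O `&` D); last by rewrite setIidr.
  rewrite integral_mkcondr; apply: eq_integral => x; rewrite inE => Ox.
  have [OTx STx] := hT Ox.
  rewrite /W /patch; case: ifPn => [/[!inE] Dx|nD].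
    by rewrite ifT // inE; split => //=; rewrite STx.
  rewrite ifF ?mul0e //; apply/negP => /[!inE] -[_ /=]; rewrite STx => Dx.
  by move: nD; rewrite notin_setE; apply.
exact: eq_trans L (eq_trans (esym E0) (eq_trans E1 (eq_trans E2 E3))).
Qed.

End ConformalChange.

(** * Integration of compactly supported functions *)

Section PlaneIntegrals.
Variable R : realType.
Local Notation P := (R * R)%type.
Local Notation MP := (measurableTypeR R * measurableTypeR R)%type.
Local Notation mble A := (@measurable _ MP A).
Local Notation mu1 := (@lebesgue_measure R).
Local Notation mu2 := (mu1 \x mu1)%E.
Implicit Types (g V : P -> R).

Lemma dist_lt_square (r : R) (c x : P) : `|x - c| <= r -> 0 < r ->
  rect (c.1 - 2 * r, c.2 - 2 * r) (c.1 + 2 * r, c.2 + 2 * r) x.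
Proof.
case: x c => x1 x2 [c1 c2]; rewrite prod_normE2 /= ge_max !ler_norml => /andP[/andP[a b] /andP[e d]] r0.
by apply/rectE => /=; split; lra.
Qed.

Lemma int_bound g (c : P) (r M : R) : 0 < r -> @measurable_fun _ _ MP R setT g ->
  (forall x, `|g x| <= M) -> (forall x, r < `|x - c| -> g x = 0) ->
  mu2.-integrable [set: MP] (EFin \o g) /\
  `|\int[mu2]_(x in [set: MP]) g x|%R <= M * (16 * r ^+ 2).
Proof.
move=> r0 mg gM g0.
have M0 : 0 <= M by apply: le_trans (gM 0).
set D := rect (c.1 - 2 * r, c.2 - 2 * r) (c.1 + 2 * r, c.2 + 2 * r).
have mD : mble D by exact: measurable_rect.
have muD : mu2 D = (16 * r ^+ 2)%:E.
  rewrite measure_rect /=; [|lra|lra].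
  by congr EFin; ring.
have gD : g \_ D = g.
  apply/funext => x; rewrite patchE; case: ifPn => // /negP xD.
  rewrite g0 // ltNge; apply/negP => /dist_lt_square /(_ r0) H.
  by apply: xD; rewrite inE.
have iD : mu2.-integrable D (EFin \o g).
  apply: (@measurable_bounded_integrable _ _ _ mu2) => //.
  - by rewrite [X in (X < _)%E]muD ltry.
  - exact: measurable_funTS.
  - exists M; split; first exact: num_real.
    by move=> N MN x Dx; apply: le_trans (gM x) (ltW MN).
have iT : mu2.-integrable [set: MP] (EFin \o g).
  have /(integrable_mkcond _ mD) := iD.
  by rewrite restrict_EFin gD.
split=> //.
have -> : \int[mu2]_(x in [set: MP]) g x = (\int[mu2]_(x in D) g x)%R.
  by rewrite [RHS]Rintegral_mkcond gD.
apply: le_trans (le_normr_Rintegral mD iD) _.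
have ic : mu2.-integrable D (EFin \o (fun=> M)).
  apply: (@measurable_bounded_integrable _ _ _ mu2) => //.
  - by rewrite [X in (X < _)%E]muD ltry.
  - exists M; split; first exact: num_real.
    by move=> N MN x Dx; rewrite /= ger0_norm // ltW.
have L := @le_Rintegral _ _ _ mu2 D (fun x => `|g x|) (fun=> M) mD (integrable_norm iD) ic (fun x _ => gM x).
apply: le_trans L _.
rewrite Rintegral_cst // (_ : fine _ = 16 * r ^+ 2) //.
exact: (congr1 fine muD).
Qed.

Lemma continuous_supp_bounded g (c : P) (K : R) : continuous g ->
  (forall x, K < `|x - c| -> g x = 0) -> exists M, forall x, `|g x| <= M.
Proof.
move=> cg g0.
pose I a := `[a - `|K|, a + `|K|]%classic.
have cI : compact (I c.1 `*` I c.2 : set P) by apply: compact_setX; exact: segment_compact.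
have : exists2 x : P, x \in I c.1 `*` I c.2 & forall y, y \in I c.1 `*` I c.2 -> `|g y| <= `|g x|.
  apply: (@compact_EVT_max P R (fun x => `|g x|)) => //.
    exists c; split; rewrite /I /= in_itv /= gerBl lerDl normr_ge0 //.
  apply: continuous_subspaceT => x; apply: continuous_comp; first exact: cg.
  exact: norm_continuous.
move=> [x _ H]; exists `|g x| => y.
have [Ky|yK] := ltP K `|y - c|; first by rewrite g0 // normr0.
apply: H; rewrite inE; move: yK; case: y => y1 y2; case: (c) => c1 c2.
rewrite prod_normE2 ge_max /= => /andP[a b]; split; rewrite /I /= in_itv /=.
  by rewrite -ler_distlC distrC; apply: le_trans a (ler_norm _).
by rewrite -ler_distlC distrC; apply: le_trans b (ler_norm _).
Qed.

Lemma continuous_measurable2 g : continuous g -> @measurable_fun _ _ MP R setT g.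
Proof. by move=> cg; apply: open_continuous_measurable; [exact: openT|move=> x _; exact: cg]. Qed.

Lemma continuous_supp_integrable g (c : P) (K : R) : continuous g ->
  (forall x, K < `|x - c| -> g x = 0) -> mu2.-integrable [set: MP] (EFin \o g).
Proof.
move=> cg g0; have [M HM] := continuous_supp_bounded cg g0.
have K0 : 0 < `|K| + 1 by apply: ltr_wpDl.
have H x : `|K| + 1 < `|x - c| -> g x = 0.
  move=> h; apply: g0; apply: le_lt_trans h; apply: le_trans (ler_norm K) _.
  by rewrite lerDl.
by have [] := int_bound K0 (continuous_measurable2 cg) HM H.
Qed.

Lemma ftc (f F : R -> R) (a b : R) : a < b -> continuous f ->
  (forall t, a <= t <= b -> is_derive t 1 F (f t)) ->
  (\int[mu1]_(x in `[a, b]) (f x)%:E = (F b - F a)%:E)%E.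
Proof.
move=> ab cf dF.
have dF' t : a <= t <= b -> derivable F t 1 by move=> /dF[].
have C t : a <= t <= b -> {for t, continuous F}.
  by move=> h; apply: differentiable_continuous; apply/derivable1_diffP; exact: dF'.
rewrite (@continuous_FTC2 R f F a b ab) //.
- exact: continuous_subspaceT.
- split.
  + by move=> t; rewrite in_itv /= => /andP[h1 h2]; apply: dF'; rewrite !ltW.
  + by apply: cvg_at_right_filter; apply: C; rewrite lexx ltW.
  + by apply: cvg_at_left_filter; apply: C; rewrite lexx ltW.
- move=> t; rewrite in_itv /= => /andP[h1 h2]; rewrite derive1E.
  by apply: (@derive_val _ _ _ _ _ _ _ (dF t _)); rewrite !ltW.
Qed.

Lemma int_itv_supp (f : R -> R) (a b : R) : (forall t : R, ~~ (a <= t <= b) -> f t = 0) ->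
  (\int[mu1]_x (f x)%:E = \int[mu1]_(x in `[a, b]) (f x)%:E)%E.
Proof.
move=> f0; rewrite [RHS]integral_mkcond; apply: eq_integral => x _.
by rewrite patchE; case: ifPn => //; rewrite notin_setE /= in_itv /= => /negP/f0 ->.
Qed.

Lemma supp_d g (c : P) (K : R) : (forall x, K < `|x - c| -> g x = 0) ->
  forall x, K < `|x - c| -> grad g x 0 0.
Proof.
move=> g0 x Kx; apply: (@grad_near R (fun=> 0) g) (grad_cst 0 x).
have : \forall y \near x, K < `|y - c|.
  apply: (@near_open _ [set y : P | K < `|y - c|]) => //.
  apply: (@open_comp _ _ (fun y : P => `|y - c|) [set t | K < t]); last exact: open_gt.
  move=> y _; apply: (@continuous_comp P P R (fun y : P => y - c) Num.norm); last exact: norm_continuous.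
  by apply: (@continuousB R P P (fun y => y) (fun=> c)); [exact: cvg_id|exact: cst_continuous].
by apply: filterS => y /g0.
Qed.

(** Fubini's theorem reduces Stokes' theorem to the fundamental theorem of
    calculus on lines. *)
Lemma stokes1 V (c : P) (K : R) : Ck 1 setT V -> (forall x, K < `|x - c| -> V x = 0) ->
  \int[mu2]_(x in [set: MP]) d1 V x = 0.
Proof.
move=> CV V0.
have g0 x : K < `|x - c| -> d1 V x = 0 by move=> h; exact: grad_d1 (supp_d V0 h).
have cd : continuous (d1 V) by move=> x; exact: (Ck_continuous (Ck_d1 CV)).
have I := continuous_supp_integrable cd g0.
rewrite /Rintegral -integral21_prod_meas1 // integral0_eq // => y _ /=.
pose K' := `|K| + 1.
have K'0 : 0 < K' by apply: ltr_wpDl.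
have KK' : K < K' by apply: le_lt_trans (ler_norm K) _; rewrite ltrDl.
have far t : ~~ (c.1 - K' < t < c.1 + K') -> K < `|(t, y) - c|.
  rewrite -ltr_distlC distrC -leNgt => h; apply: lt_le_trans KK' _; apply: le_trans h _.
  by rewrite prod_normE2 le_max /= lexx.
pose a : R := c.1 - K'; pose b : R := c.1 + K'.
transitivity (\int[mu1]_(t in `[a, b]) (d1 V (t, y))%:E)%E.
  apply: (@int_itv_supp (fun t => d1 V (t, y))) => t ht; apply: g0; apply: far.
  by apply: contra ht => /andP[h1 h2]; rewrite !ltW.
transitivity (V (b, y) - V (a, y))%:E; last first.
  by rewrite !V0 ?subrr //; apply: far; rewrite /a /b ltxx ?andbF.
apply: (@ftc (fun t => d1 V (t, y)) (fun t => V (t, y))).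
- by rewrite /a /b; lra.
- move=> t; apply: (@continuous_comp R P R (fun t => (t, y)) (d1 V)); last exact: cd.
  by apply: (@cvg_pair _ _ _ _ (nbhs t) (nbhs y)); [exact: cvg_id|exact: cvg_cst].
- move=> t _; exact: (is_derive_line1 (Ck_grad CV (x := (t, y)) Logic.I)).
Qed.

Lemma stokes2 V (c : P) (K : R) : Ck 1 setT V -> (forall x, K < `|x - c| -> V x = 0) ->
  \int[mu2]_(x in [set: MP]) d2 V x = 0.
Proof.
move=> CV V0.
have g0 x : K < `|x - c| -> d2 V x = 0 by move=> h; exact: grad_d2 (supp_d V0 h).
have cd : continuous (d2 V) by move=> x; exact: (Ck_continuous (Ck_d2 CV)).
have I := continuous_supp_integrable cd g0.
rewrite /Rintegral -integral12_prod_meas1 // integral0_eq // => y _ /=.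
pose K' := `|K| + 1.
have K'0 : 0 < K' by apply: ltr_wpDl.
have KK' : K < K' by apply: le_lt_trans (ler_norm K) _; rewrite ltrDl.
have far t : ~~ (c.2 - K' < t < c.2 + K') -> K < `|(y, t) - c|.
  rewrite -ltr_distlC distrC -leNgt => h; apply: lt_le_trans KK' _; apply: le_trans h _.
  by rewrite prod_normE2 le_max /= lexx orbT.
pose a : R := c.2 - K'; pose b : R := c.2 + K'.
transitivity (\int[mu1]_(t in `[a, b]) (d2 V (y, t))%:E)%E.
  apply: (@int_itv_supp (fun t => d2 V (y, t))) => t ht; apply: g0; apply: far.
  by apply: contra ht => /andP[h1 h2]; rewrite !ltW.
transitivity (V (y, b) - V (y, a))%:E; last first.
  by rewrite !V0 ?subrr //; apply: far; rewrite /a /b ltxx ?andbF.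
apply: (@ftc (fun t => d2 V (y, t)) (fun t => V (y, t))).
- by rewrite /a /b; lra.
- move=> t; apply: (@continuous_comp R P R (fun t => (y, t)) (d2 V)); last exact: cd.
  by apply: (@cvg_pair _ _ _ _ (nbhs y) (nbhs t)); [exact: cvg_cst|exact: cvg_id].
- move=> t _; exact: (is_derive_line2 (Ck_grad CV (x := (y, t)) Logic.I)).
Qed.

End PlaneIntegrals.

(** * The volume under a paraboloid *)

Section ParaboloidVolume.
Variable R : realType.
Local Notation P := (R * R)%type.
Local Notation MP := (measurableTypeR R * measurableTypeR R)%type.
Local Notation mble A := (@measurable _ MP A).
Local Notation mu1 := (@lebesgue_measure R).
Local Notation mu2 := (mu1 \x mu1)%E.

Lemma sin_incr : {in `[- (pi / 2), pi / 2] &, {homo (@sin R) : x y / x < y}}.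
Proof.
move=> x y; rewrite !in_itv /= => /andP[x1 x2] /andP[y1 y2] xy.
have [t] := @MVT_derive R sin cos x y xy (fun t _ => is_derive_sin t).
rewrite in_itv /= => /andP[t1 t2] E; rewrite -subr_gt0 E mulr_gt0 ?subr_gt0 //.
by apply: cos_gt0_pihalf; apply/andP; split; [exact: le_lt_trans t1|exact: lt_le_trans y2].
Qed.

Lemma is_derive_cos4 (t : R) : is_derive t 1
  (fun t => 3 / 8 * t + sin t * cos t ^+ 3 / 4 + 3 / 8 * (sin t * cos t)) (cos t ^+ 4).
Proof.
have Hs := is_derive_sin t; have Hc := is_derive_cos t.
have H1 := is_derive_mul (is_derive_cst (3 / 8 : R) t 1) (is_derive_id t (1 : R)).
have Hsc := is_derive_mul Hs Hc.
have Hc2 := is_derive_mul Hc Hc.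
have H2 := is_derive_mul (is_derive_mul Hsc Hc2) (is_derive_cst (4^-1 : R) t 1).
have H3 := is_derive_mul (is_derive_cst (3 / 8 : R) t 1) Hsc.
have H := is_derive_add (is_derive_add H1 H2) H3.
rewrite (_ : (fun t => _) = (fun y : R => 3 / 8 * y + sin y * cos y * (cos y * cos y) * 4^-1 + 3 / 8 * (sin y * cos y))).
  apply: (is_derive_eq H) => /=.
  have E : sin t * sin t = 1 - cos t ^+ 2 :> R.
    by apply/eqP; rewrite -expr2 eq_sym subr_eq addrC cos2Dsin2.
  rewrite /cst /=.
  transitivity (3 / 8 + (cos t ^+ 4 - 3 * (sin t * sin t) * cos t ^+ 2) / 4
    + 3 / 8 * (cos t ^+ 2 - sin t * sin t)); first by field.
  by rewrite E; field.
by apply/funext => y; field.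
Qed.

Lemma sqrt3_continuous (b : R) : continuous (fun x : R => Num.sqrt (1 - (x - b) ^+ 2) ^+ 3).
Proof.
move=> x; apply: (@continuous_comp R R R (fun x => Num.sqrt (1 - (x - b) ^+ 2)) (fun y => y ^+ 3)); last exact: exprn_continuous.
apply: (@continuous_comp R R R (fun x => 1 - (x - b) ^+ 2) Num.sqrt); last exact: sqrt_continuous.
apply: (@continuousB R R R (fun=> 1) (fun x => (x - b) ^+ 2)); first exact: cst_continuous.
apply: (@continuous_comp R R R (fun y => y - b) (fun y => y ^+ 2)); last exact: exprn_continuous.
by apply: (@continuousB R R R id (fun=> b)); [exact: cvg_id|exact: cst_continuous].
Qed.

Lemma int_sqrt3 (b : R) : (\int[mu1]_(x in `[(b - 1)%R, (b + 1)%R]) (Num.sqrt (1 - (x - b) ^+ 2) ^+ 3)%:E =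
  (3 / 8 * pi)%:E :> \bar R)%E.
Proof.
have p0 := pi_gt0 R.
pose h (x : R) := Num.sqrt (1 - (x - b) ^+ 2) ^+ 3.
have cs : continuous h by exact: sqrt3_continuous.
pose F (t : R) := b + sin t.
have dF (t : R) : is_derive t 1 F (cos t).
  have := is_derive_add (is_derive_cst b t 1) (is_derive_sin t).
  by move=> H; apply: (is_derive_eq H); rewrite add0r.
have D : derive1 F = cos by apply/funext => x; rewrite derive1E; exact: (@derive_val _ _ _ _ _ _ _ (dF x)).
have cc t : {for t, continuous (@cos R)} by exact: continuous_cos.
have c1 t : {for t, continuous F}.
  by apply: differentiable_continuous; apply/derivable1_diffP; have [] := dF t.
have F1 : F (- (pi / 2)) = b - 1 by rewrite /F sinN sin_pihalf.
have F2 : F (pi / 2) = b + 1 by rewrite /F sin_pihalf.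
rewrite -F1 -F2 -/h (@integration_by_substitution_increasing R F h).
- rewrite D.
  transitivity (\int[mu1]_(x in `[(- (pi / 2))%R, (pi / 2)%R]) (cos x ^+ 4)%:E)%E.
    apply: eq_integral => x; rewrite inE /= in_itv /= => hx; congr EFin.
    rewrite fctE /h /F /= [b + _]addrC addrK.
    have -> : 1 - sin x ^+ 2 = cos x ^+ 2 :> R.
      by apply/eqP; rewrite subr_eq cos2Dsin2.
    by rewrite sqrtr_sqr ger0_norm ?cos_ge0_pihalf // [in RHS]exprSr.
  pose a1 : R := - (pi / 2); pose a2 : R := pi / 2.
  pose G (t : R) := 3 / 8 * t + sin t * cos t ^+ 3 / 4 + 3 / 8 * (sin t * cos t).
  transitivity (G a2 - G a1)%:E; last first.
    by rewrite /G /a1 /a2 cosN cos_pihalf; congr EFin; field.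
  apply: (@ftc R (fun t => cos t ^+ 4) G).
  + by rewrite gtrN // divr_gt0.
  + move=> x; apply: (@continuous_comp R R R cos (fun y => y ^+ 4)) (cc x) _.
    exact: exprn_continuous.
  + by move=> t _; exact: is_derive_cos4.
- by rewrite ge0_cp // divr_ge0 // ltW.
- by move=> x y hx hy /(sin_incr hx hy); rewrite /F ltrD2l.
- by rewrite D => x _; exact: cc.
- by rewrite D; apply/cvg_ex; exists (cos (- (pi / 2))); apply: cvg_at_right_filter; exact: cc.
- by rewrite D; apply/cvg_ex; exists (cos (pi / 2)); apply: cvg_at_left_filter; exact: cc.
- split.
  + by move=> x _; have [] := dF x.
  + by apply: cvg_at_right_filter; exact: c1.
  + by apply: cvg_at_left_filter; exact: c1.
- exact: continuous_subspaceT.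
Qed.

Lemma int_parabola (a b : R) :
  (\int[mu1]_y (max0 (a - (y - b) ^+ 2))%:E = (4 / 3 * Num.sqrt a ^+ 3)%:E)%E.
Proof.
have [a0|a0] := leP a 0.
  rewrite ler0_sqrtr // expr0n /= mulr0 integral0_eq // => y _; congr EFin.
  rewrite /max0 max_l // subr_le0; apply: le_trans a0 (sqr_ge0 _).
set s := Num.sqrt a; have s0 : 0 < s by rewrite sqrtr_gt0.
have E : a = s ^+ 2 by rewrite sqr_sqrtr // ltW.
pose h y := a - (y - b) ^+ 2.
have ch : continuous h.
  move=> y; apply: (@continuousB R R R (fun=> a) (fun y => (y - b) ^+ 2)); first exact: cst_continuous.
  apply: (@continuous_comp R R R (fun y => y - b) (fun y => y ^+ 2)); last exact: exprn_continuous.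
  by apply: (@continuousB R R R id (fun=> b)); [exact: cvg_id|exact: cst_continuous].
pose b1 := b - s; pose b2 := b + s.
rewrite (@int_itv_supp R (fun y => max0 (h y)) b1 b2); last first.
  move=> y hy; rewrite /max0 max_l // leNgt; apply: contra hy.
  rewrite /h subr_gt0 E => hy; have : `|y - b| < s by rewrite -(@ltr_pXn2r _ 2) ?nnegrE ?normr_ge0 // ?real_normK ?num_real // ltW.
  by rewrite ltr_distl => /andP[/ltW h1 /ltW h2]; rewrite /b1 /b2 h1 h2.
transitivity (\int[mu1]_(y in `[b1, b2]) (h y)%:E)%E.
  apply: eq_integral => y; rewrite inE /= in_itv /= -ler_distl => hy; congr EFin.
  rewrite /max0 max_r // /h subr_ge0 E -(@real_normK _ (y - b)) ?num_real //.
  by rewrite ler_pXn2r // nnegrE ?normr_ge0 // ltW.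
pose F y := a * (y - b) - (y - b) ^+ 3 / 3.
transitivity (F b2 - F b1)%:E; last by rewrite /F /b1 /b2; congr EFin; rewrite E; field.
apply: (@ftc R h F).
- by rewrite /b1 /b2; lra.
- exact: ch.
- move=> y _.
  have H0 : is_derive y 1 (fun y => y + - b) (1 + 0) :=
    is_derive_add (is_derive_id y (1 : R)) (is_derive_cst (- b) y 1).
  have H1 := is_derive_mul (is_derive_cst a y 1) H0.
  have H2 := is_derive_mul (is_derive_cst (- 3^-1 : R) y 1) (is_derive_mul H0 (is_derive_mul H0 H0)).
  have H := is_derive_add H1 H2.
  rewrite (_ : F = (fun y : R => a * (y + - b) + - 3^-1 * ((y + - b) * ((y + - b) * (y + - b))))).
    by apply: (is_derive_eq H) => /=; rewrite /cst /h; field.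
  by apply/funext => z; rewrite /F; field.
Qed.

Definition qd (c x : P) : R := (x.1 - c.1) ^+ 2 + (x.2 - c.2) ^+ 2.

Lemma Ck_qd n c U : open U -> Ck n U (qd c).
Proof.
move=> oU; apply: (CkD oU); apply: (CkX 2 oU); apply: (CkB oU) (Ck_cst _ _ oU).
  exact: Ck_fst.
exact: Ck_snd.
Qed.

Lemma qd_ge (c x : P) : `|x - c| ^+ 2 <= qd c x.
Proof.
rewrite prod_normE2 /qd /=; case: (leP `|x.1 - c.1|) => _; rewrite real_normK ?num_real //.
  by rewrite lerDr sqr_ge0.
by rewrite lerDl sqr_ge0.
Qed.

Lemma qd_far (c x : P) : 1 < `|x - c| -> 1 < qd c x.
Proof. by move=> h; apply: lt_le_trans (qd_ge c x); rewrite exprn_egt1. Qed.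

Lemma paraboloid_continuous c : continuous (fun x : P => max0 (1 - qd c x)).
Proof.
move=> x; apply: (@continuous_comp P R R (fun x => 1 - qd c x) (@max0 R)); last exact: max0_continuous.
have oT : open [set: P] by exact: openT.
exact: (Ck_continuous (CkB oT (Ck_cst 0 1 oT) (Ck_qd 0 c oT)) (x := x) Logic.I).
Qed.

(** The slices have area (4/3) a^(3/2), and the substitution of sin t for x
    leaves the integral of cos^4. This value is the source of the constant 4
    pi in [log_residue]. *)
Lemma paraboloid_volume c : mu2.-integrable [set: MP] (EFin \o (fun x => max0 (1 - qd c x))) /\
  \int[mu2]_(x in [set: MP]) max0 (1 - qd c x) = pi / 2.
Proof.
have I : mu2.-integrable [set: MP] (EFin \o (fun x => max0 (1 - qd c x))).
  apply: (continuous_supp_integrable (c := c) (K := 1)); first exact: paraboloid_continuous.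
  by move=> x /qd_far h; rewrite /max0 max_l // subr_le0 ltW.
split=> //; rewrite /Rintegral -integral12_prod_meas1 //.
have -> : (\int[mu1]_x \int[mu1]_y (max0 (1 - qd c (x, y)))%:E =
  \int[mu1]_x (4 / 3 * Num.sqrt (1 - (x - c.1) ^+ 2) ^+ 3)%:E)%E.
  apply: eq_integral => x _; rewrite -(int_parabola _ c.2); apply: eq_integral => y _.
  by congr EFin; congr max0; rewrite /qd /=; ring.
pose h (x : R) := Num.sqrt (1 - (x - c.1) ^+ 2) ^+ 3.
pose b1 := c.1 - 1; pose b2 := c.1 + 1.
transitivity (fine ((4 / 3)%:E * \int[mu1]_(x in `[b1, b2]) (h x)%:E)%E); last first.
  by rewrite int_sqrt3 /=; field.
congr fine; rewrite -ge0_integralZl //; last 2 first.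
- by apply/measurable_EFinP; apply: measurable_funTS; apply: continuous_measurable_fun; exact: sqrt3_continuous.
- by move=> x _; rewrite lee_fin exprn_ge0 // sqrtr_ge0.
rewrite (@int_itv_supp R _ b1 b2) // => x hx; rewrite ler0_sqrtr ?expr0n ?mulr0 //.
rewrite subr_le0 -(@real_normK _ (x - _)) ?num_real // exprn_ege1 //.
rewrite leNgt; apply: contra hx; rewrite ltr_distl => /andP[/ltW h1 /ltW h2].
by rewrite /b1 /b2 h1.
Qed.

End ParaboloidVolume.

(** * Removable singularities of the Laplacian *)

Section Cutoff.
Variable R : realType.
Local Notation P := (R * R)%type.
Local Notation MP := (measurableTypeR R * measurableTypeR R)%type.
Local Notation mble A := (@measurable _ MP A).
Local Notation mu1 := (@lebesgue_measure R).
Local Notation mu2 := (mu1 \x mu1)%E.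
Implicit Types (g psi : P -> R) (c : P).

Definition off c : set P := [set x | x <> c].

Lemma open_off c : open (off c).
Proof.
rewrite (_ : off c = ~` [set c]); last by apply/seteqP; split.
apply: closed_openC; apply: accessible_closed_set1; apply: hausdorff_accessible.
exact: norm_hausdorff.
Qed.

Lemma open_far c (K : R) : open [set y : P | K < `|y - c|].
Proof.
apply: (@open_comp _ _ (fun y : P => `|y - c|) [set t | K < t]); last exact: open_gt.
move=> y _; apply: (@continuous_comp P P R (fun y : P => y - c) Num.norm); last exact: norm_continuous.
by apply: (@continuousB R P P (fun y => y) (fun=> c)); [exact: cvg_id|exact: cst_continuous].
Qed.

Lemma open_close c (K : R) : open [set y : P | `|y - c| < K].
Proof.
apply: (@open_comp _ _ (fun y : P => `|y - c|) [set t | t < K]); last exact: open_lt.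
move=> y _; apply: (@continuous_comp P P R (fun y : P => y - c) Num.norm); last exact: norm_continuous.
by apply: (@continuousB R P P (fun y => y) (fun=> c)); [exact: cvg_id|exact: cst_continuous].
Qed.

Arguments open_off : clear implicits.
Arguments open_far : clear implicits.
Arguments open_close : clear implicits.

Lemma Ck_glue n c (d : R) g : 0 < d -> Ck n (off c) g ->
  (forall x, `|x - c| < d -> g x = 0) -> Ck n setT g.
Proof.
move=> d0 Cg g0; have oB := open_close c d.
have CB : Ck n [set y : P | `|y - c| < d] g.
  by apply: (Ck_ext oB) (Ck_cst n 0 oB) => x /g0.
apply: Ck_sub (CkU Cg CB) => x _.
have [->|/eqP xc] := eqVneq x c; last by left.
by right; rewrite /= subrr normr0.
Qed.

Lemma off_measurable c g : Ck 0 (off c) g -> @measurable_fun _ _ MP R setT g.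
Proof.
move=> Cg.
have -> : [set: MP] = off c `|` [set c].
  by apply/seteqP; split=> // x _; have [->|/eqP xc] := eqVneq x c; [right|left].
have m1 : mble (off c) by exact: open_measurable2 (open_off c).
have m2 : mble [set c].
  by rewrite (_ : [set c] = ~` off c); [exact: measurableC|rewrite /off; apply/seteqP; split=> x /= => [->|/contrapT] //; apply].
apply/measurable_funU => //; split.
  exact: open_continuous_measurable (open_off c) Cg.
move=> _ Y mY; case: (pselect (Y (g c))) => h.
  by rewrite (_ : _ `&` _ = [set c]) //; apply/seteqP; split=> x /= => [[]|->].
by rewrite (_ : _ `&` _ = set0) //; apply/seteqP; split=> x //= [->].
Qed.

(** A cutoff of class C^2, equal to 0 for t <= 1/2 and to 1 for t >= 1. *)
Definition step (t : R) := 1 - max0 (1 - max0 (2 * t - 1) ^+ 3) ^+ 3.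

Lemma step_lo (t : R) : 2 * t <= 1 -> step t = 0.
Proof.
move=> h; rewrite /step {2}/max0 max_l ?subr_le0 // expr0n /= subr0.
by rewrite /max0 max_r ?ler01 // expr1n subrr.
Qed.

Lemma step_hi (t : R) : 1 <= t -> step t = 1.
Proof.
move=> h; rewrite /step; have -> : max0 (1 - max0 (2 * t - 1) ^+ 3) = 0.
  rewrite /max0 max_l // subr_le0 exprn_ege1 // le_max; apply/orP; right; lra.
by rewrite expr0n subr0.
Qed.

Lemma max0_bd (t : R) : t <= 1 -> 0 <= max0 t <= 1.
Proof. by move=> h; rewrite /max0 le_max lexx ge_max ler01 h. Qed.

Lemma step_bd (t : R) : 0 <= step t <= 1.
Proof.
have h0 : 0 <= max0 (2 * t - 1) ^+ 3 by rewrite exprn_ge0 // /max0 le_max lexx.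
have /max0_bd/andP[h1 h2] : 1 - max0 (2 * t - 1) ^+ 3 <= 1 by rewrite gerBl.
rewrite /step subr_ge0 gerBl exprn_ge0 // andbT.
by rewrite exprn_ile1.
Qed.

Lemma Ck_step U g : open U -> Ck 2 U g -> Ck 2 U (fun y => step (g y)).
Proof.
move=> oU Hg; have C1 := Ck_cst 2 1 oU; apply: (CkB oU C1).
apply: (Ck2_max0cube oU); apply: (CkB oU C1); apply: (Ck2_max0cube oU).
by apply: (CkB oU _ C1); apply: (CkM oU) Hg; exact: Ck_cst.
Qed.

Definition chi c (e : R) (x : P) := step (qd c x / e ^+ 2).

Lemma Ck_chi c (e : R) : Ck 2 setT (chi c e).
Proof.
have oT : open [set: P] by exact: openT.
apply: (Ck_step oT); apply: (CkM oT (Ck_qd 2 c oT)); exact: Ck_cst.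
Qed.

Lemma qd_near c x (e : R) : `|x - c| < e / 2 -> 0 < e -> 2 * (qd c x / e ^+ 2) <= 1.
Proof.
move=> h e0; rewrite mulrA ler_pdivrMr ?exprn_gt0 // mul1r.
move: h; rewrite prod_normE2 /= gt_max !ltr_norml => /andP[/andP[a1 a2] /andP[b1 b2]].
by rewrite /qd; nra.
Qed.

Lemma chi_near c (e : R) x : 0 < e -> `|x - c| < e / 2 -> chi c e x = 0.
Proof. by move=> e0 h; apply: step_lo; apply: qd_near. Qed.

Lemma chi_far c (e : R) x : 0 < e -> e <= `|x - c| -> chi c e x = 1.
Proof.
move=> e0 h; apply: step_hi; rewrite ler_pdivlMr ?exprn_gt0 // mul1r.
apply: le_trans (qd_ge c x); rewrite ler_pXn2r // nnegrE ?normr_ge0 //; exact: ltW.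
Qed.

(** The Laplacian of the cutoff at scale e is of size 1/e^2, on a disc of area
    of order e^2. *)
Lemma lap_chi_scale c (e : R) x : 0 < e ->
  lap (chi c e) x = lap (chi 0 1) ((x.1 - c.1) / e, (x.2 - c.2) / e) / e ^+ 2.
Proof.
move=> e0; have oT : open [set: P] by exact: openT.
pose T1 (x : P) := (x.1 - c.1) / e; pose T2 (x : P) := (x.2 - c.2) / e.
have G1 y : grad T1 y e^-1 0.
  apply: grad_eq (gradM (gradB (grad_fst y) (grad_cst c.1 y)) (grad_cst e^-1 y)) _ _; ring.
have G2 y : grad T2 y 0 e^-1.
  apply: grad_eq (gradM (gradB (grad_snd y) (grad_cst c.2 y)) (grad_cst e^-1 y)) _ _; ring.
have C1 : Ck 2 setT T1.
  by apply: (CkM oT); [apply: (CkB oT); [exact: Ck_fst|exact: Ck_cst]|exact: Ck_cst].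
have C2 : Ck 2 setT T2.
  by apply: (CkM oT); [apply: (CkB oT); [exact: Ck_snd|exact: Ck_cst]|exact: Ck_cst].
have E : chi c e = (fun y => chi 0 1 (T1 y, T2 y)).
  apply/funext => y; rewrite /chi /qd /T1 /T2 /=; congr step; field.
  exact: lt0r_neq0.
rewrite E (@lap_comp R setT setT) //.
- rewrite (grad_d1 (G1 x)) (grad_d1 (G2 x)) expr0n addr0 exprVn.
  by [].
- exact: Ck_chi.
- move=> y _; rewrite (grad_d1 (G1 y)) (grad_d1 (G2 y)) (grad_d2 (G1 y)) (grad_d2 (G2 y)).
  by rewrite oppr0.
Qed.

Lemma lap_loc g (k : R) x : (\forall y \near x, g y = k) -> lap g x = 0.
Proof.
move=> H; rewrite /lap.
have Z : \forall y \near x, grad g y 0 0.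
  have /nbhs_interior : \forall y \near x, g y = k by [].
  apply: filterS => y Hy; apply: (@grad_near R (fun=> k)) (grad_cst k y).
  by apply: filterS Hy => z ->.
have Z1 : \forall y \near x, 0 = d1 g y by apply: filterS Z => y /grad_d1.
have Z2 : \forall y \near x, 0 = d2 g y by apply: filterS Z => y /grad_d2.
rewrite (grad_d1 (grad_near Z1 (grad_cst 0 x))) (grad_d2 (grad_near Z2 (grad_cst 0 x))).
by rewrite addr0.
Qed.

Lemma lap_chi_far c (e : R) x : 0 < e -> e < `|x - c| -> lap (chi c e) x = 0.
Proof.
move=> e0 h; apply: (@lap_loc _ 1).
by have := near_open (open_far c e) h; apply: filterS => y /ltW /(chi_far e0).
Qed.

Lemma lap_chi_bounded : exists2 K : R, 0 < K &
  forall c (e : R) x, 0 < e -> `|lap (chi c e) x| <= K / e ^+ 2.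
Proof.
have oT : open [set: P] by exact: openT.
have C : continuous (lap (chi (0 : P) 1)).
  by move=> x; exact: (Ck_continuous (Ck_lap oT (Ck_chi 0 1)) (x := x) Logic.I).
have [K HK] := continuous_supp_bounded C (fun x (h : 1 < `|x - 0|) => lap_chi_far ltr01 h).
have K0 : 0 <= K by apply: le_trans (HK 0).
exists (K + 1); first by rewrite ltr_wpDl.
move=> c e x e0; rewrite lap_chi_scale // normrM [X in _ * X]ger0_norm; last by rewrite invr_ge0 exprn_ge0 // ltW.
rewrite ler_pM2r ?invr_gt0 ?exprn_gt0 //; apply: le_trans (HK _) _.
by rewrite lerDl.
Qed.

(** A singularity at which psi stays continuous carries no mass. With the
    cutoff chi, the field chi grad psi - (psi - l) grad chi is of class C^1
    with compact support, so chi lap psi and (psi - l) lap chi have the same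
    integral; the latter is small because psi - l is small where lap chi does
    not vanish. *)
Lemma flux_zero c psi (K M l : R) : Ck 2 (off c) psi ->
  (forall x, K < `|x - c| -> psi x = 0) ->
  (forall x, x <> c -> `|lap psi x| <= M) -> psi x @[x --> c] --> l ->
  \int[mu2]_(x in [set: MP]) lap psi x = 0.
Proof.
move=> Cp p0 pM pl; have oT : open [set: P] by exact: openT.
have oO := open_off c.
have [K1 K10 HK1] := lap_chi_bounded.
pose M' := Num.max M `|lap psi c|.
have M'0 : 0 <= M' by rewrite le_max normr_ge0 orbT.
have lM x : `|lap psi x| <= M'.
  have [->|/eqP xc] := eqVneq x c; first by rewrite /M' le_max lexx orbT.
  by apply: le_trans (pM x xc) _; rewrite /M' le_max lexx.
have Cl : Ck 0 (off c) (lap psi) by exact: Ck_lap.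
have ml : @measurable_fun _ _ MP R setT (lap psi) by exact: off_measurable Cl.
have K'0 : 0 < `|K| + 1 by apply: ltr_wpDl.
have KK' : K < `|K| + 1 by apply: le_lt_trans (ler_norm K) _; rewrite ltrDl.
have l0 x : K < `|x - c| -> lap psi x = 0.
  move=> h; apply: (@lap_loc _ 0).
  by have := near_open (open_far c K) h; apply: filterS => y /p0.
have [il _] := int_bound K'0 ml lM (fun x h => l0 x (lt_trans KK' h)).
apply/eqP; rewrite -normr_le0; apply/ler_addgt0Pr => eta eta0; rewrite add0r.
(* [D] adds up the constants of the two error terms, each of which is
   bounded by a multiple of [th]. *)
pose D := 16 * M' + 16 * K1 + 1.
have D0 : 0 < D by rewrite /D; nra.
pose th := eta / D; have th0 : 0 < th by rewrite divr_gt0.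
have [e1 e10 He1] : exists2 e, 0 < e & forall x, `|x - c| < e -> `|psi x - l| <= th.
  have /(nbhsPP c [set x | `|psi x - l| <= th]).1 [r r0 H] :
      \forall x \near c, `|psi x - l| <= th.
    by move/cvgrPdist_le: pl => /(_ th th0); apply: filterS => x; rewrite distrC.
  by exists r => // x; exact: H.
have [e [e0 ee1 ee2 eth]] : exists e, [/\ 0 < e, e < e1, e <= 1 & e <= th].
  exists (Num.min (Num.min 1 th) (e1 / 2)).
  rewrite !lt_min !ge_min !lexx ltr01 th0 divr_gt0 //= gt_min.
  by rewrite ltr_pdivrMr // ltr_pMr // ltr1n !orbT.
pose h := chi c e.
have Ch : Ck 2 setT h by exact: Ck_chi.
have Ch' : Ck 2 (off c) h by apply: Ck_sub Ch.
have hn x : `|x - c| < e / 2 -> grad h x 0 0.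
  move=> hx; apply: (@grad_near R (fun=> 0)) (grad_cst 0 x).
  by have := near_open (open_close c (e / 2)) hx; apply: filterS => y /(chi_near e0).
have e20 : 0 < e / 2 by rewrite divr_gt0.
pose V1 x := h x * d1 psi x - (psi x - l) * d1 h x.
pose V2 x := h x * d2 psi x - (psi x - l) * d2 h x.
have CV1' : Ck 1 (off c) V1.
  apply: (CkB oO); apply: (CkM oO); [exact: CkS|exact: Ck_d1| |exact: Ck_d1].
  by apply: (CkB oO); [exact: CkS|exact: Ck_cst].
have CV2' : Ck 1 (off c) V2.
  apply: (CkB oO); apply: (CkM oO); [exact: CkS|exact: Ck_d2| |exact: Ck_d2].
  by apply: (CkB oO); [exact: CkS|exact: Ck_cst].
have CV1 : Ck 1 setT V1.
  apply: (Ck_glue e20 CV1') => x hx.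
  by rewrite /V1 (grad_d1 (hn x hx)) /h chi_near // mul0r mulr0 subrr.
have CV2 : Ck 1 setT V2.
  apply: (Ck_glue e20 CV2') => x hx.
  by rewrite /V2 (grad_d2 (hn x hx)) /h chi_near // mul0r mulr0 subrr.
pose K2 := Num.max K e.
have far x : K2 < `|x - c| -> [/\ grad h x 0 0 & grad psi x 0 0].
  rewrite gt_max => /andP[h1 h2]; split; last exact: (supp_d p0 h1).
  apply: (@grad_near R (fun=> 1)) (grad_cst 1 x).
  by have := near_open (open_far c e) h2; apply: filterS => y /ltW /(chi_far e0).
have V10 x : K2 < `|x - c| -> V1 x = 0.
  by move=> /far[g1 g2]; rewrite /V1 (grad_d1 g1) (grad_d1 g2) !mulr0 subrr.
have V20 x : K2 < `|x - c| -> V2 x = 0.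
  by move=> /far[g1 g2]; rewrite /V2 (grad_d2 g1) (grad_d2 g2) !mulr0 subrr.
have S1 := stokes1 CV1 V10; have S2 := stokes2 CV2 V20.
have c1 : continuous (d1 V1) by move=> x; exact: (Ck_continuous (Ck_d1 CV1) (x := x) Logic.I).
have c2 : continuous (d2 V2) by move=> x; exact: (Ck_continuous (Ck_d2 CV2) (x := x) Logic.I).
have i1 := continuous_supp_integrable c1 (fun x hx => grad_d1 (supp_d V10 hx)).
have i2 := continuous_supp_integrable c2 (fun x hx => grad_d2 (supp_d V20 hx)).
have S : \int[mu2]_(x in [set: MP]) (d1 V1 x + d2 V2 x) = 0.
  by rewrite RintegralD // [X in X + _]S1 [X in _ + X]S2 addr0.
have i12 : mu2.-integrable [set: MP] (EFin \o (fun x => d1 V1 x + d2 V2 x)).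
  by have := integrableD measurableT i1 i2; apply: eq_integrable.
pose rest x := lap psi x - (d1 V1 x + d2 V2 x).
have mr : @measurable_fun _ _ MP R setT rest.
  apply: measurable_funB => //.
  by apply: measurable_funD; exact: continuous_measurable2.
have restE x : x <> c -> rest x = (1 - h x) * lap psi x + (psi x - l) * lap h x.
  move=> xc.
  have Gp := Ck_grad Cp xc; have Gh := Ck_grad Ch' xc.
  have Gp1 := Ck_grad (Ck_d1 Cp) xc; have Gh1 := Ck_grad (Ck_d1 Ch') xc.
  have Gp2 := Ck_grad (Ck_d2 Cp) xc; have Gh2 := Ck_grad (Ck_d2 Ch') xc.
  have E1 : d1 V1 x = _ := grad_d1 (gradB (gradM Gh Gp1) (gradM (gradB Gp (grad_cst l x)) Gh1)).
  have E2 : d2 V2 x = _ := grad_d2 (gradB (gradM Gh Gp2) (gradM (gradB Gp (grad_cst l x)) Gh2)).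
  by rewrite /rest E1 E2 /lap; ring.
have rest0 x : e < `|x - c| -> rest x = 0.
  move=> hx; rewrite restE; last by move=> xc; move: hx; rewrite xc subrr normr0 ltNge ltW.
  by rewrite /h lap_chi_far // chi_far ?ltW // subrr mul0r mulr0 addr0.
have restc : rest c = lap psi c.
  rewrite /rest.
  have Z (V : P -> R) : (forall x, `|x - c| < e / 2 -> V x = 0) -> grad V c 0 0.
    move=> V0; apply: (@grad_near R (fun=> 0)) (grad_cst 0 c).
    have hx : `|c - c| < e / 2 by rewrite subrr normr0.
    by have := near_open (open_close c (e / 2)) hx; apply: filterS => y /V0.
  rewrite (grad_d1 (Z V1 _)) ?(grad_d2 (Z V2 _)) ?addr0 ?subr0 //.
    by move=> x hx; rewrite /V2 (grad_d2 (hn x hx)) /h chi_near // mul0r mulr0 subrr.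
  by move=> x hx; rewrite /V1 (grad_d1 (hn x hx)) /h chi_near // mul0r mulr0 subrr.
have restM x : `|rest x| <= M' + th * (K1 / e ^+ 2).
  have t0 : 0 <= th * (K1 / e ^+ 2) by rewrite mulr_ge0 ?divr_ge0 ?exprn_ge0 // ltW.
  have [->|/eqP xc] := eqVneq x c; first by rewrite restc (le_trans (lM c)) // lerDl.
  have [hx|hx] := ltP e `|x - c|; first by rewrite rest0 // normr0 addr_ge0.
  rewrite restE //; apply: le_trans (ler_normD _ _) _; rewrite !normrM; apply: lerD.
    have /andP[s0 s1] := step_bd (qd c x / e ^+ 2).
    rewrite -[leRHS]mul1r; apply: ler_pM => //.
    by rewrite /h /chi ger0_norm ?subr_ge0 // gerBl.
  by apply: ler_pM => //; [apply: He1; apply: le_lt_trans ee1|exact: HK1].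
have [ir Br] := int_bound e0 mr restM rest0.
have -> : \int[mu2]_(x in [set: MP]) lap psi x = \int[mu2]_(x in [set: MP]) rest x.
  rewrite -[LHS]subr0 -[X in _ - X]S -RintegralB //.
apply: le_trans Br _.
have -> : (M' + th * (K1 / e ^+ 2)) * (16 * e ^+ 2) = 16 * M' * e ^+ 2 + 16 * K1 * th.
  by field; exact: lt0r_neq0.
have E : eta = D * th by rewrite /th mulrC divfK // lt0r_neq0.
rewrite E /D; have : e ^+ 2 <= th by rewrite expr2; apply: le_trans eth; rewrite ger_pMr.
by clear -M'0 K10 th0; nra.
Qed.

End Cutoff.

Arguments open_off {R} c.
Arguments open_far {R} c K.
Arguments open_close {R} c K.

(** * Logarithmic poles of the Laplacian *)

Section LogResidue.
Variable R : realType.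
Local Notation P := (R * R)%type.
Local Notation MP := (measurableTypeR R * measurableTypeR R)%type.
Local Notation mble A := (@measurable _ MP A).
Local Notation mu1 := (@lebesgue_measure R).
Local Notation mu2 := (mu1 \x mu1)%E.
Implicit Types (g psi : P -> R) (c : P).

(** A logarithm truncated so that its derivative is max0 (1 - t)^2 / t:
    composed with |x - c|^2, it vanishes outside the unit disc and has the
    bounded Laplacian - 8 max0 (1 - |x - c|^2). *)
Definition cutlog (t : R) : R :=
  let s := max0 (1 - t) in ln (1 - s) + s + s ^+ 2 / 2.

Lemma cutlog_lo (t : R) : t <= 1 -> cutlog t = ln t + (1 - t) + (1 - t) ^+ 2 / 2.
Proof.
move=> h; rewrite /cutlog; have -> : max0 (1 - t) = 1 - t by rewrite /max0 max_r // subr_ge0.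
by rewrite subKr.
Qed.

Lemma cutlog_hi (t : R) : 1 <= t -> cutlog t = 0.
Proof.
move=> h; rewrite /cutlog; have -> : max0 (1 - t) = 0 by rewrite /max0 max_l // subr_le0.
by rewrite subr0 ln1 expr0n mul0r !addr0.
Qed.

Lemma ln_quad (t : R) : 2^-1 <= t -> `|ln t + (1 - t)| <= 2 * (t - 1) ^+ 2.
Proof.
move=> ht; have t0 : 0 < t by apply: lt_le_trans ht; rewrite invr_gt0.
have A : ln t <= t - 1.
  by have := @le_ln1Dx R (t - 1); rewrite [1 + _]addrC subrK; apply; rewrite ltrBrDr addrC subrr.
have i0 : 0 < t^-1 by rewrite invr_gt0.
have B : - ln t <= t^-1 - 1.
  rewrite -lnV ?posrE //; have := @le_ln1Dx R (t^-1 - 1).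
  by rewrite [1 + _]addrC subrK; apply; rewrite ltrBrDr addrC subrr.
have I2 : t^-1 <= 2 by rewrite -[leRHS]invrK lef_pV2 ?posrE // invr_gt0.
have E : (t^-1 - 1) + (t - 1) = (t - 1) ^+ 2 * t^-1 by field; exact: lt0r_neq0.
have F : (t - 1) ^+ 2 * t^-1 <= (t - 1) ^+ 2 * 2 by rewrite ler_wpM2l // sqr_ge0.
have s0 := sqr_ge0 (t - 1).
rewrite ler_norml; apply/andP; split; lra.
Qed.

Lemma is_derive_near (f f' : R -> R) (t a : R) : (\forall y \near t, f y = f' y) ->
  is_derive t 1 f a -> is_derive t 1 f' a.
Proof. by move=> H; apply: near_eq_is_derive. Qed.

Lemma is_derive_cutlog (t : R) : 0 < t ->
  is_derive t 1 cutlog (max0 (1 - t) ^+ 2 / t).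
Proof.
move=> t0; have [t1|t1|t1] := ltgtP t 1.
- have H1 := is_derive1_ln t0.
  have H2 : is_derive t 1 (fun y => 1 + - y) (0 + - 1) :=
    is_derive_add (is_derive_cst (1 : R) t 1) (is_deriveN (is_derive_id t (1 : R))).
  have H3 := is_derive_mul (is_derive_mul H2 H2) (is_derive_cst (2^-1 : R) t 1).
  have H := is_derive_add (is_derive_add H1 H2) H3.
  apply: is_derive_near (is_derive_eq H _).
    have : \forall y \near t, y < 1 by exact: (near_open (@open_lt R 1) t1).
    by apply: filterS => y /ltW/cutlog_lo ->; rewrite /cst /= expr2.
  rewrite /max0 max_r ?subr_ge0 ?ltW // /cst; field; exact: lt0r_neq0.
- rewrite /max0 max_l ?subr_le0 ?ltW // expr0n mul0r.
  apply: is_derive_near (is_derive_cst 0 t 1).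
  have : \forall y \near t, 1 < y by exact: (near_open (@open_gt R 1) t1).
  by apply: filterS => y /ltW/cutlog_hi ->.
rewrite t1 /max0 subrr maxxx expr0n mul0r; apply: is_derive_eps => e e0.
have Q y : 2^-1 <= y -> `|cutlog y| <= 3 * `|y - 1| ^+ 2.
  move=> hy; rewrite real_normK ?num_real //; have s0 := sqr_ge0 (y - 1).
  have [h|h] := leP y 1; last by rewrite cutlog_hi ?(ltW h) // normr0; lra.
  rewrite cutlog_lo //; apply: le_trans (ler_normD _ _) _.
  have := ln_quad hy; have -> : `|(1 - y) ^+ 2 / 2| = (y - 1) ^+ 2 / 2.
    by rewrite ger0_norm ?divr_ge0 ?sqr_ge0 //; ring.
  lra.
have n1 : \forall y \near (1 : R), 2^-1 < y.
  by apply: (near_open (@open_gt R 2^-1)); rewrite /= invf_lt1 ?ltr1n.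
have n2 : \forall y \near (1 : R), `|y - 1| <= e / 3.
  near=> y; rewrite distrC; near: y; apply: cvgr_dist_le (divr_gt0 e0 _); last by [].
  exact: cvg_id.
apply: filterS2 n1 n2 => y h1 h2; rewrite (cutlog_hi (lexx 1)) subr0 mul0r subr0.
apply: le_trans (Q y (ltW h1)) _; rewrite expr2 mulrA ler_wpM2r //.
by rewrite mulrC -ler_pdivlMr.
Unshelve. all: by end_near. Qed.

Definition cutL c (x : P) := cutlog (qd c x).

Lemma qd_gt0 c (x : P) : x <> c -> 0 < qd c x.
Proof.
move=> /eqP xc; apply: lt_le_trans (qd_ge c x); rewrite exprn_gt0 // normr_gt0.
by rewrite subr_eq0.
Qed.

Lemma grad_qd c x : grad (qd c) x (2 * (x.1 - c.1)) (2 * (x.2 - c.2)).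
Proof.
have G1 := gradB (grad_fst x) (grad_cst c.1 x).
have G2 := gradB (grad_snd x) (grad_cst c.2 x).
rewrite (_ : qd c = (fun y : P => (y.1 - c.1) * (y.1 - c.1) + (y.2 - c.2) * (y.2 - c.2))); last first.
  by apply/funext => y; rewrite /qd !expr2.
by apply: grad_eq (gradD (gradM G1 G1) (gradM G2 G2)) _ _; ring.
Qed.

Let m c (x : P) := max0 (1 - qd c x) ^+ 2.
Let k1 c (x : P) := 2 * (x.1 - c.1) * (qd c x)^-1.
Let k2 c (x : P) := 2 * (x.2 - c.2) * (qd c x)^-1.

Lemma grad_cutL c x : x <> c -> grad (cutL c) x (m c x * k1 c x) (m c x * k2 c x).
Proof.
move=> xc; have := grad_comp1 (grad_qd c x) (is_derive_cutlog (qd_gt0 xc)).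
by move/grad_eq; apply; rewrite /m /k1 /k2; field; exact: lt0r_neq0 (qd_gt0 xc).
Qed.

Lemma Ck_cutL c : Ck 2 (off c) (cutL c).
Proof.
have oO := open_off c.
have Cm : Ck 1 (off c) (m c).
  by apply: (Ck1_max0sq oO); apply: (CkB oO (Ck_cst 1 1 oO)); exact: Ck_qd.
have Ci : Ck 1 (off c) (fun x => (qd c x)^-1).
  apply: (CkV oO); last exact: Ck_qd.
  by move=> x /qd_gt0/lt0r_neq0.
have K1 : Ck 1 (off c) (k1 c).
  apply: (CkM oO) Ci; apply: (CkM oO (Ck_cst 1 2 oO)); apply: (CkB oO) (Ck_cst _ _ oO).
  exact: Ck_fst.
have K2 : Ck 1 (off c) (k2 c).
  apply: (CkM oO) Ci; apply: (CkM oO (Ck_cst 1 2 oO)); apply: (CkB oO) (Ck_cst _ _ oO).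
  exact: Ck_snd.
by apply: (Ck_intro oO (grad_cutL (c := c))); exact: (CkM oO).
Qed.

Lemma lap_cutL c x : x <> c -> lap (cutL c) x = - 8 * max0 (1 - qd c x).
Proof.
move=> xc; have oO := open_off c; have q0 := lt0r_neq0 (qd_gt0 xc).
have N1 : \forall y \near x, m c y * k1 c y = d1 (cutL c) y.
  by have := near_open oO xc; apply: filterS => y /grad_cutL/grad_d1.
have N2 : \forall y \near x, m c y * k2 c y = d2 (cutL c) y.
  by have := near_open oO xc; apply: filterS => y /grad_cutL/grad_d2.
have Gq := grad_qd c x.
have Gm := grad_comp1 (gradB (grad_cst 1 x) Gq) (is_derive_max0sq (1 - qd c x)).
have Gi := gradV Gq q0.
have Gk1 := gradM (gradM (grad_cst 2 x) (gradB (grad_fst x) (grad_cst c.1 x))) Gi.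
have Gk2 := gradM (gradM (grad_cst 2 x) (gradB (grad_snd x) (grad_cst c.2 x))) Gi.
rewrite /lap (grad_d1 (grad_near N1 (gradM Gm Gk1))) (grad_d2 (grad_near N2 (gradM Gm Gk2))).
move: q0; rewrite /qd; set X := x.1 - c.1; set Y := x.2 - c.2.
move: (max0 _) => t q0; field; exact: q0.
Qed.

Lemma measurable_point2 c : mble [set c].
Proof.
rewrite (_ : [set c] = ~` off c); first by apply: measurableC; apply: open_measurable2; exact: open_off.
by rewrite /off; apply/seteqP; split=> x /= => [->|/contrapT] //; apply.
Qed.

Lemma mu2_point c : mu2 [set c] = 0%E.
Proof.
have -> : [set c] = [set c.1] `*` [set c.2].
  by case: c => c1 c2; apply/seteqP; split=> [x /= ->|[x1 x2] /= [-> ->]].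
rewrite product_measure1E; try exact: measurable_set1.
rewrite (_ : (_ * _)%E = (mu1 [set c.1] * mu1 [set c.2])%E) //.
by rewrite lebesgue_measure_set1 mul0e.
Qed.

(** The distributional Laplacian of psi has integral zero, and it contains - n
    times that of ln |x - c|^2, which is 4 pi times a Dirac mass. Adding to
    psi the truncated logarithm [cutL], whose Laplacian is explicit, removes
    the singularity. *)
Lemma log_residue (n : nat) c psi (K M l : R) : Ck 2 (off c) psi ->
  (forall x, K < `|x - c| -> psi x = 0) ->
  (forall x, x <> c -> `|lap psi x| <= M) ->
  psi x + n%:R * ln (qd c x) @[x --> c^'] --> l ->
  mu2.-integrable [set: MP] (EFin \o lap psi) /\
  \int[mu2]_(x in [set: MP]) lap psi x = 4 * pi * n%:R.
Proof.
move=> Cp p0 pM pl; have oO := open_off c.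
pose M' := Num.max M `|lap psi c|.
have lM x : `|lap psi x| <= M'.
  have [->|/eqP xc] := eqVneq x c; first by rewrite /M' le_max lexx orbT.
  by apply: le_trans (pM x xc) _; rewrite /M' le_max lexx.
have Cl : Ck 0 (off c) (lap psi) by exact: Ck_lap.
have ml : @measurable_fun _ _ MP R setT (lap psi) by exact: off_measurable Cl.
have K'0 : 0 < `|K| + 1 by apply: ltr_wpDl.
have KK' : K < `|K| + 1 by apply: le_lt_trans (ler_norm K) _; rewrite ltrDl.
have l0 x : K < `|x - c| -> lap psi x = 0.
  move=> h; apply: (@lap_loc _ _ 0).
  by have := near_open (open_far c K) h; apply: filterS => y /p0.
have [il _] := int_bound K'0 ml lM (fun x h => l0 x (lt_trans KK' h)).
split=> //.
have [iq Iq] := paraboloid_volume c.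
(* Near 0, [cutlog] is ln t + (1 - t) + (1 - t)^2 / 2: the added constant 3/2
   is the value of the polynomial part at 0. *)
pose psi' x := if x == c then l + 3 / 2 * n%:R else psi x + n%:R * cutL c x.
pose psi0 x := psi x + n%:R * cutL c x.
have C0 : Ck 2 (off c) psi0.
  by apply: (CkD oO Cp); apply: (CkM oO (Ck_cst 2 _ oO)); exact: Ck_cutL.
have E0 x : off c x -> psi0 x = psi' x by rewrite /psi' => /eqP/negbTE ->.
have C' : Ck 2 (off c) psi' by exact: Ck_ext E0 C0.
have lapE x : x <> c -> lap psi' x = lap psi x + n%:R * (- 8 * max0 (1 - qd c x)).
  move=> xc; rewrite -(lap_ext oO xc E0 C0) -lap_cutL //.
  have CL := Ck_cutL c.
  have N1 : \forall y \near x, d1 psi y + n%:R * d1 (cutL c) y = d1 psi0 y.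
    have := near_open oO xc; apply: filterS => y yc.
    rewrite (grad_d1 (gradD (Ck_grad Cp yc) (gradM (grad_cst n%:R y) (Ck_grad CL yc)))).
    by rewrite mul0r add0r.
  have N2 : \forall y \near x, d2 psi y + n%:R * d2 (cutL c) y = d2 psi0 y.
    have := near_open oO xc; apply: filterS => y yc.
    rewrite (grad_d2 (gradD (Ck_grad Cp yc) (gradM (grad_cst n%:R y) (Ck_grad CL yc)))).
    by rewrite mul0r add0r.
  have G1 := gradD (Ck_grad (Ck_d1 Cp) xc) (gradM (grad_cst n%:R x) (Ck_grad (Ck_d1 CL) xc)).
  have G2 := gradD (Ck_grad (Ck_d2 Cp) xc) (gradM (grad_cst n%:R x) (Ck_grad (Ck_d2 CL) xc)).
  by rewrite /lap (grad_d1 (grad_near N1 G1)) (grad_d2 (grad_near N2 G2)); ring.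
pose K' := Num.max 1 K.
have Z : \int[mu2]_(x in [set: MP]) lap psi' x = 0.
  apply: (@flux_zero R c psi' K' (M' + n%:R * 8) (l + 3 / 2 * n%:R)) => //.
  - move=> x; rewrite gt_max => /andP[h1 h2].
    have xc : x <> c by move=> xc; move: h1; rewrite xc subrr normr0 ltr10.
    rewrite -E0 // /psi0 p0 // /cutL cutlog_hi ?mulr0 ?addr0 //.
    by apply: ltW; exact: qd_far.
  - move=> x xc; rewrite lapE //; apply: le_trans (ler_normD _ _) _; apply: lerD => //.
    rewrite normrM [X in X * _]ger0_norm // ler_wpM2l //.
    have /max0_bd/andP : 1 - qd c x <= 1 by rewrite gerBl addr_ge0 // sqr_ge0.
    move: (max0 _) => t [a b]; rewrite ler_norml; apply/andP; split; lra.
  - apply/cvgrPdist_le => e e0.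
    pose r x : R := n%:R * ((1 - qd c x) + (1 - qd c x) ^+ 2 / 2).
    have oT : open [set: P] by exact: openT.
    have cr : r x @[x --> c] --> (3 / 2 * n%:R : R).
      have Cr : Ck 0 setT r.
        have Cq := CkB (n := 0) oT (Ck_cst 0 1 oT) (Ck_qd 0 c oT).
        apply: (CkM (n := 0) oT (Ck_cst 0 _ oT)); apply: (CkD (n := 0) oT) => //.
        by apply: (CkM (n := 0) oT); [exact: (CkX (n := 0) 2 oT)|exact: (Ck_cst 0 _ oT)].
      have -> : 3 / 2 * n%:R = r c.
        by rewrite /r /qd !subrr expr0n /= addr0 subr0 expr1n; field.
      exact: Cr c Logic.I.
    have cr' : r x @[x --> c^'] --> (3 / 2 * n%:R : R) by apply: cvg_trans cr; apply: cvg_app; exact: cvg_within.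
    have FF : Filter c^' by apply: within_filter.
    have S := @cvgD _ _ _ _ FF _ _ _ _ pl cr'; move/cvgrPdist_le: S => /(_ e e0).
    have nq : \forall x \near c, `|x - c| < 2^-1.
      by apply: (near_open (open_close c 2^-1)); rewrite /= subrr normr0 invr_gt0.
    rewrite !near_withinE => H; near=> x.
    have [->|xc] := eqVneq x c; first by rewrite /psi' eqxx subrr normr0 ltW.
    have hx : `|x - c| < 2^-1 by near: x.
    have -> : psi' x = psi x + n%:R * ln (qd c x) + r x.
      rewrite -E0; last exact/eqP.
      rewrite /psi0 /cutL cutlog_lo /r; first ring.
      move: hx; rewrite prod_normE2 /= gt_max !ltr_norml => /andP[/andP[a1 a2] /andP[b1 b2]].
      by rewrite /qd; nra.
    by move: xc; near: x.
have i8 : mu2.-integrable [set: MP] (EFin \o (fun x => n%:R * - 8 * max0 (1 - qd c x))).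
  by have := @integrableZl _ _ _ mu2 _ measurableT (n%:R * - 8) _ iq; apply: eq_integrable.
have : \int[mu2]_(x in [set: MP]) (lap psi x + n%:R * - 8 * max0 (1 - qd c x)) = 0.
  rewrite -Z /Rintegral; congr fine; apply: ae_eq_integral => //.
  - apply/measurable_EFinP; apply: measurable_funD => //.
    by have /integrableP[/measurable_EFinP] := i8.
  - by apply/measurable_EFinP; apply: off_measurable (Ck_lap oO C').
  - exists [set c]; split; [exact: measurable_point2|exact: mu2_point|].
    move=> x /= H; apply: contrapT => xc; apply: H => _; congr EFin.
    by rewrite lapE // mulrA.
rewrite RintegralD // RintegralZl // Iq => H.
apply/eqP; rewrite -subr_eq0 -H; apply/eqP; field.
Unshelve. all: by end_near. Qed.

End LogResidue.

(** * Goursat's lemma *)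

Section Goursat.
Variable R : realType.
Local Notation P := (R * R)%type.
Local Notation mu1 := (@lebesgue_measure R).
Implicit Types (f g : R -> R) (p q z : P).

Definition I1 f (a b : R) : R := (\int[mu1]_(x in `[a, b]) f x)%R.

Definition cont_on f (a b : R) := forall t, a <= t <= b -> {for t, continuous f}.

Lemma cont_on_within f a b : cont_on f a b -> {within `[a, b], continuous f}.
Proof.
move=> cf; apply: continuous_in_subspaceT => t; rewrite inE /= in_itv /=; exact: cf.
Qed.

Lemma cont_on_integrable f a b : cont_on f a b -> mu1.-integrable `[a, b] (EFin \o f).
Proof.
move=> cf; apply: continuous_compact_integrable; first exact: segment_compact.
exact: cont_on_within.
Qed.

Lemma I1_add f (a m b : R) : a <= m -> m <= b -> cont_on f a b ->
  I1 f a b = I1 f a m + I1 f m b.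
Proof.
move=> am mb cf; have := @Rintegral_itvB R f (BLeft a) (BRight b) m.
have i := cont_on_integrable cf.
rewrite /I1 => /(_ i); rewrite !bnd_simp => /(_ am mb) /eqP.
rewrite subr_eq addrC => /eqP ->; congr (_ + _).
rewrite -Rintegral_itv_obnd_cbnd //.
by apply: integrableS i => // x /=; rewrite !in_itv /= => /andP[/ltW h ->]; rewrite (le_trans am).
Qed.

Lemma I1_near_cst f (k M a b : R) : a <= b -> cont_on f a b ->
  (forall t, a <= t <= b -> `|f t - k| <= M) -> `|I1 f a b - k * (b - a)| <= M * (b - a).
Proof.
move=> ab cf fM.
have mI : measurable (`[a, b] : set (measurableTypeR R)) by exact: measurable_itv.
have L : fine (mu1 `[a, b]) = b - a.
  rewrite lebesgue_measure_itv /= lte_fin; case: ltP => // ba /=.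
  by apply/eqP; rewrite eq_sym subr_eq0 eq_le ab ba.
have cst r : I1 (fun=> r) a b = r * (b - a) by rewrite /I1 Rintegral_cst // L.
have cc r : mu1.-integrable `[a, b] (EFin \o (fun=> r)).
  by apply: cont_on_integrable => t _; exact: cst_continuous.
have i := cont_on_integrable cf.
have ib : mu1.-integrable `[a, b] (EFin \o (fun x => f x - k)).
  apply: cont_on_integrable => t /cf h.
  by apply: (@continuousB R R R f (fun=> k)) => //; exact: cst_continuous.
have -> : I1 f a b - k * (b - a) = I1 (fun x => f x - k) a b.
  by rewrite -cst /I1 -RintegralB.
apply: le_trans (le_normr_Rintegral mI ib) _; rewrite -cst.
apply: le_Rintegral => //; first exact: integrable_norm ib.
Qed.

Lemma I1_bound f (M a b : R) : a <= b -> cont_on f a b ->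
  (forall t, a <= t <= b -> `|f t| <= M) -> `|I1 f a b| <= M * (b - a).
Proof.
move=> ab cf fM; have := @I1_near_cst f 0 M a b ab cf.
by rewrite mul0r subr0; apply => t /fM; rewrite subr0.
Qed.

Lemma I1_lin f g (k a b : R) : cont_on f a b -> cont_on g a b ->
  I1 (fun x => f x + k * g x) a b = I1 f a b + k * I1 g a b.
Proof.
move=> cf cg; have mI : measurable (`[a, b] : set (measurableTypeR R)) by exact: measurable_itv.
have ig := cont_on_integrable cg.
have ikg : mu1.-integrable `[a, b] (EFin \o (fun x => k * g x)).
  apply: cont_on_integrable => t h.
  by apply: (@continuousM R R (fun=> k) g); [exact: cst_continuous|exact: cg].
by rewrite /I1 RintegralD // ?RintegralZl //; exact: cont_on_integrable.
Qed.

Lemma I1_ext f g (a b : R) : (forall t, a <= t <= b -> f t = g t) -> I1 f a b = I1 g a b.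
Proof.
by move=> E; apply: eq_Rintegral => x; rewrite inE /= in_itv /=; exact: E.
Qed.

(** The integral of the 1-form U dx + V dy along the boundary of a rectangle. *)
Definition circ (U V : P -> R) p q : R :=
  I1 (fun x => U (x, p.2) - U (x, q.2)) p.1 q.1 + I1 (fun y => V (q.1, y) - V (p.1, y)) p.2 q.2.

Definition crect p q z := (p.1 <= z.1 <= q.1) && (p.2 <= z.2 <= q.2).

Definition cont2 (U V : P -> R) p q := forall z, crect p q z ->
  {for z, continuous U} /\ {for z, continuous V}.

(** The 1-form U dx + V dy is differentiable at z, with zero exterior
    derivative. *)
Definition closed_at (U V : P -> R) z :=
  exists a b c, grad U z a b /\ grad V z b c.

Lemma line1_continuous (U : P -> R) (t y : R) : {for (t, y), continuous U} ->
  {for t, continuous (fun x => U (x, y))}.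
Proof.
move=> h; apply: (@continuous_comp R P R (fun t => (t, y)) U) => //.
by apply: (@cvg_pair _ _ _ _ (nbhs t) (nbhs y)); [exact: cvg_id|exact: cvg_cst].
Qed.

Lemma line2_continuous (U : P -> R) (t x : R) : {for (x, t), continuous U} ->
  {for t, continuous (fun y => U (x, y))}.
Proof.
move=> h; apply: (@continuous_comp R P R (fun t => (x, t)) U) => //.
by apply: (@cvg_pair _ _ _ _ (nbhs x) (nbhs t)); [exact: cvg_cst|exact: cvg_id].
Qed.

Section Circ.
Variables (U V : P -> R) (p q : P).
Hypothesis C : cont2 U V p q.
Hypotheses (pq1 : p.1 <= q.1) (pq2 : p.2 <= q.2).

Lemma cont_line1 y a b : p.1 <= a -> b <= q.1 -> p.2 <= y <= q.2 -> cont_on (fun x => U (x, y)) a b.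
Proof.
move=> pa bq hy t /andP[h1 h2]; apply: line1_continuous; apply: (C _).1.
by rewrite /crect /= hy (le_trans pa) // (le_trans h2).
Qed.

Lemma cont_line2 x a b : p.2 <= a -> b <= q.2 -> p.1 <= x <= q.1 -> cont_on (fun y => V (x, y)) a b.
Proof.
move=> pa bq hx t /andP[h1 h2]; apply: line2_continuous; apply: (C _).2.
by rewrite /crect /= hx (le_trans pa) // (le_trans h2).
Qed.

Lemma cont_diff1 y y' a b : p.1 <= a -> b <= q.1 -> p.2 <= y <= q.2 -> p.2 <= y' <= q.2 ->
  cont_on (fun x => U (x, y) - U (x, y')) a b.
Proof.
move=> pa bq hy hy' t ht; apply: (@continuousB R R R (fun x => U (x, y)) (fun x => U (x, y'))).
  exact: (cont_line1 pa bq hy).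
exact: (cont_line1 pa bq hy').
Qed.

Lemma cont_diff2 x x' a b : p.2 <= a -> b <= q.2 -> p.1 <= x <= q.1 -> p.1 <= x' <= q.1 ->
  cont_on (fun y => V (x, y) - V (x', y)) a b.
Proof.
move=> pa bq hy hy' t ht; apply: (@continuousB R R R (fun y => V (x, y)) (fun y => V (x', y))).
  exact: (cont_line2 pa bq hy).
exact: (cont_line2 pa bq hy').
Qed.

Lemma circ_split1 m : p.1 <= m <= q.1 -> circ U V p q =
  circ U V p (m, q.2) + circ U V (m, p.2) q.
Proof.
move=> /andP[pm mq]; rewrite /circ /=.
have h2 : p.2 <= p.2 <= q.2 by rewrite lexx.
have h2' : p.2 <= q.2 <= q.2 by rewrite lexx andbT.
have h1 : p.1 <= p.1 <= q.1 by rewrite lexx.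
have h1' : p.1 <= q.1 <= q.1 by rewrite lexx andbT.
have hm : p.1 <= m <= q.1 by rewrite pm.
rewrite (I1_add pm mq); last exact: cont_diff1.
have -> : I1 (fun y => V (q.1, y) - V (p.1, y)) p.2 q.2 =
    I1 (fun y => V (m, y) - V (p.1, y)) p.2 q.2 + 1 * I1 (fun y => V (q.1, y) - V (m, y)) p.2 q.2.
  rewrite -I1_lin; try exact: cont_diff2.
  by apply: I1_ext => t _; ring.
by rewrite mul1r; ring.
Qed.

Lemma circ_split2 m : p.2 <= m <= q.2 -> circ U V p q =
  circ U V p (q.1, m) + circ U V (p.1, m) q.
Proof.
move=> /andP[pm mq]; rewrite /circ /=.
have h2 : p.2 <= p.2 <= q.2 by rewrite lexx.
have h2' : p.2 <= q.2 <= q.2 by rewrite lexx andbT.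
have h1 : p.1 <= p.1 <= q.1 by rewrite lexx.
have h1' : p.1 <= q.1 <= q.1 by rewrite lexx andbT.
have hm : p.2 <= m <= q.2 by rewrite pm.
rewrite [X in _ + X = _](I1_add pm mq); last exact: cont_diff2.
have -> : I1 (fun x => U (x, p.2) - U (x, q.2)) p.1 q.1 =
    I1 (fun x => U (x, p.2) - U (x, m)) p.1 q.1 + 1 * I1 (fun x => U (x, m) - U (x, q.2)) p.1 q.1.
  rewrite -I1_lin; try exact: cont_diff1.
  by apply: I1_ext => t _; ring.
by rewrite mul1r; ring.
Qed.

(** The affine part of a closed form integrates to zero; only the error of the
    first order expansion remains. *)
Lemma circ_near (b eta : R) (A : R) (B : R) (a c : R) z :
  (forall x, crect p q x -> `|U x - A - (a * (x.1 - z.1) + b * (x.2 - z.2))| <= eta) ->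
  (forall x, crect p q x -> `|V x - B - (b * (x.1 - z.1) + c * (x.2 - z.2))| <= eta) ->
  `|circ U V p q| <= 2 * eta * ((q.1 - p.1) + (q.2 - p.2)).
Proof.
move=> HU HV; rewrite /circ.
have h2 : p.2 <= p.2 <= q.2 by rewrite lexx.
have h2' : p.2 <= q.2 <= q.2 by rewrite lexx andbT.
have h1 : p.1 <= p.1 <= q.1 by rewrite lexx.
have h1' : p.1 <= q.1 <= q.1 by rewrite lexx andbT.
have L1 : `|I1 (fun x => U (x, p.2) - U (x, q.2)) p.1 q.1 - (- b * (q.2 - p.2)) * (q.1 - p.1)|
    <= 2 * eta * (q.1 - p.1).
  apply: I1_near_cst => //; first exact: cont_diff1.
  move=> t ht.
  have := HU (t, p.2); have := HU (t, q.2); rewrite /crect /= ht !lexx pq2 /= => /(_ isT) H1 /(_ isT) H2.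
  have := ler_normB (U (t, p.2) - A - (a * (t - z.1) + b * (p.2 - z.2)))
     (U (t, q.2) - A - (a * (t - z.1) + b * (q.2 - z.2))).
  set X := `|_ - _| => /le_trans H; have -> : `|U (t, p.2) - U (t, q.2) - - b * (q.2 - p.2)| = X.
    by congr `|_|; ring.
  by apply: H; rewrite mulrDl mul1r; exact: lerD.
have L2 : `|I1 (fun y => V (q.1, y) - V (p.1, y)) p.2 q.2 - (b * (q.1 - p.1)) * (q.2 - p.2)|
    <= 2 * eta * (q.2 - p.2).
  apply: I1_near_cst => //; first exact: cont_diff2.
  move=> t ht.
  have := HV (p.1, t); have := HV (q.1, t); rewrite /crect /= ht !lexx pq1 /= => /(_ isT) H1 /(_ isT) H2.
  have := ler_normB (V (q.1, t) - B - (b * (q.1 - z.1) + c * (t - z.2)))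
     (V (p.1, t) - B - (b * (p.1 - z.1) + c * (t - z.2))).
  set X := `|_ - _| => /le_trans H; have -> : `|V (q.1, t) - V (p.1, t) - b * (q.1 - p.1)| = X.
    by congr `|_|; ring.
  by apply: H; rewrite mulrDl mul1r; exact: lerD.
rewrite mulrDr; apply: le_trans (lerD L1 L2); apply: le_trans (ler_normD _ _).
by rewrite le_eqVlt; apply/orP; left; apply/eqP; congr `|_|; ring.
Qed.

End Circ.

Lemma cont2_sub U V p q p' q' : cont2 U V p q -> p.1 <= p'.1 -> q'.1 <= q.1 -> p.2 <= p'.2 -> q'.2 <= q.2 ->
  cont2 U V p' q'.
Proof.
move=> C h1 h2 h3 h4 z /andP[/andP[a b] /andP[c d]]; apply: C.
by rewrite /crect (le_trans h1) // (le_trans b) // (le_trans h3) // (le_trans d).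
Qed.

Lemma circ_quadrants U V p q : p.1 < q.1 -> p.2 < q.2 -> cont2 U V p q ->
  circ U V p q = \sum_b1 \sum_b2 circ U V (quadrant b1 b2 (p, q)).1 (quadrant b1 b2 (p, q)).2.
Proof.
case: p q => [p1 p2] [q1 q2] /= l1 l2 C.
have m1 : p1 <= (p1 + q1) / 2 <= q1.
  by rewrite ler_pdivlMr // ler_pdivrMr //; apply/andP; split; lra.
have m2 : p2 <= (p2 + q2) / 2 <= q2.
  by rewrite ler_pdivlMr // ler_pdivrMr //; apply/andP; split; lra.
rewrite !big_bool /quadrant /mid /=.
move/andP: (m1) => [m11 m12]; move/andP: (m2) => [m21 m22].
rewrite (circ_split1 C (ltW l1) (ltW l2) m1) /=.
rewrite (@circ_split2 U V (p1, p2) ((p1 + q1) / 2, q2) _ _ _ _ m2) //=.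
  rewrite (@circ_split2 U V ((p1 + q1) / 2, p2) (q1, q2) _ _ _ _ m2) //=.
  - by ring.
  - exact: cont2_sub C _ _ _ _.
  - exact: ltW.
- exact: cont2_sub C _ _ _ _.
- exact: ltW.
Qed.

Lemma crect_dist p q z x : crect p q z -> crect p q x -> `|x - z| <= (q.1 - p.1) + (q.2 - p.2).
Proof.
move=> /andP[/andP[a b] /andP[c d]] /andP[/andP[a' b'] /andP[c' d']].
rewrite prod_normE2 /= ge_max !ler_norml; apply/andP; split; apply/andP; split; lra.
Qed.

Lemma closed_density U V p q z e : p.1 < q.1 -> p.2 < q.2 -> cont2 U V p q ->
  closed_at U V z -> 0 < e ->
  exists2 d, 0 < d & forall p' q' t, subrect p q p' q' ->
    p'.1 <= z.1 <= q'.1 -> p'.2 <= z.2 <= q'.2 ->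
    0 < t < d -> q'.1 - p'.1 = t * (q.1 - p.1) -> q'.2 - p'.2 = t * (q.2 - p.2) ->
    `|circ U V p' q'| <= e * ((q'.1 - p'.1) * (q'.2 - p'.2)).
Proof.
move=> l1 l2 C [a [b [c [GU GV]]]] e0.
set W1 := q.1 - p.1; set W2 := q.2 - p.2.
have W10 : 0 < W1 by rewrite subr_gt0.
have W20 : 0 < W2 by rewrite subr_gt0.
have WS : 0 < W1 + W2 by rewrite addr_gt0.
have WW : 0 < 2 * (W1 + W2) ^+ 2 by rewrite mulr_gt0 // exprn_gt0.
pose eps := e * (W1 * W2) / (2 * (W1 + W2) ^+ 2).
have eps0 : 0 < eps by rewrite divr_gt0 // mulr_gt0 // mulr_gt0.
have /nbhsPP[r1 r10 H1] := gradP GU eps0; have /nbhsPP[r2 r20 H2] := gradP GV eps0.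
exists (Num.min r1 r2 / (W1 + W2)); first by rewrite divr_gt0 ?lt_min ?r10.
move=> p' q' t [[s1 t1] s2 [s3 t2] s4] z1' z2' /andP[t0 tr] E1 E2.
have z' : crect p' q' z by rewrite /crect z1' z2'.
have D x : crect p' q' x -> `|x - z| <= t * (W1 + W2).
  by move=> /(crect_dist z'); rewrite E1 E2 -mulrDr.
have tr1 : t * (W1 + W2) < r1 by rewrite -ltr_pdivlMr // (lt_le_trans tr) // ler_pM2r ?invr_gt0 // ge_min lexx.
have tr2 : t * (W1 + W2) < r2 by rewrite -ltr_pdivlMr // (lt_le_trans tr) // ler_pM2r ?invr_gt0 // ge_min lexx orbT.
have := @circ_near U V p' q' (cont2_sub C s1 s2 s3 s4) (ltW t1) (ltW t2) b (eps * (t * (W1 + W2))) (U z) (V z) a c z.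
move=> /(_ _ _)/le_trans; apply.
- by move=> x hx; apply: le_trans (H1 x (le_lt_trans (D x hx) tr1)) _; rewrite ler_pM2l // D.
- by move=> x hx; apply: le_trans (H2 x (le_lt_trans (D x hx) tr2)) _; rewrite ler_pM2l // D.
rewrite E1 E2 le_eqVlt; apply/orP; left; apply/eqP; rewrite /eps -/W1 -/W2.
by field; exact: lt0r_neq0.
Qed.

Lemma circ_subadditive U V p q p' q' : cont2 U V p q -> subrect p q p' q' ->
  `|circ U V p' q'| <=
  \sum_b1 \sum_b2 `|circ U V (quadrant b1 b2 (p', q')).1 (quadrant b1 b2 (p', q')).2|.
Proof.
move=> C [[s1 t1] s2 [s3 t2] s4].
rewrite circ_quadrants //; last exact: cont2_sub C _ _ _ _.
by apply: le_trans (ler_norm_sum _ _ _) _; apply: ler_sum => b1 _; exact: ler_norm_sum.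
Qed.

(** Goursat's lemma, without continuity of the derivatives: the boundary
    integral is additive, and has zero density at each point by the first
    order expansion. *)
Lemma goursat_regular U V p q : p.1 < q.1 -> p.2 < q.2 -> cont2 U V p q ->
  (forall z, crect p q z -> closed_at U V z) -> circ U V p q = 0.
Proof.
move=> l1 l2 C reg; apply: bisection => // [p' q'|z e z1 z2 e0].
  exact: circ_subadditive.
by apply: closed_density => //; apply: reg; rewrite /crect z1 z2.
Qed.

Definition corner (b1 b2 : bool) p q : P :=
  (if b1 then q.1 else p.1, if b2 then q.2 else p.2).

Let cornered b1 b2 U V p q := [/\ p.1 < q.1, p.2 < q.2, cont2 U V p q &
  forall z, crect p q z -> z <> corner b1 b2 p q -> closed_at U V z].

Lemma corner_step b1 b2 U V p q : cornered b1 b2 U V p q ->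
  let r := quadrant b1 b2 (p, q) in
  [/\ cornered b1 b2 U V r.1 r.2, circ U V p q = circ U V r.1 r.2,
    corner b1 b2 r.1 r.2 = corner b1 b2 p q &
    (r.2.1 - r.1.1) + (r.2.2 - r.1.2) = ((q.1 - p.1) + (q.2 - p.2)) / 2].
Proof.
case: p q => [p1 p2] [q1 q2] [/= l1 l2 C reg].
pose m1 := (p1 + q1) / 2; pose m2 := (p2 + q2) / 2.
have [k1 k2] : p1 < m1 /\ m1 < q1 by rewrite /m1 ltr_pdivlMr // ltr_pdivrMr //; split; lra.
have [k3 k4] : p2 < m2 /\ m2 < q2 by rewrite /m2 ltr_pdivlMr // ltr_pdivrMr //; split; lra.
have E : corner b1 b2 (quadrant b1 b2 ((p1, p2), (q1, q2))).1
    (quadrant b1 b2 ((p1, p2), (q1, q2))).2 = corner b1 b2 (p1, p2) (q1, q2).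
  by rewrite /corner /quadrant /=; case: (b1); case: (b2).
have S c1 c2 : let r := quadrant c1 c2 ((p1, p2), (q1, q2)) in
    [/\ r.1.1 < r.2.1, r.1.2 < r.2.2, p1 <= r.1.1, r.2.1 <= q1 & p2 <= r.1.2 /\ r.2.2 <= q2].
  by rewrite /quadrant /mid /= -/m1 -/m2; case: c1; case: c2; split; rewrite ?lexx // ?(ltW k1) ?(ltW k2) // ?(ltW k3) ?(ltW k4) ?lexx.
have CS c1 c2 : let r := quadrant c1 c2 ((p1, p2), (q1, q2)) in cont2 U V r.1 r.2.
  have [h1 h2 h3 h4 [h5 h6]] := S c1 c2 => r; exact: (cont2_sub C).
have RS c1 c2 z : let r := quadrant c1 c2 ((p1, p2), (q1, q2)) in
    crect r.1 r.2 z -> crect (p1, p2) (q1, q2) z.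
  have [h1 h2 h3 h4 [h5 h6]] := S c1 c2 => r /andP[/andP[a b] /andP[c d]].
  by rewrite /crect (le_trans h3) // (le_trans b) // (le_trans h5) // (le_trans d).
have Z c1 c2 : (c1, c2) != (b1, b2) -> circ U V (quadrant c1 c2 ((p1, p2), (q1, q2))).1
      (quadrant c1 c2 ((p1, p2), (q1, q2))).2 = 0.
  set r := quadrant c1 c2 _ => ne; have [h1 h2 _ _ _] := S c1 c2.
  apply: goursat_regular => // [|z hz]; first exact: CS.
  apply: reg; first exact: RS hz.
  move=> zE; move: hz ne; rewrite zE /crect /corner /r /quadrant /mid /= -/m1 -/m2.
  case: (c1); case: (c2); case: (b1); case: (b2) => //= /andP[/andP[a b] /andP[c d]] _; lra.
split=> //.
- have [h1 h2 _ _ _] := S b1 b2; split=> //; first exact: CS.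
  move=> z hz; rewrite E; apply: reg; exact: RS hz.
- rewrite circ_quadrants // !big_bool; move: Z; case: (b1); case: (b2) => Z.
  + by rewrite (Z true false isT) (Z false true isT) (Z false false isT) /quadrant /mid /= !(addr0, add0r).
  + by rewrite (Z true true isT) (Z false true isT) (Z false false isT) /quadrant /mid /= !(addr0, add0r).
  + by rewrite (Z true true isT) (Z true false isT) (Z false false isT) /quadrant /mid /= !(addr0, add0r).
  + by rewrite (Z true true isT) (Z true false isT) (Z false true isT) /quadrant /mid /= !(addr0, add0r).
- by rewrite /quadrant /mid /=; case: (b1); case: (b2) => /=; field.
Qed.

(** When the singular point is a corner, the three quadrants away from it
    contribute nothing; iterating, the boundary integral equals that of an
    arbitrarily small rectangle at the corner. *)
Lemma goursat_corner b1 b2 U V p q : cornered b1 b2 U V p q -> circ U V p q = 0.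
Proof.
move=> H; set z := corner b1 b2 p q.
have It n : exists p' q', [/\ cornered b1 b2 U V p' q', circ U V p q = circ U V p' q',
    corner b1 b2 p' q' = z & (q'.1 - p'.1) + (q'.2 - p'.2) = ((q.1 - p.1) + (q.2 - p.2)) / 2 ^+ n].
  elim: n => [|n [p' [q' [h1 h2 h3 h4]]]]; first by exists p, q; rewrite expr0 divr1.
  have [k1 k2 k3 k4] := corner_step h1.
  exists (quadrant b1 b2 (p', q')).1, (quadrant b1 b2 (p', q')).2.
  split=> //; [by rewrite h2 k2|by rewrite k3 h3|rewrite k4 h4 exprSr].
  by field; rewrite expf_neq0.
have [l1 l2 C _] := H.
have zin p' q' : p'.1 < q'.1 -> p'.2 < q'.2 -> crect p' q' (corner b1 b2 p' q').
  by move=> a b; rewrite /crect /corner /=; case: (b1); case: (b2); rewrite !lexx ?(ltW a) ?(ltW b).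
have [CU CV] := C z (zin p q l1 l2).
have n1 : \forall x \near z, `|U x - U z| <= 1.
  by move/cvgrPdist_le: CU => /(_ 1 ltr01); apply: filterS => x; rewrite distrC.
have n2 : \forall x \near z, `|V x - V z| <= 1.
  by move/cvgrPdist_le: CV => /(_ 1 ltr01); apply: filterS => x; rewrite distrC.
have /nbhsPP[r r0 Hr] : \forall x \near z, `|U x - U z| <= 1 /\ `|V x - V z| <= 1.
  exact: filterI n1 n2.
set W := (q.1 - p.1) + (q.2 - p.2).
have W0 : 0 < W by rewrite addr_gt0 // subr_gt0.
apply/eqP; rewrite -normr_le0; apply/ler_addgt0Pr => e e0; rewrite add0r.
have [n hn] : exists n, W / 2 ^+ n < Num.min r (e / 2).
  have m0 : 0 < Num.min r (e / 2) by rewrite lt_min r0 divr_gt0.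
  have := archi_boundP (ltW (divr_gt0 W0 m0)); set n := Num.bound _ => hn.
  exists n; rewrite ltr_pdivrMr ?exprn_gt0 // mulrC -ltr_pdivrMr //.
  by apply: lt_trans hn _; rewrite -natrX ltr_nat ltn_expl.
have [p' [q' [[k1 k2 k3 _] -> k5 k6]]] := It n.
have := @circ_near U V p' q' k3 (ltW k1) (ltW k2) 0 1 (U z) (V z) 0 0 z.
have zin' : crect p' q' z by rewrite -k5; exact: zin.
have small x : crect p' q' x -> `|x - z| < r.
  move=> hx; apply: le_lt_trans (crect_dist zin' hx) _.
  by rewrite k6; apply: lt_le_trans hn _; rewrite ge_min lexx.
move=> /(_ _ _)/le_trans; apply.
- by move=> x hx; rewrite !mul0r addr0 subr0; have [] := Hr x (small x hx).
- by move=> x hx; rewrite !mul0r addr0 subr0; have [] := Hr x (small x hx).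
rewrite k6 mulr1 mulrC -ler_pdivlMr //; apply: ltW; apply: lt_le_trans hn _.
by rewrite ge_min lexx orbT.
Qed.

Lemma circ_flat1 U V p q : p.1 = q.1 -> circ U V p q = 0.
Proof.
move=> E; rewrite /circ E {1}/I1 set_itv1 Rintegral_set1 add0r.
by rewrite (@I1_ext _ (fun=> 0)) => [|t _]; [rewrite /I1 Rintegral_cst ?mul0r|rewrite subrr].
Qed.

Lemma circ_flat2 U V p q : p.2 = q.2 -> circ U V p q = 0.
Proof.
move=> E; rewrite /circ E [X in _ + X]/I1 set_itv1 Rintegral_set1 addr0.
by rewrite (@I1_ext _ (fun=> 0)) => [|t _]; [rewrite /I1 Rintegral_cst ?mul0r|rewrite subrr].
Qed.

Lemma goursat_around U V p q z : crect p q z -> cont2 U V p q ->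
  (forall x, crect p q x -> x <> z -> closed_at U V x) -> circ U V p q = 0.
Proof.
case: p q z => [p1 p2] [q1 q2] [z1 z2] hz C reg.
have := hz => /andP[/andP[/= h1 h2] /andP[h3 h4]].
have hp1 := le_trans h1 h2; have hp2 := le_trans h3 h4.
have Q b1 b2 p q : p.1 <= q.1 -> p.2 <= q.2 -> p1 <= p.1 -> q.1 <= q1 -> p2 <= p.2 -> q.2 <= q2 ->
    corner b1 b2 p q = (z1, z2) -> circ U V p q = 0.
  move=> l1 l2 k1 k2 k3 k4 E.
  move: l1; rewrite le_eqVlt => /predU1P[/circ_flat1 //|l1].
  move: l2; rewrite le_eqVlt => /predU1P[/circ_flat2 //|l2].
  apply: (@goursat_corner b1 b2); split=> //; first exact: cont2_sub C _ _ _ _.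
  move=> x hx; rewrite E; apply: reg.
  move: hx => /andP[/andP[a b] /andP[c d]].
  by rewrite /crect /= (le_trans k1) // (le_trans b) // (le_trans k3) // (le_trans d).
have hz1 : p1 <= z1 <= q1 by rewrite h1.
have hz2 : p2 <= z2 <= q2 by rewrite h3.
rewrite (circ_split1 C hp1 hp2 hz1) /=.
rewrite (@circ_split2 U V (p1, p2) (z1, q2) _ _ _ _ hz2) //=; last exact: cont2_sub C _ _ _ _.
rewrite (@circ_split2 U V (z1, p2) (q1, q2) _ _ _ _ hz2) //=; last exact: cont2_sub C _ _ _ _.
rewrite (Q true true (p1, p2) (z1, z2)) //= (Q true false (p1, z2) (z1, q2)) //=.
by rewrite (Q false true (z1, p2) (q1, z2)) //= (Q false false (z1, z2) (q1, q2)) //= !addr0.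
Qed.

(** Around an isolated singularity, the two lines through it cut a rectangle
    into rectangles having it at a corner, which contribute nothing; this
    leaves the density zero there as well. *)
Lemma goursat U V p q : p.1 < q.1 -> p.2 < q.2 -> cont2 U V p q ->
  (forall z, crect p q z -> closed_at U V z \/
     exists2 d, 0 < d & forall x, crect p q x -> x <> z -> `|x - z| < d -> closed_at U V x) ->
  circ U V p q = 0.
Proof.
move=> l1 l2 C reg; apply: bisection => // [p' q'|z e z1 z2 e0].
  exact: circ_subadditive.
have [|cz|[d d0 Hd]] := reg z; first by rewrite /crect z1 z2.
  exact: closed_density.
have sub p' q' x : subrect p q p' q' -> crect p' q' x -> crect p q x.
  move=> [[k1 _] k2 [k3 _] k4] /andP[/andP[a b] /andP[c g]].
  by rewrite /crect /= (le_trans k1) // (le_trans b) // (le_trans k3) // (le_trans g).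
set W1 := q.1 - p.1; set W2 := q.2 - p.2.
have WS : 0 < W1 + W2 by rewrite addr_gt0 // subr_gt0.
exists (d / (W1 + W2)); first by rewrite divr_gt0.
move=> p' q' t S z1' z2' /andP[t0 td] E1 E2.
have z' : crect p' q' z by rewrite /crect z1' z2'.
have [[s1 t1] s2 [s3 t2] s4] := S.
rewrite (@goursat_around _ _ _ _ z) ?normr0 //.
- by rewrite mulr_ge0 ?(ltW e0) // mulr_ge0 // subr_ge0 ltW.
- exact: cont2_sub C _ _ _ _.
- move=> x hx xz; apply: Hd => //; first exact: sub S hx.
  by apply: le_lt_trans (crect_dist z' hx) _; rewrite E1 E2 -mulrDr -ltr_pdivlMr.
Qed.

End Goursat.

(** * Cauchy's theorem on a rectangle *)

Section Cauchy.
Variable R : realType.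
Local Notation P := (R * R)%type.
Local Notation C := (cplx R).
Implicit Types (U V : P -> R) (p q z : P) (f g : C -> C).

Definition bd p q z := crect p q z &&
  [|| z.1 == p.1, z.1 == q.1, z.2 == p.2 | z.2 == q.2].

Definition bcont U p q := forall z, bd p q z -> {for z, continuous U}.

Lemma bcont_lin U V (k : R) p q : bcont U p q -> bcont V p q ->
  bcont (fun x => U x + k * V x) p q.
Proof.
move=> cU cV z hz; apply: (@continuousD R R P U (fun x => k * V x)); first exact: cU.
by apply: (@continuousM R P (fun=> k) V); [exact: cst_continuous|exact: cV].
Qed.

Lemma bcontN U p q : bcont U p q -> bcont (fun x => - U x) p q.
Proof. by move=> cU z hz; apply: (@continuousN R R P U); exact: cU. Qed.

Section Sides.
Variables (p q : P).
Hypotheses (l1 : p.1 <= q.1) (l2 : p.2 <= q.2).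

Lemma bd_lo t : p.1 <= t <= q.1 -> bd p q (t, p.2).
Proof. by move=> h; rewrite /bd /crect /= h !lexx l2 eqxx !orbT. Qed.
Lemma bd_hi t : p.1 <= t <= q.1 -> bd p q (t, q.2).
Proof. by move=> h; rewrite /bd /crect /= h !lexx l2 eqxx !orbT. Qed.
Lemma bd_left t : p.2 <= t <= q.2 -> bd p q (p.1, t).
Proof. by move=> h; rewrite /bd /crect /= h !lexx l1 eqxx. Qed.
Lemma bd_right t : p.2 <= t <= q.2 -> bd p q (q.1, t).
Proof. by move=> h; rewrite /bd /crect /= h !lexx l1 eqxx !orbT. Qed.

Lemma side1 U : bcont U p q -> cont_on (fun x => U (x, p.2) - U (x, q.2)) p.1 q.1.
Proof.
move=> cU t ht; apply: (@continuousB R R R (fun x => U (x, p.2)) (fun x => U (x, q.2)));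
  apply: line1_continuous; apply: cU; [exact: bd_lo|exact: bd_hi].
Qed.

Lemma side2 V : bcont V p q -> cont_on (fun y => V (q.1, y) - V (p.1, y)) p.2 q.2.
Proof.
move=> cU t ht; apply: (@continuousB R R R (fun x => V (q.1, x)) (fun x => V (p.1, x)));
  apply: line2_continuous; apply: cU; [exact: bd_right|exact: bd_left].
Qed.

Lemma circ_lin U V U' V' (k : R) : bcont U p q -> bcont V p q -> bcont U' p q -> bcont V' p q ->
  circ (fun x => U x + k * U' x) (fun x => V x + k * V' x) p q = circ U V p q + k * circ U' V' p q.
Proof.
move=> cU cV cU' cV'; rewrite /circ mulrDr addrACA -!I1_lin; try exact: side1; try exact: side2.
by congr (_ + _); apply: I1_ext => t _; ring.
Qed.

Lemma circ_bound U V (M : R) : bcont U p q -> bcont V p q ->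
  (forall z, bd p q z -> `|U z| <= M) -> (forall z, bd p q z -> `|V z| <= M) ->
  `|circ U V p q| <= 2 * M * ((q.1 - p.1) + (q.2 - p.2)).
Proof.
move=> cU cV bU bV; rewrite /circ mulrDr; apply: le_trans (ler_normD _ _) _; apply: lerD.
  apply: I1_bound l1 (side1 cU) _ => t ht; apply: le_trans (ler_normB _ _) _.
  by rewrite mulrDl mul1r lerD // bU // ?bd_lo ?bd_hi.
apply: I1_bound l2 (side2 cV) _ => t ht; apply: le_trans (ler_normB _ _) _.
by rewrite mulrDl mul1r lerD // bV // ?bd_left ?bd_right.
Qed.

End Sides.

Definition re f : P -> R := fun x => complex.Re (f (toC x)).
Definition im f : P -> R := fun x => complex.Im (f (toC x)).

(** The integral of f(z) dz along the boundary of a rectangle. *)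
Definition circC f p q : C :=
  toC (circ (re f) (fun x => - im f x) p q, circ (im f) (re f) p q).

Definition bcontC f p q := bcont (re f) p q /\ bcont (im f) p q.

Lemma circC_lin f g (k : C) p q : p.1 <= q.1 -> p.2 <= q.2 -> bcontC f p q -> bcontC g p q ->
  circC (fun w => f w + k * g w) p q = circC f p q + k * circC g p q.
Proof.
move=> l1 l2 [fr fi] [gr gi]; case: k => k1 k2.
have E1 : circ (re (fun w => f w + Complex k1 k2 * g w))
      (fun x => - im (fun w => f w + Complex k1 k2 * g w) x) p q =
    circ (re f) (fun x => - im f x) p q + k1 * circ (re g) (fun x => - im g x) p q
    + (- k2) * circ (im g) (re g) p q.
  rewrite -!circ_lin //; try exact: bcontN; try (by apply: bcont_lin => //; exact: bcontN).
  congr (circ _ _ p q); apply/funext => x; rewrite /re /im /=;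
    by case: (f _) => ? ?; case: (g _) => ? ? /=; ring.
have E2 : circ (im (fun w => f w + Complex k1 k2 * g w)) (re (fun w => f w + Complex k1 k2 * g w)) p q =
    circ (im f) (re f) p q + k1 * circ (im g) (re g) p q
    + k2 * circ (re g) (fun x => - im g x) p q.
  rewrite -!circ_lin //; try exact: bcontN; try (by apply: bcont_lin => //; exact: bcontN).
  congr (circ _ _ p q); apply/funext => x; rewrite /re /im /=;
    by case: (f _) => ? ?; case: (g _) => ? ? /=; ring.
rewrite /circC E1 E2 /toC /=; congr Complex => /=; ring.
Qed.

Lemma nC_split (a b : R) : nC (toC (a, b)) <= `|a| + `|b|.
Proof.
have -> : toC (a, b) = toC (a, 0) + toC (0, b) :> C.
  by rewrite -toCD /=; congr toC; congr pair => /=; rewrite ?addr0 ?add0r.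
apply: le_trans (nCD _ _) _.
by rewrite !nCE /= !expr0n /= !(addr0, add0r) !sqrtr_sqr.
Qed.

Lemma circC_bound f (M : R) p q : p.1 <= q.1 -> p.2 <= q.2 -> bcontC f p q ->
  (forall z, bd p q z -> nC (f (toC z)) <= M) ->
  nC (circC f p q) <= 4 * M * ((q.1 - p.1) + (q.2 - p.2)).
Proof.
move=> l1 l2 [fr fi] fM; apply: le_trans (nC_split _ _) _.
have rM z : bd p q z -> `|re f z| <= M by move=> /fM; apply: le_trans; exact: Re_le_nC.
have iM z : bd p q z -> `|im f z| <= M by move=> /fM; apply: le_trans; exact: Im_le_nC.
have H1 := circ_bound l1 l2 fr (bcontN fi) rM (fun z hz => eq_ind_r (fun t => t <= M) (iM z hz) (normrN _)).
have H2 := circ_bound l1 l2 fi fr iM rM.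
by apply: le_trans (lerD H1 H2) _; rewrite le_eqVlt; apply/orP; left; apply/eqP; ring.
Qed.

Lemma derivable_closed f z : derivable f (toC z) 1 ->
  closed_at (re f) (fun x => - im f x) z /\ closed_at (im f) (re f) z.
Proof.
move=> /derivable_grad[]; set d := derive1 f _ => H1 H2.
split; last by exists (complex.Im d), (complex.Re d), (- complex.Im d).
by exists (complex.Re d), (- complex.Im d), (- complex.Re d); split => //; exact: (gradN H2).
Qed.

Lemma continuous_re f z : {for toC z, continuous f} -> {for z, continuous (re f)} /\ {for z, continuous (im f)}.
Proof.
move=> cf.
have cf' : {for z, continuous (fun x => ofC (f (toC x)))}.
  apply: (@continuous_comp P C P (fun x => f (toC x)) (@ofC R)); last exact: ofC_continuous.
  by apply: (@continuous_comp P C C (@toC R) f); [exact: toC_continuous|exact: cf].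
split.
  by apply: (@continuous_comp P P R (fun x => ofC (f (toC x))) fst); [exact: cf'|exact: cvg_fst].
by apply: (@continuous_comp P P R (fun x => ofC (f (toC x))) snd); [exact: cf'|exact: cvg_snd].
Qed.

(** By the Cauchy-Riemann equations f(z) dz is a closed form wherever f is
    holomorphic; the points of Z are isolated singularities. *)
Lemma cauchy_rect f p q (Z : seq C) : p.1 < q.1 -> p.2 < q.2 ->
  (forall z, crect p q z -> {for toC z, continuous f}) ->
  (forall z, crect p q z -> toC z \notin Z -> derivable f (toC z) 1) ->
  circC f p q = 0.
Proof.
move=> l1 l2 cf df.
have reg z : crect p q z ->
    exists2 d : R, 0 < d & forall x, crect p q x -> x <> z -> `|x - z| < d -> derivable f (toC x) 1.
  move=> hz; have : \forall x \near z, x != z -> toC x \notin Z.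
    elim: Z {df} => [|a Z IH]; first by apply: filterE.
    have [E|/eqP ne] := eqVneq (toC z) a.
      apply: filterS IH => x H xz; rewrite inE negb_or H // andbT.
      by apply: contra xz => /eqP; rewrite -E => /(congr1 (@ofC R)); rewrite !toCK => ->.
    have : \forall x \near z, off (ofC a) x.
      apply: (near_open (open_off _)) => E; apply: ne; by rewrite E ofCK.
    apply: filterS2 IH => x H xa xz; rewrite inE negb_or H // andbT.
    by apply/eqP => E; apply: xa; rewrite -E toCK.
  move=> /nbhsPP[d d0 H]; exists d => // x hx xz xd; apply: df => //; apply: H => //.
  exact/eqP.
rewrite /circC; congr (toC (_, _)); apply: goursat => //.
- move=> z /cf/continuous_re[h1 h2]; split=> //.
  by apply: (@continuousN R R P (im f)).
- move=> z hz; right; have [d d0 H] := reg z hz; exists d => // x hx xz xd.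
  by have [] := derivable_closed (H x hx xz xd).
- by move=> z /cf/continuous_re[h1 h2].
- move=> z hz; right; have [d d0 H] := reg z hz; exists d => // x hx xz xd.
  by have [] := derivable_closed (H x hx xz xd).
Qed.

End Cauchy.

(** * Cauchy's formula *)

Section InverseBound.
Variable R : realType.
Local Notation P := (R * R)%type.
Local Notation C := (cplx R).
Implicit Types (f g : C -> C) (z : P) (w : C).

Lemma contCP f w : {for w, continuous f} <->
  forall e : R, 0 < e -> exists2 d : R, 0 < d & forall v, nC (v - w) < d -> nC (f v - f w) <= e.
Proof.
split=> [cf e e0|H].
  have : \forall v \near w, nC (f v - f w) <= e.
    move/cvgrPdist_le: cf => /(_ (realC e)); rewrite realC_gt0 => /(_ e0).
    by apply: filterS => v; rewrite norm_nC realC_le nC_dist.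
  by move=> /nbhsCP[d d0 K]; exists d.
rewrite /prop_for /continuous_at; apply/(@cvgrPdist_le C C C (nbhs w)) => e' /gt0_realC[e e0 ->]; have [d d0 K] := H e e0.
by apply/nbhsCP; exists d => // v /K; rewrite norm_nC realC_le nC_dist.
Qed.

Lemma circC_ext f g (p q : P) : p.1 <= q.1 -> p.2 <= q.2 ->
  (forall z, bd p q z -> f (toC z) = g (toC z)) -> circC f p q = circC g p q.
Proof.
move=> l1 l2 E; rewrite /circC /circ.
by congr (toC (_ + _, _ + _)); apply: I1_ext => t ht; rewrite /re /im !E //;
  (apply: bd_lo || apply: bd_hi || apply: bd_left || apply: bd_right).
Qed.

Lemma bcontC_cont f (p q : P) : (forall z, bd p q z -> {for toC z, continuous f}) -> bcontC f p q.
Proof. by move=> H; split=> z /H/continuous_re[]. Qed.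

Section Square.
Variable r : R.
Hypothesis r0 : 0 < r.
Let p : P := (- r, - r).
Let q : P := (r, r).

Lemma sq1 : p.1 < q.1. Proof. by rewrite /= gtrN. Qed.
Lemma sq2 : p.2 < q.2. Proof. by rewrite /= gtrN. Qed.
Lemma sqp : (q.1 - p.1) + (q.2 - p.2) = 4 * r. Proof. by rewrite /=; ring. Qed.

Lemma crect_sq z : crect p q z = (`|z| <= r).
Proof. by rewrite /crect /= prod_normE2 ge_max !ler_norml. Qed.

Lemma bd_far z : bd p q z -> r <= nC (toC z).
Proof.
move=> /andP[_ H]; apply: le_trans (norm_le_nC _); rewrite prod_normE2 le_max.
have A (a : R) : (a == - r) || (a == r) -> r <= `|a|.
  by move=> /orP[/eqP ->|/eqP ->]; rewrite ?normrN ler_norm.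
by apply/orP; move: H; rewrite orbA => /orP[/A h|/A h]; [left|right].
Qed.

Definition kern w : C -> C := fun v => (v - w)^-1.

Lemma kern_cont w v : v != w -> {for v, continuous (kern w)}.
Proof.
move=> vw; apply: (@cvgV C C (nbhs v)); first by rewrite subr_eq0.
by apply: (@continuousB C C C id (fun=> w)); [exact: cvg_id|exact: cst_continuous].
Qed.

Lemma bd_apart w z : nC w <= r / 2 -> bd p q z -> r / 2 <= nC (toC z - w).
Proof.
move=> wr /bd_far h; have := nCD (toC z - w) w; rewrite subrK => h'.
have := le_trans h h'; lra.
Qed.

Lemma bd_neq w z : nC w <= r / 2 -> bd p q z -> toC z != w.
Proof.
move=> wr /(bd_apart wr) h; apply: contraTneq h => ->.
by rewrite subrr nC0 -ltNge divr_gt0.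
Qed.

Lemma kern_diff w z : nC w <= r / 2 -> bd p q z ->
  nC (kern w (toC z) - kern 0 (toC z)) <= 2 / r ^+ 2 * nC w.
Proof.
move=> wr hz; have h1 := bd_far hz; have h2 := bd_apart wr hz.
have n0 : toC z - w != 0 by rewrite subr_eq0 bd_neq.
have n1 : toC z != 0 by apply: (@bd_neq 0) => //; rewrite nC0 divr_ge0 // ltW.
have -> : kern w (toC z) - kern 0 (toC z) = w * ((toC z - w)^-1 * (toC z)^-1).
  by rewrite /kern subr0; move: n0 n1; move: (toC z) => v n0 n1; field; rewrite n1.
rewrite !nCM !nCV mulrC ler_wpM2r ?nC_ge0 //.
have -> : 2 / r ^+ 2 = (r / 2)^-1 * r^-1 by field; exact: lt0r_neq0.
have r2 : 0 < r / 2 by rewrite divr_gt0.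
apply: ler_pM; rewrite ?invr_ge0 ?nC_ge0 //; rewrite lef_pV2 // posrE //.
  exact: lt_le_trans h2.
exact: lt_le_trans h1.
Qed.

Lemma bd_neq0 z : bd p q z -> toC z != 0.
Proof. by apply: bd_neq; rewrite nC0 divr_ge0 // ltW. Qed.

(** The value is 2 pi i. A lower bound is enough, and each pair of opposite
    sides contributes at least 2, because 2 r / (t^2 + r^2) is at least 1 / r
    there. *)
Lemma circ_kern0 : 4 <= nC (circC (kern 0) p q).
Proof.
apply: le_trans (Im_le_nC _); rewrite /circC /=; apply: le_trans (ler_norm _).
have sq t : 0 < t ^+ 2 + r ^+ 2 by rewrite ltr_wpDl ?sqr_ge0 // exprn_gt0.
have E (a b : R) : kern 0 (Complex a b) = Complex (a / (a ^+ 2 + b ^+ 2)) (- (b / (a ^+ 2 + b ^+ 2))).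
  by rewrite /kern subr0 /GRing.inv /=.
have Ei (a b : R) : im (kern 0) (a, b) = - (b / (a ^+ 2 + b ^+ 2)) :=
  congr1 (@complex.Im R) (E a b).
have Er (a b : R) : re (kern 0) (a, b) = a / (a ^+ 2 + b ^+ 2) :=
  congr1 (@complex.Re R) (E a b).
have nb : bcontC (kern 0) p q by apply: bcontC_cont => z /bd_neq0 h; exact: kern_cont.
have B t : - r <= t <= r -> `|2 * r / (t ^+ 2 + r ^+ 2) - 3 / 2 / r| <= 1 / 2 / r.
  move=> /andP[a b].
  have h1 : t ^+ 2 <= r ^+ 2 by nra.
  have h0 := sqr_ge0 t.
  have E1 : 2 * r / (t ^+ 2 + r ^+ 2) - 3 / 2 / r = (r ^+ 2 - 3 * t ^+ 2) / (2 * r * (t ^+ 2 + r ^+ 2)).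
    by field; rewrite (lt0r_neq0 (sq t)) (lt0r_neq0 r0).
  have E2 : 1 / 2 / r = (t ^+ 2 + r ^+ 2) / (2 * r * (t ^+ 2 + r ^+ 2)).
    by field; rewrite (lt0r_neq0 (sq t)) (lt0r_neq0 r0).
  have D0 : 0 < 2 * r * (t ^+ 2 + r ^+ 2) by rewrite mulr_gt0 // mulr_gt0.
  rewrite E1 E2 normrM [X in _ * X]ger0_norm ?invr_ge0 ?(ltW D0) //.
  rewrite ler_pM2r ?invr_gt0 // ler_norml; apply/andP; split; lra.
have S (h : R -> R) : cont_on h (- r) r -> (forall t, - r <= t <= r -> h t = 2 * r / (t ^+ 2 + r ^+ 2)) ->
    2 <= I1 h (- r) r.
  move=> ch hE; have rr : - r <= r by rewrite ge0_cp // ltW.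
  have := @I1_near_cst R h (3 / 2 / r) (1 / 2 / r) (- r) r rr ch.
  have -> : 3 / 2 / r * (r - - r) = 3 by field; exact: lt0r_neq0.
  have -> : 1 / 2 / r * (r - - r) = 1 by field; exact: lt0r_neq0.
  rewrite ler_distl => /(_ _)/andP[]; first by move=> t ht; rewrite hE // B.
  move=> h1 _; lra.
rewrite /circ (_ : 4 = 2 + 2); last by ring.
apply: lerD; apply: S => /=.
- by have := side1 (ltW sq2) nb.2.
- move=> t _; rewrite !Ei sqrrN; field; exact: lt0r_neq0.
- by have := side2 (ltW sq1) nb.1.
- move=> t _; rewrite !Er sqrrN [r ^+ 2 + _]addrC; field; exact: lt0r_neq0.
Qed.

Variables (s : C -> C) (M : R).
Hypothesis cs : forall z, `|z| <= r -> {for toC z, continuous s}.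
Hypothesis sM : forall z, `|z| <= r -> nC (s (toC z)) <= M.
Hypothesis ds : forall z, `|z| <= r -> toC z != 0 -> derivable s (toC z) 1.

Lemma bd_in z : bd p q z -> `|z| <= r.
Proof. by move=> /andP[]; rewrite crect_sq. Qed.

Lemma skern_bcont w : nC w <= r / 2 -> bcontC (fun v => s v * kern w v) p q.
Proof.
move=> wr; apply: bcontC_cont => z hz.
apply: (@continuousM C C s (kern w)); first exact: cs (bd_in hz).
exact: kern_cont (bd_neq wr hz).
Qed.

Lemma kern_bcont w : nC w <= r / 2 -> bcontC (kern w) p q.
Proof. by move=> wr; apply: bcontC_cont => z /(bd_neq wr); exact: kern_cont. Qed.

(** Cauchy's theorem for the difference quotient of s at w, extended by the
    derivative of s. *)
Lemma cauchy_formula w : w != 0 -> nC w <= r / 2 ->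
  circC (fun v => s v * kern w v) p q = s w * circC (kern w) p q.
Proof.
move=> w0 wr.
have wz : `|ofC w| <= r.
  by apply: le_trans (norm_le_nC _) _; rewrite ofCK; apply: le_trans wr _; rewrite ler_pdivrMr // ler_pMr // ler1n.
have /derivable_eps : derivable s w 1 by have := ds wz; rewrite ofCK; apply.
set d := derive1 s w => Hd.
pose g v := if v == w then d else (s v - s w) * kern w v.
have gE v : v != w -> \forall u \near v, g u = (s u - s w) * kern w u.
  move=> vw; have : \forall u \near v, u != w.
    apply: (near_open (U := [set u | u != w])) => //.
    have -> : [set u : C | u != w] = ~` [set w] by apply/seteqP; split=> u /= /eqP.
    by apply: closed_openC; apply: accessible_closed_set1; apply: hausdorff_accessible; exact: norm_hausdorff.
  by apply: filterS => u uw; rewrite /g (negbTE uw).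
have cg z : crect p q z -> {for toC z, continuous g}.
  rewrite crect_sq => hz; have [->|vw] := eqVneq (toC z) w.
    apply/contCP => e e0; have [r1 r10 H] := Hd e e0; exists r1 => // v vw.
    rewrite /g eqxx; case: eqVneq => [_|ne]; first by rewrite subrr nC0 ltW.
    have n0 : v - w != 0 by rewrite subr_eq0.
    have -> : (s v - s w) * kern w v - d = (s v - s w - d * (v - w)) * kern w v.
      by rewrite /kern [in RHS]mulrBl mulfK.
    by rewrite nCM nCV ler_pdivrMr ?nC_gt0 // H.
  have E := gE _ vw; rewrite /prop_for /continuous_at (nbhs_singleton E).
  have E' : \forall u \near toC z, (s u - s w) * kern w u = g u by apply: filterS E => u ->.
  apply: cvg_trans (near_eq_cvg E') _.
  apply: (@continuousM C C (fun u => s u - s w) (kern w)); last exact: kern_cont.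
  by apply: (@continuousB C C C s (fun=> s w)); [exact: cs|exact: cst_continuous].
have dg z : crect p q z -> toC z \notin [:: 0; w] -> derivable g (toC z) 1.
  rewrite crect_sq !inE negb_or => hz /andP[z0 zw].
  have E := gE _ zw.
  have E' : \forall u \near toC z, (s u - s w) * kern w u = g u by apply: filterS E => u ->.
  apply: near_eq_derivable E' _.
  apply: derivableM.
    by apply: derivableB; [exact: ds|exact: derivable_cst].
  apply: derivableV; first by rewrite subr_eq0.
  by apply: derivableB; [exact: derivable_id|exact: derivable_cst].
have G0 := cauchy_rect sq1 sq2 cg dg.
have : circC g p q = circC (fun v => s v * kern w v + - s w * kern w v) p q.
  apply: circC_ext; [exact: ltW sq1|exact: ltW sq2|].
  by move=> z hz; rewrite /g (negbTE (bd_neq wr hz)) mulrBl mulNr.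
rewrite G0 circC_lin ?(ltW sq1) ?(ltW sq2) //; [|exact: skern_bcont|exact: kern_bcont].
by rewrite mulNr => /esym/eqP; rewrite subr_eq0 => /eqP.
Qed.

(** Cauchy's formula gives s w up to the factor L(w), the integral of dz / (z
    - w), as a boundary integral; both are Lipschitz in w, L stays away from
    zero, and the boundary integral tends to 0 with w since s does. *)
Lemma lipschitz_at0 : s 0 = 0 -> exists K d : R,
  0 < d /\ forall w, nC w < d -> nC (s w) <= K * nC w.
Proof.
move=> s0.
have M0 : 0 <= M by apply: le_trans (sM (z := 0) _); rewrite ?nC_ge0 // normr0 ltW.
have b0 : nC (0 : C) <= r / 2 by rewrite nC0 divr_ge0 // ltW.
set L := circC (kern 0) p q; set K := circC (fun v => s v * kern 0 v) p q.
have EL w : nC w <= r / 2 -> nC (circC (kern w) p q - L) <= 32 / r * nC w.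
  move=> wr.
  have -> : circC (kern w) p q - L = circC (fun v => kern w v + - 1 * kern 0 v) p q.
    rewrite circC_lin ?(ltW sq1) ?(ltW sq2) ?mulN1r //; exact: kern_bcont.
  have := @circC_bound R (fun v => kern w v + - 1 * kern 0 v) (2 / r ^+ 2 * nC w) p q (ltW sq1) (ltW sq2).
  rewrite sqp => /(_ _ _)/le_trans; apply.
  - apply: bcontC_cont => z hz; apply: (@continuousD C C C (kern w) (fun v => - 1 * kern 0 v)).
      exact: kern_cont (bd_neq wr hz).
    apply: (@continuousM C C (fun=> - 1) (kern 0)); first exact: cst_continuous.
    exact: kern_cont (bd_neq0 hz).
  - by move=> z hz; rewrite mulN1r kern_diff.
  - rewrite le_eqVlt; apply/orP; left; apply/eqP; field; exact: lt0r_neq0.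
have EK w : nC w <= r / 2 -> nC (circC (fun v => s v * kern w v) p q - K) <= 32 * M / r * nC w.
  move=> wr.
  have -> : circC (fun v => s v * kern w v) p q - K =
      circC (fun v => s v * kern w v + - 1 * (s v * kern 0 v)) p q.
    rewrite circC_lin ?(ltW sq1) ?(ltW sq2) ?mulN1r //; exact: skern_bcont.
  have := @circC_bound R (fun v => s v * kern w v + - 1 * (s v * kern 0 v)) (M * (2 / r ^+ 2 * nC w)) p q (ltW sq1) (ltW sq2).
  rewrite sqp => /(_ _ _)/le_trans; apply.
  - have [a1 a2] := skern_bcont wr; have [a3 a4] := skern_bcont b0.
    apply: bcontC_cont => z hz; apply: (@continuousD C C C (fun v => s v * kern w v) (fun v => - 1 * (s v * kern 0 v))).
      apply: (@continuousM C C s (kern w)); first exact: cs (bd_in hz).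
      exact: kern_cont (bd_neq wr hz).
    apply: (@continuousM C C (fun=> - 1) (fun v => s v * kern 0 v)); first exact: cst_continuous.
    apply: (@continuousM C C s (kern 0)); first exact: cs (bd_in hz).
    exact: kern_cont (bd_neq0 hz).
  - move=> z hz; rewrite mulN1r -mulrBr nCM; apply: ler_pM; rewrite ?nC_ge0 //.
      exact: sM (bd_in hz).
    exact: kern_diff.
  - rewrite le_eqVlt; apply/orP; left; apply/eqP; field; exact: lt0r_neq0.
have F w : w != 0 -> nC w <= r / 2 -> exists E1 E2 : C,
    [/\ s w * (L + E1) = K + E2, nC E1 <= 32 / r * nC w & nC E2 <= 32 * M / r * nC w].
  move=> w0 wr; exists (circC (kern w) p q - L), (circC (fun v => s v * kern w v) p q - K).
  by split; [rewrite ![_ + (_ - _)]addrC !subrK cauchy_formula|exact: EL|exact: EK].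
have L4 : 4 <= nC L by exact: circ_kern0.
(* The constant K equals s w L up to errors that vanish with w. *)
have K0 : K = 0.
  apply/eqP; rewrite -nC_eq0 eq_le nC_ge0 andbT; apply/ler_addgt0Pr => e e0; rewrite add0r.
  have D0 : 0 < nC L + 16 by rewrite ltr_wpDl ?nC_ge0.
  have c0 : {for 0, continuous s} by have := cs (z := 0); rewrite normr0 => /(_ (ltW r0)).
  have [d d0 Hd] := (contCP s 0).1 c0 _ (divr_gt0 e0 (mulr_gt0 (ltr0n R 2) D0)).
  pose t := Num.min (Num.min (r / 2) (d / 2)) (e * r / (64 * (M + 1))).
  have t0 : 0 < t by rewrite !lt_min !divr_gt0 ?mulr_gt0 // ltr_wpDl.
  have [t1 t2 t3] : [/\ t <= r / 2, t <= d / 2 & t <= e * r / (64 * (M + 1))].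
    by rewrite /t !ge_min !lexx !orbT.
  have nt : nC (realC t) = t by rewrite nCE /= expr0n addr0 sqrtr_sqr ger0_norm // ltW.
  have w0 : realC t != 0 :> C by rewrite -nC_eq0 nt lt0r_neq0.
  have [|E1 [E2 [EE H1 H2]]] := F _ w0; first by rewrite nt.
  rewrite nt in H1 H2.
  have KE : nC K <= nC (s (realC t)) * (nC L + nC E1) + nC E2.
    have -> : K = s (realC t) * (L + E1) + - E2 by rewrite EE addrK.
    apply: le_trans (nCD _ _) _; rewrite nCN lerD2r nCM ler_wpM2l ?nC_ge0 //; exact: nCD.
  have S : nC (s (realC t)) <= e / (2 * (nC L + 16)).
    have := Hd (realC t); rewrite s0 !subr0 nt; apply.
    by apply: le_lt_trans t2 _; rewrite ltr_pdivrMr // ltr_pMr // ltr1n.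
  have B1 : nC E1 <= 16.
    apply: le_trans H1 _; have -> : 16 = 32 / r * (r / 2) by field; exact: lt0r_neq0.
    by rewrite ler_pM2l // divr_gt0.
  have B2 : nC E2 <= e / 2.
    apply: le_trans H2 _; apply: le_trans (ler_wpM2l _ t3) _.
      by rewrite divr_ge0 ?mulr_ge0 // ltW.
    have M1 : 0 < M + 1 by rewrite ltr_wpDl.
    have -> : 32 * M / r * (e * r / (64 * (M + 1))) = e / 2 * (M / (M + 1)).
      by field; rewrite (lt0r_neq0 M1) (lt0r_neq0 r0).
    by rewrite ler_piMr ?divr_ge0 ?(ltW e0) // ler_pdivrMr // mul1r lerDl.
  apply: le_trans KE _; have -> : e = e / 2 + e / 2 by field.
  apply: lerD => //.
  have -> : e / 2 = e / (2 * (nC L + 16)) * (nC L + 16) by field; exact: lt0r_neq0.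
  by apply: ler_pM; rewrite ?addr_ge0 ?nC_ge0 // lerD2l.
(* In this range |L + E1| is at least 4 - 1, so dividing by it is harmless. *)
exists (32 * M / r), (r / 32); split; first by rewrite divr_gt0.
move=> w wd; have [->|w0] := eqVneq w 0; first by rewrite s0 nC0 mulr0.
have [||E1 [E2 [EE H1 H2]]] := F w => //.
  by apply: ltW; apply: lt_le_trans wd _; rewrite ler_pM2l // lef_pV2 ?posrE // ler_nat.
have e1 : nC E1 <= 1.
  apply: le_trans H1 _; rewrite mulrC -ler_pdivlMr ?divr_gt0 //.
  by rewrite invf_div mul1r ltW.
have : nC (s w) * nC (L + E1) <= 32 * M / r * nC w by rewrite -nCM EE K0 add0r.
apply: le_trans; rewrite ler_peMr ?nC_ge0 //.
have := nCD (L + E1) (- E1); rewrite addrK nCN; lra.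
Qed.

End Square.

End InverseBound.

(** * The Bryant representation at a point *)

Section BryantAlgebra.
Variable R : realType.
Local Notation P := (R * R)%type.
Local Notation C := (cplx R).
Local Notation E3 := 'rV[R]_3.

Definition frob (A : 'M[C]_2) : R := \sum_i \sum_j nC (A i j) ^+ 2.

(** The value of A A^* prescribed by [bryant_formula], as a function of the
    point. *)
Definition gram_of (y : E3) : 'M[C]_2 :=
  let t := 2 / (1 - dot y y) in
  mx22 (realC (t - 1 + t * y 0 o2)) (toC (t * y 0 o0, t * y 0 o1))
       (toC (t * y 0 o0, - (t * y 0 o1))) (realC (t - 1 - t * y 0 o2)).

Lemma sum2 (V : zmodType) (h : 'I_2 -> V) : \sum_k h k = h 0 + h 1.
Proof. by rewrite big_ord_recl big_ord1; congr (_ + h _); apply: val_inj. Qed.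

Lemma det2 (A : 'M[C]_2) : \det A = A 0 0 * A 1 1 - A 0 1 * A 1 0.
Proof.
rewrite (expand_det_row _ 0) sum2 /cofactor !det_mx11 !mxE /= expr0 expr1 mul1r mulN1r mulrN.
by congr (_ * A _ _ - _ * A _ _); apply: val_inj.
Qed.

Lemma lagrange (a1 a2 b1 b2 c1 c2 d1 d2 x0 x1 x2 x3 : R) :
  a1 * d1 - a2 * d2 - (b1 * c1 - b2 * c2) = 1 -> a1 * d2 + a2 * d1 - (b1 * c2 + b2 * c1) = 0 ->
  a1 ^+ 2 + a2 ^+ 2 + (b1 ^+ 2 + b2 ^+ 2) = x0 + x3 ->
  c1 ^+ 2 + c2 ^+ 2 + (d1 ^+ 2 + d2 ^+ 2) = x0 - x3 ->
  a1 * c1 + a2 * c2 + (b1 * d1 + b2 * d2) = x1 ->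
  a2 * c1 - a1 * c2 + (b2 * d1 - b1 * d2) = x2 ->
  x0 ^+ 2 - x1 ^+ 2 - x2 ^+ 2 - x3 ^+ 2 = 1 /\ 0 <= x0.
Proof.
move=> h1 h2 h3 h4 h5 h6; split.
  have -> : x0 ^+ 2 - x1 ^+ 2 - x2 ^+ 2 - x3 ^+ 2 = (x0 + x3) * (x0 - x3) - x1 ^+ 2 - x2 ^+ 2 by ring.
  rewrite -h3 -h4 -h5 -h6.
  transitivity ((a1 * d1 - a2 * d2 - (b1 * c1 - b2 * c2)) ^+ 2 + (a1 * d2 + a2 * d1 - (b1 * c2 + b2 * c1)) ^+ 2).
    by ring.
  by rewrite h1 h2; ring.
have := addr_ge0 (addr_ge0 (sqr_ge0 a1) (sqr_ge0 a2)) (addr_ge0 (sqr_ge0 b1) (sqr_ge0 b2)).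
have := addr_ge0 (addr_ge0 (sqr_ge0 c1) (sqr_ge0 c2)) (addr_ge0 (sqr_ge0 d1) (sqr_ge0 d2)).
rewrite h3 h4; lra.
Qed.

(** In the coordinates x0, x1, x2, x3 of A A^* the determinant gives x0^2 -
    x1^2 - x2^2 - x3^2 = 1 and the trace |A|^2 = 2 x0, while 1 - |y|^2 = 2 /
    (x0 + 1). *)
Lemma bryant_gram (A : 'M[C]_2) (y : E3) : \det A = 1 -> bryant_formula A y ->
  1 - dot y y = 4 / (2 + frob A) /\ A *m (map_mx Num.conj A)^T = gram_of y.
Proof.
move=> dA [x0 [x1 [x2 [x3 [AA yE]]]]].
have e00 : (A *m (map_mx Num.conj A)^T) 0 0 = realC (x0 + x3) by rewrite AA !mxE.
have e01 : (A *m (map_mx Num.conj A)^T) 0 1 = toC (x1, x2) by rewrite AA !mxE.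
have e11 : (A *m (map_mx Num.conj A)^T) 1 1 = realC (x0 - x3) by rewrite AA !mxE.
have F0 : frob A = nC (A 0 0) ^+ 2 + nC (A 0 1) ^+ 2 + (nC (A 1 0) ^+ 2 + nC (A 1 1) ^+ 2).
  by rewrite /frob !sum2.
move: dA F0 e00 e01 e11; rewrite det2 !mxE !sum2 !mxE !nC_sqr.
case: (A 0 0) => a1 a2; case: (A 0 1) => b1 b2; case: (A 1 0) => c1 c2; case: (A 1 1) => d1 d2 /=.
move=> [h1 h2] F0 [h3 _] [h5 h6] [h4 _].
have [K x00] : x0 ^+ 2 - x1 ^+ 2 - x2 ^+ 2 - x3 ^+ 2 = 1 /\ 0 <= x0.
  apply: (lagrange h1 h2).
  - by rewrite -h3; ring.
  - by rewrite -h4; ring.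
  - by rewrite -h5; ring.
  - by rewrite -h6; ring.
have D0 : x0 + 1 != 0 by rewrite lt0r_neq0 // ltr_wpDl.
have H : 1 - dot y y = 2 / (x0 + 1).
  rewrite dot3 yE !mxE /= .
  transitivity (1 - (x1 ^+ 2 + x2 ^+ 2 + x3 ^+ 2) / (x0 + 1) ^+ 2); first by field.
  have -> : x1 ^+ 2 + x2 ^+ 2 + x3 ^+ 2 = x0 ^+ 2 - 1 by rewrite -K; ring.
  by field.
split.
  rewrite H; have -> : frob A = 2 * x0.
    rewrite F0; transitivity ((x0 + x3) + (x0 - x3)); last by ring.
    by rewrite -h3 -h4; ring.
  have D1 : 2 + 2 * x0 != 0 by rewrite lt0r_neq0 // ltr_wpDr // mulr_ge0.
  by field; rewrite D1 D0.
rewrite AA /gram_of H invf_div mulrCA divff // mulr1 yE !mxE /=.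
by congr mx22; rewrite /realC; congr toC; congr pair; field.
Qed.

End BryantAlgebra.

(** * Critical points and the Bryant representation *)

Section RepDerivative.
Variable R : realType.
Local Notation P := (R * R)%type.
Local Notation C := (cplx R).
Local Notation E3 := 'rV[R]_3.

Lemma grad0D (g h : P -> R) x : grad g x 0 0 -> grad h x 0 0 -> grad (fun y => g y + h y) x 0 0.
Proof. by move=> G H; apply: grad_eq (gradD G H) _ _; rewrite addr0. Qed.

Lemma grad0B (g h : P -> R) x : grad g x 0 0 -> grad h x 0 0 -> grad (fun y => g y - h y) x 0 0.
Proof. by move=> G H; apply: grad_eq (gradB G H) _ _; rewrite subr0. Qed.

Lemma grad0M (g h : P -> R) x : grad g x 0 0 -> grad h x 0 0 -> grad (fun y => g y * h y) x 0 0.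
Proof. by move=> G H; apply: grad_eq (gradM G H) _ _; rewrite mul0r mulr0 addr0. Qed.

Lemma gram_of_grad0 (y : P -> E3) (x : P) : 1 - dot (y x) (y x) != 0 ->
  (forall k, grad (fc y k) x 0 0) -> forall i j,
  grad (fun v => complex.Re (gram_of (y v) i j)) x 0 0 /\
  grad (fun v => complex.Im (gram_of (y v) i j)) x 0 0.
Proof.
move=> n0 G.
pose t v := 2 / (1 - dot (y v) (y v)).
have Gd : grad (fun v => dot (y v) (y v)) x 0 0.
  apply: (@grad_near R (fun v => fc y o0 v * fc y o0 v + fc y o1 v * fc y o1 v + fc y o2 v * fc y o2 v)).
    by apply: filterE => v; rewrite dot3.
  by apply: grad0D; [apply: grad0D|]; exact: grad0M.
have c0 := grad_cst (0 : R) x; have c1 := grad_cst (1 : R) x.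
have Gt : grad t x 0 0.
  apply: grad_eq (gradM (grad_cst 2 x) (gradV (grad0B c1 Gd) n0)) _ _; rewrite !(mul0r, mulr0, oppr0); ring.
have Gk k : grad (fun v => t v * y v 0 k) x 0 0 by exact: grad0M Gt (G k).
have E (h : P -> R) i j : grad h x 0 0 -> (forall v, h v = complex.Re (gram_of (y v) i j)) ->
    grad (fun v => complex.Re (gram_of (y v) i j)) x 0 0.
  by move=> H hE; apply: grad_near H; exact: filterE.
have E' (h : P -> R) i j : grad h x 0 0 -> (forall v, h v = complex.Im (gram_of (y v) i j)) ->
    grad (fun v => complex.Im (gram_of (y v) i j)) x 0 0.
  by move=> H hE; apply: grad_near H; exact: filterE.
apply: ord2P; apply: ord2P; split.
- by apply: E (grad0D (grad0B Gt c1) (Gk o2)) _ => v; rewrite mxE.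
- by apply: E' c0 _ => v; rewrite mxE.
- by apply: E (Gk o0) _ => v; rewrite mxE.
- by apply: E' (Gk o1) _ => v; rewrite mxE.
- by apply: E (Gk o0) _ => v; rewrite mxE.
- by apply: E' (grad0B c0 (Gk o1)) _ => v; rewrite mxE /= sub0r.
- by apply: E (grad0B (grad0B Gt c1) (Gk o2)) _ => v; rewrite mxE.
- by apply: E' c0 _ => v; rewrite mxE.
Qed.

(** A conformal map whose image determines A A^* cannot be critical where A is
    immersed: differentiating A A^* gives A' A^* = 0. *)
Lemma rep_deriv_neq0 (A : C -> 'M[C]_2) (g : P -> E3) (T1 T2 : P -> R) (x : P) a b :
  (forall i j, derivable (fun z => A z i j) (toC x) 1) -> \det (A (toC x)) = 1 ->
  (\forall y \near x, A (toC y) *m (map_mx Num.conj (A (toC y)))^T = gram_of (g (T1 y, T2 y))) ->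
  1 - dot (g (T1 x, T2 x)) (g (T1 x, T2 x)) != 0 ->
  (forall k, exists c d, grad (fc g k) (T1 x, T2 x) c d) ->
  grad T1 x a (- b) -> grad T2 x b a ->
  (\matrix_(i, j) derive1 (fun z => A z i j) (toC x)) != 0 -> a ^+ 2 + b ^+ 2 != 0.
Proof.
move=> dA det1 AG n0 Gg G1 G2; apply: contraNneq => ab0.
have a0 : a = 0.
  by apply/eqP; rewrite -sqrf_eq0; apply/eqP; have := sqr_ge0 a; have := sqr_ge0 b; lra.
have b0 : b = 0.
  by apply/eqP; rewrite -sqrf_eq0; apply/eqP; have := sqr_ge0 a; have := sqr_ge0 b; lra.
rewrite {}a0 {}b0 oppr0 in G1 G2.
pose y v := g (T1 v, T2 v).
have Gy k : grad (fc y k) x 0 0.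
  have [c [d H]] := Gg k; apply: grad_eq (grad_comp G1 G2 H) _ _; ring.
have GG := gram_of_grad0 n0 Gy.
set D := \matrix_(i, j) _.
suff H : D *m (map_mx Num.conj (A (toC x)))^T = 0.
  have U : (map_mx Num.conj (A (toC x)))^T \in unitmx.
    by rewrite unitmxE det_tr det_map_mx det1 rmorph1 unitr1.
  by have := congr1 (mulmx^~ (invmx (map_mx Num.conj (A (toC x)))^T)) H; rewrite mulmxK // mul0mx => ->.
pose Re i j v := complex.Re (A (toC v) i j); pose Im i j v := complex.Im (A (toC v) i j).
pose d i j := derive1 (fun z => A z i j) (toC x).
have GA i j := derivable_grad (dA i j).
apply/matrixP => i j; rewrite mxE sum2 !mxE.
have HRe : grad (fun v => Re i 0 v * Re j 0 v + Im i 0 v * Im j 0 v +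
    (Re i 1 v * Re j 1 v + Im i 1 v * Im j 1 v)) x 0 0.
  apply: (grad_near _ (GG i j).1); apply: filterS AG => v /matrixP/(_ i j) <-.
  rewrite mxE sum2 !mxE /Re /Im.
  case: (A _ i 0) => ? ?; case: (A _ j 0) => ? ?; case: (A _ i 1) => ? ?; case: (A _ j 1) => ? ? /=; ring.
have HIm : grad (fun v => Im i 0 v * Re j 0 v - Re i 0 v * Im j 0 v +
    (Im i 1 v * Re j 1 v - Re i 1 v * Im j 1 v)) x 0 0.
  apply: (grad_near _ (GG i j).2); apply: filterS AG => v /matrixP/(_ i j) <-.
  rewrite mxE sum2 !mxE /Re /Im.
  case: (A _ i 0) => ? ?; case: (A _ j 0) => ? ?; case: (A _ i 1) => ? ?; case: (A _ j 1) => ? ? /=; ring.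
have [R1 R2] := grad_unique HRe (gradD (gradD (gradM (GA i 0).1 (GA j 0).1) (gradM (GA i 0).2 (GA j 0).2))
   (gradD (gradM (GA i 1).1 (GA j 1).1) (gradM (GA i 1).2 (GA j 1).2))).
have [I1 I2] := grad_unique HIm (gradD (gradB (gradM (GA i 0).2 (GA j 0).1) (gradM (GA i 0).1 (GA j 0).2))
   (gradB (gradM (GA i 1).2 (GA j 1).1) (gradM (GA i 1).1 (GA j 1).2))).
move: R1 R2 I1 I2; rewrite -/(d i 0) -/(d i 1) -/(d j 0) -/(d j 1).
case: (d i 0) => p1 p2; case: (d i 1) => q1 q2; case: (d j 0) => s1 s2; case: (d j 1) => t1 t2.
case: (A _ i 0) => a1 a2; case: (A _ i 1) => b1 b2; case: (A _ j 0) => c1 c2; case: (A _ j 1) => e1 e2 /=.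
move=> R1 R2 I1 I2; congr Complex => /=; lra.
Qed.

End RepDerivative.

(** * Growth at a pole *)

Section PoleAsymptotics.
Variable R : realType.
Local Notation P := (R * R)%type.
Local Notation C := (cplx R).

Lemma nC_continuous : continuous (@nC R).
Proof.
move=> w; apply/(@cvgrPdist_le R R C (nbhs w)) => e e0.
apply/nbhsCP; exists e => // v vw; apply: le_trans (ltW vw).
rewrite ler_norml; apply/andP; split.
  by have := nCD (v - w) w; rewrite subrK; lra.
by have := nCD (w - v) v; rewrite subrK nC_dist; lra.
Qed.

Lemma derivable_continuousC (h : C -> C) z : derivable h z 1 -> {for z, continuous h}.
Proof. by move=> /derivable1_diffP; exact: differentiable_continuous. Qed.

Lemma pole_entry (g : C -> C) z0 k n : has_pole_order g z0 k -> (k <= n)%N ->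
  exists2 l : R, 0 <= l /\ (k = n -> (0 < n)%N -> 0 < l) &
    nC (g z) ^+ 2 * nC (z - z0) ^+ (2 * n) @[z --> z0^'] --> l.
Proof.
move=> [h [dh gh h0]] kn.
pose H z := nC (h z) ^+ 2 * nC (z - z0) ^+ (2 * (n - k)).
have ch : {for z0, continuous h} by apply: derivable_continuousC; exact: nbhs_singleton dh.
have cn : {for z0, continuous (fun z => nC (h z))}.
  by apply: (@continuous_comp C C R h (@nC R)); [exact: ch|exact: nC_continuous].
have cd : {for z0, continuous (fun z => nC (z - z0))}.
  apply: (@continuous_comp C C R (fun z => z - z0) (@nC R)); last exact: nC_continuous.
  by apply: (@continuousB C C C id (fun=> z0)); [exact: cvg_id|exact: cst_continuous].
have cH : H z @[z --> z0] --> H z0.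
  apply: (@continuousM R C (fun z => nC (h z) ^+ 2) (fun z => nC (z - z0) ^+ (2 * (n - k)))).
    by apply: (@continuous_comp C R R (fun z => nC (h z)) (fun t => t ^+ 2)); [exact: cn|exact: exprn_continuous].
  by apply: (@continuous_comp C R R (fun z => nC (z - z0)) (fun t => t ^+ (2 * (n - k)))); [exact: cd|exact: exprn_continuous].
exists (H z0).
  split; first by rewrite mulr_ge0 // exprn_ge0 // nC_ge0.
  move=> kE n0; rewrite /H kE subnn muln0 expr0 mulr1 exprn_gt0 // nC_gt0.
  by case: h0 => // k0; rewrite -kE k0 in n0.
have E : \forall z \near z0^', H z = nC (g z) ^+ 2 * nC (z - z0) ^+ (2 * n).
  apply: filterS gh => z Ez; rewrite /H -Ez nCM nCX exprMn -exprM mulrAC -exprD.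
  by rewrite [(k * 2)%N]mulnC -mulnDr subnKC // mulrC.
apply: cvg_trans (near_eq_cvg E) _.
by apply: cvg_trans cH; apply: cvg_app; exact: cvg_within.
Qed.

Lemma punctured_filter (z0 : C) : Filter z0^'. Proof. exact: within_filter. Qed.

(** After multiplication by |z - z0|^(2n), an entry of pole order k tends to 0
    if k < n, and to a positive limit if k = n > 0; if n = 0 the constant 2
    keeps the limit positive. *)
Lemma pole_matrix (A : C -> 'M[C]_2) z0 (k : 'I_2 -> 'I_2 -> nat) :
  (forall i j, has_pole_order (fun z => A z i j) z0 (k i j)) ->
  let n := \max_(i < 2) \max_(j < 2) k i j in
  exists2 L : R, 0 < L &
    (2 + frob (A z)) * nC (z - z0) ^+ (2 * n) @[z --> z0^'] --> L.
Proof.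
move=> H n; have FF := punctured_filter z0.
have kn i j : (k i j <= n)%N.
  exact: (leq_trans (leq_bigmax (F := fun j => k i j) j) (leq_bigmax (F := fun i => \max_(j < 2) k i j) i)).
have [l00 [p00 q00] c00] := pole_entry (H 0 0) (kn 0 0).
have [l01 [p01 q01] c01] := pole_entry (H 0 1) (kn 0 1).
have [l10 [p10 q10] c10] := pole_entry (H 1 0) (kn 1 0).
have [l11 [p11 q11] c11] := pole_entry (H 1 1) (kn 1 1).
have hz0 : has_pole_order (fun=> 1 : C) z0 0.
  exists (fun=> 1); split; [by apply: filterE => z; exact: derivable_cst| |by left].
  by apply: filterE => z; rewrite expr0 mul1r.
have [l l0 cl] : exists2 l : R, 0 <= l /\ (n = 0%N -> 0 < l) & 2 * nC (z - z0) ^+ (2 * n) @[z --> z0^'] --> l.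
  have [l' [l0 _] cl'] := pole_entry hz0 (leq0n n).
  have n1 : nC (1 : C) = 1 by rewrite nCE /= expr0n /= expr1n addr0 sqrtr1.
  have [n0|n0] := eqVneq n 0%N.
    exists 2; first by rewrite ltr0n.
    by rewrite n0 muln0; under eq_fun do rewrite expr0 mulr1; exact: cvg_cst.
  exists (2 * l'); first by split; [rewrite mulr_ge0|move=> n0'; rewrite n0' in n0].
  apply: (@cvgM _ _ _ FF _ _ (2 : R)); first exact: cvg_cst.
  by move: cl'; under eq_fun do rewrite n1 expr1n mul1r.
exists (l + (l00 + l01 + (l10 + l11))).
  have [n0|n0] := eqVneq n 0%N.
    by have := l0.2 n0; lra.
  have n0' : (0 < n)%N by rewrite lt0n.
  have c2 : (0 < #|'I_2|)%N by rewrite card_ord.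
  have [i Ei] := @bigop.eq_bigmax _ (fun i : 'I_2 => \max_(j < 2) k i j) c2.
  have [j Ej] := @bigop.eq_bigmax _ (fun j : 'I_2 => k i j) c2.
  have : k i j = n by rewrite /n Ei Ej.
  move: l0.1 p00 p01 p10 p11 => a0 a1 a2 a3 a4; move: i j {Ei Ej}; apply: ord2P; apply: ord2P => kE.
  - by have := q00 kE n0'; lra.
  - by have := q01 kE n0'; lra.
  - by have := q10 kE n0'; lra.
  - by have := q11 kE n0'; lra.
have C1 := @cvgD _ _ _ _ FF _ _ _ _ c00 c01.
have C2 := @cvgD _ _ _ _ FF _ _ _ _ c10 c11.
have C3 := @cvgD _ _ _ _ FF _ _ _ _ cl (@cvgD _ _ _ _ FF _ _ _ _ C1 C2).
apply: cvg_trans C3; apply: near_eq_cvg; apply: filterE => z.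
by rewrite /frob !sum2 !fctE /=; ring.
Qed.

End PoleAsymptotics.

(** * Inverses of holomorphic maps *)

Section EndAsymptotics.
Variable R : realType.
Local Notation P := (R * R)%type.
Local Notation C := (cplx R).
Local Notation E3 := 'rV[R]_3.

Lemma inverse_derivable (U S : C -> C) w : derivable U (S w) 1 -> derive1 U (S w) != 0 ->
  {for w, continuous S} -> (\forall v \near w, U (S v) = v) -> derivable S w 1.
Proof.
move=> /derivable_eps HU; set d := derive1 U _ => d0 /contCP cS US.
have nd : 0 < nC d by rewrite nC_gt0.
have Uw : U (S w) = w by exact: nbhs_singleton US.
apply: (@eps_derivable _ _ _ d^-1) => e e0.
pose e' := Num.min (nC d / 2) (e * nC d ^+ 2 / 2).
have e'0 : 0 < e' by rewrite lt_min !divr_gt0 // mulr_gt0 // exprn_gt0.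
have [r r0 Hr] := HU e' e'0.
have [r1 r10 Hr1] := cS (r / 2) (divr_gt0 r0 (ltr0n R 2)).
have /nbhsCP[r2 r20 Hr2] := US.
exists (Num.min r1 r2) => [|v]; first by rewrite lt_min r10.
rewrite lt_min => /andP[v1 v2].
have Sv : nC (S v - S w) < r by apply: le_lt_trans (Hr1 v v1) _; rewrite ltr_pdivrMr // ltr_pMr // ltr1n.
have := Hr _ Sv; rewrite (Hr2 v v2) Uw; set D := S v - S w => H.
have D1 : nC D * nC d <= 2 * nC (v - w).
  have h1 := nCD (v - w) (- (v - w - d * D)).
  have E : v - w - (v - w - d * D) = d * D by ring.
  rewrite E nCN nCM in h1.
  have h2 : e' * nC D <= nC d / 2 * nC D by rewrite ler_wpM2r ?nC_ge0 // /e' ge_min lexx.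
  have := le_trans h1 (lerD (lexx _) (le_trans H h2)); lra.
have -> : D - d^-1 * (v - w) = - (d^-1 * (v - w - d * D)) by field; exact: d0.
rewrite nCN nCM nCV mulrC ler_pdivrMr //; apply: le_trans H _.
have h3 : e' * nC D <= e * nC d ^+ 2 / 2 * nC D by rewrite ler_wpM2r ?nC_ge0 // /e' ge_min lexx orbT.
apply: le_trans h3 _.
have -> : e * nC d ^+ 2 / 2 * nC D = e * nC d / 2 * (nC D * nC d) by ring.
have -> : e * nC (v - w) * nC d = e * nC d / 2 * (2 * nC (v - w)) by field.
by rewrite ler_wpM2l // divr_ge0 // mulr_ge0 // ltW.
Qed.

Lemma derivable_shift (S : C -> C) w0 c v : derivable S (v + w0) 1 ->
  derivable (fun w => S (w + w0) - c) v 1.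
Proof.
move=> /derivable_eps H; apply: (@eps_derivable _ _ _ (derive1 S (v + w0))) => e e0.
have [r r0 Hr] := H e e0; exists r => // w wv.
have E : w + w0 - (v + w0) = w - v by ring.
have := Hr (w + w0); rewrite E => /(_ wv).
by rewrite (_ : S (w + w0) - S (v + w0) = S (w + w0) - c - (S (v + w0) - c)) //; ring.
Qed.

(** The inverse S is continuous at w0 and holomorphic around it, hence
    Lipschitz at w0. So U does not contract the distance to its base point by
    arbitrarily small factors, as it would if its derivative vanished. *)
Lemma inverse_deriv_neq0 (U S : C -> C) w0 : derivable U (S w0) 1 ->
  (\forall w \near w0, [/\ {for w, continuous S}, U (S w) = w &
     w != w0 -> derivable U (S w) 1 /\ derive1 U (S w) != 0]) ->
  derive1 U (S w0) != 0.
Proof.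
move=> dU H; set z0 := S w0.
have [cS0 US0 _] : [/\ {for w0, continuous S}, U (S w0) = w0 &
     w0 != w0 -> derivable U (S w0) 1 /\ derive1 U (S w0) != 0] by exact: nbhs_singleton H.
have [r1 r10 H1] := (contCP S w0).1 cS0 1 ltr01.
have /nbhsCP[r2 r20 H2] := H.
pose r := Num.min r1 r2 / 4.
have r0 : 0 < r by rewrite divr_gt0 // lt_min r10.
pose S0 w := S (w + w0) - z0.
have sm (z : P) : `|z| <= r -> nC (toC z + w0 - w0) < r1 /\ nC (toC z + w0 - w0) < r2.
  move=> zr; rewrite addrK.
  have h : nC (toC z) <= 2 * r by apply: le_trans (nC_le _) _; rewrite ler_wpM2l.
  have m1 : Num.min r1 r2 <= r1 by rewrite ge_min lexx.
  have m2 : Num.min r1 r2 <= r2 by rewrite ge_min lexx orbT.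
  have m0 : 0 < Num.min r1 r2 by rewrite lt_min r10.
  by split; apply: le_lt_trans h _; rewrite /r; lra.
have near_eqv (v : C) : nC (v - w0) < r2 -> \forall w \near v, U (S w) = w.
  move=> hv; apply/nbhsCP; exists (r2 - nC (v - w0)); first by rewrite subr_gt0.
  move=> w hw; have := H2 w _; case=> //.
  have -> : w - w0 = (w - v) + (v - w0) by ring.
  by apply: le_lt_trans (nCD _ _) _; rewrite -ltrBrDr.
have [||||K [d1 [d10 Hd]]] := @lipschitz_at0 R r r0 S0 1.
- move=> z /sm[h1 h2]; have [cS _ _] := H2 _ h2.
  apply: (@continuousB C C C (fun w => S (w + w0)) (fun=> z0)); last exact: cst_continuous.
  apply: (@continuous_comp C C C (fun w => w + w0) S); last exact: cS.
  by apply: (@continuousD C C C id (fun=> w0)); [exact: cvg_id|exact: cst_continuous].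
- by move=> z /sm[h1 h2]; exact: H1.
- move=> z /sm[h1 h2] z0'; have [cS _ dS] := H2 _ h2.
  apply: derivable_shift; have [|a b] := dS.
    by rewrite -subr_eq0 addrK.
  exact: inverse_derivable a b cS (near_eqv _ h2).
- by rewrite /S0 add0r subrr.
apply/eqP => d0.
have K0 : 0 < `|K| + 1 by rewrite ltr_wpDl.
pose e := (2 * (`|K| + 1))^-1.
have e0 : 0 < e by rewrite invr_gt0 mulr_gt0.
have [r3 r30 H3] := derivable_eps dU e0.
have [r4 r40 H4] := (contCP S w0).1 cS0 (r3 / 2) (divr_gt0 r30 (ltr0n R 2)).
pose t := Num.min (Num.min r2 r4) d1 / 2.
have t0 : 0 < t by rewrite divr_gt0 // !lt_min r20 r40.
have nt : nC (realC t) = t by rewrite nCE /= expr0n addr0 sqrtr_sqr ger0_norm // ltW.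
have [t2 t4 t1] : [/\ t < r2, t < r4 & t < d1].
  have m0 : 0 < Num.min (Num.min r2 r4) d1 by rewrite !lt_min r20 r40.
  have lt : t < Num.min (Num.min r2 r4) d1 by rewrite /t ltr_pdivrMr // ltr_pMr // ltr1n.
  by move: lt; rewrite !lt_min => /andP[/andP[]].
have := Hd (realC t); rewrite nt => /(_ t1); rewrite /S0.
set w := realC t + w0.
have E : w - w0 = realC t by rewrite addrK.
have wr2 : nC (w - w0) < r2 by rewrite E nt.
have [_ Uw _] := H2 w wr2.
have h4 := H4 w; rewrite E nt in h4.
have h5 : nC (S w - S w0) < r3.
  by apply: le_lt_trans (h4 t4) _; rewrite ltr_pdivrMr // ltr_pMr // ltr1n.
have := H3 _ h5; rewrite Uw US0 d0 mul0r subr0 E nt -/z0 => h6 h7.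
have h8 : e * nC (S w - z0) <= e * (K * t) by rewrite ler_wpM2l // ltW.
have h9 : e * (K * t) <= t / 2.
  have kk : K <= `|K| + 1 by apply: le_trans (ler_norm K) _; rewrite lerDl.
  have -> : t / 2 = e * ((`|K| + 1) * t) by rewrite /e; field; exact: lt0r_neq0.
  by rewrite ler_wpM2l ?(ltW e0) // ler_wpM2r // ltW.
have := le_trans h6 (le_trans h8 h9); lra.
Qed.

End EndAsymptotics.

(** * The height near an end *)

Section Surface.
Variable R : realType.
Local Notation P := (R * R)%type.
Local Notation C := (cplx R).
Local Notation E3 := 'rV[R]_3.

Lemma near_toC (Q : C -> Prop) (x : P) : (\forall w \near toC x, Q w) ->
  \forall y \near x, Q (toC y).
Proof. exact: toC_continuous. Qed.

Lemma cimg_mem (X : topologicalType) (c : chart R X) x : cdom c x -> cimg c (cmap c x).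
Proof. by move=> cx; exists x. Qed.

Lemma cinv_mem (X : topologicalType) (c : chart R X) z : cimg c z ->
  cdom c (cinv c z) /\ cmap c (cinv c z) = z.
Proof. by move=> [x cx <-]; rewrite cmapK. Qed.

Lemma chart_image_open (X : topologicalType) (c : chart R X) (O : set X) : open O ->
  open (cmap c @` (cdom c `&` O)).
Proof.
move=> oO; rewrite openE => _ [x [cx Ox] <-].
have iz : cimg c (cmap c x) by exact: cimg_mem.
have n1 : \forall z \near cmap c x, cimg c z by apply: open_nbhs_nbhs; split; [exact: cimg_open|exact: iz].
have n2 : \forall z \near cmap c x, O (cinv c z).
  have := @cinv_continuous _ _ c _ iz; apply; rewrite cmapK //; exact: (near_open oO Ox).
by apply: filterS2 n1 n2 => z /cinv_mem[h1 h2] h3; exists (cinv c z).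
Qed.

Lemma chart_image_mem (X : topologicalType) (c : chart R X) (O : set X) z :
  (cmap c @` (cdom c `&` O)) z -> [/\ cimg c z, cdom c (cinv c z), O (cinv c z) & cmap c (cinv c z) = z].
Proof. by move=> [x [cx Ox] <-]; rewrite cmapK //; split=> //; exact: cimg_mem. Qed.

Variables (M : riemannSurface R) (E : set M) (f : M -> E3) (Mt : riemannSurface R)
  (u : Mt -> M) (F : Mt -> 'M[C]_2).
Hypothesis fE : finite_set E.
Hypothesis bf : bryant_surface (~` E) f.
Hypothesis hF : bryant_representation E f u F.

Lemma closed_finite (A : set M) : finite_set A -> closed A.
Proof.
exact: (accessible_finite_set_closed.1 (hausdorff_accessible (@rs_hausdorff R M))).
Qed.

Lemma open_offE : open (~` E).
Proof. by apply: closed_openC; exact: closed_finite. Qed.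

Definition patch (c : chart R M) : set P := @toC R @^-1` (cmap c @` (cdom c `&` ~` E)).

Lemma open_patch c : open (patch c).
Proof. by apply: open_toC; apply: chart_image_open; exact: open_offE. Qed.

Let hol : holomorphic_map u. Proof. by case: hF => -[]. Qed.
Let cu : continuous u. Proof. by case: hol. Qed.

Lemma lift_derivable c ct q : rs_atlas c -> rs_atlas ct -> cdom ct q -> cdom c (u q) ->
  derivable (fun z => cmap c (u (cinv ct z))) (cmap ct q) 1.
Proof. by move=> ac act dq du; case: hol => _; apply. Qed.

(** Off the ends the covering map is not critical: f o u determines F F^* and
    factors through u, whereas F is immersed. *)
Lemma lift_deriv_neq0 c ct q : rs_atlas c -> rs_atlas ct -> cdom ct q -> cdom c (u q) ->
  ~ E (u q) -> derive1 (fun z => cmap c (u (cinv ct z))) (cmap ct q) != 0.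
Proof.
move=> ac act dq du nE; set U := fun z => _.
have dU : derivable U (cmap ct q) 1 by exact: lift_derivable.
have [_ _ h1 h2] := hF.
have [dF F0 _] := h2 ct q act dq nE.
have [detF _] := h1 q nE.
set x := ofC (cmap ct q).
have xE : toC x = cmap ct q by rewrite ofCK.
have UE : U (cmap ct q) = cmap c (u q) by rewrite /U cmapK.
pose T1 y := complex.Re (U (toC y)); pose T2 y := complex.Im (U (toC y)).
have TE y : toC (T1 y, T2 y) = U (toC y) by rewrite -[RHS]ofCK.
have [g1 g2] : grad T1 x (complex.Re (derive1 U (cmap ct q))) (- complex.Im (derive1 U (cmap ct q))) /\
    grad T2 x (complex.Im (derive1 U (cmap ct q))) (complex.Re (derive1 U (cmap ct q))).
  by rewrite -xE in dU *; exact: derivable_grad dU.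
have [cg bg] := bf ac.
have px : patch c (T1 x, T2 x).
  by rewrite /patch /= TE xE UE; exists (u q).
have gx : local_rep f c (T1 x, T2 x) = f (u q) by rewrite /local_rep TE xE UE cmapK.
suff : complex.Re (derive1 U (cmap ct q)) ^+ 2 + complex.Im (derive1 U (cmap ct q)) ^+ 2 != 0.
  by rewrite -nC_sqr sqrf_eq0 nC_eq0.
apply: (@rep_deriv_neq0 R (fun z => F (cinv ct z)) (local_rep f c) T1 T2 x (complex.Re (derive1 U (cmap ct q))) (complex.Im (derive1 U (cmap ct q)))).
- by move=> i j; rewrite xE; exact: dF.
- by rewrite xE cmapK.
- have n1 : \forall z \near cmap ct q, cimg ct z by apply: open_nbhs_nbhs; split; [exact: cimg_open|exact: (cimg_mem dq)].
  have cc : u (cinv ct z) @[z --> cmap ct q] --> u q.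
    have : {for cmap ct q, continuous (fun z => u (cinv ct z))}.
      apply: (@continuous_comp _ _ _ (cinv ct) u); last exact: cu.
      exact: (cinv_continuous (cimg_mem dq)).
    by rewrite /prop_for /continuous_at cmapK.
  have n2 : \forall z \near cmap ct q, cdom c (u (cinv ct z)) by apply: cc; exact: (near_open (@cdom_open _ _ c) du).
  have n3 : \forall z \near cmap ct q, ~ E (u (cinv ct z)).
    by apply: (cc (~` E)); apply: open_nbhs_nbhs; split; [exact: open_offE|exact: nE].
  pose Q z := F (cinv ct z) *m (map_mx Num.conj (F (cinv ct z)))^T =
      gram_of (f (u (cinv ct z))) /\ cdom c (u (cinv ct z)).
  have : \forall z \near cmap ct q, Q z.
    by apply: filterS2 n2 n3 => z z2 z3; rewrite /Q; have [d b] := h1 _ z3; have [_ ->] := bryant_gram d b.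
  rewrite -xE => /near_toC; apply: filterS => y [-> z2].
  by rewrite /local_rep TE /U cmapK.
- have := height_gt0 (conj cg bg) px; rewrite /height => h; exact: lt0r_neq0.
- move=> k; have Ck1 : Ck 1 (patch c) (fc (local_rep f c) k).
    by apply: smooth_Ck; [exact: open_patch|case: cg].
  by eexists; eexists; exact: Ck_grad Ck1 px.
- exact: g1.
- exact: g2.
- by move: F0; rewrite xE.
Qed.

Section AtEnd.
Variables (p : M) (q : Mt) (c : chart R M).
Hypothesis uq : u q = p.
Hypothesis ac : rs_atlas c.
Hypothesis cp : cdom c p.

Let ct := chart_at q.
Let act : rs_atlas ct. Proof. by rewrite /ct /chart_at; case: cid => ? []. Qed.
Let ctq : cdom ct q. Proof. by rewrite /ct /chart_at; case: cid => ? []. Qed.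
Let w0 := cmap c p.
Let z0 := cmap ct q.
Let U := fun z => cmap c (u (cinv ct z)).

(** The local inverse of the covering map, given by the sheet through q. *)
Lemma local_inverse : exists S : C -> C, S w0 = z0 /\
  (\forall w \near w0, [/\ {for w, continuous S}, U (S w) = w, cimg c w, cdom ct (cinv ct (S w)) &
     cmap ct (cinv ct (S w)) = S w /\ u (cinv ct (S w)) = cinv c w]).
Proof.
have [[[_ _ /(_ p)[V [oV Vp [I [s [cs us _ _ sq]]]]]] _ _] _ _ _] := hF.
have [i si] : exists i, s i (u q) = q by apply: sq; rewrite uq.
rewrite uq in si.
have iw0 : cimg c w0 by exact: cimg_mem.
have K0 : cinv c w0 = p by rewrite /w0 cmapK.
exists (fun w => cmap ct (s i (cinv c w))); split; first by rewrite K0 si.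
have n1 : \forall w \near w0, cimg c w.
  by apply: open_nbhs_nbhs; split; [exact: cimg_open|exact: iw0].
have cc : cinv c w @[w --> w0] --> p.
  by have := cinv_continuous iw0; rewrite /prop_for /continuous_at K0.
have n2 : \forall w \near w0, V (cinv c w) by apply: cc; apply: open_nbhs_nbhs; split.
have cS : s i (cinv c w) @[w --> w0] --> q.
  rewrite -si -K0; apply: (@continuous_comp _ _ _ (cinv c) (s i)).
    exact: cinv_continuous iw0.
  by apply: cs; rewrite K0.
have n3 : \forall w \near w0, cdom ct (s i (cinv c w)).
  by apply: cS; apply: open_nbhs_nbhs; split; [exact: cdom_open|exact: ctq].
near=> w.
have h1 : cimg c w by near: w.
have h2 : V (cinv c w) by near: w.
have h3 : cdom ct (s i (cinv c w)) by near: w.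
rewrite /U cmapK // us //; have [_ ->] := cinv_mem h1.
split=> //.
apply: (@continuous_comp _ _ _ (fun w => s i (cinv c w)) (cmap ct)); last exact: cmap_continuous.
apply: (@continuous_comp _ _ _ (cinv c) (s i)); last exact: cs.
exact: cinv_continuous.
Unshelve. all: by end_near. Qed.

Lemma near_offE : \forall w \near w0, w != w0 -> cimg c w -> ~ E (cinv c w).
Proof.
have K0 : cinv c w0 = p by rewrite /w0 cmapK.
have oE : open (~` (E `\ p)) by apply: closed_openC; apply: closed_finite; exact: finite_setD.
have iw0 : cimg c w0 by exact: cimg_mem.
have : \forall w \near w0, ~ (E `\ p) (cinv c w).
  have := cinv_continuous iw0; rewrite /prop_for /continuous_at K0 => cc; apply: (cc (~` (E `\ p))).
  by apply: open_nbhs_nbhs; split => // -[_]; apply.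
apply: filterS => w H /eqP ww0 iw Ew; apply: H; split; first exact: Ew.
by move=> E'; apply: ww0; have [_ <-] := cinv_mem iw; rewrite E'.
Qed.

Lemma lift_deriv_at : derivable U z0 1 /\ derive1 U z0 != 0.
Proof.
have [S [S0 nS]] := local_inverse.
have dU : derivable U z0 1 by apply: lift_derivable => //; rewrite uq.
split=> //; rewrite -S0; apply: inverse_deriv_neq0; first by rewrite S0.
apply: filterS2 nS near_offE => w [h1 h2 h3 h4 [h5 h6]] h7; split; [exact: h1|exact: h2|move=> ww0].
have du : cdom c (u (cinv ct (S w))) by rewrite h6; have [] := cinv_mem h3.
rewrite -h5; split; first exact: (lift_derivable ac act h4 du).
apply: (lift_deriv_neq0 ac act h4 du); rewrite h6; exact: h7.
Qed.

Lemma log_identity (a r w : R) (m : nat) : 0 < a -> 0 < r -> 0 < w ->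
  - ln (4 / a) + m%:R * ln (w ^+ 2) = ln (a * r ^+ (2 * m) * (w / r) ^+ (2 * m) / 4).
Proof.
move=> a0 r0 w0'.
have -> : a * r ^+ (2 * m) * (w / r) ^+ (2 * m) / 4 = (4 / a)^-1 * (w ^+ 2) ^+ m.
  by rewrite -exprM expr_div_n; field; rewrite expf_neq0 ?lt0r_neq0.
have p1 : 0 < 4 / a by rewrite divr_gt0.
have p2 : 0 < w ^+ 2 by rewrite exprn_gt0.
transitivity (ln (4 / a)^-1 + ln ((w ^+ 2) ^+ m)); first by rewrite lnV ?posrE // [in RHS]lnXn // (mulr_natl _ m).
by rewrite lnM ?posrE ?invr_gt0 ?exprn_gt0.
Qed.

(** The height is 4 / (2 + |F|^2), which behaves like the 2n-th power of the
    distance to the puncture in a chart of the covering surface. Passing to a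
    chart of M only multiplies that distance by a factor with a finite nonzero
    limit, by [lift_deriv_at]. *)
Lemma end_asymptotics : meromorphic_mx F -> exists l : R,
  - ln (height (local_rep f c) x) + (pole_order_mx F q)%:R * ln (qd (ofC w0) x)
    @[x --> (ofC w0)^'] --> l.
Proof.
move=> mF; set n := pole_order_mx F q.
have [S [S0 nS]] := local_inverse; have [dU d0] := lift_deriv_at.
pose k i j := pole_order (entry_rep F ct i j) z0.
have hk i j : has_pole_order (entry_rep F ct i j) z0 (k i j).
  by have [k0 hk0] := mF ct q act ctq i j; apply: (xgetPex 0%N); exists k0.
have [L L0 HL] : exists2 L : R, 0 < L &
    (2 + frob (F (cinv ct z))) * nC (z - z0) ^+ (2 * n) @[z --> z0^'] --> L.
  exact: pole_matrix hk.
set x0 := ofC w0; have x0E : toC x0 = w0 by rewrite ofCK.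
have Uz0 : U z0 = w0 by rewrite /U /z0 cmapK // uq.
have F0 : Filter x0^' by exact: within_filter.
have F1 : Filter z0^' by exact: within_filter.
have cS : {for w0, continuous S} by have [] := nbhs_singleton nS.
have nS' : \forall x \near x0, [/\ U (S (toC x)) = toC x, cimg c (toC x), cdom ct (cinv ct (S (toC x))),
    cmap ct (cinv ct (S (toC x))) = S (toC x) & u (cinv ct (S (toC x))) = cinv c (toC x)].
  have N := nS; rewrite -x0E in N; have := near_toC N.
  by apply: filterS => x [? ? ? ? []].
have nE' : \forall x \near x0, toC x != w0 -> cimg c (toC x) -> ~ E (cinv c (toC x)).
  by have N := near_offE; rewrite -x0E in N; have := near_toC N; rewrite x0E.
have SzC : S (toC x) @[x --> x0^'] --> z0^'.
  move=> A zA; have zA' : \forall z \near z0, z != z0 -> A z := zA.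
  suff : \forall x \near x0, x != x0 -> A (S (toC x)) by [].
  have : \forall x \near x0, S (toC x) != z0 -> A (S (toC x)).
    have C1 : {for x0, continuous (fun x => S (toC x))}.
      by apply: (@continuous_comp P C C (@toC R) S); [exact: toC_continuous|rewrite x0E].
    have := C1; rewrite /prop_for /continuous_at x0E S0 => C2.
    exact: (C2 (fun z => z != z0 -> A z) zA').
  apply: filterS2 nS' => x [h1 _ _ _ _] h2 /eqP xx0; apply: h2; apply/eqP => Sz.
  by apply: xx0; rewrite Sz Uz0 in h1; rewrite /x0 h1 toCK.
have rho0 : nC (U z - w0) / nC (z - z0) @[z --> z0^'] --> nC (derive1 U z0).
  apply/(@cvgrPdist_le R R C z0^') => e e0.
  have [r r0 Hr] := derivable_eps dU e0.
  rewrite near_withinE; apply/nbhsCP; exists r => // z zr zz0.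
  have pz : 0 < nC (z - z0) by rewrite nC_gt0 subr_eq0.
  have := Hr z zr; rewrite Uz0; set D := derive1 U z0 => H.
  rewrite -(ler_pM2r pz) -[X in _ * X <= _](ger0_norm (ltW pz)) -normrM mulrBl divfK ?lt0r_neq0 //.
  apply: le_trans H; rewrite -nCM ler_norml; apply/andP; split.
    have := nCD (D * (z - z0)) (U z - w0 - D * (z - z0)).
    have -> : D * (z - z0) + (U z - w0 - D * (z - z0)) = U z - w0 by ring.
    lra.
  have := nCD (U z - w0) (- (U z - w0 - D * (z - z0))).
  have -> : U z - w0 + - (U z - w0 - D * (z - z0)) = D * (z - z0) by ring.
  rewrite nCN; lra.
pose H z := (2 + frob (F (cinv ct z))) * nC (z - z0) ^+ (2 * n) * (nC (U z - w0) / nC (z - z0)) ^+ (2 * n) / 4.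
pose L' := L * nC (derive1 U z0) ^+ (2 * n) / 4.
have L'0 : 0 < L' by rewrite /L' divr_gt0 // mulr_gt0 // exprn_gt0 // nC_gt0.
have HH : H z @[z --> z0^'] --> L'.
  have c2 : (nC (U z - w0) / nC (z - z0)) ^+ (2 * n) @[z --> z0^'] --> nC (derive1 U z0) ^+ (2 * n).
    apply: (@cvg_comp _ _ _ (fun z => nC (U z - w0) / nC (z - z0)) (fun t => t ^+ (2 * n)) z0^' _ _ rho0).
    exact: exprn_continuous.
  apply: (@cvgM _ _ _ F1 _ _ _ _ _ (cvg_cst _)).
  exact: (@cvgM _ _ _ F1 _ _ _ _ HL c2).
exists (ln L').
have lnH : ln (H (S (toC x))) @[x --> x0^'] --> ln L'.
  apply: (@cvg_comp _ _ _ (fun x => H (S (toC x))) (@ln R) x0^' (nbhs L')); last exact: continuous_ln.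
  exact: cvg_comp SzC HH.
apply: cvg_trans lnH; apply: near_eq_cvg.
rewrite near_withinE; apply: filterS2 nS' nE' => x [h1 h2 h3 h4 h5] h6 /eqP xx0.
have xw : toC x != w0 by apply/eqP => E'; apply: xx0; rewrite /x0 -E' toCK.
have nEx := h6 xw h2.
have [_ _ /(_ (cinv ct (S (toC x)))) hd _] := hF.
rewrite h5 in hd; have [d b] := hd nEx; have [hE _] := bryant_gram d b.
have frob0 : 0 <= frob (F (cinv ct (S (toC x)))).
  by rewrite /frob; apply: sumr_ge0 => i _; apply: sumr_ge0 => j _; exact: sqr_ge0.
have Sz : S (toC x) != z0.
  by apply/eqP => Sz; move/eqP: xw; apply; rewrite -h1 Sz Uz0.
rewrite /height /local_rep hE /H h1 -log_identity ?nC_gt0 ?subr_eq0 //; last by rewrite ltr_wpDr.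
by congr (_ + _ * ln _); rewrite /qd -x0E -toCB nC_sqr /toC /=.
Qed.

End AtEnd.

End Surface.

Arguments open_patch {R M E} fE c.

(** * Changes of charts and densities *)

Section Transitions.
Variable R : realType.
Local Notation P := (R * R)%type.
Local Notation C := (cplx R).
Local Notation E3 := 'rV[R]_3.
Variables (M : riemannSurface R) (E : set M) (f : M -> E3).
Hypothesis fE : finite_set E.
Hypothesis bf : bryant_surface (~` E) f.
Implicit Types (c d : chart R M) (x : P).

Definition tr c d x : P := ofC (cmap d (cinv c (toC x))).

Definition overlap c d : set P := @toC R @^-1` (cmap c @` (cdom c `&` (cdom d `&` ~` E))).

Lemma patchP c x : patch E c x <-> cimg c (toC x) /\ ~ E (cinv c (toC x)).
Proof.
split=> [/chart_image_mem[h1 _ h3 _] //|[[m cm mE] h2]].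
by exists m; rewrite -mE cmapK // in h2 *; split.
Qed.

Lemma overlapP c d x : overlap c d x <->
  [/\ cimg c (toC x), cdom d (cinv c (toC x)) & ~ E (cinv c (toC x))].
Proof.
split=> [/chart_image_mem[h1 _ [h3 h4] _] //|[[m cm mE] h2 h3]].
by exists m; rewrite -mE cmapK // in h2 h3 *; split.
Qed.

Lemma overlap_patch c d : overlap c d `<=` patch E c.
Proof. by move=> x /overlapP[? ? ?]; apply/patchP. Qed.

Lemma open_overlap c d : open (overlap c d).
Proof.
apply: open_toC; apply: chart_image_open; apply: openI; first exact: cdom_open.
exact: open_offE.
Qed.

Arguments open_overlap : clear implicits.

Lemma trE c d x : cimg c (toC x) -> cdom d (cinv c (toC x)) ->
  [/\ cimg d (toC (tr c d x)), cinv d (toC (tr c d x)) = cinv c (toC x) & tr d c (tr c d x) = x].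
Proof.
move=> ix dx; rewrite /tr !ofCK cmapK //; split=> //; first exact: cimg_mem.
by have [_ ->] := cinv_mem ix; rewrite toCK.
Qed.

Lemma tr_overlap c d x : overlap c d x -> overlap d c (tr c d x) /\ tr d c (tr c d x) = x.
Proof.
move=> /overlapP[h1 h2 h3]; have [k1 k2 k3] := trE h1 h2; split=> //.
by apply/overlapP; rewrite k2; split=> //; have [] := cinv_mem h1.
Qed.

Lemma tr_CR c d x : rs_atlas c -> rs_atlas d -> overlap c d x ->
  exists a b, grad (fun y => (tr c d y).1) x a (- b) /\ grad (fun y => (tr c d y).2) x b a.
Proof.
move=> ac ad /overlapP[h1 h2 h3]; have [k1 k2] := cinv_mem h1.
have H := @rs_holomorphic _ _ _ _ ac ad _ k1 h2; rewrite k2 in H.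
by have [g1 g2] := derivable_grad H; eexists; eexists; split; [exact: g1|exact: g2].
Qed.

Lemma smooth_sub (U V : set P) (g : P -> E3) : V `<=` U -> conformal_immersion U g -> conformal_immersion V g.
Proof. by move=> VU [h1 h2]; split=> [s x /VU|x /VU]; [exact: h1|exact: h2]. Qed.

Lemma Ck_tr n c d : rs_atlas c -> rs_atlas d ->
  Ck n (overlap c d) (fun y => (tr c d y).1) /\ Ck n (overlap c d) (fun y => (tr c d y).2).
Proof.
move=> ac ad; have [cc _] := bf ac; have [cd _] := bf ad.
apply: (@bootstrap R (overlap c d) (patch E d) (local_rep f c) (local_rep f d)).
- exact: open_overlap.
- exact: open_patch.
- exact: smooth_sub (@overlap_patch c d) cc.
- exact: cd.
- move=> x ox; have [h _] := tr_overlap ox; have /overlapP[h1 h2 h3] := ox.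
  have [k1 k2 k3] := trE h1 h2; have -> : ((tr c d x).1, (tr c d x).2) = tr c d x by case: (tr c d x).
  by split; [exact: overlap_patch h|rewrite /local_rep k2].
- by move=> x; exact: tr_CR.
Qed.

Definition tr_a c d x := d1 (fun y => (tr c d y).1) x.
Definition tr_b c d x := d1 (fun y => (tr c d y).2) x.
Definition jac c d x := tr_a c d x ^+ 2 + tr_b c d x ^+ 2.

Lemma tr_grad c d x : rs_atlas c -> rs_atlas d -> overlap c d x ->
  grad (fun y => (tr c d y).1) x (tr_a c d x) (- tr_b c d x) /\
  grad (fun y => (tr c d y).2) x (tr_b c d x) (tr_a c d x).
Proof.
move=> ac ad ox; have [a [b [g1 g2]]] := tr_CR ac ad ox.
by rewrite /tr_a /tr_b (grad_d1 g1) (grad_d1 g2).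
Qed.

(** By the chain rule for the change of charts followed by its inverse. *)
Lemma jac_neq0 c d x : rs_atlas c -> rs_atlas d -> overlap c d x -> jac c d x != 0.
Proof.
move=> ac ad ox; have [g1 g2] := tr_grad ac ad ox; have [ox' _] := tr_overlap ox.
have [k1 k2] := tr_grad ad ac ox'.
have E1 : ((tr c d x).1, (tr c d x).2) = tr c d x by case: (tr c d x).
rewrite -E1 in k1 k2.
have G := grad_comp g1 g2 k1.
have N : \forall y \near x, (fun y => (tr d c ((tr c d y).1, (tr c d y).2)).1) y = y.1.
  have := near_open (open_overlap c d) ox; apply: filterS => y /tr_overlap[_ h].
  by rewrite -[in RHS]h; case: (tr c d y).
have [e1 e2] := grad_unique (grad_near N G) (grad_fst x).
apply/eqP => J0; rewrite /jac in J0.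
have a0 : tr_a c d x = 0.
  apply/eqP; rewrite -sqrf_eq0; apply/eqP.
  have := sqr_ge0 (tr_a c d x); have := sqr_ge0 (tr_b c d x); lra.
have b0 : tr_b c d x = 0.
  apply/eqP; rewrite -sqrf_eq0; apply/eqP.
  have := sqr_ge0 (tr_a c d x); have := sqr_ge0 (tr_b c d x); lra.
by move: e1; rewrite a0 b0 !mulr0 addr0 => /esym/eqP; rewrite oner_eq0.
Qed.

Lemma Ck_jac n c d : rs_atlas c -> rs_atlas d -> Ck n (overlap c d) (jac c d).
Proof.
move=> ac ad; have [h1 h2] := Ck_tr n.+1 ac ad; have oO := open_overlap c d.
by apply: (CkD oO); apply: (CkX 2 oO); exact: Ck_d1.
Qed.

Lemma tr_continuous c d x : rs_atlas c -> rs_atlas d -> overlap c d x -> {for x, continuous (tr c d)}.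
Proof.
move=> ac ad ox; have [h1 h2] := Ck_tr 0 ac ad.
have -> : tr c d = (fun y => ((tr c d y).1, (tr c d y).2)) by apply/funext => y; case: (tr c d y).
apply: (@cvg_pair _ _ _ _ (nbhs (tr c d x).1) (nbhs (tr c d x).2)); [exact: h1|exact: h2].
Qed.

(** The coefficients of a 2-form defined off the ends; the Jacobian of a
    conformal change of charts is |T'|^2. *)
Definition density (om : chart R M -> P -> R) := forall c d, rs_atlas c -> rs_atlas d ->
  forall x, overlap c d x -> om c x = om d (tr c d x) * jac c d x.

Definition in_chart (h : M -> R) c : P -> R := fun x => h (cinv c (toC x)).

(** The Laplacian of a function is a 2-form because changes of charts are
    conformal. *)
Lemma density_lap (h : M -> R) : (forall c, rs_atlas c -> Ck 2 (patch E c) (in_chart h c)) ->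
  density (fun c => lap (in_chart h c)).
Proof.
move=> Ch c d ac ad x ox; have oO := open_overlap c d; have [t1 t2] := Ck_tr 2 ac ad.
have [ox' _] := tr_overlap ox.
have E1 y : ((tr c d y).1, (tr c d y).2) = tr c d y by case: (tr c d y).
have Chd : Ck 2 (overlap d c) (in_chart h d) by apply: Ck_sub (Ch d ad); exact: overlap_patch.
have Chc : Ck 2 (overlap c d) (in_chart h c) by apply: Ck_sub (Ch c ac); exact: overlap_patch.
have hE y : overlap c d y -> in_chart h c y = in_chart h d ((tr c d y).1, (tr c d y).2).
  by move=> /overlapP[k1 k2 _]; rewrite E1 /in_chart; have [_ -> _] := trE k1 k2.
rewrite (lap_ext oO ox hE Chc).
rewrite (@lap_comp R (overlap c d) (overlap d c)) //.
- exact: open_overlap.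
- by move=> y /tr_overlap[]; rewrite E1.
- move=> y oy; have [g1 g2] := tr_grad ac ad oy.
  by rewrite (grad_d1 g1) (grad_d2 g1) (grad_d1 g2) (grad_d2 g2).
Qed.

Lemma density_max0 (om : chart R M -> P -> R) : density om ->
  density (fun c x => max0 (om c x)).
Proof.
move=> H c d ac ad x ox; rewrite (H c d ac ad x ox).
have J0 : 0 <= jac c d x by rewrite addr_ge0 // sqr_ge0.
rewrite /max0; case: (leP 0 (om d _)) => h.
  by rewrite max_r // mulr_ge0.
by rewrite max_l ?mul0r // mulr_le0_ge0 // ltW.
Qed.

Lemma densityN (om : chart R M -> P -> R) : density om -> density (fun c x => - om c x).
Proof. by move=> H c d ac ad x ox; rewrite (H c d ac ad x ox) mulNr. Qed.

End Transitions.

Arguments open_overlap {R M E} fE c d.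

(** * Integration over the surface *)

Section Cells.
Variable R : realType.
Local Notation P := (R * R)%type.
Local Notation C := (cplx R).
Local Notation E3 := 'rV[R]_3.
Local Notation MP := (measurableTypeR R * measurableTypeR R)%type.
Local Notation mble A := (@measurable _ MP A).
Local Notation mu2 := (@lebesgue_measure R \x @lebesgue_measure R)%E.

Lemma finite_null (N : set P) : finite_set N -> mble N /\ mu2 N = 0%E.
Proof.
move=> /finite_seqP[s ->]; elim: s => [|a s [IH1 IH2]].
  by rewrite set_nil measure0; split=> //; exact: measurable0.
have -> : [set` a :: s] = [set a] `|` [set` s].
  by apply/seteqP; split=> x /=; rewrite inE => /predU1P.
have m1 := measurable_point2 a; have m2 : mble ([set a] `|` [set` s]) by exact: measurableU.
split=> //; rewrite measureU0 //; exact: mu2_point.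
Qed.

Lemma finite_measurable_fun (N : set P) (g : P -> R) : finite_set N -> @measurable_fun _ _ MP R N g.
Proof.
move=> fN _ Y mY; apply: (finite_null _).1.
by apply: sub_finite_set fN => x [].
Qed.

Variables (M : riemannSurface R) (E : set M) (f : M -> E3).
Hypothesis fE : finite_set E.
Hypothesis bf : bryant_surface (~` E) f.
Variables (n : nat) (cc : 'I_n -> chart R M) (U : 'I_n -> set M).
Hypothesis acc : forall i, rs_atlas (cc i).
Hypothesis oU : forall i, open (U i).
Hypothesis Ucc : forall i, U i `<=` cdom (cc i).
Hypothesis Ucov : forall m, ~ E m -> exists i, U i m.

(** The ends are left out, so that the changes of charts are smooth on the
    cells. *)
Definition cell i : set M := [set m | [/\ U i m, forall l : 'I_n, (l < i)%N -> ~ U l m & ~ E m]].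

Lemma cell_cover m : ~ E m -> exists i, cell i m.
Proof.
move=> nE; have [i0 Ui0] := Ucov nE; have p0 : `[< U i0 m >] by exact/asboolP.
exists [arg min_(i < i0 | `[< U i m >]) (i : nat)].
case: arg_minnP => // i /asboolP Ui min; split=> // l li /asboolP Ul.
by have := min l Ul; rewrite leqNgt li.
Qed.

Lemma cell_inj i j m : cell i m -> cell j m -> i = j.
Proof.
move=> [Ui mi _] [Uj mj _].
have h1 : (i <= j)%N by rewrite leqNgt; apply/negP => h; exact: (mi j h Uj).
have h2 : (j <= i)%N by rewrite leqNgt; apply/negP => h; exact: (mj i h Ui).
by apply: val_inj; apply: anti_leq; rewrite h1 h2.
Qed.

Definition in_cell (c : chart R M) i : set P := [set x | patch E c x /\ cell i (cinv c (toC x))].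

Lemma in_cell_patch c i : in_cell c i `<=` patch E c.
Proof. by move=> x []. Qed.

Lemma in_cell_measurable c i : mble (in_cell c i).
Proof.
pose A l : set P := @toC R @^-1` (cmap c @` (cdom c `&` (U l `&` ~` E))).
have oA l : open (A l).
  by apply: open_toC; apply: chart_image_open; apply: openI => //; exact: open_offE.
have AP l x : A l x <-> patch E c x /\ U l (cinv c (toC x)).
  split=> [/chart_image_mem[h1 _ [h3 h4] _]|[/patchP[h1 h2] h3]].
    by split=> //; apply/patchP.
  by have [k1 k2] := cinv_mem h1; exists (cinv c (toC x)).
have -> : in_cell c i = A i `\` \bigcup_(l in [set l : 'I_n | (l < i)%N]) A l.
  apply/seteqP; split=> x.
    by move=> [px [Ui mi nE]]; split; [apply/AP|move=> [l /= li] /AP[_ /(mi l li)]].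
  move=> [/AP[px Ui] H]; split=> //; split=> //; last by have /patchP[] := px.
  by move=> l li Ul; apply: H; exists l => //; apply/AP.
apply: measurableD; first exact: open_measurable2.
by apply: open_measurable2; apply: bigcup_open.
Qed.

Definition cellD i : set P := in_cell (cc i) i.

Section Density.
Variable om : chart R M -> P -> R.
Hypothesis dom : density E om.
Hypothesis com : forall c, rs_atlas c -> Ck 0 (patch E c) (om c).
Hypothesis om0 : forall c x, rs_atlas c -> patch E c x -> 0 <= om c x.

Definition total : \bar R := (\sum_(i < n) \int[mu2]_(x in cellD i) (om (cc i) x)%:E)%E.

Lemma om_measurable c (A : set P) : rs_atlas c -> A `<=` patch E c ->
  @measurable_fun _ _ MP _ A (fun x => (om c x)%:E).
Proof.
move=> ac Ap; apply/measurable_EFinP; apply: (measurable_funS _ Ap).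
  by apply: open_measurable2; exact: open_patch.
by apply: open_continuous_measurable; [exact: open_patch|exact: com].
Qed.

Lemma integral_cells c (D : set P) : rs_atlas c -> mble D -> D `<=` patch E c ->
  (\int[mu2]_(x in D) (om c x)%:E = \sum_(i < n) \int[mu2]_(x in D `&` in_cell c i) (om c x)%:E)%E.
Proof.
move=> ac mD Dp.
have DE : D = \big[setU/set0]_(i < n) (D `&` in_cell c i).
  rewrite -(bigcup_seq (index_enum 'I_n) (fun i => D `&` in_cell c i)); apply/seteqP; split=> x.
    move=> Dx; have /patchP[h1 /cell_cover[i ci]] := Dp x Dx.
    by exists i; [rewrite /= mem_index_enum|split=> //; split=> //; exact: Dp].
  by move=> [i _ []].
rewrite [in LHS]DE (@ge0_integral_bigsetU _ MP _ mu2) //.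
- by move=> i; apply: measurableI => //; exact: in_cell_measurable.
- exact: index_enum_uniq.
- by move=> i j _ _ [x [[_ [_ hi]] [_ [_ hj]]]]; exact: cell_inj hi hj.
- by rewrite -DE; exact: om_measurable.
- by rewrite -DE => x /Dp px; rewrite lee_fin om0.
Qed.

Definition pull c (D : set P) i : set P := [set y | overlap E (cc i) c y /\ D (tr (cc i) c y)].

Lemma cell_change c (D : set P) i : rs_atlas c -> mble D ->
  (\int[mu2]_(x in D `&` in_cell c i) (om c x)%:E =
   \int[mu2]_(y in cellD i `&` pull c D i) (om (cc i) y)%:E)%E.
Proof.
move=> ac mD; have ai := acc i.
have DO : D `&` in_cell c i `<=` overlap E c (cc i).
  move=> x [_ [/patchP[h1 h2] [h3 _ _]]]; apply/overlapP; split=> //; exact: Ucc h3.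
have mDi : mble (D `&` in_cell c i) by apply: measurableI => //; exact: in_cell_measurable.
have := @change_of_variables R (overlap E c (cc i)) (overlap E (cc i) c) (tr c (cc i)) (tr (cc i) c)
  (tr_a c (cc i)) (tr_b c (cc i)) (open_overlap fE c (cc i)) (open_overlap fE (cc i) c)
  (@tr_overlap _ _ _ c (cc i)) (@tr_overlap _ _ _ (cc i) c)
  (fun y => tr_continuous fE bf ai ac) (fun x => tr_grad ac ai) (fun x => jac_neq0 fE ac ai)
  (fun x => Ck_continuous (Ck_jac fE bf 0 ac ai)) (D `&` in_cell c i) (fun y => (om (cc i) y)%:E) mDi DO.
move=> /(_ _ _) H.
transitivity (\int[mu2]_(x in D `&` in_cell c i) ((om (cc i) (tr c (cc i) x))%:E * (tr_a c (cc i) x ^+ 2 + tr_b c (cc i) x ^+ 2)%:E))%E.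
  apply: eq_integral => x; rewrite inE => /DO ox.
  by rewrite (dom ac ai ox) EFinM.
rewrite H.
- have -> : overlap E (cc i) c `&` tr (cc i) c @^-1` (D `&` in_cell c i) = cellD i `&` pull c D i => //.
  apply/seteqP; split=> y.
    move=> [oy [Dy [_ cy]]]; have /overlapP[h1 h2 h3] := oy; have [_ k2 _] := trE h1 h2.
    rewrite k2 in cy; split; last by split.
    by split=> //; apply/patchP.
  move=> [[py cy] [oy Dy]]; split=> //; split=> //; split.
    by have [h4 _] := tr_overlap oy; exact: overlap_patch h4.
  by have /overlapP[h1 h2 h3] := oy; have [_ -> _] := trE h1 h2.
- by apply: om_measurable => //; exact: overlap_patch.
- by move=> y oy; rewrite lee_fin om0 //; exact: overlap_patch oy.
Qed.

Lemma pull_measurable c D i : rs_atlas c -> mble D -> mble (cellD i `&` pull c D i).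
Proof.
move=> ac mD; apply: measurableI; first exact: in_cell_measurable.
have -> : pull c D i = overlap E (cc i) c `&` tr (cc i) c @^-1` D by apply/seteqP; split=> y [].
apply: preimage_measurable => //; first exact: open_overlap.
by move=> x ox; exact: (tr_continuous fE bf (acc i) ac ox).
Qed.

(** Each part of D that lies in a cell is moved to the chart of that cell. *)
Lemma density_split c (D : set P) : rs_atlas c -> mble D -> D `<=` patch E c ->
  (\int[mu2]_(x in D) (om c x)%:E =
   \sum_(i < n) \int[mu2]_(y in cellD i `&` pull c D i) (om (cc i) y)%:E)%E.
Proof.
move=> ac mD Dp; rewrite integral_cells //; apply: eq_bigr => i _; exact: cell_change.
Qed.

(** A density that vanishes outside the domain of a chart can be integrated in
    that chart. *)
Lemma total_supp c : rs_atlas c ->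
  (forall i y, cellD i y -> ~ cdom c (cinv (cc i) (toC y)) -> om (cc i) y = 0) ->
  total = (\int[mu2]_(x in patch E c) (om c x)%:E)%E.
Proof.
move=> ac H; have mp : mble (patch E c) by apply: open_measurable2; exact: open_patch.
rewrite density_split //; apply: eq_bigr => i _.
rewrite integral_mkcond [RHS]integral_mkcond; apply: eq_integral => y _; rewrite !patchE.
case: ifPn => [|/negP] hy; case: ifPn => [|/negP] hy' //.
  rewrite inE in hy; rewrite (H i y hy) // => dy; apply: hy'; rewrite inE; split=> //.
  have [/patchP[h1 h2] _] := hy.
  have oy : overlap E (cc i) c y by apply/overlapP.
  by have [h4 _] := tr_overlap oy; split; last exact: (overlap_patch h4).
by exfalso; apply: hy; apply: mem_set; have [] := set_mem hy'.
Qed.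

End Density.

Lemma off_patch_null c (D : set P) : D `<=` @toC R @^-1` cimg c -> finite_set (D `\` patch E c).
Proof.
move=> Dc; apply: (@sub_finite_set _ _ ((fun m => ofC (cmap c m)) @` E)); last exact: finite_image.
move=> x [Dx /patchP px]; have ix := Dc x Dx.
exists (cinv c (toC x)); first by apply: contrapT => nE; apply: px.
by have [_ ->] := cinv_mem ix; rewrite toCK.
Qed.

(** The supremum is attained by the cells: the cells cut the pieces of any
    other family into parts which, once moved to the charts of the cells, are
    disjoint. The ends do not matter, being finitely many. *)
Lemma surface_integral_total (om : chart R M -> P -> R) : density E om ->
  (forall c, rs_atlas c -> Ck 0 (patch E c) (om c)) -> (forall c x, 0 <= om c x) ->
  surface_integral (fun c x => (om c x)%:E) = total om.
Proof.
move=> dom com om0; apply/eqP; rewrite eq_le; apply/andP; split; last first.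
  apply: ereal_sup_ubound; exists n, cc, cellD; split=> //.
  - by move=> i; exact: in_cell_measurable.
  - by move=> i x [/patchP[]].
  - move=> i j ij; apply/seteqP; split=> // m [[x [_ xi] xE] [y [_ yj] yE]].
    rewrite xE in xi; rewrite yE in yj.
    by move/eqP: ij; apply; exact: cell_inj xi yj.
apply: ub_ereal_sup => _ [m [c [D [ac mD Dc disj ->]]]].
have mp a : mble (D a `&` patch E (c a)).
  by apply: measurableI; [exact: mD|apply: open_measurable2; exact: open_patch].
(* The ends contained in a piece form a null set. *)
have E1 : forall a : 'I_m, (\int[mu2]_(x in D a) (om (c a) x)%:E = \int[mu2]_(x in D a `&` patch E (c a)) (om (c a) x)%:E)%E.
  move=> a; have fN := off_patch_null (Dc a).
  have [mN N0] := finite_null fN.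
  have DN : D a `\` (D a `\` patch E (c a)) = D a `&` patch E (c a) by rewrite setDD.
  rewrite (@ge0_negligible_integral _ MP _ mu2 (D a) (D a `\` patch E (c a))) ?DN //.
  - exact: mD.
  - apply/measurable_EFinP; rewrite -(setUIDK (D a) (patch E (c a))).
    apply/measurable_funU => //; split; last exact: finite_measurable_fun.
    by apply/measurable_EFinP; exact: om_measurable.
  - by move=> x _; rewrite lee_fin.
have E2 : forall b : 'I_m, (\int[mu2]_(x in D b) (om (c b) x)%:E <=
    \sum_(i < n) \int[mu2]_(y in cellD i `&` pull (c b) (D b `&` patch E (c b)) i) (om (cc i) y)%:E)%E.
  move=> b; rewrite E1 (density_split dom com (fun c x _ _ => om0 c x) (ac b) (mp b)) //.
apply: le_trans (lee_sum _ (fun b _ => E2 b)) _.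
rewrite exchange_big /=; apply: lee_sum => i _.
pose A a := cellD i `&` pull (c a) (D a `&` patch E (c a)) i.
have mA a : mble (A a) by exact: pull_measurable.
have mi : mble (cellD i) by exact: in_cell_measurable.
have Ai a : A a `<=` cellD i by move=> y [].
(* Disjointness of the pieces is a statement about points of the surface,
   which does not depend on the chart used to read them. *)
have tA : trivIset [set` index_enum 'I_m] A.
  move=> a b _ _ [y [[_ [oa [Da _]]] [_ [ob [Db _]]]]]; apply/eqP; apply: contraT => ab.
  have := disj a b ab; rewrite -subset0 => /(_ (cinv (cc i) (toC y)))[]; split.
    exists (tr (cc i) (c a) y) => //; have /overlapP[h1 h2 _] := oa.
    by have [_ -> _] := trE h1 h2.
  exists (tr (cc i) (c b) y) => //; have /overlapP[h1 h2 _] := ob.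
  by have [_ -> _] := trE h1 h2.
have mo : @measurable_fun _ _ MP _ (cellD i) (fun x => (om (cc i) x)%:E).
  by apply: om_measurable => //; exact: in_cell_patch.
have UA : \big[setU/set0]_(a <- index_enum 'I_m) A a `<=` cellD i.
  by rewrite -bigcup_seq => y [a _ /Ai].
have mU : mble (\big[setU/set0]_(a <- index_enum 'I_m) A a).
  by apply: bigsetU_measurable => a _; exact: mA.
rewrite -(@ge0_integral_bigsetU _ MP _ mu2 _ A _ (index_enum 'I_m)) //.
- by apply: (@ge0_subset_integral _ MP _ mu2) => // x _; rewrite lee_fin.
- exact: index_enum_uniq.
- exact: measurable_funS mo.
- by move=> x _; rewrite lee_fin.
Qed.

End Cells.

(** * Discs and bump functions *)

Section Discs.
Variable R : realType.
Local Notation P := (R * R)%type.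
Local Notation C := (cplx R).
Local Notation E3 := 'rV[R]_3.
Variables (M : riemannSurface R) (E : set M) (f : M -> E3).
Hypothesis fE : finite_set E.
Hypothesis bf : bryant_surface (~` E) f.
Hypothesis ends : forall p, E p -> smooth_bryant_end f p.

Definition ctr (c : chart R M) (p : M) : P := ofC (cmap c p).

(** Around an end the disc contains no other end, and f stays immersed, which
    keeps the Willmore density bounded; the other discs avoid the ends. *)
Definition good (p : M) (c : chart R M) (r : R) : Prop :=
  [/\ rs_atlas c, cdom c p, 0 < r,
    forall x, qd (ctr c p) x <= r ^+ 2 ->
      cimg c (toC x) /\ (E (cinv c (toC x)) -> x = ctr c p) &
    E p -> exists2 V, open V /\ V (ctr c p) & conformal_immersion V (local_rep f c)].

Lemma toC_ctr c p : toC (ctr c p) = cmap c p. Proof. exact: ofCK. Qed.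

Lemma good_radius p c : rs_atlas c -> cdom c p ->
  (E p -> exists2 V, open V /\ V (ctr c p) & conformal_immersion V (local_rep f c)) ->
  exists r, good p c r.
Proof.
move=> ac cp HV.
have ip : cimg c (toC (ctr c p)) by rewrite toC_ctr; exact: cimg_mem.
have K0 : cinv c (toC (ctr c p)) = p by rewrite toC_ctr cmapK.
have oE : open (~` (E `\ p)) by apply: closed_openC; apply: closed_finite; exact: finite_setD.
have n1 : \forall w \near toC (ctr c p), cimg c w.
  by apply: open_nbhs_nbhs; split; [exact: cimg_open|exact: ip].
have n2 : \forall w \near toC (ctr c p), ~ (E `\ p) (cinv c w).
  have := cinv_continuous ip; rewrite /prop_for /continuous_at K0 => cc; apply: (cc (~` (E `\ p))).
  by apply: open_nbhs_nbhs; split => // -[_]; apply.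
have n3 : \forall w \near toC (ctr c p), cimg c w /\ ~ (E `\ p) (cinv c w) by exact: filterI n1 n2.
have /nbhsPP[d d0 Hd] := near_toC n3.
exists (d / 2); split=> //; first by rewrite divr_gt0.
move=> x hx; have xd : `|x - ctr c p| < d.
  have h := le_trans (qd_ge _ _) hx.
  apply: le_lt_trans (_ : `|x - ctr c p| <= d / 2) _.
    by rewrite -(@ler_pXn2r _ 2) // nnegrE ?normr_ge0 // divr_ge0 // ltW.
  by rewrite ltr_pdivrMr // ltr_pMr // ltr1n.
have [h1 h2] := Hd x xd; split=> // Ex; apply: contrapT => xc; apply: h2; split=> // E'.
by apply: xc; have [_ h3] := cinv_mem h1; rewrite /ctr -E' h3 toCK.
Qed.

Lemma good_exists p : exists cr : chart R M * R, good p cr.1 cr.2.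
Proof.
have [Ep|nE] := pselect (E p).
  have [c [r [[ac cp r0 _] [_ _ ci]]]] := ends Ep.
  have [|rr H] := good_radius ac cp; last by exists (c, rr).
  move=> _; exists (@toC R @^-1` ball (cmap c p) r) => //; split.
    by apply: open_toC; exact: ball_open.
  by rewrite /= toC_ctr; exact: ballxx.
have [c [ac cp]] := rs_cover p.
by have [|rr H] := good_radius ac cp; last by exists (c, rr).
Qed.

Section Bump.
Variables (p : M) (c : chart R M) (r : R).
Hypothesis g : good p c r.

Let ac : rs_atlas c. Proof. by case: g. Qed.
Let cp : cdom c p. Proof. by case: g. Qed.
Let r0 : 0 < r. Proof. by case: g. Qed.
Let x0 := ctr c p.

Definition disc : set M := [set m | cdom c m /\ qd x0 (ofC (cmap c m)) < r ^+ 2].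

Definition cdisc : set M := (fun x => cinv c (toC x)) @` [set x | qd x0 x <= r ^+ 2].

Definition bump (m : M) : R :=
  if `[< cdom c m >] then max0 (r ^+ 2 - qd x0 (ofC (cmap c m))) ^+ 3 else 0.

Definition pbump (x : P) : R := max0 (r ^+ 2 - qd x0 x) ^+ 3.

Lemma disc_center : disc p.
Proof. by split=> //; rewrite /qd /x0 /ctr !subrr expr0n addr0 exprn_gt0. Qed.

Lemma qd_cont : continuous (qd x0).
Proof. by move=> x; exact: (Ck_continuous (Ck_qd 0 x0 openT) (x := x) Logic.I). Qed.

Lemma open_qd_lt (t : R) : open [set x | qd x0 x < t].
Proof.
by apply: (@open_comp _ _ (qd x0) [set s | s < t]); [move=> x _; exact: qd_cont|exact: open_lt].
Qed.

Lemma open_qd_gt (t : R) : open [set x | t < qd x0 x].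
Proof.
by apply: (@open_comp _ _ (qd x0) [set s | t < s]); [move=> x _; exact: qd_cont|exact: open_gt].
Qed.

Arguments open_qd_lt : clear implicits.
Arguments open_qd_gt : clear implicits.

Lemma open_disc : open disc.
Proof.
rewrite openE => m [dm qm].
have n1 : \forall y \near m, cdom c y by apply: open_nbhs_nbhs; split; [exact: cdom_open|].
have cc : ofC (cmap c y) @[y --> m] --> ofC (cmap c m).
  apply: (@continuous_comp _ _ _ (cmap c) (@ofC R)); first exact: cmap_continuous.
  exact: ofC_continuous.
have n2 : \forall y \near m, qd x0 (ofC (cmap c y)) < r ^+ 2.
  exact: (cc _ (near_open (open_qd_lt (r ^+ 2)) qm)).
by apply: filterS2 n1 n2 => y h1 h2; split.
Qed.

Lemma disc_sub : disc `<=` cdom c. Proof. by move=> m []. Qed.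

Lemma bump_ge0 m : 0 <= bump m.
Proof. by rewrite /bump; case: ifP => // _; rewrite exprn_ge0 // /max0 le_max lexx. Qed.

Lemma bump_gt0 m : disc m -> 0 < bump m.
Proof.
move=> [dm qm]; rewrite /bump asboolT // exprn_gt0 // /max0 lt_max; apply/orP; right.
by rewrite subr_gt0.
Qed.

Lemma bump_out m : ~ cdisc m -> bump m = 0.
Proof.
move=> H; rewrite /bump; case: asboolP => // dm.
rewrite /max0 max_l ?expr0n // subr_le0 leNgt; apply/negP => h; apply: H.
by exists (ofC (cmap c m)); [exact: ltW|rewrite ofCK cmapK].
Qed.

Lemma disc_cdisc : disc `<=` cdisc.
Proof.
by move=> m [dm qm]; exists (ofC (cmap c m)); [exact: ltW|rewrite ofCK cmapK].
Qed.

Lemma closed_cdisc : closed cdisc.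
Proof.
apply: compact_closed; first exact: rs_hausdorff.
apply: continuous_compact.
  apply: continuous_in_subspaceT => x; rewrite inE /= => hx.
  have [_ _ _ /(_ x hx)[ix _] _] := g.
  by apply: (@continuous_comp _ _ _ (@toC R) (cinv c)); [exact: toC_continuous|exact: cinv_continuous].
pose I (a : R) := `[a - r, a + r]%classic.
apply: (@subclosed_compact _ _ (I x0.1 `*` I x0.2 : set P)).
- rewrite (_ : [set x | _] = ~` [set x | r ^+ 2 < qd x0 x]).
    by apply: open_closedC; exact: open_qd_gt.
  by apply/seteqP; split=> x /=; [move=> h; apply/negP; rewrite -leNgt|move=> /negP; rewrite -leNgt].
- by apply: compact_setX; exact: segment_compact.
- move=> x /= hx; have h := le_trans (qd_ge _ _) hx.
  have : `|x - x0| <= r by rewrite -(@ler_pXn2r _ 2) // nnegrE ?normr_ge0 // ltW.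
  rewrite prod_normE2 ge_max /= !ler_distl => /andP[a b].
  by split; rewrite /I /= in_itv.
Qed.

Lemma cdisc_end e : E e -> cdisc e -> e = p.
Proof.
move=> Ee [x hx xe]; have [_ _ _ /(_ x hx)[ix Hx] _] := g.
by rewrite -xe Hx ?xe // toC_ctr cmapK.
Qed.

Lemma Ck_pbump U : open U -> Ck 2 U pbump.
Proof.
move=> oU; apply: (Ck2_max0cube oU); apply: (CkB oU (Ck_cst _ _ oU)); exact: Ck_qd.
Qed.

Lemma bump_chart x : cimg c (toC x) -> bump (cinv c (toC x)) = pbump x.
Proof. by move=> /cinv_mem[h1 h2]; rewrite /bump asboolT // h2 toCK. Qed.

Lemma pbump_far x : r ^+ 2 <= qd x0 x -> pbump x = 0.
Proof. by move=> h; rewrite /pbump /max0 max_l ?expr0n // subr_le0. Qed.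

(** In the chart of the disc this is a change of charts; elsewhere the bump
    vanishes identically around the point, because the closed disc is compact,
    hence closed in the surface. *)
Lemma Ck_bump d : rs_atlas d -> Ck 2 (patch E d) (in_chart bump d).
Proof.
move=> ad; pose O2 : set P := @toC R @^-1` (cmap d @` (cdom d `&` (~` cdisc `&` ~` E))).
have oO2 : open O2.
  apply: open_toC; apply: chart_image_open; apply: openI; last exact: open_offE.
  by apply: closed_openC; exact: closed_cdisc.
have oO := open_overlap fE d c.
have C2 : Ck 2 O2 (in_chart bump d).
  apply: (Ck_ext oO2) (Ck_cst 2 0 oO2) => x /chart_image_mem[_ _ [h _] _].
  by rewrite /in_chart bump_out.
have C1 : Ck 2 (overlap E d c) (in_chart bump d).
  have [t1 t2] := Ck_tr fE bf 2 ad ac.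
  have oT : open [set: P] by exact: openT.
  have H := Ck_comp oO oT (fun _ _ => Logic.I) t1 t2 (Ck_pbump oT).
  apply: (Ck_ext oO) H => x /overlapP[h1 h2 h3].
  by rewrite /in_chart /bump asboolT.
apply: Ck_sub (CkU C1 C2) => x /patchP[h1 h2].
have [h3|h3] := pselect (cdom c (cinv d (toC x))); [left|right].
  by apply/overlapP.
have [k1 k2] := cinv_mem h1; exists (cinv d (toC x)) => //; split=> //; split=> // -[y hy ye].
by apply: h3; rewrite -ye; have [_ _ _ /(_ y hy)[/cinv_mem[]]] := g.
Qed.

Variable h : M -> R.
Hypothesis Ch : forall d, rs_atlas d -> Ck 2 (patch E d) (in_chart h d).

Definition cut (m : M) : R := bump m * h m.
(** [cut] read in the chart of the disc, and extended by zero to the plane. *)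
Definition pcut (x : P) : R := pbump x * in_chart h c x.

Lemma Ck_cut d : rs_atlas d -> Ck 2 (patch E d) (in_chart cut d).
Proof. by move=> ad; apply: (CkM (open_patch fE d)); [exact: Ck_bump|exact: Ch]. Qed.

Lemma cut_pcut x : cimg c (toC x) -> in_chart cut c x = pcut x.
Proof. by move=> ix; rewrite /in_chart /cut bump_chart. Qed.

Lemma pcut_far x : r ^+ 2 < qd x0 x -> pcut x = 0.
Proof. by move=> hx; rewrite /pcut pbump_far ?mul0r // ltW. Qed.

Lemma pcut_supp x : r < `|x - x0| -> pcut x = 0.
Proof.
move=> hx; apply: pcut_far; apply: lt_le_trans (qd_ge _ _).
by rewrite ltr_pXn2r // nnegrE ?normr_ge0 // ltW.
Qed.

Lemma Ck_pcut_gen (A : set P) : (forall x, A x -> qd x0 x <= r ^+ 2 -> patch E c x) ->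
  Ck 2 A pcut.
Proof.
move=> HA; have oF := open_qd_gt (r ^+ 2); have oP := open_patch fE c.
have C1 : Ck 2 [set x | r ^+ 2 < qd x0 x] pcut.
  by apply: (Ck_ext oF) (Ck_cst 2 0 oF) => x /pcut_far.
have C2 : Ck 2 (patch E c) pcut by apply: (CkM oP (Ck_pbump oP)); exact: Ch.
apply: Ck_sub (CkU C2 C1) => x Ax; have [hx|hx] := leP (qd x0 x) (r ^+ 2); last by right.
by left; exact: HA.
Qed.

Lemma Ck_pcut : Ck 2 (off x0) pcut.
Proof.
apply: Ck_pcut_gen => x xx0 hx; have [_ _ _ /(_ x hx)[ix Hx] _] := g.
by apply/patchP; split=> // /Hx.
Qed.

Lemma Ck_pcut_setT : ~ E p -> Ck 2 setT pcut.
Proof.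
move=> nE; apply: Ck_pcut_gen => x _ hx; have [_ _ _ /(_ x hx)[ix Hx] _] := g.
apply/patchP; split=> // Ex; apply: nE; have xE := Hx Ex.
by move: Ex; rewrite xE toC_ctr cmapK.
Qed.

Lemma lap_pcut x : patch E c x -> lap (in_chart cut c) x = lap pcut x.
Proof.
move=> px; apply: (lap_ext (open_patch fE c) px _ (Ck_cut ac)) => y /patchP[iy _].
exact: cut_pcut.
Qed.

Lemma lap_pcut_out x : ~ patch E c x -> x <> x0 -> lap pcut x = 0.
Proof.
move=> px xx0; apply: (@lap_loc _ _ 0).
have hx : r ^+ 2 < qd x0 x.
  rewrite ltNge; apply/negP => hx; apply: px; have [_ _ _ /(_ x hx)[ix Hx] _] := g.
  by apply/patchP; split=> // /Hx.
by have := near_open (open_qd_gt (r ^+ 2)) hx; apply: filterS => y /pcut_far.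
Qed.

Lemma lap_cut_out d y : patch E d y -> ~ cdom c (cinv d (toC y)) -> lap (in_chart cut d) y = 0.
Proof.
move=> /patchP[iy nE] nd; apply: (@lap_loc _ _ 0).
pose O2 : set P := @toC R @^-1` (cmap d @` (cdom d `&` ~` cdisc)).
have oO2 : open O2.
  by apply: open_toC; apply: chart_image_open; apply: closed_openC; exact: closed_cdisc.
have Oy : O2 y.
  have [k1 k2] := cinv_mem iy; exists (cinv d (toC y)) => //; split=> // -[z hz ze].
  by apply: nd; rewrite -ze; have [_ _ _ /(_ z hz)[/cinv_mem[]]] := g.
have := near_open oO2 Oy; apply: filterS => z /chart_image_mem[_ _ hz _].
by rewrite /in_chart /cut bump_out // mul0r.
Qed.

End Bump.

End Discs.

(** * The Willmore energy *)

Section Assembly.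
Variable R : realType.
Local Notation P := (R * R)%type.
Local Notation C := (cplx R).
Local Notation E3 := 'rV[R]_3.
Local Notation MP := (measurableTypeR R * measurableTypeR R)%type.
Local Notation mble A := (@measurable _ MP A).
Local Notation mu2 := (@lebesgue_measure R \x @lebesgue_measure R)%E.

Lemma lapD (U : set P) (g h : P -> R) x : open U -> Ck 2 U g -> Ck 2 U h -> U x ->
  lap (fun y => g y + h y) x = lap g x + lap h x.
Proof.
move=> oU Cg Ch Ux.
have N1 : \forall y \near x, d1 g y + d1 h y = d1 (fun y => g y + h y) y.
  by have := near_open oU Ux; apply: filterS => y Uy; rewrite (grad_d1 (gradD (Ck_grad Cg Uy) (Ck_grad Ch Uy))).
have N2 : \forall y \near x, d2 g y + d2 h y = d2 (fun y => g y + h y) y.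
  by have := near_open oU Ux; apply: filterS => y Uy; rewrite (grad_d2 (gradD (Ck_grad Cg Uy) (Ck_grad Ch Uy))).
have G1 := gradD (Ck_grad (Ck_d1 Cg) Ux) (Ck_grad (Ck_d1 Ch) Ux).
have G2 := gradD (Ck_grad (Ck_d2 Cg) Ux) (Ck_grad (Ck_d2 Ch) Ux).
by rewrite /lap (grad_d1 (grad_near N1 G1)) (grad_d2 (grad_near N2 G2)); ring.
Qed.

Lemma lap_sum (U : set P) (I : Type) (s : seq I) (h : I -> P -> R) x : open U ->
  (forall i, Ck 2 U (h i)) -> U x ->
  lap (fun y => \sum_(i <- s) h i y) x = \sum_(i <- s) lap (h i) x.
Proof.
move=> oU Ch Ux; elim: s => [|i s IH].
  rewrite big_nil; apply: (@lap_loc _ _ 0); apply: filterE => y; by rewrite big_nil.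
rewrite big_cons -IH -(lapD oU (Ch i) (Ck_sum s oU Ch) Ux).
by congr lap; apply/funext => y; rewrite big_cons.
Qed.

Lemma max0_measurable (g : MP -> R) : @measurable_fun _ _ MP R setT g ->
  @measurable_fun _ _ MP R setT (fun x => max0 (g x)).
Proof.
move=> mg; apply: (@measurableT_comp _ _ _ MP _ _ (@max0 R)) => //.
by apply: continuous_measurable_fun; exact: max0_continuous.
Qed.

Lemma max0_norm (t : R) : `|max0 t| <= `|t|.
Proof. by rewrite /max0; case: (leP 0 t) => _ //; rewrite normr0. Qed.

Lemma max0_diff (t : R) : max0 t - max0 (- t) = t.
Proof.
by rewrite /max0; case: (leP 0 t) => h; case: (leP 0 (- t)) => h'; lra.
Qed.

Lemma integral_parts (g : P -> R) : mu2.-integrable [set: MP] (EFin \o g) ->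
  exists a b : R, [/\ (\int[mu2]_(x in [set: MP]) (max0 (g x))%:E = a%:E)%E,
    (\int[mu2]_(x in [set: MP]) (max0 (- g x))%:E = b%:E)%E &
    a - b = (\int[mu2]_(x in [set: MP]) g x)%R].
Proof.
move=> ig; have /integrableP[/measurable_EFinP mg _] := ig.
have mT : mble setT by exact: measurableT.
have i1 : mu2.-integrable [set: MP] (EFin \o (fun x => max0 (g x))).
  apply: (le_integrable mT _ _ ig); first by apply/measurable_EFinP; exact: max0_measurable.
  by move=> x _; rewrite lee_fin; exact: max0_norm.
have i2 : mu2.-integrable [set: MP] (EFin \o (fun x => max0 (- g x))).
  apply: (le_integrable mT _ _ ig).
    by apply/measurable_EFinP; apply: max0_measurable; exact: measurableT_comp.
  by move=> x _; rewrite lee_fin -[leRHS]normrN; exact: max0_norm.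
exists (\int[mu2]_(x in [set: MP]) max0 (g x))%R, (\int[mu2]_(x in [set: MP]) max0 (- g x))%R; split.
- by rewrite /Rintegral fineK //; exact: integrable_fin_num i1.
- by rewrite /Rintegral fineK //; exact: integrable_fin_num i2.
- rewrite -RintegralB //; apply: eq_Rintegral => x _; exact: max0_diff.
Qed.

Variables (M : riemannSurface R) (E : set M) (f : M -> E3)
  (Mt : riemannSurface R) (u : Mt -> M) (F : Mt -> 'M[C]_2) (lift : M -> Mt).
Hypothesis fE : finite_set E.
Hypothesis bf : bryant_surface (~` E) f.
Hypothesis hF : bryant_representation E f u F.
Hypothesis hlift : forall p, E p -> u (lift p) = p.

Definition phi (m : M) : R := - ln (1 - dot (f m) (f m)).

Lemma Ck_phi n c : rs_atlas c -> Ck n (patch E c) (in_chart phi c).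
Proof.
move=> ac; have oP := open_patch fE c.
exact: (CkN oP (Ck_ln oP (height_gt0 (bf ac)) (Ck_height oP (bf ac) n))).
Qed.

Definition wil (c : chart R M) (x : P) : R :=
  mean_curvature (@metric_euc R) (local_rep f c) x ^+ 2 * area_density (@metric_euc R) (local_rep f c) x.

Lemma wil_ge0 c x : 0 <= wil c x.
Proof. by rewrite mulr_ge0 ?sqr_ge0 // sqrtr_ge0. Qed.

Lemma wil_lap c x : rs_atlas c -> patch E c x -> wil c x = lap (in_chart phi c) x.
Proof.
move=> ac px; have oP := open_patch fE c; have [cg _] := bf ac.
by rewrite /wil (wdensE oP cg px) (wdens_lap oP (bf ac) px).
Qed.

Lemma Ck_wil c : rs_atlas c -> Ck 0 (patch E c) (wil c).
Proof.
move=> ac; have oP := open_patch fE c.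
apply: (Ck_ext oP) (Ck_lap oP (Ck_phi 2 ac)) => x px; by rewrite wil_lap.
Qed.

Lemma density_wil : density E wil.
Proof.
move=> c d ac ad x ox; have px := overlap_patch ox.
have [oy _] := tr_overlap ox; have py := overlap_patch oy.
rewrite (wil_lap ac px) (wil_lap ad py); apply: (density_lap fE bf) => // e ae.
exact: Ck_phi.
Qed.

Section OneDisc.
Variables (p : M) (c : chart R M) (r : R) (h : M -> R).
Hypothesis g : good E f p c r.
Hypothesis Ch : forall d, rs_atlas d -> Ck 2 (patch E d) (in_chart h d).
Hypothesis near_end : E p -> \forall x \near ctr c p, pcut p c r h x = in_chart phi c x.

Let x0 := ctr c p.
Let nu : nat := if `[< E p >] then pole_order_mx F (lift p) else 0%N.

(** Near an end [pcut] agrees with [phi]: its Laplacian is the Willmore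
    density, bounded because f is immersed there, and its logarithmic pole is
    that of the height. A disc without end carries no singularity. *)
Lemma disc_residue : mu2.-integrable [set: MP] (EFin \o lap (pcut p c r h)) /\
  \int[mu2]_(x in [set: MP]) lap (pcut p c r h) x = 4 * pi * nu%:R.
Proof.
have [ac cp r0 gx gE] := g.
have Cp := Ck_pcut fE g Ch.
have supp x : r < `|x - x0| -> pcut p c r h x = 0 by apply: (pcut_supp g).
have lap0 x : r < `|x - x0| -> lap (pcut p c r h) x = 0.
  move=> hx; apply: (@lap_loc _ _ 0).
  by have := near_open (open_far x0 r) hx; apply: filterS => y /supp.
have oT : open [set: P] by exact: openT.
have [Ep|nE] := pselect (E p).
  have [V [oV Vx] cV] := gE Ep.
  have NE := near_end Ep.
  have [l Hl] : exists l : R, - ln (height (local_rep f c) x) + nu%:R * ln (qd x0 x) @[x --> x0^'] --> l.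
    rewrite /nu asboolT //; have [_ mF _ _] := hF.
    exact: (end_asymptotics fE bf hF (hlift Ep) ac cp mF).
  (* The Laplacian, given the value of the Willmore density at the end, is
     continuous with compact support, hence bounded. *)
  pose G x := if x == x0 then wdens (local_rep f c) x0 else lap (pcut p c r h) x.
  have /nbhs_interior NE' : nbhs x0 [set x | pcut p c r h x = in_chart phi c x] by exact: NE.
  have n3 : \forall x \near x0, patch E c x \/ x = x0.
    have : \forall x \near x0, qd x0 x <= r ^+ 2.
      have := near_open (open_qd_lt (p := p) (c := c) (t := r ^+ 2)); move/(_ x0).
      have q0 : qd x0 x0 < r ^+ 2 by rewrite /qd !subrr expr0n addr0 exprn_gt0.
      by move=> /(_ q0); apply: filterS => x /ltW.
    apply: filterS => x hx; have [ix Hx] := gx x hx.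
    by have [->|/eqP xx] := eqVneq x x0; [right|left; apply/patchP; split=> // /Hx].
  have GE : \forall x \near x0, wdens (local_rep f c) x = G x.
    apply: filterS2 NE' n3 => x nx [px|->]; last by rewrite /G eqxx.
    rewrite /G; case: eqVneq => [->//|xx].
    rewrite (wdens_lap (open_patch fE c) (bf ac) px).
    have N1 : \forall y \near x, pcut p c r h y = in_chart phi c y by exact: nx.
    pose W : set P := patch E c `&` [set y | pcut p c r h y = in_chart phi c y]^°.
    have oW : open W by apply: openI; [exact: open_patch|exact: open_interior].
    apply: (lap_ext oW (g := in_chart phi c)) => //.
      by move=> y [_ /interior_subset ->].
    by apply: Ck_sub (Ck_phi 2 ac) => y [].
  have cG : continuous G.
    move=> x; have [->|xx] := eqVneq x x0.
      have Cw := Ck_wdens oV cV Vx; rewrite /continuous_at.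
      have -> : G x0 = wdens (local_rep f c) x0 by rewrite /G eqxx.
      exact: cvg_trans (near_eq_cvg GE) Cw.
    have Cl := Ck_lap (open_off x0) Cp (x := x); rewrite /continuous_at.
    have -> : G x = lap (pcut p c r h) x by rewrite /G (negbTE xx).
    have ox : off x0 x by exact/eqP.
    apply: cvg_trans (Cl ox); apply: near_eq_cvg.
    by have := near_open (open_off x0) ox; apply: filterS => y /eqP/negbTE; rewrite /G => ->.
  have G0 x : r < `|x - x0| -> G x = 0.
    move=> hx; rewrite /G; case: eqVneq => [E'|_]; last exact: lap0.
    by move: hx; rewrite E' subrr normr0 ltNge ltW.
  have [B HB] := continuous_supp_bounded cG G0.
  apply: (@log_residue R nu x0 _ r B l) => //.
    by move=> x /eqP/negbTE xx; have := HB x; rewrite /G xx.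
  apply: cvg_trans Hl; apply: near_eq_cvg; rewrite near_withinE.
  by apply: filterS NE => x -> _.
have CT := Ck_pcut_setT fE g Ch nE.
have cl : continuous (lap (pcut p c r h)).
  by move=> x; exact: (Ck_continuous (Ck_lap oT CT) (x := x) Logic.I).
have [B HB] := continuous_supp_bounded cl lap0.
apply: (@log_residue R nu x0 _ r B (pcut p c r h x0)) => //.
rewrite /nu asboolF //.
have c0 : {for x0, continuous (pcut p c r h)} by exact: (Ck_continuous CT (x := x0) Logic.I).
have cw : pcut p c r h x @[x --> x0^'] --> pcut p c r h x0.
  by apply: cvg_trans c0; apply: cvg_app; exact: cvg_within.
by under eq_fun do rewrite mul0r addr0.
Qed.

End OneDisc.

Hypothesis cM : compact [set: M].
Hypothesis ends : forall p, E p -> smooth_bryant_end f p.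

Let ord p : nat := if `[< E p >] then pole_order_mx F (lift p) else 0%N.

Lemma disc_cover : exists (c : M -> chart R M) (r : M -> R) (s : seq M),
  [/\ forall p, good E f p (c p) (r p), uniq s &
    forall m, exists2 p, p \in s & disc p (c p) (r p) m].
Proof.
have [cr hcr] := choice (good_exists fE ends).
have [m0 _] := @rs_nonempty R M.
pose PM : ptopologicalType := HB.pack_for ptopologicalType (rs_carrier M) (isPointed.Build (rs_carrier M) m0).
have cM' : @cover_compact PM setT by rewrite -compact_cover.
move: cM' => /(_ M setT (fun p => disc p (cr p).1 (cr p).2)).
move=> [p _|m _|D _ HD].
- exact: open_disc.
- by exists m => //; exact: disc_center (hcr m).
- exists (fun p => (cr p).1), (fun p => (cr p).2), (finmap.enum_fset D); split; [exact: hcr|exact: finmap.fset_uniq|].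
  by move=> m; have [|p pD hp] := HD m; [|exists p].
Qed.

Section Cover.
Variables (c : M -> chart R M) (r : M -> R) (s : seq M).
Hypothesis gd : forall p, good E f p (c p) (r p).
Hypothesis us : uniq s.
Hypothesis cov : forall m, exists2 p, p \in s & disc p (c p) (r p) m.

Let ac p : rs_atlas (c p). Proof. by case: (gd p). Qed.
Let bmp p m := bump p (c p) (r p) m.
Definition bumps (m : M) : R := \sum_(p <- s) bmp p m.
(** Multiplied by the bumps, it gives pieces whose sum is [phi]. *)
Definition quot (m : M) : R := phi m / bumps m.
Let psi p := cut p (c p) (r p) quot.

Lemma bumps_gt0 m : 0 < bumps m.
Proof.
have [p ps hp] := cov m; rewrite /bumps (bigD1_seq p) //= ltr_wpDr //.
  by apply: sumr_ge0 => q _; exact: bump_ge0.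
exact: bump_gt0.
Qed.

Lemma Ck_quot d : rs_atlas d -> Ck 2 (patch E d) (in_chart quot d).
Proof.
move=> ad; have oP := open_patch fE d; apply: (CkM oP (Ck_phi 2 ad)).
apply: (CkV oP); first by move=> x _; exact: lt0r_neq0 (bumps_gt0 _).
by apply: (Ck_sum s oP) => p; exact: (Ck_bump fE bf (gd p)).
Qed.

Lemma psi_sum m : \sum_(p <- s) psi p m = phi m.
Proof.
rewrite /psi /cut -big_distrl /= -/(bumps m) /quot mulrC divfK //.
exact: lt0r_neq0 (bumps_gt0 m).
Qed.

(** The discs of the other points of [s] stay away from the end, so that the
    sum of the bumps reduces to one of them. *)
Lemma near_end p : p \in s -> E p ->
  \forall x \near ctr (c p) p, pcut p (c p) (r p) quot x = in_chart phi (c p) x.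
Proof.
move=> ps Ep; have [_ cp _ _ _] := gd p.
have away q : q != p -> \forall m \near p, ~ cdisc q (c q) (r q) m.
  move=> qp; have oK : open (~` cdisc q (c q) (r q)).
    by apply: closed_openC; exact: closed_cdisc (gd q).
  by apply: (near_open oK) => /(cdisc_end (gd q) Ep) E'; move: qp; rewrite E' eqxx.
have n1 (t : seq M) : \forall m \near p, forall q, q \in t -> q != p -> ~ cdisc q (c q) (r q) m.
  elim: t => [|q t IH]; first exact: filterE.
  have [->|qp] := eqVneq q p.
    apply: filterS IH => m Hm q'; rewrite inE => /predU1P[-> /eqP //|]; exact: Hm.
  apply: filterS2 (away q qp) IH => m H1 Hm q'; rewrite inE => /predU1P[-> //|]; exact: Hm.
have n2 : \forall m \near p, disc p (c p) (r p) m.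
  exact: (near_open (@open_disc _ _ p (c p) (r p)) (disc_center (gd p))).
have ip : cimg (c p) (toC (ctr (c p) p)) by rewrite toC_ctr; exact: cimg_mem.
have cc : cinv (c p) w @[w --> toC (ctr (c p) p)] --> p.
  by have := cinv_continuous ip; rewrite /prop_for /continuous_at {2}toC_ctr cmapK.
have n3 : \forall w \near toC (ctr (c p) p), cimg (c p) w.
  by apply: open_nbhs_nbhs; split; [exact: cimg_open|exact: ip].
have N : \forall x \near ctr (c p) p, [/\ cimg (c p) (toC x), disc p (c p) (r p) (cinv (c p) (toC x)) &
    forall q, q \in s -> q != p -> ~ cdisc q (c q) (r q) (cinv (c p) (toC x))].
  apply: (near_toC (Q := fun w => [/\ cimg (c p) w, disc p (c p) (r p) (cinv (c p) w) &
    forall q, q \in s -> q != p -> ~ cdisc q (c q) (r q) (cinv (c p) w)])).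
  have n4 : \forall w \near toC (ctr (c p) p), disc p (c p) (r p) (cinv (c p) w) := cc _ n2.
  have n5 : \forall w \near toC (ctr (c p) p), forall q, q \in s -> q != p ->
      ~ cdisc q (c q) (r q) (cinv (c p) w) := cc _ (n1 s).
  by apply: filterS3 n3 n4 n5.
apply: filterS N => x [ix dx nx].
rewrite /pcut -bump_chart // /in_chart /quot.
have -> : bumps (cinv (c p) (toC x)) = bmp p (cinv (c p) (toC x)).
  rewrite /bumps (bigD1_seq p) //= big_seq_cond big1 ?addr0 // => q /andP[qs qp].
  by rewrite /bmp bump_out //; exact: nx.
by rewrite mulrC divfK // lt0r_neq0 //; exact: bump_gt0.
Qed.

Let om p d := lap (in_chart (psi p) d).

Lemma Ck_psi p d : rs_atlas d -> Ck 2 (patch E d) (in_chart (psi p) d).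
Proof. by move=> ad; exact: (Ck_cut fE bf (gd p) Ck_quot ad). Qed.

Lemma Ck_om p d : rs_atlas d -> Ck 0 (patch E d) (om p d).
Proof. by move=> ad; apply: Ck_lap; [exact: open_patch|exact: Ck_psi]. Qed.

Lemma density_om p : density E (om p).
Proof. by apply: (density_lap fE bf) => d; exact: Ck_psi. Qed.

Let n := size s.
Let k (i : 'I_n) := tnth (in_tuple s) i.
Let cc i := c (k i).
Let UU i := disc (k i) (c (k i)) (r (k i)).

Lemma cover_ord m : exists i, UU i m.
Proof.
have [p ps hp] := cov m; have /tnthP[i pE] : p \in in_tuple s by [].
by exists i; rewrite /UU /k -pE.
Qed.

Let tot := total E cc UU.

Lemma Ck0_max0 (w : chart R M -> P -> R) : (forall d, rs_atlas d -> Ck 0 (patch E d) (w d)) ->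
  forall d, rs_atlas d -> Ck 0 (patch E d) (fun x => max0 (w d x)).
Proof.
move=> Cw d ad x px; apply: (@continuous_comp P R R (w d) (@max0 R)); first exact: Cw.
exact: max0_continuous.
Qed.

Lemma max0_ge0 (t : R) : 0 <= max0 t. Proof. by rewrite /max0 le_max lexx. Qed.

Lemma tot_plane p (w : chart R M -> P -> R) (W : P -> R) : density E w ->
  (forall d, rs_atlas d -> Ck 0 (patch E d) (w d)) -> (forall d x, 0 <= w d x) ->
  (forall d y, patch E d y -> ~ cdom (c p) (cinv d (toC y)) -> w d y = 0) ->
  (forall x, patch E (c p) x -> w (c p) x = W x) ->
  (forall x, ~ patch E (c p) x -> x <> ctr (c p) p -> W x = 0) ->
  (forall x, 0 <= W x) -> @measurable_fun _ _ MP R setT W ->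
  tot w = (\int[mu2]_(x in [set: MP]) (W x)%:E)%E.
Proof.
move=> dw Cw w0 wout wW Wout W0 mW.
have oU i : open (UU i) by exact: open_disc.
have Usub i : UU i `<=` cdom (cc i) by exact: disc_sub.
have aci i : rs_atlas (cc i) by exact: ac.
have mp : mble (patch E (c p)) by apply: open_measurable2; exact: open_patch.
rewrite /tot (total_supp fE bf aci oU Usub (fun m _ => cover_ord m) dw Cw (fun d x _ _ => w0 d x) (ac p)); last first.
  by move=> i y [py _] nd; exact: wout.
have mWe : @measurable_fun _ _ MP _ setT (EFin \o W) by exact/measurable_EFinP.
have mc := measurable_point2 (ctr (c p) p); have c0 := mu2_point (ctr (c p) p).
transitivity (\int[mu2]_(x in patch E (c p)) (W x)%:E)%E.
  by apply: eq_integral => x; rewrite inE => px; rewrite wW.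
rewrite (@ge0_negligible_integral _ MP _ mu2 _ [set ctr (c p) p] _ mc mp) //; last 2 first.
- exact: measurable_funS mWe.
- by move=> x _; rewrite lee_fin.
rewrite [RHS](@ge0_negligible_integral _ MP _ mu2 _ [set ctr (c p) p] _ mc measurableT) //; last first.
  by move=> x _; rewrite lee_fin.
rewrite integral_mkcond [RHS]integral_mkcond; apply: eq_integral => x _; rewrite !patchE.
case: ifPn => [|/negP] hx; case: ifPn => [|/negP] hx' //.
  by exfalso; apply: hx'; apply: mem_set; have [_ ?] := set_mem hx.
have [_ xc] := set_mem hx'; rewrite Wout // => px; apply: hx; apply: mem_set; split=> //.
Qed.

Lemma tot_parts p : p \in s -> exists ab : R * R,
  [/\ tot (fun d x => max0 (om p d x)) = ab.1%:E, tot (fun d x => max0 (- om p d x)) = ab.2%:E &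
   ab.1 - ab.2 = 4 * pi * (ord p)%:R].
Proof.
move=> ps; have [ig Ig] := disc_residue (gd p) Ck_quot (near_end ps).
have [a [b [Ea Eb ab]]] := integral_parts ig.
have [/measurable_EFinP mg _] := integrableP _ _ _ ig.
exists (a, b); split => /=; last by rewrite ab Ig.
- rewrite -Ea; apply: (@tot_plane p) => //.
  + by apply: density_max0; exact: density_om.
  + by apply: Ck0_max0 => d ad; exact: Ck_om.
  + by move=> d x; exact: max0_ge0.
  + by move=> d y py nd; rewrite /om (lap_cut_out (gd p)) // /max0 maxxx.
  + by move=> x px; rewrite /om (lap_pcut fE bf (gd p) Ck_quot px).
  + by move=> x px xc; rewrite (lap_pcut_out (gd p)) // /max0 maxxx.
  + by move=> x; exact: max0_ge0.
  + exact: max0_measurable.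
- rewrite -Eb; apply: (@tot_plane p) => //.
  + by apply: density_max0; apply: densityN; exact: density_om.
  + by apply: Ck0_max0 => d ad; apply: (CkN (n := 0) (open_patch fE d)); exact: Ck_om.
  + by move=> d x; exact: max0_ge0.
  + by move=> d y py nd; rewrite /om (lap_cut_out (gd p)) // oppr0 /max0 maxxx.
  + by move=> x px; rewrite /om (lap_pcut fE bf (gd p) Ck_quot px).
  + by move=> x px xc; rewrite (lap_pcut_out (gd p)) // oppr0 /max0 maxxx.
  + by move=> x; exact: max0_ge0.
  + by apply: max0_measurable; exact: measurableT_comp.
Qed.

Lemma wil_sum d x : rs_atlas d -> patch E d x ->
  wil d x + \sum_(p <- s) max0 (- om p d x) = \sum_(p <- s) max0 (om p d x).
Proof.
move=> ad px; apply/eqP; rewrite eq_sym -subr_eq -sumrB eq_sym.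
suff -> : wil d x = \sum_(p <- s) om p d x.
  by apply/eqP; apply: eq_bigr => p _; rewrite max0_diff.
rewrite (wil_lap ad px) -(lap_sum s (open_patch fE d) (fun p => Ck_psi p ad) px).
by congr lap; apply/funext => y; rewrite /in_chart -psi_sum.
Qed.

(** The positive parts of the Laplacians of the pieces of [phi] exceed the
    negative parts by the Willmore density; keeping the two parts apart avoids
    integrating signed densities over the surface. *)
Lemma tot_balance :
  (tot wil + \sum_(p <- s) tot (fun d x => max0 (- om p d x)) =
   \sum_(p <- s) tot (fun d x => max0 (om p d x)))%E.
Proof.
rewrite /tot /total exchange_big /= -big_split /= [RHS]exchange_big /=.
apply: eq_bigr => i _.
have oU j : open (UU j) by exact: open_disc.
have mD : mble (cellD E cc UU i) by exact: in_cell_measurable.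
have Dp : cellD E cc UU i `<=` patch E (cc i) by exact: in_cell_patch.
have m0 (w : chart R M -> P -> R) : (forall d, rs_atlas d -> Ck 0 (patch E d) (w d)) ->
    @measurable_fun _ _ MP _ (cellD E cc UU i) (fun x => (w (cc i) x)%:E).
  by move=> Cw; apply: (om_measurable fE Cw (ac _)).
have mneg p : @measurable_fun _ _ MP _ (cellD E cc UU i) (fun x => (max0 (- om p (cc i) x))%:E).
  apply: (m0 (fun d x => max0 (- om p d x))); apply: Ck0_max0 => d ad.
  by apply: (CkN (n := 0) (open_patch fE d)); exact: Ck_om.
have mpos p : @measurable_fun _ _ MP _ (cellD E cc UU i) (fun x => (max0 (om p (cc i) x))%:E).
  by apply: (m0 (fun d x => max0 (om p d x))); apply: Ck0_max0 => d ad; exact: Ck_om.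
rewrite -(@ge0_integral_sum _ MP _ mu2 _ mD) //; last by move=> p x _; rewrite lee_fin max0_ge0.
rewrite -(@ge0_integral_sum _ MP _ mu2 _ mD) //; last by move=> p x _; rewrite lee_fin max0_ge0.
rewrite -(@ge0_integralD _ MP _ mu2 _ mD) //.
- apply: eq_integral => x; rewrite inE => /Dp px.
  by rewrite !sumEFin -EFinD wil_sum //; exact: ac.
- by move=> x _; rewrite lee_fin wil_ge0.
- exact: m0 Ck_wil.
- by move=> x _; apply: sume_ge0 => p _; rewrite lee_fin max0_ge0.
- by apply: emeasurable_sum.
Qed.

Lemma ends_in_cover p : E p -> p \in s.
Proof.
move=> Ep; have [q qs hq] := cov p.
by rewrite (cdisc_end (gd q) Ep (disc_cdisc hq)).
Qed.

Lemma willmore_cover : willmore_energy f = (4 * pi * \sum_(p <- s) (ord p)%:R)%:E.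
Proof.
have oU i : open (UU i) by exact: open_disc.
have Usub i : UU i `<=` cdom (cc i) by exact: disc_sub.
have aci i : rs_atlas (cc i) by exact: ac.
transitivity (tot wil).
  exact: (surface_integral_total fE bf aci oU Usub (fun m _ => cover_ord m) density_wil Ck_wil wil_ge0).
have [ab Hab] : {ab : M -> R * R & forall p, p \in s ->
    [/\ tot (fun d x => max0 (om p d x)) = (ab p).1%:E, tot (fun d x => max0 (- om p d x)) = (ab p).2%:E &
      (ab p).1 - (ab p).2 = 4 * pi * (ord p)%:R]}.
  apply: (@choice _ _ (fun p ab => p \in s -> [/\ tot (fun d x => max0 (om p d x)) = ab.1%:E,
    tot (fun d x => max0 (- om p d x)) = ab.2%:E & ab.1 - ab.2 = 4 * pi * (ord p)%:R])) => p.
  have [ps|ps] := boolP (p \in s); last by exists 0.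
  by have [ab H] := tot_parts ps; exists ab.
have := tot_balance.
rewrite big_seq [in RHS]big_seq (eq_bigr (fun p => (ab p).2%:E)); last by move=> p /Hab[].
rewrite [in RHS](eq_bigr (fun p => (ab p).1%:E)); last by move=> p /Hab[].
rewrite -!big_seq !sumEFin => H.
have -> : 4 * pi * \sum_(p <- s) (ord p)%:R = \sum_(p <- s) (ab p).1 - \sum_(p <- s) (ab p).2.
  rewrite mulr_sumr -sumrB big_seq [RHS]big_seq; apply: eq_bigr => p /Hab[_ _ ->].
  by [].
case: (tot wil) H => [t| |] //= [<-]; by rewrite addrK.
Qed.

End Cover.

Lemma willmore_ends : willmore_energy f =
  (4 * pi * \sum_(p \in E) ((pole_order_mx F (lift p))%:R : R))%:E.
Proof.
have [c [r [s [gd us cov]]]] := disc_cover.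
rewrite (willmore_cover gd us cov); congr (_ * _)%:E.
pose t := [seq p <- s | `[< E p >]].
rewrite (@fsbigE _ _ _ _ _ t) //; last 3 first.
- exact: filter_uniq.
- by move=> p /=; rewrite mem_filter => /andP[/asboolP].
- move=> p Ep; rewrite mem_filter asboolT //= => /negP ps; exfalso; apply: ps.
  exact: (ends_in_cover gd cov Ep).
rewrite big_filter_cond [RHS]big_mkcond /=; apply: eq_bigr => p _; rewrite /ord.
case: asboolP => Ep; first by rewrite mem_set.
by [].
Qed.

End Assembly.

Theorem theorem10 (R : realType) (M : riemannSurface R) (E : set M)
    (f : M -> 'rV[R]_3) (Mt : riemannSurface R) (u : Mt -> M)
    (F : Mt -> 'M[cplx R]_2) (lift : M -> Mt)
    (hf : compact_bryant_surface E f)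
    (hF : bryant_representation E f u F)
    (hlift : forall p, E p -> u (lift p) = p) :
  willmore_energy f
    = (4 * pi * \sum_(p \in E) ((pole_order_mx F (lift p))%:R : R))%:E.
Proof.
have [cM fE bf ends] := hf.
exact: (willmore_ends fE bf hF hlift cM ends).
Qed.
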